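(* Consider the delay problem $$u'(t)+Au(t)=g(t,u(t),u^\tau(t)),\ t>0,\qquad u(t)=\phi(t),\ t\le 0,$$ where $A$ is sectorial and $g$ is locally Lipschitz-continuous in a strip along the exact solution $u$ as specified in the context, and consider for its numerical solution the ERKC-I method. Let $f(t)=g(t,u(t),u^\tau(t))$ for $t\in[0,T]$. Let the step size sequence $\{h_j\}_{j=1}^N$ satisfy the following condition: there is a constant $\varrho>1$ such that $h_j\le\varrho h_{j+1}$ for all $j$. If $u:\mathcal I^\mu\to V$ and $f:\mathcal I^\mu\to X$ are both $s$ times differentiable for $\mu=1,2,\dots,m+1$, with $u^{(s)}\in L^\infty(0,T;V)$ and $f^{(s)}\in L^\infty(0,T;X)$, then for $h=\max_{1\le j\le N}h_j$ sufficiently small, the numerical solution $\Pi_hU$ is determined uniquely and the error of $\Pi_hU(t)$ satisfies $$\max_{0\le t\le T}\|\Pi_hU(t)-u(t)\|_V\le Ch^s\Big(\sup_{\sigma\in[0,T]}\|f^{(s)}(\sigma)\|_X+\sup_{\sigma\in[0,T]}\|u^{(s)}(\sigma)\|_V\Big),$$ where the constant $C$ depends on $T$, but is independent of the step size sequence.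
   Context: Setting. $(X,\|\cdot\|)$ is a Banach space (the norm is also written $\|\cdot\|_X$) and $T>0$. $A:D(A)\to X$ is sectorial with $\overline{D(A)}=X$ and, without restriction of generality, spectrum satisfying $\mathrm{Re}\,\sigma(A)>0$; thus $-A$ generates an analytic semigroup $\{\mathrm e^{-tA}\}_{t\ge0}$ and the fractional powers of $A$ are well defined. For $0\le\alpha<1$, $V=\{v\in X:A^\alpha v\in X\}$ with norm $\|v\|_V=\|A^\alpha v\|$. Delay. $\tau:[0,\infty)\to\mathbb R^+$; there is a constant $\tau_0>0$ with $\tau(t)\ge\tau_0$ for all $t\ge0$; and $t-\tau(t)$ is strictly increasing for $t\ge0$. For a function $v$ of time, $v^\tau(t)=v(t-\tau(t))$. Nonlinearity. $g:[0,T]\times V\times V\to X$ is locally Lipschitz-continuous in a strip along the exact solution $u$, so that there is a real number $L=L(R,T)$ with $\|g(t,v_1,w_1)-g(t,v_2,w_2)\|\le L(\|v_1-v_2\|_V+\|w_1-w_2\|_V)$ for all $t\in[0,T]$ and all $v_1,w_1,v_2,w_2\in V$ with $\max(\|v_1-u(t)\|_V,\|v_2-u(t)\|_V,\|w_1-u^\tau(t)\|_V,\|w_2-u^\tau(t)\|_V)\le R$. Discontinuity points. $\xi_0=0$ and $\xi_{\mu+1}-\tau(\xi_{\mu+1})=\xi_\mu$ for $\mu=0,1,\dots$; $m$ is such that $\xi_m<T\le\xi_{m+1}$; $J=\{\xi_\mu\}_{\mu=0}^m$ and $\mathcal I^\mu=[\xi_{\mu-1},\min\{\xi_\mu,T\}]$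 for $\mu=1,\dots,m+1$. Derivatives are understood segmentwise on the $\mathcal I^\mu$. Standing regularity. The problem admits a solution $u:[0,T]\to V$ that is sufficiently smooth in each segment $\mathcal I^\mu$, with its derivatives belonging to $V$. Moreover $g$ is sufficiently often Fréchet differentiable in a strip along the exact solution, $\tau$ is sufficiently smooth in $[0,T]$ and $\phi$ is sufficiently smooth in $[-\tau_0,0]$, so that $f$ is sufficiently smooth in each $\mathcal I^\mu$ as well. Mesh. $0=t_0<t_1<\dots<t_N=T$ is a mesh containing $J$; $I_{n+1}=[t_n,t_{n+1}]$, $h_{n+1}=t_{n+1}-t_n$. The collocation parameters $c_1,\dots,c_s\in[0,1]$ are nonconfluent (pairwise distinct); $t_{n,i}=t_n+c_ih_{n+1}$. Coefficients. $\ell_j(\rho)=\prod_{q=1,q\ne j}^s\frac{\rho-c_q}{c_j-c_q}$, $b_i(-h_{n+1}A)=\int_0^1\mathrm e^{-(1-\xi)h_{n+1}A}\ell_i(\xi)\,\mathrm d\xi$, $a_{ij}(-h_{n+1}A)=\int_0^{c_i}\mathrm e^{-(c_i-\xi)h_{n+1}A}\ell_j(\xi)\,\mathrm d\xi$. ERKC-I method (exponential Runge–Kutta method of collocation type, with interpolation of the delayed solution). With $U_0=\phi(0)$ and for $n=0,\dots,N-1$, $$U_{n+1}=\mathrm e^{-h_{n+1}A}U_n+h_{n+1}\sum_{i=1}^sb_i(-h_{n+1}A)G_{n,i},$$ $$U_{n,i}=\mathrm e^{-c_ih_{n+1}A}U_n+h_{n+1}\sum_{j=1}^sa_{ij}(-h_{n+1}A)G_{n,j},\quad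 1\le i\le s,$$ $$G_{n,j}=g(t_{n,j},U_{n,j},(\Pi_hU)^\tau(t_{n,j})),\quad 1\le j\le s.$$ Here $\Pi_hU(t)=\phi(t)$ for $t\le0$, and on each $I_{k+1}$, $k=0,\dots,N-1$, $\Pi_hU$ is the interpolation polynomial based on the nodes $\{t_k,t_{k+1}\}\cup\{t_{k,1},\dots,t_{k,s}\}$ with $\Pi_hU(t_k)=U_k$, $\Pi_hU(t_{k+1})=U_{k+1}$ and $\Pi_hU(t_{k,i})=U_{k,i}$ for $1\le i\le s$; its degree is $s-1$, $s$ or $s+1$, depending on the number of distinct nodes.
   Formalization: Since g is Lipschitz only in the strip, existence, uniqueness and the error bound are stated for numerical solutions whose stages satisfy ‖U_{n,i}−u(t_{n,i})‖_V ≤ R; unrestricted uniqueness fails, e.g. X=C, A=1, g=v², φ=0, s=1, c₁=1. *)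

(* Defs.v *)
From Stdlib Require Export Reals List Lra Lia.
From Coquelicot Require Export Coquelicot.
Export ListNotations.
Open Scope R_scope.

(* A complex Banach space is a [CompleteNormedModule C_AbsRing]; the spectrum of
   an operator only makes sense over the complex numbers, whereas derivatives and
   Riemann integrals of vector-valued functions of time are developed over the
   reals.  [real_space X] is X with the same norm, scalars restricted to R. *)

Lemma real_scal_assoc (X : CompleteNormedModule C_AbsRing) (a b : R) (x : X) :
  scal (RtoC a) (scal (RtoC b) x) = scal (RtoC (a * b)) x.
Proof. rewrite RtoC_mult. exact (scal_assoc (RtoC a) (RtoC b) x). Qed.

Lemma real_scal_distr (X : CompleteNormedModule C_AbsRing) (a b : R) (x : X) :
  scal (RtoC (a + b)) x = plus (scal (RtoC a) x) (scal (RtoC b) x).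
Proof. rewrite RtoC_plus. exact (scal_distr_r (RtoC a) (RtoC b) x). Qed.

Lemma real_norm_scal (X : CompleteNormedModule C_AbsRing) (a : R) (x : X) :
  norm (scal (RtoC a) x) <= Rabs a * norm x.
Proof. rewrite <- Cmod_R. exact (norm_scal (RtoC a) x). Qed.

Definition real_module (X : CompleteNormedModule C_AbsRing) :
    ModuleSpace.mixin_of R_Ring X :=
  ModuleSpace.Mixin R_Ring X (fun (a : R) (x : X) => scal (RtoC a) x)
    (real_scal_assoc X)
    (@scal_one C_Ring X)
    (fun a x y => scal_distr_l (RtoC a) x y)
    (real_scal_distr X).

Definition real_aux (X : CompleteNormedModule C_AbsRing) :
    NormedModuleAux.class_of R_AbsRing X :=
  NormedModuleAux.Class R_AbsRing X
    (ModuleSpace.Class R_Ring X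
       (AbelianGroup.class (CompleteNormedModule.AbelianGroup C_AbsRing X))
       (real_module X))
    (UniformSpace.class (CompleteNormedModule.UniformSpace C_AbsRing X)).

Definition real_norm_mixin (X : CompleteNormedModule C_AbsRing) :
    NormedModule.mixin_of R_AbsRing (NormedModuleAux.Pack R_AbsRing X (real_aux X) X) :=
  NormedModule.Mixin R_AbsRing (NormedModuleAux.Pack R_AbsRing X (real_aux X) X)
    (fun x : X => norm x) (@norm_factor C_AbsRing X)
    (@norm_triangle C_AbsRing X)
    (real_norm_scal X)
    (@norm_compat1 C_AbsRing X)
    (@norm_compat2 C_AbsRing X)
    (@norm_eq_zero C_AbsRing X).

Definition real_space (X : CompleteNormedModule C_AbsRing) :
    CompleteNormedModule R_AbsRing :=
  CompleteNormedModule.Pack R_AbsRing X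
    (CompleteNormedModule.Class R_AbsRing X
       (NormedModule.Class R_AbsRing X (real_aux X) (real_norm_mixin X))
       (CompleteSpace.class (CompleteNormedModule.CompleteSpace C_AbsRing X))) X.

Definition cscal {X : CompleteNormedModule C_AbsRing} (lam : C)
    (x : real_space X) : real_space X :=
  @scal C_AbsRing X lam x.

Definition bounded_linear {X : CompleteNormedModule C_AbsRing}
    (B : real_space X -> real_space X) : Prop :=
  @is_linear C_AbsRing X X B.

(* [app A x] is meaningful only for x in [dom A]. *)
Record operator (X : CompleteNormedModule C_AbsRing) := Operator {
  dom : real_space X -> Prop;
  app :> real_space X -> real_space X
}.
Arguments dom {X} _ _.
Arguments app {X} _ _.

Definition linear_operator {X : CompleteNormedModule C_AbsRing} (A : operator X) : Prop :=
  dom A zero /\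
  (forall x y, dom A x -> dom A y ->
     dom A (plus x y) /\ A (plus x y) = plus (A x) (A y)) /\
  (forall (lam : C) x, dom A x ->
     dom A (cscal lam x) /\ A (cscal lam x) = cscal lam (A x)).

Definition closed_operator {X : CompleteNormedModule C_AbsRing} (A : operator X) : Prop :=
  closed (fun p : real_space X * real_space X => dom A (fst p) /\ A (fst p) = snd p).

Definition densely_defined {X : CompleteNormedModule C_AbsRing} (A : operator X) : Prop :=
  forall (x : real_space X) (eps : posreal), exists y, dom A y /\ ball x eps y.

Definition is_resolvent {X : CompleteNormedModule C_AbsRing} (A : operator X)
    (lam : C) (B : real_space X -> real_space X) : Prop :=
  bounded_linear B /\
  (forall y, dom A (B y) /\ minus (cscal lam (B y)) (A (B y)) = y) /\
  (forall x, dom A x -> B (minus (cscal lam x) (A x)) = x).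

Definition in_spectrum {X : CompleteNormedModule C_AbsRing} (A : operator X)
    (lam : C) : Prop :=
  ~ exists B, is_resolvent A lam B.

(* Convention of Henry, under which -A (not A) generates the semigroup: the
   sector { lam <> a : theta0 <= |arg (lam - a)| <= PI } lies in the resolvent set
   and || (lam - A)^{-1} || <= M / |lam - a| there. *)
Definition sectorial {X : CompleteNormedModule C_AbsRing} (A : operator X) : Prop :=
  linear_operator A /\ closed_operator A /\
  exists a theta0 M : R,
    0 < theta0 < PI / 2 /\ 1 <= M /\
    forall r theta : R, 0 < r -> theta0 <= Rabs theta <= PI ->
      exists B,
        is_resolvent A ((a + r * cos theta, r * sin theta) : C) B /\
        forall x, norm (B x) <= M / r * norm x.

Definition C0_semigroup {X : CompleteNormedModule C_AbsRing}
    (S : R -> real_space X -> real_space X) : Prop :=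
  (forall t, 0 <= t -> bounded_linear (S t)) /\
  (forall x, S 0 x = x) /\
  (forall t r x, 0 <= t -> 0 <= r -> S (t + r) x = S t (S r x)) /\
  (forall x, filterlim (fun t => S t x) (at_right 0) (locally x)).

(* This determines [S t] for all t >= 0: it is e^{-tA}. *)
Definition semigroup_of {X : CompleteNormedModule C_AbsRing} (A : operator X)
    (S : R -> real_space X -> real_space X) : Prop :=
  C0_semigroup S /\
  forall x y,
    (dom A x /\ A x = y) <->
    filterlim (fun t => scal (/ t) (minus (S t x) x)) (at_right 0) (locally (opp y)).

Definition Gamma_fun (a : R) : R :=
  RInt_gen (V := R_CompleteNormedModule)
    (fun t => Rpower t (a - 1) * exp (- t)) (at_right 0) (Rbar_locally p_infty).

(* A^{-alpha} = 1 / Gamma(alpha) int_0^oo t^{alpha-1} e^{-tA} dt for alpha > 0. *)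
Definition neg_frac_pow {X : CompleteNormedModule C_AbsRing}
    (S : R -> real_space X -> real_space X) (alpha : R) (x : real_space X) : real_space X :=
  if Req_EM_T alpha 0 then x
  else scal (/ Gamma_fun alpha)
         (RInt_gen (fun t => scal (Rpower t (alpha - 1)) (S t x))
            (at_right 0) (Rbar_locally p_infty)).

(* A^alpha is the inverse of the injective operator A^{-alpha}; V is its domain. *)
Definition in_V {X : CompleteNormedModule C_AbsRing}
    (S : R -> real_space X -> real_space X) (alpha : R) (v : real_space X) : Prop :=
  exists w, neg_frac_pow S alpha w = v.

Definition frac_pow {X : CompleteNormedModule C_AbsRing}
    (S : R -> real_space X -> real_space X) (alpha : R) (v : real_space X) : real_space X :=
  iota (fun w => neg_frac_pow S alpha w = v).

Definition norm_V {X : CompleteNormedModule C_AbsRing}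
    (S : R -> real_space X -> real_space X) (alpha : R) (v : real_space X) : R :=
  norm (frac_pow S alpha v).

Definition is_delay (tau : R -> R) : Prop :=
  (exists tau0, 0 < tau0 /\ forall t, 0 <= t -> tau0 <= tau t) /\
  (forall t r, 0 <= t -> t < r -> t - tau t < r - tau r).

Definition delayed {Y : Type} (tau : R -> R) (v : R -> Y) (t : R) : Y := v (t - tau t).

Definition discontinuity_points (tau : R -> R) (xi : nat -> R) : Prop :=
  xi 0%nat = 0 /\
  forall mu, 0 <= xi (S mu) /\ xi (S mu) - tau (xi (S mu)) = xi mu.

(* I^mu, for mu >= 1 *)
Definition segment (xi : nat -> R) (T : R) (mu : nat) (t : R) : Prop :=
  xi (pred mu) <= t <= Rmin (xi mu) T.

(* d is the derivative at t, in the norm nrm, of the restriction of v to J: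
   one-sided at the end points of a segment J. *)
Definition is_derive_in {X : CompleteNormedModule C_AbsRing} (nrm : real_space X -> R)
    (J : R -> Prop) (v : R -> real_space X) (t : R) (d : real_space X) : Prop :=
  forall eps, 0 < eps ->
    exists delta, 0 < delta /\
      forall r, J r -> Rabs (r - t) < delta ->
        nrm (minus (minus (v r) (v t)) (scal (r - t) d)) <= eps * Rabs (r - t).

(* v : J -> (Y, nrm) is s times differentiable, with derivatives D 0 = v, ..., D s. *)
Definition derivatives_in {X : CompleteNormedModule C_AbsRing}
    (Y : real_space X -> Prop) (nrm : real_space X -> R) (J : R -> Prop) (s : nat)
    (v : R -> real_space X) (D : nat -> R -> real_space X) : Prop :=
  (forall t, J t -> D 0%nat t = v t) /\
  (forall k t, (k <= s)%nat -> J t -> Y (D k t)) /\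
  (forall k t, (k < s)%nat -> J t -> is_derive_in nrm J (D k) t (D (S k) t)).

(* D mu is a function on the segment I^mu, so that at a discontinuity point the
   values from both sides are taken into account.  For the derivative of an
   everywhere differentiable function on a segment, the essential supremum of the
   norm equals the supremum, so boundedness of these values is membership in
   L^oo(0,T). *)
Definition segment_norms {X : CompleteNormedModule C_AbsRing} (nrm : real_space X -> R)
    (xi : nat -> R) (T : R) (m : nat) (D : nat -> R -> real_space X) : R -> Prop :=
  fun y => exists mu sigma,
    (1 <= mu <= m + 1)%nat /\ segment xi T mu sigma /\ y = nrm (D mu sigma).

Definition segment_sup {X : CompleteNormedModule C_AbsRing} (nrm : real_space X -> R)
    (xi : nat -> R) (T : R) (m : nat) (D : nat -> R -> real_space X) : R :=
  real (Lub_Rbar (segment_norms nrm xi T m D)).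

Definition is_solution {X : CompleteNormedModule C_AbsRing} (A : operator X)
    (inV : real_space X -> Prop)
    (g : R -> real_space X -> real_space X -> real_space X)
    (tau : R -> R) (phi : R -> real_space X) (xi : nat -> R) (m : nat) (T : R)
    (u : R -> real_space X) : Prop :=
  (forall t, t <= 0 -> u t = phi t) /\
  (forall t, 0 <= t <= T -> inV (u t)) /\
  (forall mu t, (1 <= mu <= m + 1)%nat -> segment xi T mu t -> 0 < t ->
     dom A (u t) /\
     exists du, is_derive_in norm (segment xi T mu) u t du /\
       plus du (A (u t)) = g t (u t) (delayed tau u t)).

Definition lipschitz_in_strip {X : CompleteNormedModule C_AbsRing}
    (inV : real_space X -> Prop) (nV : real_space X -> R)
    (g : R -> real_space X -> real_space X -> real_space X)
    (tau : R -> R) (T : R) (u : R -> real_space X) (rad L : R) : Prop :=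
  forall t v1 w1 v2 w2, 0 <= t <= T ->
    inV v1 -> inV w1 -> inV v2 -> inV w2 ->
    nV (minus v1 (u t)) <= rad -> nV (minus v2 (u t)) <= rad ->
    nV (minus w1 (delayed tau u t)) <= rad -> nV (minus w2 (delayed tau u t)) <= rad ->
    norm (minus (g t v1 w1) (g t v2 w2)) <= L * (nV (minus v1 v2) + nV (minus w1 w2)).

Definition stepsize (tn : nat -> R) (j : nat) : R := tn j - tn (pred j).

Definition is_mesh (xi : nat -> R) (m : nat) (T : R) (N : nat) (tn : nat -> R) : Prop :=
  tn 0%nat = 0 /\ tn N = T /\
  (forall n, (n < N)%nat -> tn n < tn (S n)) /\
  (forall mu, (mu <= m)%nat -> exists n, (n <= N)%nat /\ tn n = xi mu).

Definition max_step (N : nat) (tn : nat -> R) : R :=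
  fold_right Rmax 0 (map (stepsize tn) (seq 1 N)).

(* t_{n,i} *)
Definition coll_point (c : nat -> R) (tn : nat -> R) (n i : nat) : R :=
  tn n + c i * stepsize tn (S n).

(* Lagrange polynomial for the nodes c 1, ..., c s. *)
Definition lagrange (s : nat) (c : nat -> R) (j : nat) (rho : R) : R :=
  fold_right Rmult 1
    (map (fun q => (rho - c q) / (c j - c q))
       (filter (fun q => negb (Nat.eqb q j)) (seq 1 s))).

(* b_i(-hA) x and a_ij(-hA) x, with S t = e^{-tA}: the operator-valued integrals are
   strong (pointwise) integrals. *)
Definition coef_b {X : CompleteNormedModule C_AbsRing}
    (S : R -> real_space X -> real_space X) (s : nat) (c : nat -> R)
    (h : R) (i : nat) (x : real_space X) : real_space X :=
  RInt (fun xi => scal (lagrange s c i xi) (S ((1 - xi) * h) x)) 0 1.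

Definition coef_a {X : CompleteNormedModule C_AbsRing}
    (S : R -> real_space X -> real_space X) (s : nat) (c : nat -> R)
    (h : R) (i j : nat) (x : real_space X) : real_space X :=
  RInt (fun xi => scal (lagrange s c j xi) (S ((c i - xi) * h) x)) 0 (c i).

(* On J, P is a polynomial whose degree is less than the number of distinct nodes. *)
Definition interp_degree_on {X : CompleteNormedModule C_AbsRing} (nodes : list R)
    (J : R -> Prop) (P : R -> real_space X) : Prop :=
  exists a : nat -> real_space X,
    forall t, J t ->
      P t = sum_n (fun k => scal (t ^ k) (a k)) (length (nodup Req_EM_T nodes) - 1).

Record numerical (X : CompleteNormedModule C_AbsRing) := Numerical {
  nodal : nat -> real_space X;
  stage : nat -> nat -> real_space X;
  interp : R -> real_space X
}.
Arguments nodal {X} _ _.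
Arguments stage {X} _ _ _.
Arguments interp {X} _ _.

Definition stage_rhs {X : CompleteNormedModule C_AbsRing}
    (g : R -> real_space X -> real_space X -> real_space X)
    (tau : R -> R) (c : nat -> R) (tn : nat -> R) (W : numerical X)
    (n j : nat) : real_space X :=
  g (coll_point c tn n j) (stage W n j) (delayed tau (interp W) (coll_point c tn n j)).

(* g is defined on [0,T] x V x V, so its arguments have to belong to V. *)
Definition is_ERKC_I {X : CompleteNormedModule C_AbsRing}
    (S : R -> real_space X -> real_space X) (inV : real_space X -> Prop)
    (g : R -> real_space X -> real_space X -> real_space X)
    (tau : R -> R) (phi : R -> real_space X)
    (s : nat) (c : nat -> R) (N : nat) (tn : nat -> R) (W : numerical X) : Prop :=
  nodal W 0%nat = phi 0 /\
  (forall t, t <= 0 -> interp W t = phi t) /\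
  forall n, (n < N)%nat ->
    let h := stepsize tn (n + 1) in
    nodal W (n + 1)%nat =
      plus (S h (nodal W n))
        (scal h (sum_n_m (fun i => coef_b S s c h i (stage_rhs g tau c tn W n i)) 1 s)) /\
    (forall i, (1 <= i <= s)%nat ->
       inV (stage W n i) /\
       inV (delayed tau (interp W) (coll_point c tn n i)) /\
       stage W n i =
         plus (S (c i * h) (nodal W n))
           (scal h (sum_n_m (fun j => coef_a S s c h i j (stage_rhs g tau c tn W n j)) 1 s))) /\
    interp_degree_on (tn n :: tn (n + 1)%nat :: map (coll_point c tn n) (seq 1 s))
      (fun t => tn n <= t <= tn (n + 1)%nat) (interp W) /\
    interp W (tn n) = nodal W n /\
    interp W (tn (n + 1)%nat) = nodal W (n + 1)%nat /\
    (forall i, (1 <= i <= s)%nat -> interp W (coll_point c tn n i) = stage W n i).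

(* g is Lipschitz only near the exact solution, so the implicit stage equations can
   have further solutions far away (e.g. X = C, A = 1, g t v w = v * v); the stages
   looked for are those in the strip. *)
Definition stages_in_strip {X : CompleteNormedModule C_AbsRing}
    (nV : real_space X -> R) (u : R -> real_space X) (rad : R)
    (s : nat) (c : nat -> R) (N : nat) (tn : nat -> R) (W : numerical X) : Prop :=
  forall n i, (n < N)%nat -> (1 <= i <= s)%nat ->
    nV (minus (stage W n i) (u (coll_point c tn n i))) <= rad.

(* Main.v *)
(* Contour integration is avoided: with R = (lam - A)^-1, the identity
     S(t)(t^2/2 R - t R^2 + R^3) x = e^(-lam t) R^3 x + int_0^t e^(-lam (t - s)) s^2/2 S(s)x ds
   is integrated along a vertical line with an Abel weight. Its last term becomes a Poisson
   integral converging to a multiple of t^2 S(t)x, and the R^3 term is absolutely integrable;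
   lines through a fixed abscissa and through -1/t give ||S(t)x|| <= M (1+t)^-2 ||x|| and
   ||A S(t)x|| <= M/t ||x||.
   For K_b x = int_0^oo r^(b-1) S(r)x dr one has K_(1-b) K_b = B A^-1 with B <> 0, so that
   A^-alpha is injective, and A^alpha S(t)x is a multiple of K_(1-alpha) A S(t)x, whence
   ||A^alpha S(t)x|| <= K t^-alpha ||x||.

   By variation of constants the global error is the sum of the integrals of S(t - s) d_k(s) over
   the steps, where d_k is the collocation polynomial of the computed right-hand sides minus f.
   The Lipschitz condition bounds d_k by the stage errors, the interpolation errors at the delayed
   arguments (which lie in earlier steps), and O(h^s). A bound ||d_k|| <= D e^(lam t_k) reproduces
   itself, because for large lam the kernel (t - s)^-alpha maps D e^(lam t_k) to a small multiple
   of itself. Existence and uniqueness come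
   from a contraction in the strip at each step, the errors there being smaller than its radius. *)

Require Import Defs.
From Stdlib Require Import ClassicalEpsilon Classical Psatz.

(** The hypothesis on [A] speaks of resolvents R, while [expA] is known only through its generator;
    inverting the Laplace transform connects the two. The obstacle is that R x decays only like
    1/|l| along a line. Hence the Abel weight, and hence the subtraction of the scalar resolvent
    x/(l - mu): for x in the domain the difference is O(|l|^-2), and the integral of the subtracted
    part has a known sign. Cauchy's theorem is replaced by differentiation in the abscissa and a
    mean value inequality. The third power of R stays integrable after a factor A.

    In the estimates an element of V is given by its preimage under A^-alpha, so that membership and
    bound travel together. For the error induction the V-norm of the nodal error is the wrong
    quantity: the semigroup is bounded by a constant K that may exceed 1, and a factor K would be
    lost in each step. Instead S(r)(U_n - u(t_n)) is bounded for all r at once; each step then adds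
    its own convolution as seen from a later time, and the bounds telescope. *)

Arguments real_space : simpl never.

(** * Vector-valued calculus *)

Section VecTactic.
Variable V : ModuleSpace R_Ring.

Inductive vexp : Type :=
  | VAtom (n : nat) | VZero | VPlus (a b : vexp) | VOpp (a : vexp)
  | VMinus (a b : vexp) | VScal (r : R) (a : vexp).

Fixpoint veval (env : list V) (e : vexp) : V :=
  match e with
  | VAtom n => nth n env zero
  | VZero => zero
  | VPlus a b => plus (veval env a) (veval env b)
  | VOpp a => opp (veval env a)
  | VMinus a b => minus (veval env a) (veval env b)
  | VScal r a => scal r (veval env a)
  end.

Fixpoint vcoef (e : vexp) (k : nat) : R :=
  match e with
  | VAtom n => if Nat.eqb n k then 1 else 0
  | VZero => 0
  | VPlus a b => vcoef a k + vcoef b k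
  | VOpp a => - vcoef a k
  | VMinus a b => vcoef a k - vcoef b k
  | VScal r a => r * vcoef a k
  end.

Fixpoint vlin (c : nat -> R) (env : list V) : V :=
  match env with
  | nil => zero
  | x :: l => plus (scal (c 0%nat) x) (vlin (fun k => c (S k)) l)
  end.

Lemma vlin_zero env : vlin (fun _ => 0) env = zero.
Proof.
  induction env as [|x l IH]; cbn; [reflexivity|].
  rewrite IH, plus_zero_r. exact (scal_zero_l x).
Qed.

Lemma vlin_ext env : forall c d, (forall k, c k = d k) -> vlin c env = vlin d env.
Proof.
  induction env as [|x l IH]; intros c d E; cbn; [reflexivity|].
  rewrite (E 0%nat). f_equal. apply IH. intros k. apply E.
Qed.

Lemma vlin_plus env : forall c d,
  vlin (fun k => c k + d k) env = plus (vlin c env) (vlin d env).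
Proof.
  induction env as [|x l IH]; intros c d; cbn.
  - now rewrite plus_zero_r.
  - rewrite IH. rewrite (scal_distr_r (K := R_Ring) (c 0%nat) (d 0%nat) x : scal (c 0%nat + d 0%nat) x = _).
    rewrite <- !plus_assoc. f_equal. rewrite !plus_assoc. f_equal. apply plus_comm.
Qed.

Lemma vlin_scal env : forall r c, vlin (fun k => r * c k) env = scal r (vlin c env).
Proof.
  induction env as [|x l IH]; intros r c; cbn.
  - now rewrite scal_zero_r.
  - rewrite IH, scal_distr_l, scal_assoc. reflexivity.
Qed.

Lemma vlin_opp env c : vlin (fun k => - c k) env = opp (vlin c env).
Proof.
  rewrite <- (scal_opp_one (V := V)).
  rewrite (vlin_ext env (fun k => - c k) (fun k => (-1) * c k)) by (intros; ring).
  apply vlin_scal.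
Qed.

Lemma vlin_atom env : forall n, vlin (fun k => if Nat.eqb n k then 1 else 0) env = nth n env zero.
Proof.
  induction env as [|x l IH]; intros [|n]; cbn; try reflexivity.
  - rewrite vlin_zero, plus_zero_r. exact (scal_one x).
  - rewrite IH. rewrite (scal_zero_l (K := R_Ring) x : scal 0 x = zero). apply plus_zero_l.
Qed.

Lemma veval_vlin env e : veval env e = vlin (vcoef e) env.
Proof.
  induction e; cbn -[vlin].
  - now rewrite vlin_atom.
  - now rewrite vlin_zero.
  - now rewrite vlin_plus, IHe1, IHe2.
  - now rewrite vlin_opp, IHe.
  - unfold Rminus. rewrite vlin_plus, vlin_opp, IHe1, IHe2. reflexivity.
  - now rewrite vlin_scal, IHe.
Qed.

Lemma veval_eq env a b : vlin (vcoef a) env = vlin (vcoef b) env -> veval env a = veval env b.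
Proof. now rewrite !veval_vlin. Qed.

End VecTactic.

Arguments veval {V}. Arguments vlin {V}.

Ltac vec_mem x l :=
  match l with
  | nil => false
  | cons x _ => true
  | cons _ ?l' => vec_mem x l'
  end.
Ltac vec_atoms t acc :=
  match t with
  | plus ?a ?b => let acc := vec_atoms a acc in vec_atoms b acc
  | minus ?a ?b => let acc := vec_atoms a acc in vec_atoms b acc
  | opp ?a => vec_atoms a acc
  | scal ?r ?a => vec_atoms a acc
  | zero => acc
  | _ => match vec_mem t acc with true => acc | false => constr:(cons t acc) end
  end.
Ltac vec_index x l :=
  match l with
  | cons x _ => constr:(O)
  | cons _ ?l' => let n := vec_index x l' in constr:(S n)
  end.
Ltac vec_reify t env :=
  match t with
  | plus ?a ?b => let a := vec_reify a env in let b := vec_reify b env in constr:(VPlus a b)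
  | minus ?a ?b => let a := vec_reify a env in let b := vec_reify b env in constr:(VMinus a b)
  | opp ?a => let a := vec_reify a env in constr:(VOpp a)
  | scal ?r ?a => let a := vec_reify a env in constr:(VScal r a)
  | zero => constr:(VZero)
  | _ => let n := vec_index t env in constr:(VAtom n)
  end.
(* Proves an identity in a module by comparing the coefficients of its atoms; [tac] proves the resulting identities in R. *)
Ltac vec_with tac :=
  match goal with
  | |- @eq ?T ?a ?b =>
    let l := vec_atoms a (@nil T) in
    let l := vec_atoms b l in
    let ea := vec_reify a l in
    let eb := vec_reify b l in
    apply (veval_eq _ l ea eb);
    cbv beta iota delta [vlin vcoef Nat.eqb];
    repeat (apply f_equal2; [apply f_equal2; [tac | reflexivity] | ]); try reflexivity
  end.
Ltac real_eq := match goal with |- @eq _ ?a ?b => change (@eq R a b) end.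
Ltac vec := vec_with ltac:(try (real_eq; ring)).

Lemma norm_plus_le {V : CompleteNormedModule R_AbsRing} (x y : V) :
  norm (plus x y) <= norm x + norm y.
Proof. exact (norm_triangle x y). Qed.

Lemma norm_oppV {V : CompleteNormedModule R_AbsRing} (x : V) : norm (opp x) = norm x.
Proof. exact (norm_opp x). Qed.

Lemma norm_zeroV {V : CompleteNormedModule R_AbsRing} : norm (zero : V) = 0.
Proof. exact norm_zero. Qed.

Lemma norm_eq_zeroV {V : CompleteNormedModule R_AbsRing} (x : V) : norm x = 0 -> x = zero.
Proof. exact (norm_eq_zero x). Qed.

Lemma norm_scalR {V : CompleteNormedModule R_AbsRing} (a : R) (x : V) :
  norm (scal a x) <= Rabs a * norm x.
Proof. exact (norm_scal a x). Qed.

Lemma norm_scal_bound {V : CompleteNormedModule R_AbsRing} (a : R) (x : V) p q :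
  Rabs a <= p -> norm x <= q -> norm (scal a x) <= p * q.
Proof.
  intros Ha Hx. eapply Rle_trans; [apply norm_scalR|].
  apply Rmult_le_compat; auto using Rabs_pos, norm_ge_0.
Qed.

Lemma norm_le_plus {V : CompleteNormedModule R_AbsRing} (x y z : V) p q :
  x = plus y z -> norm y <= p -> norm z <= q -> norm x <= p + q.
Proof. intros -> Hy Hz. eapply Rle_trans; [apply norm_plus_le | lra]. Qed.

Lemma norm_le_zero {V : CompleteNormedModule R_AbsRing} (x : V) e : x = zero -> 0 <= e -> norm x <= e.
Proof. intros -> H. now rewrite norm_zeroV. Qed.

Lemma norm_minus_sym {V : CompleteNormedModule R_AbsRing} (x y : V) : norm (minus x y) = norm (minus y x).
Proof. rewrite <- norm_oppV. f_equal. vec. Qed.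

Lemma minus_eq0 {V : CompleteNormedModule R_AbsRing} (x y : V) : minus x y = zero -> x = y.
Proof. intros E. transitivity (plus (minus x y) y); [vec | rewrite E; vec]. Qed.

Lemma norm_minus_eq0 {V : CompleteNormedModule R_AbsRing} (x y : V) :
  (forall eps, 0 < eps -> norm (minus x y) <= eps) -> x = y.
Proof.
  intros H. assert (E : norm (minus x y) = 0).
  { apply Rle_antisym; [|apply norm_ge_0]. apply le_epsilon. intros e He. rewrite Rplus_0_l. auto. }
  apply norm_eq_zeroV in E. transitivity (plus (minus x y) y); [vec | rewrite E; vec].
Qed.

Definition contn_in {V : CompleteNormedModule R_AbsRing} (J : R -> Prop) (f : R -> V) (t : R) : Prop :=
  forall eps, 0 < eps -> exists delta, 0 < delta /\
    forall r, J r -> Rabs (r - t) < delta -> norm (minus (f r) (f t)) <= eps.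

(** The formula of [is_derive_in] over an arbitrary real Banach space. Being relative to [J], it is
    one-sided at the ends of a segment, where [u] and [f] may lack a two-sided derivative. *)
Definition deriv_in {V : CompleteNormedModule R_AbsRing} (J : R -> Prop) (v : R -> V) (t : R) (d : V) : Prop :=
  forall eps, 0 < eps -> exists delta, 0 < delta /\
    forall r, J r -> Rabs (r - t) < delta ->
      norm (minus (minus (v r) (v t)) (scal (r - t) d)) <= eps * Rabs (r - t).

Definition itv (a b t : R) : Prop := a <= t <= b.

Definition cont_on {V : CompleteNormedModule R_AbsRing} (a b : R) (f : R -> V) : Prop :=
  forall t, itv a b t -> contn_in (itv a b) f t.

Section Calculus.
Context {V W : CompleteNormedModule R_AbsRing}.
Implicit Types f g : R -> V.

Lemma contn_in_sub (J K : R -> Prop) f t : (forall r, K r -> J r) -> contn_in J f t -> contn_in K f t.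
Proof. intros S H e He. destruct (H e He) as [d [Hd D]]. exists d. split; auto. Qed.

Lemma deriv_in_sub (J K : R -> Prop) f t d : (forall r, K r -> J r) -> deriv_in J f t d -> deriv_in K f t d.
Proof. intros S H e He. destruct (H e He) as [p [Hp D]]. exists p. split; auto. Qed.

Lemma cont_on_sub a b c d f : a <= c -> d <= b -> cont_on a b f -> cont_on c d f.
Proof.
  intros H1 H2 H t Ht. apply contn_in_sub with (itv a b).
  - unfold itv; intros; lra.
  - apply H. unfold itv in *; lra.
Qed.

Lemma contn_in_ext (J : R -> Prop) f g t : J t -> (forall r, J r -> f r = g r) -> contn_in J f t -> contn_in J g t.
Proof.
  intros Jt E H e He. destruct (H e He) as [d [Hd D]]. exists d. split; auto.
  intros r Hr Hrt. rewrite <- !E; auto.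
Qed.

Lemma cont_on_ext a b f g : (forall r, a <= r <= b -> f r = g r) -> cont_on a b f -> cont_on a b g.
Proof. intros E H t Ht. apply contn_in_ext with f; auto. Qed.

Lemma contn_in_plus J f g t : contn_in J f t -> contn_in J g t -> contn_in J (fun r => plus (f r) (g r)) t.
Proof.
  intros H1 H2 e He. destruct (H1 (e/2)) as [d1 [Hd1 D1]]; [lra|].
  destruct (H2 (e/2)) as [d2 [Hd2 D2]]; [lra|].
  exists (Rmin d1 d2). split; [apply Rmin_glb_lt; auto|].
  intros r Hr Hrt. replace e with (e/2 + e/2) by field.
  apply norm_le_plus with (minus (f r) (f t)) (minus (g r) (g t)); [vec| |].
  - apply D1; auto. eapply Rlt_le_trans; [exact Hrt | apply Rmin_l].
  - apply D2; auto. eapply Rlt_le_trans; [exact Hrt | apply Rmin_r].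
Qed.

Lemma contn_in_const J (x : V) t : contn_in J (fun _ => x) t.
Proof.
  intros e He. exists 1. split; [lra|]. intros.
  apply norm_le_zero; [vec|lra].
Qed.

Lemma contn_in_minus J f g t : contn_in J f t -> contn_in J g t -> contn_in J (fun r => minus (f r) (g r)) t.
Proof.
  intros H1 H2. apply (contn_in_plus J f (fun r => opp (g r))); auto.
  intros e He. destruct (H2 e He) as [d [Hd D]]. exists d. split; auto. intros r Hr Hrt.
  rewrite <- norm_oppV. replace (opp _) with (minus (g r) (g t)) by vec. auto.
Qed.

Lemma contn_in_lin J f t (L : V -> W) M : (forall x y, L (minus x y) = minus (L x) (L y)) ->
  (forall x, norm (L x) <= M * norm x) -> contn_in J f t -> contn_in J (fun r => L (f r)) t.
Proof.
  intros HL HM H e He.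
  assert (M1 : 0 < Rabs M + 1) by (generalize (Rabs_pos M); lra).
  destruct (H (e / (Rabs M + 1))) as [d [Hd D]]; [apply Rdiv_lt_0_compat; lra|].
  exists d. split; auto. intros r Hr Hrt. rewrite <- HL. eapply Rle_trans; [apply HM|].
  specialize (D r Hr Hrt).
  apply Rle_trans with ((Rabs M + 1) * norm (minus (f r) (f t))).
  - apply Rmult_le_compat_r; [apply norm_ge_0|]. generalize (Rle_abs M); lra.
  - apply Rle_trans with ((Rabs M + 1) * (e / (Rabs M + 1))).
    + apply Rmult_le_compat_l; lra.
    + right. field. lra.
Qed.

Lemma contn_in_scal J (k : R -> R) f t :
  contn_in (V := R_CompleteNormedModule) J k t -> contn_in J f t -> contn_in J (fun r => scal (k r) (f r)) t.
Proof.
  intros Hk Hf e He.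
  set (A := Rabs (k t) + 1). set (B := norm (f t) + 1).
  assert (HA : 0 < A) by (unfold A; generalize (Rabs_pos (k t)); lra).
  assert (HB : 0 < B) by (unfold B; generalize (norm_ge_0 (f t)); lra).
  assert (H1 : 0 < Rmin 1 (e / 2 / B)).
  { apply Rmin_glb_lt; [lra|]. apply Rdiv_lt_0_compat; lra. }
  destruct (Hk _ H1) as [d1 [Hd1 D1]].
  destruct (Hf (e / 2 / A)) as [d2 [Hd2 D2]]; [apply Rdiv_lt_0_compat; lra|].
  exists (Rmin d1 d2). split; [apply Rmin_glb_lt; auto|].
  intros r Hr Hrt. replace e with (A * (e / 2 / A) + (e / 2 / B) * B) by (field; lra).
  assert (E1 : Rabs (k r - k t) <= Rmin 1 (e/2/B)).
  { apply D1; auto. eapply Rlt_le_trans; [exact Hrt | apply Rmin_l]. }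
  apply norm_le_plus with (scal (k r) (minus (f r) (f t))) (scal (k r - k t) (f t)); [vec| |].
  - apply norm_scal_bound.
    + generalize (Rmin_l 1 (e/2/B)). unfold A. replace (k r) with (k t + (k r - k t)) by ring.
      intros. eapply Rle_trans; [apply Rabs_triang|]. lra.
    + apply D2; auto. eapply Rlt_le_trans; [exact Hrt | apply Rmin_r].
  - apply norm_scal_bound.
    + eapply Rle_trans; [exact E1 | apply Rmin_r].
    + unfold B; lra.
Qed.

Lemma deriv_contn J f t d : deriv_in J f t d -> contn_in J f t.
Proof.
  intros H e He. destruct (H 1 Rlt_0_1) as [p [Hp D]].
  set (B := norm d + 1).
  assert (HB : 0 < B) by (unfold B; generalize (norm_ge_0 d); lra).
  exists (Rmin p (e / B)). split; [apply Rmin_glb_lt; auto; apply Rdiv_lt_0_compat; lra|].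
  intros r Hr Hrt.
  assert (h1 : Rabs (r - t) < p) by (eapply Rlt_le_trans; [exact Hrt | apply Rmin_l]).
  assert (h2 : Rabs (r - t) < e / B) by (eapply Rlt_le_trans; [exact Hrt | apply Rmin_r]).
  apply Rle_trans with (1 * Rabs (r - t) + Rabs (r - t) * norm d).
  - apply norm_le_plus with (minus (minus (f r) (f t)) (scal (r - t) d)) (scal (r - t) d); [vec| |].
    + auto.
    + apply norm_scalR.
  - replace e with (e / B * B) by (field; lra). unfold B in *.
    generalize (Rabs_pos (r - t)); intros.
    replace (1 * Rabs (r - t) + Rabs (r - t) * norm d) with (Rabs (r - t) * (norm d + 1)) by ring.
    apply Rmult_le_compat_r; lra.
Qed.

Lemma deriv_in_plus J f g t d1 d2 : deriv_in J f t d1 -> deriv_in J g t d2 ->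
  deriv_in J (fun r => plus (f r) (g r)) t (plus d1 d2).
Proof.
  intros H1 H2 e He. destruct (H1 (e/2)) as [p1 [Hp1 D1]]; [lra|].
  destruct (H2 (e/2)) as [p2 [Hp2 D2]]; [lra|].
  exists (Rmin p1 p2). split; [apply Rmin_glb_lt; auto|].
  intros r Hr Hrt. replace (e * Rabs (r - t)) with (e/2 * Rabs (r-t) + e/2 * Rabs (r-t)) by field.
  eapply norm_le_plus; [| apply D1; auto; eapply Rlt_le_trans; [exact Hrt | apply Rmin_l]
                        | apply D2; auto; eapply Rlt_le_trans; [exact Hrt | apply Rmin_r]].
  vec.
Qed.

Lemma deriv_in_minus J f g t d1 d2 : deriv_in J f t d1 -> deriv_in J g t d2 ->
  deriv_in J (fun r => minus (f r) (g r)) t (minus d1 d2).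
Proof.
  intros H1 H2. apply (deriv_in_plus J f (fun r => opp (g r))); auto.
  intros e He. destruct (H2 e He) as [d [Hd D]]. exists d. split; auto. intros r Hr Hrt.
  rewrite <- norm_oppV. replace (opp _) with (minus (minus (g r) (g t)) (scal (r - t) d2)) by vec. auto.
Qed.

Lemma deriv_in_const J (x : V) t : deriv_in J (fun _ => x) t zero.
Proof.
  intros e He. exists 1. split; [lra|]. intros r _ _.
  apply norm_le_zero; [vec|]. generalize (Rabs_pos (r - t)); nra.
Qed.

Lemma deriv_in_lin J f t d (L : V -> W) M :
  (forall x y, L (plus x y) = plus (L x) (L y)) -> (forall a x, L (scal a x) = scal a (L x)) ->
  (forall x, norm (L x) <= M * norm x) -> deriv_in J f t d -> deriv_in J (fun r => L (f r)) t (L d).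
Proof.
  intros HLp HLs HM H e He.
  assert (HLm : forall x y, L (minus x y) = minus (L x) (L y)).
  { intros. replace (minus x y) with (plus x (scal (-1) y)) by vec. rewrite HLp, HLs. vec. }
  assert (M1 : 0 < Rabs M + 1) by (generalize (Rabs_pos M); lra).
  destruct (H (e / (Rabs M + 1))) as [p [Hp D]]; [apply Rdiv_lt_0_compat; lra|].
  exists p. split; auto. intros r Hr Hrt. rewrite <- HLs, <- !HLm. eapply Rle_trans; [apply HM|].
  specialize (D r Hr Hrt).
  apply Rle_trans with ((Rabs M + 1) * norm (minus (minus (f r) (f t)) (scal (r - t) d))).
  - apply Rmult_le_compat_r; [apply norm_ge_0|]. generalize (Rle_abs M); lra.
  - apply Rle_trans with ((Rabs M + 1) * (e / (Rabs M + 1) * Rabs (r - t))).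
    + apply Rmult_le_compat_l; lra.
    + right. field. lra.
Qed.

Lemma deriv_in_scal J (k : R -> R) f t k' d :
  deriv_in (V := R_CompleteNormedModule) J k t k' -> deriv_in J f t d ->
  deriv_in J (fun r => scal (k r) (f r)) t (plus (scal k' (f t)) (scal (k t) d)).
Proof.
  intros Hk Hf e He.
  set (A := Rabs (k t) + 1). set (B := norm (f t) + 1). set (C := Rabs k' + 1).
  assert (HA : 0 < A) by (unfold A; generalize (Rabs_pos (k t)); lra).
  assert (HB : 0 < B) by (unfold B; generalize (norm_ge_0 (f t)); lra).
  assert (HC : 0 < C) by (unfold C; generalize (Rabs_pos k'); lra).
  assert (Hm : 0 < Rmin 1 (e / 3 / B)) by (apply Rmin_glb_lt; [lra|apply Rdiv_lt_0_compat; lra]).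
  destruct (Hk _ Hm) as [p1 [Hp1 D1]].
  destruct (Hf (e / 3 / A)) as [p2 [Hp2 D2]]; [apply Rdiv_lt_0_compat; lra|].
  destruct (deriv_contn _ _ _ _ Hf (e / 3 / C)) as [p3 [Hp3 D3]]; [apply Rdiv_lt_0_compat; lra|].
  exists (Rmin p1 (Rmin p2 p3)). split; [repeat apply Rmin_glb_lt; auto|].
  intros r Hr Hrt.
  assert (h1 : Rabs (r - t) < p1) by (eapply Rlt_le_trans; [exact Hrt | apply Rmin_l]).
  assert (h2 : Rabs (r - t) < p2).
  { eapply Rlt_le_trans; [exact Hrt |]. eapply Rle_trans; [apply Rmin_r | apply Rmin_l]. }
  assert (h3 : Rabs (r - t) < p3).
  { eapply Rlt_le_trans; [exact Hrt |]. eapply Rle_trans; [apply Rmin_r | apply Rmin_r]. }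
  specialize (D1 r Hr h1). specialize (D2 r Hr h2). specialize (D3 r Hr h3).
  change (Rabs (k r - k t - (r - t) * k') <= Rmin 1 (e/3/B) * Rabs (r - t)) in D1.
  set (h := Rabs (r - t)) in *. assert (Hh : 0 <= h) by apply Rabs_pos.
  assert (D1' : Rabs (k r - k t - (r - t) * k') <= e/3/B * h).
  { eapply Rle_trans; [exact D1|]. apply Rmult_le_compat_r; [auto|apply Rmin_r]. }
  assert (D1'' : Rabs (k r - k t) <= C * h).
  { replace (k r - k t) with ((k r - k t - (r - t) * k') + (r-t)*k') by ring.
    eapply Rle_trans; [apply Rabs_triang|]. rewrite Rabs_mult. fold h. unfold C.
    assert (Rmin 1 (e/3/B) * h <= 1 * h) by (apply Rmult_le_compat_r; [auto|apply Rmin_l]). lra. }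
  replace (e * h) with ((e/3/B * h) * B + (A * (e/3/A * h) + (C * h) * (e/3/C))) by (field; lra).
  apply norm_le_plus with (scal (k r - k t - (r - t) * k') (f t))
     (plus (scal (k t) (minus (minus (f r) (f t)) (scal (r - t) d))) (scal (k r - k t) (minus (f r) (f t)))); [vec| |].
  - apply norm_scal_bound; auto. unfold B; lra.
  - eapply norm_le_plus; [reflexivity| |]; apply norm_scal_bound; auto. unfold A; lra.
Qed.

(* Real induction on the set of [t] up to which the bound with slope [B + eps] holds. *)
Lemma mean_value_closed f a b B : a <= b ->
  (forall t, itv a b t -> exists d, deriv_in (itv a b) f t d /\ norm d <= B) ->
  norm (minus (f b) (f a)) <= B * (b - a).
Proof.
  intros Hab H.
  assert (K : forall eps, 0 < eps -> norm (minus (f b) (f a)) <= (B + eps) * (b - a)).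
  { intros eps Heps.
    assert (loc : forall s, itv a b s -> exists p, 0 < p /\ forall r, itv a b r -> Rabs (r - s) < p ->
              norm (minus (f r) (f s)) <= (B + eps) * Rabs (r - s)).
    { intros s Hs. destruct (H s Hs) as [d [Hd Nd]]. destruct (Hd eps Heps) as [p [Hp D]].
      exists p. split; auto. intros r Hr Hrs.
      replace ((B + eps) * Rabs (r - s)) with (eps * Rabs (r - s) + Rabs (r - s) * B) by ring.
      apply norm_le_plus with (minus (minus (f r) (f s)) (scal (r - s) d)) (scal (r - s) d); [vec|auto|].
      apply norm_scal_bound; [lra|auto]. }
    set (E := fun t => itv a b t /\ forall r, a <= r <= t -> norm (minus (f r) (f a)) <= (B + eps) * (r - a)).
    assert (Ea : E a).
    { split; [unfold itv; lra|]. intros r Hr. replace r with a by lra.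
      apply norm_le_zero; [vec|lra]. }
    destruct (completeness E) as [s [Hs1 Hs2]].
    - exists b. intros t [Ht _]. apply Ht.
    - exists a. exact Ea.
    - assert (Hs : itv a b s).
      { split; [apply Hs1; auto|]. apply Hs2. intros t [Ht _]. apply Ht. }
      destruct (loc s Hs) as [p [Hp D]].
      assert (X : exists t, E t /\ s - p < t).
      { apply NNPP. intros N. assert (s <= s - p); [|lra].
        apply Hs2. intros t Ht. apply Rnot_lt_le. intros L. apply N. exists t; auto. }
      destruct X as [t [Et Hts]].
      assert (ts : t <= s) by (apply Hs1; auto).
      destruct Et as [It Et].
      (* A point t of E closer than p to s links the bound up to t with the two local bounds at s.
         The estimate therefore reaches p/2 beyond s, which contradicts the supremum unless b comes
         first. *)
      assert (Es : forall r, a <= r <= Rmin b (s + p/2) -> norm (minus (f r) (f a)) <= (B + eps) * (r - a)).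
      { intros r [Hr1 Hr2].
        assert (r <= b) by (eapply Rle_trans; [exact Hr2 | apply Rmin_l]).
        assert (r <= s + p/2) by (eapply Rle_trans; [exact Hr2 | apply Rmin_r]).
        destruct (Rlt_dec r s) as [Hrs|Hrs].
        - assert (Y : exists t', E t' /\ r < t').
          { apply NNPP. intros N. assert (s <= r); [|lra].
            apply Hs2. intros t' Ht'. apply Rnot_lt_le. intros L. apply N. exists t'; auto. }
          destruct Y as [t' [[_ Et'] Hr']]. apply Et'. lra.
        - assert (N1 : norm (minus (f t) (f a)) <= (B + eps) * (t - a)) by (apply Et; unfold itv in It; lra).
          assert (N2 : norm (minus (f t) (f s)) <= (B + eps) * (s - t)).
          { replace (s - t) with (Rabs (t - s)) by (rewrite Rabs_left1; lra). apply D; auto.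
            rewrite Rabs_left1; lra. }
          assert (N3 : norm (minus (f r) (f s)) <= (B + eps) * (r - s)).
          { replace (r - s) with (Rabs (r - s)) by (rewrite Rabs_right; lra). apply D.
            - unfold itv; lra.
            - rewrite Rabs_right; lra. }
          rewrite norm_minus_sym in N2.
          replace ((B + eps) * (r - a)) with ((B+eps)*(t-a) + ((B+eps)*(s-t) + (B+eps)*(r-s))) by ring.
          eapply norm_le_plus; [|exact N1|].
          2: eapply norm_le_plus; [reflexivity|exact N2|exact N3].
          vec. }
      destruct (Rle_dec b (s + p/2)) as [L|L].
      + apply Es. rewrite Rmin_left by lra. lra.
      + exfalso. assert (s + p/2 <= s); [|lra]. apply Hs1. split.
        * unfold itv in *; lra.
        * intros r Hr. apply Es. rewrite Rmin_right by lra. lra. }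
  apply le_epsilon. intros e He.
  assert (P : 0 < b - a + 1) by lra.
  specialize (K (e / (b - a + 1)) (Rdiv_lt_0_compat _ _ He P)).
  eapply Rle_trans; [exact K|].
  assert (e / (b-a+1) * (b - a) <= e); [|lra].
  apply Rmult_le_reg_r with (b - a + 1); [lra|].
  replace (e / (b - a + 1) * (b - a) * (b - a + 1)) with (e * (b - a)) by (field; lra). nra.
Qed.

(** The interval is shortened by [h] at both ends and the loss is paid by continuity. Derivatives in
    the open interval suit the differential equation, which is given only for positive times. *)
Lemma mean_value f a b B : a <= b -> 0 <= B -> cont_on a b f ->
  (forall t, a < t < b -> exists d, deriv_in (itv a b) f t d /\ norm d <= B) ->
  norm (minus (f b) (f a)) <= B * (b - a).
Proof.
  intros Hab HB C H. destruct Hab as [Hab| ->].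
  2:{ apply norm_le_zero; [vec|lra]. }
  apply le_epsilon. intros e He.
  assert (Ia : itv a b a) by (unfold itv; lra). assert (Ib : itv a b b) by (unfold itv; lra).
  destruct (C a Ia (e/2)) as [p [Hp Dp]]; [lra|].
  destruct (C b Ib (e/2)) as [q [Hq Dq]]; [lra|].
  set (h := Rmin (Rmin (p/2) (q/2)) ((b-a)/3)).
  assert (Hh : 0 < h) by (unfold h; repeat apply Rmin_glb_lt; lra).
  assert (h1 : h <= p/2) by (unfold h; eapply Rle_trans; [apply Rmin_l|apply Rmin_l]).
  assert (h2 : h <= q/2) by (unfold h; eapply Rle_trans; [apply Rmin_l|apply Rmin_r]).
  assert (h3 : h <= (b-a)/3) by (unfold h; apply Rmin_r).
  assert (N1 : norm (minus (f (a+h)) (f a)) <= e/2).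
  { apply Dp; [unfold itv; lra|]. rewrite Rabs_right; lra. }
  assert (N2 : norm (minus (f (b-h)) (f b)) <= e/2).
  { apply Dq; [unfold itv; lra|]. rewrite Rabs_left1; lra. }
  assert (N3 : norm (minus (f (b-h)) (f (a+h))) <= B * ((b-h) - (a+h))).
  { apply mean_value_closed; [lra|]. intros t Ht. unfold itv in Ht.
    destruct (H t) as [d [Hd Nd]]; [lra|]. exists d. split; auto.
    apply deriv_in_sub with (itv a b); auto. unfold itv; intros; lra. }
  rewrite norm_minus_sym in N2.
  apply Rle_trans with (e/2 + (B * (b-h - (a+h)) + e/2)).
  - eapply norm_le_plus; [|exact N2|].
    2: eapply norm_le_plus; [reflexivity|exact N3|exact N1]. vec.
  - nra.
Qed.

End Calculus.

(** * Riemann integrals of continuous vector-valued functions *)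

Section Integral.
Context {V : CompleteNormedModule R_AbsRing}.
Implicit Types f g : R -> V.

(** Composition with [clamp a b] extends a function continuous on [a, b] continuously to the whole
    line, where results for everywhere continuous functions apply. *)
Definition clamp (a b t : R) : R := Rmax a (Rmin b t).

Lemma clamp_itv a b t : a <= b -> a <= clamp a b t <= b.
Proof.
  intros H. unfold clamp. split; [apply Rmax_l|]. apply Rmax_lub; [auto|apply Rmin_l].
Qed.

Lemma clamp_id a b t : a <= t <= b -> clamp a b t = t.
Proof. intros H. unfold clamp. rewrite Rmin_right, Rmax_right; lra. Qed.

Lemma clamp_lip a b t r : Rabs (clamp a b r - clamp a b t) <= Rabs (r - t).
Proof.
  unfold clamp, Rmax, Rmin, Rabs.
  repeat (destruct Rle_dec || destruct Rcase_abs); lra.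
Qed.

Lemma contn_continuous f t : contn_in (fun _ => True) f t -> continuous f t.
Proof.
  intros H. apply filterlim_locally. intros eps.
  destruct (H (eps/2)) as [d [Hd D]]; [generalize (cond_pos eps); lra|].
  exists (mkposreal d Hd). intros y Hy. apply (norm_compat1 (f t) (f y) eps).
  eapply Rle_lt_trans; [apply D; auto|]. generalize (cond_pos eps); lra.
Qed.

Lemma cont_on_clamp a b f : a <= b -> cont_on a b f -> forall t, continuous (fun r => f (clamp a b r)) t.
Proof.
  intros Hab H t. apply contn_continuous. intros e He.
  destruct (H (clamp a b t) (clamp_itv a b t Hab) e He) as [d [Hd D]].
  exists d. split; auto. intros r _ Hr. apply D; [apply clamp_itv; auto|].
  eapply Rle_lt_trans; [apply clamp_lip|auto].
Qed.

Lemma ex_RInt_cont_on a b f : a <= b -> cont_on a b f -> ex_RInt f a b.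
Proof.
  intros Hab H. apply ex_RInt_ext with (fun r => f (clamp a b r)).
  - intros x. rewrite Rmin_left, Rmax_right by auto. intros Hx. rewrite clamp_id; [auto|lra].
  - apply ex_RInt_continuous. intros. apply cont_on_clamp; auto.
Qed.

Lemma RInt_norm_le a b f B : a <= b -> cont_on a b f ->
  (forall t, a <= t <= b -> norm (f t) <= B) -> norm (RInt f a b) <= B * (b - a).
Proof.
  intros Hab H HB. rewrite Rmult_comm. eapply norm_RInt_le_const; eauto.
  apply RInt_correct. apply ex_RInt_cont_on; auto.
Qed.

Lemma RInt_Chasles_on a b c f : a <= b <= c -> cont_on a c f ->
  RInt f a c = plus (RInt f a b) (RInt f b c).
Proof.
  intros [H1 H2] H. symmetry. apply RInt_Chasles; apply ex_RInt_cont_on; auto; eapply cont_on_sub; eauto; lra.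
Qed.

Lemma deriv_RInt a b f t : cont_on a b f -> itv a b t ->
  deriv_in (itv a b) (fun r => RInt f a r) t (f t).
Proof.
  intros C It e He. destruct (C t It e He) as [d [Hd D]]. exists d. split; auto.
  intros r Ir Hr. unfold itv in *.
  assert (P : forall p q, a <= p -> p <= q -> q <= b -> Rabs (p - t) < d -> Rabs (q - t) < d ->
     norm (minus (RInt f p q) (scal (q - p) (f t))) <= e * (q - p)).
  { intros p q H1 H2 H3 H4 H5.
    assert (C' : cont_on p q f) by (eapply cont_on_sub; [| |exact C]; lra).
    assert (Cm : cont_on p q (fun x => minus (f x) (f t))).
    { intros x Hx. apply contn_in_minus; [apply C'; auto | apply contn_in_const]. }
    replace (scal (q - p) (f t)) with (RInt (fun _ => f t) p q) by (apply RInt_const).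
    rewrite <- RInt_minus.
    - apply RInt_norm_le; auto. intros x Hx. apply D; [lra|].
      revert H4 H5. unfold Rabs. repeat destruct Rcase_abs; lra.
    - apply ex_RInt_cont_on; auto.
    - apply ex_RInt_const. }
  destruct (Rle_dec t r) as [L|L].
  - replace (Rabs (r - t)) with (r - t) by (rewrite Rabs_right; lra).
    rewrite (RInt_Chasles_on a t r f); [|lra|eapply cont_on_sub; [| |exact C]; lra].
    eapply Rle_trans; [right; apply f_equal | apply (P t r); try lra].
    + vec.
    + rewrite Rminus_diag_eq, Rabs_R0; auto.
  - replace (Rabs (r - t)) with (t - r) by (rewrite Rabs_left; lra).
    rewrite (RInt_Chasles_on a r t f); [|lra|eapply cont_on_sub; [| |exact C]; lra].
    eapply Rle_trans; [right | apply (P r t); try lra].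
    + rewrite <- norm_oppV. apply f_equal. vec.
    + rewrite Rminus_diag_eq, Rabs_R0; auto.
Qed.

(** The function minus the primitive of [k] has derivative 0 inside, so the mean value inequality
    with bound 0 makes it constant. *)
Lemma ftc_in a b f k : a <= b -> cont_on a b f -> cont_on a b k ->
  (forall t, a < t < b -> deriv_in (itv a b) f t (k t)) -> minus (f b) (f a) = RInt k a b.
Proof.
  intros Hab Cf Ck D.
  set (g := fun t => minus (f t) (RInt k a t)).
  assert (N : norm (minus (g b) (g a)) <= 0 * (b - a)).
  { apply mean_value; auto; [lra| |].
    - intros t Ht. apply contn_in_minus; [auto|].
      eapply deriv_contn. apply deriv_RInt; auto.
    - intros t Ht. exists (minus (k t) (k t)). split; [|apply norm_le_zero; [vec|lra]].
      apply deriv_in_minus; [auto|].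
      apply deriv_RInt; auto. unfold itv; lra. }
  assert (E : minus (g b) (g a) = zero).
  { apply norm_eq_zeroV. apply Rle_antisym; [lra | apply norm_ge_0]. }
  apply minus_eq0 in E. unfold g in E. rewrite RInt_point in E.
  transitivity (minus (plus (minus (f b) (RInt k a b)) (RInt k a b)) (f a)); [vec|rewrite E; vec].
Qed.

End Integral.

(** [L] applied to the primitive of [f] is differentiated, so that no Riemann sums have to be
    carried through [L]. *)
Lemma RInt_lin {V W : CompleteNormedModule R_AbsRing} (L : V -> W) M a b f :
  (forall x y, L (plus x y) = plus (L x) (L y)) -> (forall r x, L (scal r x) = scal r (L x)) ->
  (forall x, norm (L x) <= M * norm x) -> a <= b -> cont_on a b f ->
  L (RInt f a b) = RInt (fun t => L (f t)) a b.
Proof.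
  intros H1 H2 HM Hab C.
  assert (Hm : forall x y, L (minus x y) = minus (L x) (L y)).
  { intros. replace (minus x y) with (plus x (scal (-1) y)) by vec. rewrite H1, H2. vec. }
  assert (Z : L zero = zero).
  { replace (zero : V) with (scal 0 (zero : V)) by vec. rewrite H2. vec. }
  rewrite <- (ftc_in a b (fun t => L (RInt f a t)) (fun t => L (f t))); auto.
  - rewrite RInt_point, Z. vec.
  - intros t Ht. eapply contn_in_lin; eauto. eapply deriv_contn. apply deriv_RInt; auto.
  - intros t Ht. eapply contn_in_lin; eauto.
  - intros t Ht. eapply deriv_in_lin; eauto. apply deriv_RInt; auto. unfold itv; lra.
Qed.

Lemma deriv_in_real (J : R -> Prop) (f : R -> R) t d :
  is_derive f t d -> deriv_in (V := R_CompleteNormedModule) J f t d.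
Proof.
  intros H e He. apply is_derive_Reals in H. destruct (H e He) as [p Hp].
  exists p. split; [apply cond_pos|]. intros r _ Hr.
  change (Rabs (f r - f t - (r - t) * d) <= e * Rabs (r - t)).
  destruct (Req_dec r t) as [->|N].
  - replace (f t - f t - (t - t) * d) with 0 by ring. rewrite Rabs_R0, Rminus_diag_eq, Rabs_R0; lra.
  - assert (N' : r - t <> 0) by lra. specialize (Hp (r - t) N' Hr).
    replace (t + (r - t)) with r in Hp by ring.
    replace (f r - f t - (r - t) * d) with (((f r - f t) / (r - t) - d) * (r - t)) by (field; auto).
    rewrite Rabs_mult. apply Rmult_le_compat_r; [apply Rabs_pos|lra].
Qed.

Lemma contn_in_real (J : R -> Prop) (f : R -> R) t :
  continuous f t -> contn_in (V := R_CompleteNormedModule) J f t.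
Proof.
  intros H e He. apply filterlim_locally with (eps := mkposreal e He) in H.
  destruct H as [d Hd]. exists d. split; [apply cond_pos|]. intros r _ Hr.
  apply Rlt_le. exact (Hd r Hr).
Qed.

(** * Sequential limits and fixed points *)

Definition seq_lim {V : CompleteNormedModule R_AbsRing} (u : nat -> V) (l : V) : Prop :=
  forall eps, 0 < eps -> exists N, forall n, (N <= n)%nat -> norm (minus (u n) l) <= eps.

Section Complete.
Context {V : CompleteNormedModule R_AbsRing}.
Implicit Types u : nat -> V.

Lemma cauchy_lim u :
  (forall eps, 0 < eps -> exists N, forall n m, (N <= n)%nat -> (N <= m)%nat -> norm (minus (u n) (u m)) <= eps) ->
  exists l, seq_lim u l.
Proof.
  intros H.
  destruct (proj1 (filterlim_locally_cauchy (F := eventually) u)) as [l Hl].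
  - intros eps. destruct (H (eps/2)) as [N HN]; [generalize (cond_pos eps); lra|].
    exists (fun n => (N <= n)%nat). split; [exists N; auto|].
    intros n m Hn Hm. apply (norm_compat1 (u n) (u m) eps).
    eapply Rle_lt_trans; [apply HN; auto|]. generalize (cond_pos eps); lra.
  - exists l. intros eps Heps.
    assert (K : locally l (fun y => norm (minus y l) < eps)).
    { apply (locally_le_locally_norm l). exists (mkposreal eps Heps). intros y Hy. exact Hy. }
    destruct (Hl _ K) as [N HN]. exists N. intros n Hn. left. apply HN; auto.
Qed.

Lemma seq_lim_norm u l B : seq_lim u l -> (exists N, forall n, (N <= n)%nat -> norm (u n) <= B) -> norm l <= B.
Proof.
  intros H [N0 HB]. apply le_epsilon. intros e He. destruct (H e He) as [N HN].
  apply norm_le_plus with (u (max N N0)) (opp (minus (u (max N N0)) l)); [vec| apply HB; lia|].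
  rewrite norm_oppV. apply HN. lia.
Qed.

Lemma seq_lim_unique u l l' : seq_lim u l -> seq_lim u l' -> l = l'.
Proof.
  intros H H'. apply norm_minus_eq0. intros e He.
  destruct (H (e/2)) as [N HN]; [lra|]. destruct (H' (e/2)) as [N' HN']; [lra|].
  replace e with (e/2+e/2) by field.
  apply norm_le_plus with (minus l (u (max N N'))) (minus (u (max N N')) l'); [vec| |apply HN'; lia].
  rewrite norm_minus_sym. apply HN. lia.
Qed.

(* Families indexed by [1..s]; values at other indices are irrelevant. *)
Lemma contraction_fixpoint (s : nat) (F : (nat -> V) -> nat -> V) (r q : R) :
  0 <= r -> 0 <= q < 1 ->
  (forall x, (forall i, (1 <= i <= s)%nat -> norm (x i) <= r) ->
     forall i, (1 <= i <= s)%nat -> norm (F x i) <= r) ->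
  (forall x y d, (forall i, (1 <= i <= s)%nat -> norm (x i) <= r) ->
     (forall i, (1 <= i <= s)%nat -> norm (y i) <= r) ->
     (forall i, (1 <= i <= s)%nat -> norm (minus (x i) (y i)) <= d) ->
     forall i, (1 <= i <= s)%nat -> norm (minus (F x i) (F y i)) <= q * d) ->
  exists x, (forall i, (1 <= i <= s)%nat -> norm (x i) <= r) /\
     forall i, (1 <= i <= s)%nat -> F x i = x i.
Proof.
  intros Hr Hq Hball Hlip.
  set (it := fix it n := match n with O => fun _ : nat => zero : V | S k => F (it k) end).
  assert (B : forall n i, (1 <= i <= s)%nat -> norm (it n i) <= r).
  { induction n; intros i Hi; cbn; [apply norm_le_zero; auto | apply Hball; auto]. }
  assert (D : forall n i, (1 <= i <= s)%nat -> norm (minus (it (S n) i) (it n i)) <= q ^ n * (2 * r)).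
  { induction n; intros i Hi.
    - replace (q ^ 0 * (2 * r)) with (r + r) by (cbn; ring).
      apply norm_le_plus with (it 1%nat i) (opp (it 0%nat i)); [vec|apply B; auto|].
      rewrite norm_oppV. apply B; auto.
    - replace (q ^ S n * (2 * r)) with (q * (q ^ n * (2 * r))) by (cbn; ring).
      apply (Hlip (it (S n)) (it n)); auto. }
  assert (qn : forall n, 0 <= q ^ n) by (intros; apply pow_le; lra).
  assert (Dk : forall k n i, (1 <= i <= s)%nat -> norm (minus (it (n + k)%nat i) (it n i)) <= q ^ n * (2 * r) / (1 - q)).
  { intros k n i Hi.
    assert (G : norm (minus (it (n + k)%nat i) (it n i)) <= (q ^ n - q ^ (n + k)) * (2 * r) / (1 - q)).
    { induction k.
      - rewrite Nat.add_0_r. apply norm_le_zero; [vec|]. rewrite Rminus_diag_eq by auto. unfold Rdiv. lra.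
      - rewrite Nat.add_succ_r.
        replace ((q ^ n - q ^ S (n + k)) * (2 * r) / (1 - q)) with
          (q ^ (n + k) * (2 * r) + (q ^ n - q ^ (n + k)) * (2 * r) / (1 - q)) by (cbn; field; lra).
        apply norm_le_plus with (minus (it (S (n + k)) i) (it (n + k)%nat i)) (minus (it (n + k)%nat i) (it n i)); [vec|apply D; auto|exact IHk]. }
    eapply Rle_trans; [exact G|]. unfold Rdiv. apply Rmult_le_compat_r.
    - apply Rlt_le, Rinv_0_lt_compat; lra.
    - apply Rmult_le_compat_r; [lra|]. generalize (qn (n+k)%nat); lra. }
  assert (L : forall eps, 0 < eps -> exists N, forall n, (N <= n)%nat -> q ^ n * (2 * r) / (1 - q) <= eps).
  { intros eps He. destruct (pow_lt_1_zero q) with (y := eps * (1 - q) / (2 * r + 1)) as [N HN].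
    - rewrite Rabs_right; lra.
    - apply Rdiv_lt_0_compat; [apply Rmult_lt_0_compat; lra|lra].
    - exists N. intros n Hn. specialize (HN n Hn). rewrite Rabs_right in HN by (apply Rle_ge; auto).
      apply Rmult_le_reg_r with (1 - q); [lra|].
      replace (q ^ n * (2 * r) / (1 - q) * (1 - q)) with (q ^ n * (2 * r)) by (field; lra).
      apply Rle_trans with (q ^ n * (2 * r + 1)); [generalize (qn n); lra|].
      apply Rle_trans with (eps * (1 - q) / (2 * r + 1) * (2 * r + 1)); [|right; field; lra].
      apply Rmult_le_compat_r; lra. }
  assert (X : forall i, exists l, (1 <= i <= s)%nat -> seq_lim (fun n => it n i) l).
  { intros i. destruct (classic ((1 <= i <= s)%nat)) as [Hi|Hi].
    - destruct (cauchy_lim (fun n => it n i)) as [l Hl].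
      + intros eps He. destruct (L (eps/2)) as [N HN]; [lra|]. exists N. intros n m Hn Hm.
        replace eps with (eps/2 + eps/2) by field.
        apply norm_le_plus with (minus (it n i) (it N i)) (minus (it N i) (it m i)); [vec| |].
        * replace n with (N + (n - N))%nat by lia. eapply Rle_trans; [apply Dk; auto|auto].
        * rewrite norm_minus_sym. replace m with (N + (m - N))%nat by lia. eapply Rle_trans; [apply Dk; auto|auto].
      + exists l; auto.
    - exists zero. intros; contradiction. }
  exists (fun i => proj1_sig (constructive_indefinite_description _ (X i))).
  set (x := fun i => proj1_sig (constructive_indefinite_description _ (X i))).
  assert (Hx : forall i, (1 <= i <= s)%nat -> seq_lim (fun n => it n i) (x i)).
  { intros i. unfold x. destruct constructive_indefinite_description; auto. }
  assert (Bx : forall i, (1 <= i <= s)%nat -> norm (x i) <= r).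
  { intros i Hi. apply (seq_lim_norm (fun n => it n i)); auto. exists O. intros; apply B; auto. }
  split; [exact Bx|]. intros i Hi. change (F x i = x i).
  assert (Dx : forall n j, (1 <= j <= s)%nat -> norm (minus (x j) (it n j)) <= q ^ n * (2 * r) / (1 - q)).
  { intros n j Hj. apply (seq_lim_norm (fun k => minus (it k j) (it n j))).
    - intros e He. destruct (Hx j Hj e He) as [N HN]. exists N. intros k Hk.
      replace (minus _ _) with (minus (it k j) (x j)) by vec. auto.
    - exists n. intros k Hk. replace k with (n + (k - n))%nat by lia. apply Dk; auto. }
  apply norm_minus_eq0. intros e He. destruct (L (e/2)) as [N HN]; [lra|].
  replace e with (e/2 + e/2) by field.
  apply norm_le_plus with (minus (F x i) (it (S N) i)) (minus (it (S N) i) (x i)); [vec| |].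
  - apply Rle_trans with (q * (q ^ N * (2 * r) / (1 - q))); [cbn; apply Hlip; auto|].
    assert (0 <= q ^ N * (2 * r) / (1 - q)).
    { apply Rmult_le_pos; [apply Rmult_le_pos; [auto|lra]|]. apply Rlt_le, Rinv_0_lt_compat; lra. }
    specialize (HN N (le_n _)). nra.
  - rewrite norm_minus_sym. eapply Rle_trans; [apply Dx; auto|]. apply HN; lia.
Qed.

End Complete.

(** * Integrals with a parameter, exchange of order, uniform continuity *)

Section Fubini.
Context {V : CompleteNormedModule R_AbsRing}.

Lemma RInt_plus_on a b (f g : R -> V) : a <= b -> cont_on a b f -> cont_on a b g ->
  RInt (fun t => plus (f t) (g t)) a b = plus (RInt f a b) (RInt g a b).
Proof. intros. apply RInt_plus; apply ex_RInt_cont_on; auto. Qed.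

Lemma RInt_minus_on a b (f g : R -> V) : a <= b -> cont_on a b f -> cont_on a b g ->
  RInt (fun t => minus (f t) (g t)) a b = minus (RInt f a b) (RInt g a b).
Proof. intros. apply RInt_minus; apply ex_RInt_cont_on; auto. Qed.

Lemma RInt_scal_on a b (f : R -> V) r : a <= b -> cont_on a b f ->
  RInt (fun t => scal r (f t)) a b = scal r (RInt f a b).
Proof. intros. apply RInt_scal; apply ex_RInt_cont_on; auto. Qed.

Lemma RInt_ext_on a b (f g : R -> V) : a <= b -> (forall t, a <= t <= b -> f t = g t) -> RInt f a b = RInt g a b.
Proof. intros H E. apply RInt_ext. rewrite Rmin_left, Rmax_right by auto. intros; apply E; lra. Qed.

(** Continuity in the second variable, uniform in the first. This condition, required in both
    variables, replaces joint continuity on the rectangle in the exchange of integrals. *)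
Definition equicont_snd (a b c d : R) (k : R -> R -> V) : Prop :=
  forall t, itv c d t -> forall eps, 0 < eps -> exists delta, 0 < delta /\
    forall t', itv c d t' -> Rabs (t' - t) < delta ->
      forall s, itv a b s -> norm (minus (k s t') (k s t)) <= eps.

Lemma cont_on_RInt_param a b c d k : a <= b -> c <= d -> equicont_snd a b c d k ->
  (forall t, itv c d t -> cont_on a b (fun s => k s t)) ->
  cont_on c d (fun t => RInt (fun s => k s t) a b).
Proof.
  intros Hab Hcd E C t It e He. set (B := b - a + 1). assert (0 < B) by (unfold B; lra).
  destruct (E t It (e / B)) as [p [Hp D]]; [apply Rdiv_lt_0_compat; auto|].
  exists p. split; auto. intros r Ir Hr. rewrite <- RInt_minus_on; auto.
  apply Rle_trans with (e / B * (b - a)).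
  - apply RInt_norm_le; auto. intros s Is. apply contn_in_minus; [apply C|apply C]; auto.
  - apply Rle_trans with (e / B * B); [|right; field; lra].
    apply Rmult_le_compat_l; [apply Rlt_le, Rdiv_lt_0_compat; auto|unfold B; lra].
Qed.

(** Fubini by differentiation: the right-hand side, as a function of the upper limit in t, vanishes
    at [c] and has the inner integral over s as its derivative. *)
Lemma RInt_swap_on a b c d k : a <= b -> c <= d -> equicont_snd a b c d k ->
  equicont_snd c d a b (fun t s => k s t) ->
  RInt (fun t => RInt (fun s => k s t) a b) c d = RInt (fun s => RInt (fun t => k s t) c d) a b.
Proof.
  intros Hab Hcd E1 E2.
  assert (C1 : forall t, itv c d t -> cont_on a b (fun s => k s t)).
  { intros t It s Is e He. destruct (E2 s Is e He) as [p [Hp D]]. exists p. split; auto. }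
  assert (C2 : forall s, itv a b s -> cont_on c d (fun t => k s t)).
  { intros s Is t It e He. destruct (E1 t It e He) as [p [Hp D]]. exists p. split; auto. }
  assert (P : forall t, itv c d t -> cont_on a b (fun s => RInt (fun r => k s r) c t)).
  { intros t It. unfold itv in It. apply (cont_on_RInt_param c t a b (fun r s => k s r)); try lra.
    - intros s Is e He. destruct (E2 s Is e He) as [p [Hp D]]. exists p. split; auto.
      intros s' Is' Hs r Ir. apply D; auto. unfold itv in *; lra.
    - intros s Is. eapply cont_on_sub; [| |apply C2; auto]; lra. }
  symmetry.
  transitivity (minus (RInt (fun s => RInt (fun t => k s t) c d) a b) (RInt (fun s => RInt (fun t => k s t) c c) a b)).
  { rewrite (RInt_ext_on a b (fun s => RInt (fun t => k s t) c c) (fun _ => scal 0 zero)); auto.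
    2: intros; rewrite RInt_point; vec.
    rewrite RInt_const. vec. }
  assert (D : forall t, itv c d t ->
    deriv_in (itv c d) (fun t => RInt (fun s => RInt (fun r => k s r) c t) a b) t (RInt (fun s => k s t) a b)).
  { intros t It e He. set (B := b - a + 1). assert (HB : 0 < B) by (unfold B; lra).
    destruct (E1 t It (e / B)) as [p [Hp D]]; [apply Rdiv_lt_0_compat; auto|].
    exists p. split; auto. intros r Ir Hr.
    rewrite <- RInt_scal_on, <- !RInt_minus_on; auto.
    - apply Rle_trans with (e / B * Rabs (r - t) * (b - a)).
      + apply RInt_norm_le; auto.
        * intros s Is. apply contn_in_minus; [apply contn_in_minus; apply P; auto|].
          apply contn_in_scal; [apply (contn_in_const (V := R_CompleteNormedModule))|apply C1; auto].
        * intros s Is. unfold itv in *.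
          assert (Q : forall x y, c <= x -> x <= y -> y <= d -> Rabs (x - t) < p -> Rabs (y - t) < p ->
             norm (minus (minus (RInt (fun r => k s r) c y) (RInt (fun r => k s r) c x)) (scal (y - x) (k s t))) <= e / B * (y - x)).
          { intros x y H1 H2 H3 H4 H5.
            assert (Cx : cont_on x y (fun r => k s r)) by (eapply cont_on_sub; [| |apply C2; auto]; lra).
            rewrite (RInt_Chasles_on c x y); [|lra|eapply cont_on_sub; [| |apply C2; auto]; lra].
            rewrite <- (RInt_const x y (k s t)).
            replace (minus _ _) with (minus (RInt (fun r => k s r) x y) (RInt (fun _ => k s t) x y)) by vec.
            rewrite <- RInt_minus_on; auto; [|intros ? ?; apply contn_in_const].
            apply RInt_norm_le; auto.
            - intros z Iz. apply contn_in_minus; [apply Cx; auto|apply contn_in_const].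
            - intros z Iz. apply D; auto; [lra|]. revert H4 H5. unfold Rabs. repeat destruct Rcase_abs; lra. }
          assert (z0 : Rabs (t - t) < p) by (rewrite Rminus_diag_eq, Rabs_R0; auto).
          destruct (Rle_dec t r).
          -- rewrite (Rabs_right (r - t)) by lra. apply Q; auto; lra.
          -- rewrite (Rabs_left (r - t)) by lra. replace (- (r - t)) with (t - r) by ring.
             rewrite <- norm_oppV.
             replace (opp _) with (minus (minus (RInt (fun r => k s r) c t) (RInt (fun r => k s r) c r)) (scal (t - r) (k s t))) by vec.
             apply Q; auto; lra.
      + apply Rle_trans with (e / B * Rabs (r - t) * B).
        * apply Rmult_le_compat_l; [|unfold B; lra].
          apply Rmult_le_pos; [apply Rlt_le, Rdiv_lt_0_compat; auto|apply Rabs_pos].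
        * right. field. lra.
    - intros s Is. apply contn_in_minus; apply P; auto.
    - intros s Is. apply contn_in_scal; [apply (contn_in_const (V := R_CompleteNormedModule))|apply C1; auto]. }
  apply (ftc_in c d (fun t => RInt (fun s => RInt (fun r => k s r) c t) a b)); auto.
  - intros t It. eapply deriv_contn. apply D; auto.
  - apply cont_on_RInt_param; auto.
  - intros t It. apply D. unfold itv; lra.
Qed.

Lemma uniform_cont (f : R -> V) a b : (forall t, contn_in (fun _ => True) f t) ->
  forall eps, 0 < eps -> exists delta, 0 < delta /\
    forall s t, itv a b s -> Rabs (t - s) < delta -> norm (minus (f t) (f s)) <= eps.
Proof.
  intros C eps He.
  (* The factor 2 leaves room for two points: s lies within [dl] of a centre, and t within a further
     distance that is at most [dl]. *)
  assert (X : forall t, exists d : posreal, forall r, Rabs (r - t) < 2 * d -> norm (minus (f r) (f t)) <= eps / 2).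
  { intros t. destruct (C t (eps/2)) as [d [Hd D]]; [lra|].
    assert (h : 0 < d / 2) by lra. exists (mkposreal _ h). cbn. intros r Hr. apply D; auto. lra. }
  set (dl := fun t => proj1_sig (constructive_indefinite_description _ (X t))).
  assert (Hdl : forall t r, Rabs (r - t) < 2 * dl t -> norm (minus (f r) (f t)) <= eps / 2).
  { intros t. unfold dl. destruct constructive_indefinite_description; auto. }
  destruct (compactness_value_1d a b dl) as [d Hd].
  exists d. split; [apply cond_pos|]. intros s t Is Hst.
  apply NNPP. intros N. apply (Hd s Is). intros [u [Iu [Hu Hdu]]]. apply N.
  replace eps with (eps/2+eps/2) by field.
  apply norm_le_plus with (minus (f t) (f u)) (minus (f u) (f s)); [vec| |].
  - apply Hdl. replace (t - u) with ((t - s) + (s - u)) by ring.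
    eapply Rle_lt_trans; [apply Rabs_triang|]. lra.
  - rewrite norm_minus_sym. apply Hdl. generalize (cond_pos (dl u)); lra.
Qed.

End Fubini.

(** * Strongly continuous semigroups *)

Section ComplexScalars.
Context {X : CompleteNormedModule C_AbsRing}.
Implicit Types x y : real_space X.

Lemma cscal_plus_r (l : C) x y : cscal l (plus x y) = plus (cscal l x) (cscal l y).
Proof. exact (@scal_distr_l C_Ring X l x y). Qed.

Lemma cscal_plus_l (l m : C) x : cscal (l + m)%C x = plus (cscal l x) (cscal m x).
Proof. exact (@scal_distr_r C_Ring X l m x). Qed.

Lemma cscal_assoc (l m : C) x : cscal l (cscal m x) = cscal (l * m)%C x.
Proof. exact (@scal_assoc C_Ring X l m x). Qed.

Lemma cscal_RtoC (a : R) x : cscal (RtoC a) x = scal a x.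
Proof. reflexivity. Qed.

Lemma cscal_scal (l : C) (a : R) x : cscal l (scal a x) = scal a (cscal l x).
Proof. rewrite <- !cscal_RtoC, !cscal_assoc. f_equal. apply Cmult_comm. Qed.

Lemma cscal_minus_r (l : C) x y : cscal l (minus x y) = minus (cscal l x) (cscal l y).
Proof.
  replace (minus x y) with (plus x (scal (-1) y)) by vec.
  rewrite cscal_plus_r, cscal_scal. vec.
Qed.

Lemma cscal_minus_l (l m : C) x : cscal (l - m)%C x = minus (cscal l x) (cscal m x).
Proof.
  transitivity (minus (plus (cscal (l - m)%C x) (cscal m x)) (cscal m x)); [vec|].
  rewrite <- cscal_plus_l. f_equal. f_equal. ring.
Qed.

Lemma cscal_one x : cscal 1%C x = x.
Proof. exact (@scal_one C_Ring X x). Qed.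

Lemma cscal_zero_l x : cscal 0%C x = zero.
Proof. change (scal 0 x = zero). vec. Qed.

Lemma cscal_zero_r (l : C) : cscal l (zero : real_space X) = zero.
Proof.
  transitivity (cscal l (scal 0 (zero : real_space X))); [f_equal; vec|].
  rewrite cscal_scal. vec.
Qed.

Lemma cscal_opp_l (l : C) x : cscal (- l)%C x = opp (cscal l x).
Proof.
  transitivity (cscal (0 - l)%C x); [f_equal; ring|].
  rewrite (cscal_minus_l 0%C l), cscal_zero_l. vec.
Qed.

Lemma norm_cscal (l : C) x : norm (cscal l x) <= Cmod l * norm x.
Proof. exact (@norm_scal C_AbsRing X l x). Qed.

(* Real and imaginary parts of a scalar act through [scal] and multiplication by [i]. *)
Lemma cscal_pair (a b : R) x : cscal (a, b) x = plus (scal a x : real_space X) (scal b (cscal Ci x) : real_space X).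
Proof.
  rewrite <- !cscal_RtoC, cscal_assoc, <- cscal_plus_l. f_equal.
  unfold RtoC, Cplus, Cmult, Ci; cbn. f_equal; ring.
Qed.

Lemma cscal_Ci2 x : cscal Ci (cscal Ci x) = opp x.
Proof.
  rewrite cscal_assoc. replace (Ci * Ci)%C with (RtoC (-1)).
  - rewrite cscal_RtoC. vec.
  - unfold RtoC, Cmult, Ci; cbn. f_equal; ring.
Qed.

Lemma norm_Ci x : norm (cscal Ci x) <= norm x.
Proof.
  eapply Rle_trans; [apply norm_cscal|].
  replace (Cmod Ci) with 1; [lra|]. unfold Cmod, Ci; cbn. rewrite <- sqrt_1 at 1. f_equal. ring.
Qed.

Variable B : real_space X -> real_space X.
Hypothesis HB : bounded_linear B.

Lemma lin_plus x y : B (plus x y) = plus (B x) (B y).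
Proof. exact (@linear_plus C_AbsRing X X B HB x y). Qed.

Lemma lin_cscal l x : B (cscal l x) = cscal l (B x).
Proof. exact (@linear_scal C_AbsRing X X B HB l x). Qed.

Lemma lin_scal (a : R) x : B (scal a x) = scal a (B x).
Proof. exact (@linear_scal C_AbsRing X X B HB (RtoC a) x). Qed.

Lemma lin_minus x y : B (minus x y) = minus (B x) (B y).
Proof.
  replace (minus x y) with (plus x (scal (-1) y)) by vec. rewrite lin_plus, lin_scal. vec.
Qed.

Lemma lin_opp x : B (opp x) = opp (B x).
Proof. replace (opp x) with (scal (-1) x) by vec. rewrite lin_scal. vec. Qed.

Lemma lin_zero : B zero = zero.
Proof. replace (zero : real_space X) with (scal 0 (zero : real_space X)) by vec. rewrite lin_scal. vec. Qed.

Lemma lin_bound : exists M, 0 < M /\ forall x, norm (B x) <= M * norm x.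
Proof. exact (@linear_norm C_AbsRing X X B HB). Qed.

End ComplexScalars.

Section Semigroup.
Context {X : CompleteNormedModule C_AbsRing}.
Variable S : R -> real_space X -> real_space X.
Hypothesis C0 : C0_semigroup S.
Implicit Types x y : real_space X.

Lemma sg_lin t : 0 <= t -> bounded_linear (S t).
Proof. intros; apply C0; auto. Qed.

Lemma sg_zero x : S 0 x = x.
Proof. apply C0. Qed.

Lemma sg_plus t r x : 0 <= t -> 0 <= r -> S (t + r) x = S t (S r x).
Proof. intros; apply C0; auto. Qed.

Lemma sg_right_limit x eps : 0 < eps -> exists delta, 0 < delta /\
  forall t, 0 <= t < delta -> norm (minus (S t x) x) <= eps.
Proof.
  intros He. destruct C0 as (_ & _ & _ & L). specialize (L x).
  assert (K : locally x (fun y => norm (minus y x) < eps)).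
  { apply (locally_le_locally_norm x). exists (mkposreal eps He). intros y Hy. exact Hy. }
  destruct (L _ K) as [d Hd]. exists d. split; [apply cond_pos|].
  intros t [[H1|<-] H2].
  - left. apply Hd; auto. unfold ball; cbn; unfold AbsRing_ball, abs, minus, plus, opp; cbn.
    rewrite Ropp_0, Rplus_0_r, Rabs_right; lra.
  - rewrite sg_zero. apply norm_le_zero; [vec|lra].
Qed.

(* Nested balls: an unbounded sequence of operators near 0 would be unbounded on a common point. *)
Lemma sg_locally_bounded : exists M delta, 1 <= M /\ 0 < delta /\
  forall t x, 0 <= t <= delta -> norm (S t x) <= M * norm x.
Proof.
  apply NNPP. intros N.
  assert (U : forall M delta, 1 <= M -> 0 < delta -> exists t z, 0 <= t <= delta /\ M * norm z < norm (S t z)).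
  { intros M delta HM Hd. apply NNPP. intros N'. apply N. exists M, delta. repeat split; auto.
    intros t x Ht. apply Rnot_lt_le. intros L. apply N'. exists t, x; auto. }
  assert (St : forall (k : nat) (p : real_space X * posreal), exists q : real_space X * posreal * R,
     snd (fst q) <= snd p / 2 /\ norm (minus (fst (fst q)) (fst p)) <= snd p / 2 /\
     0 <= snd q <= / (INR k + 1) /\
     forall y : real_space X, norm (minus y (fst (fst q))) <= snd (fst q) -> INR k <= norm (S (snd q) y)).
  { intros k [x [e He]]. cbn.
    assert (Hk : 0 <= INR k) by apply pos_INR.
    (* The second entry of the maximum is such that [w], a multiple of z of norm at most e/2, has an
       image of norm at least k + 1. *)
    destruct (U (Rmax 1 (2 * (INR k + 1) / e)) (/ (INR k + 1))) as [t [z [Ht Hz]]].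
    { apply Rmax_l. } { apply Rinv_0_lt_compat; lra. }
    assert (Lt : bounded_linear (S t)) by (apply sg_lin; lra).
    destruct (lin_bound _ Lt) as [m [Hm Bm]].
    assert (nz : 0 < norm z).
    { destruct (Rle_lt_or_eq_dec 0 (norm z)) as [|E0]; [apply norm_ge_0|auto|].
      specialize (Bm z). rewrite <- E0 in *. lra. }
    set (w := scal (e / 2 / norm z) z : real_space X).
    assert (cw : 0 <= e / 2 / norm z) by (apply Rlt_le, Rdiv_lt_0_compat; lra).
    assert (Nw : norm w <= e / 2).
    { unfold w. eapply Rle_trans; [apply norm_scalR|]. rewrite Rabs_right by lra. right. field. lra. }
    assert (Tw : INR k + 1 <= norm (S t w)).
    { assert (E1 : norm (S t z) <= norm (S t w) * (2 * norm z / e)).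
      { replace (S t z) with (scal (2 * norm z / e) (S t w)).
        - eapply Rle_trans; [apply norm_scalR|]. rewrite Rabs_right; [lra|].
          apply Rle_ge, Rlt_le, Rdiv_lt_0_compat; lra.
        - unfold w. rewrite lin_scal by auto. vec_with ltac:(real_eq; field; lra). }
      assert (E2 : 2 * (INR k + 1) / e * norm z < norm (S t w) * (2 * norm z / e)).
      { eapply Rle_lt_trans; [|eapply Rlt_le_trans; [exact Hz|exact E1]].
        apply Rmult_le_compat_r; [lra|apply Rmax_r]. }
      replace (2 * (INR k + 1) / e * norm z) with ((INR k + 1) * (2 * norm z / e)) in E2 by (field; lra).
      left. eapply Rmult_lt_reg_r; [|exact E2]. apply Rdiv_lt_0_compat; lra. }
    (* The images of x + w and x - w differ by 2 S(t)w, so one of them has at least the norm of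
       S(t)w. *)
    assert (Hx : exists x' : real_space X, norm (minus x' x) <= e / 2 /\ INR k + 1 <= norm (S t x')).
    { destruct (Rle_dec (INR k + 1) (norm (S t (plus x w)))) as [L|L].
      - exists (plus x w). split; auto. replace (minus (plus x w) x) with w by vec. auto.
      - exists (minus x w). split.
        + replace (minus (minus x w) x) with (opp w) by vec. rewrite norm_oppV; auto.
        + apply Rnot_lt_le. intros L'. apply Rnot_le_lt in L.
          assert (norm (scal 2 (S t w)) <= norm (S t (plus x w)) + norm (S t (minus x w))).
          { rewrite <- (norm_oppV (S t (minus x w))).
            eapply norm_le_plus; [|apply Rle_refl|apply Rle_refl].
            rewrite lin_plus, lin_minus by auto. vec. }
          assert (norm (S t w) * 2 <= norm (scal 2 (S t w))).
          { assert (norm (scal (/2) (scal 2 (S t w))) <= / 2 * norm (scal 2 (S t w))).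
            { eapply Rle_trans; [apply norm_scalR|]. rewrite Rabs_right; lra. }
            replace (scal (/2) (scal 2 (S t w))) with (S t w) in H0 by (vec_with ltac:(real_eq; field)). lra. }
          lra. }
    destruct Hx as [x' [Hx1 Hx2]].
    assert (He' : 0 < Rmin (e / 2) (/ m)) by (apply Rmin_glb_lt; [lra|apply Rinv_0_lt_compat; auto]).
    exists (x', mkposreal _ He', t). cbn. repeat split; auto; try lra.
    - apply Rmin_l.
    - intros y Hy.
      assert (norm (S t (minus y x')) <= 1).
      { eapply Rle_trans; [apply Bm|]. apply Rle_trans with (m * / m).
        - apply Rmult_le_compat_l; [lra|]. eapply Rle_trans; [exact Hy|apply Rmin_r].
        - right. field. lra. }
      assert (norm (S t x') <= norm (S t y) + norm (S t (minus y x'))).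
      { rewrite <- (norm_oppV (S t (minus y x'))). eapply norm_le_plus; [|apply Rle_refl|apply Rle_refl].
        rewrite lin_minus by auto. vec. }
      lra. }
  set (step := fun k p => proj1_sig (constructive_indefinite_description _ (St k p))).
  assert (Hstep : forall k p, let q := step k p in
     snd (fst q) <= snd p / 2 /\ norm (minus (fst (fst q)) (fst p)) <= snd p / 2 /\
     0 <= snd q <= / (INR k + 1) /\
     forall y : real_space X, norm (minus y (fst (fst q))) <= snd (fst q) -> INR k <= norm (S (snd q) y)).
  { intros k p. unfold step. destruct constructive_indefinite_description; auto. }
  set (sq := fix sq n := match n with O => (zero : real_space X, mkposreal 1 Rlt_0_1) | Datatypes.S k => fst (step k (sq k)) end).
  assert (Hs : forall n, snd (sq n) <= (/2) ^ n).
  { induction n; [cbn; lra|]. destruct (Hstep n (sq n)) as [H1 _].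
    change (sq (Datatypes.S n)) with (fst (step n (sq n))). cbn [pow]. lra. }
  assert (Hd : forall k n, norm (minus (fst (sq (n + k)%nat)) (fst (sq n))) <= snd (sq n) - snd (sq (n + k)%nat)).
  { induction k; intros n.
    - rewrite Nat.add_0_r. apply norm_le_zero; [vec|lra].
    - rewrite Nat.add_succ_r. destruct (Hstep (n + k)%nat (sq (n + k)%nat)) as (H1 & H2 & _).
      change (sq (Datatypes.S (n + k))) with (fst (step (n + k)%nat (sq (n + k)%nat))).
      set (q := step (n + k)%nat (sq (n + k)%nat)) in *.
      replace (snd (sq n) - snd (fst q)) with ((snd (sq (n+k)%nat) - snd (fst q)) + (snd (sq n) - snd (sq (n+k)%nat))) by ring.
      apply norm_le_plus with (minus (fst (fst q)) (fst (sq (n+k)%nat))) (minus (fst (sq (n+k)%nat)) (fst (sq n))); [vec|lra|auto]. }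
  destruct (cauchy_lim (fun n => fst (sq n))) as [x Hx].
  { intros eps He. destruct (pow_lt_1_zero (/2)) with (y := eps / 2) as [N0 HN].
    - rewrite Rabs_right; lra.
    - lra.
    - exists N0. intros n m Hn Hm. replace eps with (eps/2+eps/2) by field.
      specialize (HN N0 (le_n _)). apply Rabs_def2 in HN. specialize (Hs N0).
      assert (G : forall j, (N0 <= j)%nat -> norm (minus (fst (sq j)) (fst (sq N0))) <= eps / 2).
      { intros j Hj. replace j with (N0 + (j - N0))%nat by lia. eapply Rle_trans; [apply Hd|].
        generalize (cond_pos (snd (sq (N0 + (j - N0))%nat))). lra. }
      apply norm_le_plus with (minus (fst (sq n)) (fst (sq N0))) (minus (fst (sq N0)) (fst (sq m))); [vec|auto|].
      rewrite norm_minus_sym. auto. }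
  assert (Bx : forall k, norm (minus x (fst (sq k))) <= snd (sq k)).
  { intros k. apply (seq_lim_norm (fun n => minus (fst (sq n)) (fst (sq k)))).
    - intros e He. destruct (Hx e He) as [N0 HN]. exists N0. intros n Hn.
      replace (minus _ _) with (minus (fst (sq n)) x) by vec. auto.
    - exists k. intros n Hn. replace n with (k + (n - k))%nat by lia. eapply Rle_trans; [apply Hd|].
      generalize (cond_pos (snd (sq (k + (n - k))%nat))). lra. }
  destruct (sg_right_limit x 1 Rlt_0_1) as [d [Hdpos Dd]].
  destruct (nfloor_ex (norm x + 2 + / d)) as [k [_ Hk]].
  { generalize (norm_ge_0 x) (Rinv_0_lt_compat d Hdpos); lra. }
  assert (Hid := Rinv_0_lt_compat d Hdpos).
  destruct (Hstep (Datatypes.S k) (sq (Datatypes.S k))) as (_ & _ & Ht & Hy).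
  set (q := step (Datatypes.S k) (sq (Datatypes.S k))) in *.
  specialize (Hy x (Bx (Datatypes.S (Datatypes.S k)))).
  rewrite S_INR in *.
  assert (snd q < d).
  { eapply Rle_lt_trans; [apply Ht|]. rewrite <- (Rinv_inv d). apply Rinv_lt_contravar.
    - apply Rmult_lt_0_compat; auto. generalize (norm_ge_0 x); lra.
    - generalize (norm_ge_0 x); lra. }
  assert (norm (S (snd q) x) <= 1 + norm x).
  { apply norm_le_plus with (minus (S (snd q) x) x) x; [vec| |lra]. apply Dd. lra. }
  lra.
Qed.

Lemma sg_bounded b : exists M, 1 <= M /\ forall t x, 0 <= t <= b -> norm (S t x) <= M * norm x.
Proof.
  destruct sg_locally_bounded as (M & d & HM & Hd & H).
  assert (K : forall n t x, 0 <= t <= INR n * d -> norm (S t x) <= M ^ n * norm x).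
  { induction n; intros t x Ht.
    - cbn in Ht. replace t with 0 by lra. rewrite sg_zero. cbn; lra.
    - rewrite S_INR in Ht. assert (1 <= M ^ n) by (apply pow_R1_Rle; auto).
      destruct (Rle_dec t d) as [L|L].
      + eapply Rle_trans; [apply H; lra|]. cbn. apply Rmult_le_compat_r; [apply norm_ge_0|]. nra.
      + replace t with (d + (t - d)) by ring. rewrite sg_plus by lra.
        eapply Rle_trans; [apply H; lra|]. cbn. rewrite Rmult_assoc. apply Rmult_le_compat_l; [lra|].
        apply IHn. lra. }
  destruct (nfloor_ex (Rmax 0 (b / d))) as [n [_ Hn]]; [apply Rmax_l|].
  exists (M ^ (Datatypes.S n)). split; [apply pow_R1_Rle; auto|].
  intros t x Ht. apply K. split; [lra|]. rewrite S_INR.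
  assert (b / d <= INR n + 1) by (generalize (Rmax_r 0 (b/d)); lra).
  apply Rle_trans with (b / d * d); [|apply Rmult_le_compat_r; lra].
  replace (b / d * d) with b by (field; lra). lra.
Qed.

Lemma sg_cont x t : 0 <= t -> contn_in (fun r => 0 <= r) (fun r => S r x) t.
Proof.
  intros Ht e He. destruct (sg_bounded (t + 1)) as (M & HM & HB).
  destruct (sg_right_limit x (e / M)) as [d [Hd D]]; [apply Rdiv_lt_0_compat; lra|].
  exists (Rmin d 1). split; [apply Rmin_glb_lt; lra|].
  assert (K : forall p q, 0 <= p -> p <= q -> q <= t + 1 -> q - p < d -> norm (minus (S q x) (S p x)) <= e).
  { intros p q H1 H2 H3 H4. replace q with (p + (q - p)) by ring. rewrite sg_plus by lra.
    rewrite <- lin_minus by (apply sg_lin; auto).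
    eapply Rle_trans; [apply HB; lra|].
    apply Rle_trans with (M * (e / M)); [|right; field; lra].
    apply Rmult_le_compat_l; [lra|]. apply D. lra. }
  intros r Hr Hrt.
  assert (h1 : Rabs (r - t) < d) by (eapply Rlt_le_trans; [exact Hrt|apply Rmin_l]).
  assert (h2 : Rabs (r - t) < 1) by (eapply Rlt_le_trans; [exact Hrt|apply Rmin_r]).
  apply Rabs_def2 in h1. apply Rabs_def2 in h2.
  destruct (Rle_dec t r).
  - apply K; lra.
  - rewrite norm_minus_sym. apply K; lra.
Qed.

(* [S] extended by the identity to negative times, so that orbits are continuous on the whole line. *)
Definition Sp (t : R) x : real_space X := S (Rmax 0 t) x.

Lemma Sp_eq t x : 0 <= t -> Sp t x = S t x.
Proof. intros. unfold Sp. now rewrite Rmax_right. Qed.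

Lemma Sp_cont x t : contn_in (fun _ => True) (fun r => Sp r x) t.
Proof.
  intros e He. destruct (sg_cont x (Rmax 0 t) (Rmax_l _ _) e He) as [d [Hd D]].
  exists d. split; auto. intros r _ Hr. apply D; [apply Rmax_l|].
  eapply Rle_lt_trans; [|exact Hr]. unfold Rmax. repeat destruct Rle_dec; unfold Rabs; repeat destruct Rcase_abs; lra.
Qed.

Variable A : operator X.
Hypothesis SA : semigroup_of A S.

Lemma sg_generator x eps : dom A x -> 0 < eps -> exists delta, 0 < delta /\
  forall t, 0 <= t < delta -> norm (plus (minus (S t x) x) (scal t (A x))) <= eps * t.
Proof.
  intros Dx He. destruct SA as [_ G]. specialize (proj1 (G x (A x)) (conj Dx eq_refl)) as L.
  assert (K : locally (opp (A x)) (fun y => norm (minus y (opp (A x))) < eps)).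
  { apply (locally_le_locally_norm (opp (A x))). exists (mkposreal eps He). intros y Hy. exact Hy. }
  destruct (L _ K) as [d Hd]. exists d. split; [apply cond_pos|].
  intros t [[H1|<-] H2].
  - assert (B : norm (minus (scal (/ t) (minus (S t x) x)) (opp (A x))) < eps).
    { apply Hd; auto. unfold ball; cbn; unfold AbsRing_ball, abs, minus, plus, opp; cbn.
      rewrite Ropp_0, Rplus_0_r, Rabs_right; lra. }
    replace (plus _ _) with (scal t (minus (scal (/ t) (minus (S t x) x)) (opp (A x))))
      by (vec_with ltac:(real_eq; field; lra)).
    eapply Rle_trans; [apply norm_scalR|]. rewrite Rabs_right by lra. rewrite Rmult_comm.
    apply Rmult_le_compat_r; lra.
  - rewrite sg_zero. apply norm_le_zero; [vec|lra].
Qed.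

(** From the left the increment starts at r: it is S(r) applied to an increment at 0, and S(r)Ax is
    then compared with S(t)Ax by continuity of the orbit. The bound of S on [0, t + 1] makes the
    error uniform. *)
Lemma sg_deriv x t : dom A x -> 0 <= t ->
  deriv_in (fun r => 0 <= r) (fun r => S r x) t (opp (S t (A x))).
Proof.
  intros Dx Ht e He. destruct (sg_bounded (t + 1)) as (M & HM & HB).
  destruct (sg_generator x (e / 2 / M) Dx) as [d [Hd D]]; [repeat apply Rdiv_lt_0_compat; lra|].
  destruct (sg_cont (A x) t Ht (e / 2)) as [d2 [Hd2 D2]]; [lra|].
  exists (Rmin (Rmin d d2) 1). split; [repeat apply Rmin_glb_lt; lra|].
  intros r Hr Hrt.
  assert (h1 : Rabs (r - t) < d).
  { eapply Rlt_le_trans; [exact Hrt|]. eapply Rle_trans; [apply Rmin_l|apply Rmin_l]. }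
  assert (h2 : Rabs (r - t) < d2).
  { eapply Rlt_le_trans; [exact Hrt|]. eapply Rle_trans; [apply Rmin_l|apply Rmin_r]. }
  assert (h3 : Rabs (r - t) < 1) by (eapply Rlt_le_trans; [exact Hrt|apply Rmin_r]).
  assert (K : forall p h, 0 <= p -> 0 <= h -> p + h <= t + 1 -> h < d ->
     norm (plus (minus (S (p + h) x) (S p x)) (scal h (S p (A x)))) <= e / 2 * h).
  { intros p h H1 H2 H3 H4.
    replace (plus _ _) with (S p (plus (minus (S h x) x) (scal h (A x)))).
    - eapply Rle_trans; [apply HB; lra|].
      apply Rle_trans with (M * (e / 2 / M * h)); [|right; field; lra].
      apply Rmult_le_compat_l; [lra|]. apply D. lra.
    - assert (Lp := sg_lin p H1). rewrite lin_plus, lin_minus, lin_scal, sg_plus by auto. reflexivity. }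
  assert (D2' := D2 r Hr h2).
  apply Rabs_def2 in h1. apply Rabs_def2 in h3.
  destruct (Rle_dec t r).
  - rewrite (Rabs_right (r - t)) by lra. apply Rle_trans with (e / 2 * (r - t)); [|nra].
    replace (minus _ _) with (plus (minus (S (t + (r - t)) x) (S t x)) (scal (r - t) (S t (A x)))).
    + apply K; lra.
    + replace (t + (r - t)) with r by ring. vec.
  - rewrite (Rabs_left (r - t)) by lra. replace (- (r - t)) with (t - r) by ring.
    replace (e * (t - r)) with (e / 2 * (t - r) + (t - r) * (e / 2)) by field.
    apply norm_le_plus with (opp (plus (minus (S (r + (t - r)) x) (S r x)) (scal (t - r) (S r (A x)))))
        (scal (t - r) (minus (S r (A x)) (S t (A x)))).
    + replace (r + (t - r)) with t by ring. vec.
    + rewrite norm_oppV. apply K; lra.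
    + apply norm_scal_bound; auto. rewrite Rabs_right; lra.
Qed.

End Semigroup.

(** * Resolvent bounds in a half-plane *)

Lemma Cmod_le_abs (a b : R) : Cmod (a, b) <= Rabs a + Rabs b.
Proof.
  replace (a, b) with (RtoC a + Ci * RtoC b)%C.
  - eapply Rle_trans; [apply Cmod_triangle|]. rewrite Cmod_mult, !Cmod_R.
    replace (Cmod Ci) with 1; [lra|]. unfold Cmod, Ci; cbn. rewrite <- sqrt_1 at 1. f_equal. ring.
  - unfold RtoC, Cplus, Cmult, Ci; cbn. f_equal; ring.
Qed.

Section Resolvent.
Context {X : CompleteNormedModule C_AbsRing}.
Variable A : operator X.
Hypothesis lin_A : linear_operator A.
Implicit Types x y z : real_space X.

Lemma resolvent_eq l B z : is_resolvent A l B -> dom A z ->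
  forall y, minus (cscal l z) (A z) = y -> z = B y.
Proof. intros (_ & _ & H) Dz y <-. symmetry. apply H; auto. Qed.

Lemma resolvent_identity l m B B' x : is_resolvent A l B -> is_resolvent A m B' ->
  minus (B x) (B' x) = cscal (m - l)%C (B (B' x)).
Proof.
  intros HB HB'. assert (LB : bounded_linear B) by apply HB.
  destruct HB' as (_ & H' & _). destruct (H' x) as [D E].
  assert (F : B' x = B (plus x (cscal (l - m)%C (B' x)))).
  { apply resolvent_eq with l; auto. rewrite cscal_minus_l.
    transitivity (plus (minus (cscal m (B' x)) (A (B' x))) (minus (cscal l (B' x)) (cscal m (B' x)))); [vec|].
    rewrite E. reflexivity. }
  rewrite lin_plus, lin_cscal in F by auto. rewrite F at 1.
  rewrite (cscal_minus_l l m), (cscal_minus_l m l). vec.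
Qed.

(** The equation m z - A z = y is equivalent to z = B(y + (l - m)z), whose right-hand side contracts
    with factor 1/2. The contraction theorem is used with families of a single element. *)
Lemma resolvent_neumann l m B b : is_resolvent A l B -> 0 < b -> (forall x, norm (B x) <= b * norm x) ->
  Cmod (m - l)%C * b <= 1 / 2 ->
  exists B', is_resolvent A m B' /\ forall x, norm (B' x) <= 2 * b * norm x.
Proof.
  intros HB Hb Bb Hc. assert (LB : bounded_linear B) by apply HB. destruct HB as (_ & H1 & H2).
  set (k := Cmod (m - l)%C) in *. assert (Hk : 0 <= k) by apply Cmod_ge_0.
  assert (kk : Cmod (l - m)%C = k).
  { unfold k. rewrite <- Cmod_opp. f_equal. ring. }
  assert (kb : forall x, norm (B (cscal (l - m)%C x)) <= 1 / 2 * norm x).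
  { intros x. eapply Rle_trans; [apply Bb|].
    apply Rle_trans with (b * (k * norm x)).
    - apply Rmult_le_compat_l; [lra|]. rewrite <- kk. apply norm_cscal.
    - generalize (norm_ge_0 x); nra. }
  assert (small : forall x, x = B (cscal (l - m)%C x) -> x = zero).
  { intros x E. apply norm_eq_zeroV. specialize (kb x). rewrite <- E in kb. generalize (norm_ge_0 x); lra. }
  assert (ex : forall y, exists z, z = B (plus y (cscal (l - m)%C z)) /\ norm z <= 2 * b * norm y).
  { intros y. assert (r0 : 0 <= 2 * b * norm y) by (generalize (norm_ge_0 y); nra).
    destruct (contraction_fixpoint (V := real_space X) 1 (fun f i => B (plus y (cscal (l - m)%C (f i))))
                (2 * b * norm y) (1/2)) as [f [F1 F2]]; auto.
    - lra.
    - intros f Hf i Hi. rewrite lin_plus by auto.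
      replace (2 * b * norm y) with (b * norm y + 1 / 2 * (2 * b * norm y)) by field.
      eapply norm_le_plus; [reflexivity|apply Bb|]. eapply Rle_trans; [apply kb|].
      apply Rmult_le_compat_l; [lra|auto].
    - intros f g d Hf Hg Hd i Hi.
      assert (EE : forall u v : real_space X, minus (B (plus y (cscal (l - m)%C u))) (B (plus y (cscal (l - m)%C v)))
                   = B (cscal (l - m)%C (minus u v))).
      { intros u v. rewrite cscal_minus_r, (lin_minus B LB), !(lin_plus B LB). vec. }
      rewrite EE. eapply Rle_trans; [apply kb|]. apply Rmult_le_compat_l; [lra|auto].
    - exists (f 1%nat). split; [symmetry; apply F2; lia | apply F1; lia]. }
  set (B' := fun y => proj1_sig (constructive_indefinite_description _ (ex y))).
  assert (E' : forall y, B' y = B (plus y (cscal (l - m)%C (B' y)))).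
  { intros y. unfold B' at 1 2. destruct constructive_indefinite_description as [z [E N]]; auto. }
  assert (N' : forall y, norm (B' y) <= 2 * b * norm y).
  { intros y. unfold B'. destruct constructive_indefinite_description as [z [E N]]; auto. }
  assert (uniq : forall y z, z = B (plus y (cscal (l - m)%C z)) -> z = B' y).
  { intros y z E. apply minus_eq0. apply small. rewrite E at 1. rewrite (E' y) at 1.
    rewrite cscal_minus_r, !(lin_plus B LB), (lin_minus B LB). vec. }
  assert (P1 : forall x y, B' (plus x y) = plus (B' x) (B' y)).
  { intros x y. symmetry. apply uniq. rewrite (E' x) at 1. rewrite (E' y) at 1.
    rewrite cscal_plus_r, !(lin_plus B LB). vec. }
  assert (P2 : forall c x, B' (cscal c x) = cscal c (B' x)).
  { intros c x. symmetry. apply uniq. rewrite (E' x) at 1.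
    rewrite <- lin_cscal by auto. f_equal. rewrite cscal_plus_r, !cscal_assoc.
    rewrite (Cmult_comm c). reflexivity. }
  exists B'. split; auto. split; [|split].
  - apply (Build_is_linear (K := C_AbsRing) (U := X) (V := X)).
    + exact P1.
    + exact P2.
    + exists (2 * b). split; [lra|]. exact N'.
  - intros y. destruct (H1 (plus y (cscal (l - m)%C (B' y)))) as [D E].
    rewrite <- E' in D, E. split; auto.
    transitivity (minus (minus (cscal l (B' y)) (A (B' y))) (cscal (l - m)%C (B' y))).
    + rewrite cscal_minus_l. vec.
    + rewrite E. vec.
  - intros x Dx. symmetry. apply uniq.
    rewrite <- (H2 x Dx) at 1. f_equal. rewrite cscal_minus_l. vec.
Qed.

End Resolvent.

Section HalfPlane.
Context {X : CompleteNormedModule C_AbsRing}.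
Variable A : operator X.
Hypothesis sect : sectorial A.
Hypothesis spec : forall lam : C, in_spectrum A lam -> 0 < Re lam.

(** The angle is acos(p/r) up to sign. The condition on p says that this angle is at least [theta0],
    and the sign of q decides between the two choices. *)
Lemma polar_form p q theta0 r : 0 < theta0 < PI / 2 -> 0 < r -> r * r = p * p + q * q -> p <= r * cos theta0 ->
  exists theta, theta0 <= Rabs theta <= PI /\ p = r * cos theta /\ q = r * sin theta.
Proof.
  intros Ht Hr E Hp.
  assert (Hx : -1 <= p / r <= 1).
  { assert (- r <= p <= r) by nra. split.
    - apply Rmult_le_reg_r with r; auto. replace (p / r * r) with p by (field; lra). lra.
    - apply Rmult_le_reg_r with r; auto. replace (p / r * r) with p by (field; lra). lra. }
  assert (Hc : cos (acos (p / r)) = p / r) by (apply cos_acos; auto).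
  assert (Hs : r * sin (acos (p / r)) = Rabs q).
  { rewrite sin_acos by auto. apply Rsqr_inj.
    - apply Rmult_le_pos; [lra|apply sqrt_pos].
    - apply Rabs_pos.
    - rewrite <- Rsqr_abs. unfold Rsqr.
      set (w := p / r * (p / r)). assert (H0 : 0 <= 1 - w) by (unfold w; nra).
      assert (H1 := sqrt_sqrt _ H0).
      transitivity (r * r * (sqrt (1 - w) * sqrt (1 - w))); [ring|]. rewrite H1. unfold w.
      replace (r * r * (1 - p / r * (p / r))) with (r * r - p * p) by (field; lra). lra. }
  assert (Hb := acos_bound (p / r)).
  assert (Hge : theta0 <= acos (p / r)).
  { apply Rnot_lt_le. intros L.
    assert (cos theta0 < cos (acos (p / r))) by (apply cos_decreasing_1; lra).
    rewrite Hc in H. apply Rmult_lt_compat_l with (r := r) in H; auto.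
    replace (r * (p / r)) with p in H by (field; lra). lra. }
  destruct (Rle_dec 0 q) as [L|L].
  - exists (acos (p / r)). rewrite Rabs_right by lra. rewrite Hs, Hc, Rabs_right by lra.
    repeat split; try lra. field; lra.
  - exists (- acos (p / r)). rewrite Rabs_Ropp, Rabs_right by lra.
    rewrite cos_neg, sin_neg, Hc.
    replace (r * - sin (acos (p / r))) with (- (r * sin (acos (p / r)))) by ring.
    rewrite Hs, Rabs_left by lra. repeat split; try lra. field; lra.
Qed.

(** Three regions are combined: far from the vertex the sector condition applies; the remaining
    compact part of the closed left half-plane is covered by finitely many Neumann discs, by the
    hypothesis on the spectrum; the points slightly to the right of the axis are reached by one more
    perturbation. *)
Lemma resolvent_half_plane : exists omega K, 0 < omega /\ 1 <= K /\
  forall sig tau, sig <= omega -> exists B, is_resolvent A (sig, tau) B /\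
    forall x, norm (B x) <= K / (1 + Rabs sig + Rabs tau) * norm x.
Proof.
  destruct sect as (linA & _ & a & theta0 & M & Ht & HM & Hsec).
  assert (c0 : 0 < cos theta0) by (apply cos_gt_0; lra).
  assert (c1 : cos theta0 <= 1) by apply COS_bound.
  (* For Re l <= 1 the real part of l - a is at most |a| + 1 = rho cos theta0. From distance [rho]
     on, such an l lies in the sector of the hypothesis. *)
  set (rho := (Rabs a + 1) / cos theta0).
  assert (Ha := Rabs_pos a).
  assert (Hrho : Rabs a + 1 <= rho).
  { unfold rho. apply Rmult_le_reg_r with (cos theta0); auto.
    replace ((Rabs a + 1) / cos theta0 * cos theta0) with (Rabs a + 1) by (field; lra). nra. }
  assert (Hrc : rho * cos theta0 = Rabs a + 1) by (unfold rho; field; lra).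
  assert (far : forall sig tau r, sig <= 1 -> 0 < r -> r * r = (sig - a) * (sig - a) + tau * tau -> rho <= r ->
     exists B, is_resolvent A (sig, tau) B /\ forall x, norm (B x) <= M / r * norm x).
  { intros sig tau r Hs Hr E L. destruct (polar_form (sig - a) tau theta0 r) as (th & H1 & H2 & H3); auto.
    - apply Rle_trans with (rho * cos theta0); [rewrite Hrc; generalize (Rle_abs (-a)); rewrite Rabs_Ropp; lra|].
      apply Rmult_le_compat_r; lra.
    - destruct (Hsec r th Hr H1) as [B HB]. exists B.
      replace (sig, tau) with ((a + r * cos th)%R, (r * sin th)%R) by (f_equal; lra). exact HB. }
  assert (near : forall u v, exists Bb : (real_space X -> real_space X) * posreal, u <= 0 ->
     is_resolvent A (u, v) (fst Bb) /\ forall x, norm (fst Bb x) <= snd Bb * norm x).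
  { intros u v. destruct (Rle_dec u 0) as [L|L].
    - assert (N : ~ in_spectrum A (u, v)).
      { intros S. apply spec in S. cbn in S. lra. }
      apply NNPP in N. destruct N as [B HB].
      destruct (lin_bound B (proj1 HB)) as [b [Hb Bb]].
      exists (B, mkposreal b Hb). intros _. split; auto.
    - exists (fun x => x, mkposreal 1 Rlt_0_1). intros; contradiction. }
  set (nb := fun u v => proj1_sig (constructive_indefinite_description _ (near u v))).
  assert (Hnb : forall u v, u <= 0 -> is_resolvent A (u, v) (fst (nb u v)) /\
      forall x, norm (fst (nb u v) x) <= snd (nb u v) * norm x).
  { intros u v. unfold nb. destruct constructive_indefinite_description; auto. }
  assert (dpos : forall u v, 0 < / (4 * snd (nb u v))).
  { intros. apply Rinv_0_lt_compat. generalize (cond_pos (snd (nb u v))); lra. }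
  destruct (compactness_value_2d (a - rho) 0 (- rho) rho (fun u v => mkposreal _ (dpos u v))) as [d Hd].
  (* At a centre with bound b both coordinates may vary by 1/(4b), so that |m - l| b <= 1/2. The
     centre found for a point satisfies d <= 1/(4b), hence the perturbed bound 2b is at most
     1/(2d). *)
  set (b0 := / (2 * d)).
  assert (Hd0 := cond_pos d). assert (b0p : 0 < b0) by (apply Rinv_0_lt_compat; lra).
  assert (cpt : forall sig tau, a - rho <= sig <= 0 -> - rho <= tau <= rho ->
     exists B, is_resolvent A (sig, tau) B /\ forall x, norm (B x) <= b0 * norm x).
  { intros sig tau H1 H2. apply NNPP. intros N. apply (Hd sig tau H1 H2).
    intros (u & v & Hu & Hv & Hsu & Htv & Hdd). cbn in *. apply N.
    destruct (Hnb u v) as [R1 R2]; [lra|]. set (b := snd (nb u v)) in *. assert (bp := cond_pos b).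
    destruct (resolvent_neumann A (u, v) (sig, tau) _ b R1 bp R2) as [B [HB1 HB2]].
    - eapply Rle_trans; [apply Rmult_le_compat_r; [lra|apply Cmod_le_abs]|]. cbn.
      apply Rle_trans with ((/ (4 * b) + / (4 * b)) * b); [|right; field; lra].
      apply Rmult_le_compat_r; [lra|]. unfold Rminus in *. lra.
    - exists B. split; auto. intros x. eapply Rle_trans; [apply HB2|].
      apply Rmult_le_compat_r; [apply norm_ge_0|]. unfold b0.
      apply Rmult_le_reg_r with (2 * d); [lra|]. rewrite Rinv_l by lra.
      apply Rmult_le_compat_l with (r := 4 * b) in Hdd; [|lra].
      rewrite Rinv_r in Hdd by lra. nra. }
  (* A shift from the imaginary axis by at most 1/(2 b0) satisfies the condition of
     [resolvent_neumann]. *)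
  set (omega := Rmin 1 (/ (2 * b0))).
  assert (iob : 0 < / (2 * b0)) by (apply Rinv_0_lt_compat; lra).
  assert (om : 0 < omega) by (unfold omega; apply Rmin_glb_lt; lra).
  (* With r the distance from l to a, D <= 1 + |a| + 2r. This is at most Q r if r >= rho, and at
     most Q otherwise, so that one constant serves all regions. *)
  set (Q := 1 + 2 * Rabs a + 2 * rho + 2).
  exists omega, (1 + M * Q + 2 * b0 * Q). split; auto.
  assert (Qp : 1 <= Q) by (unfold Q; lra).
  split; [nra|].
  intros sig tau Hs. set (D := 1 + Rabs sig + Rabs tau).
  assert (Dp : 1 <= D) by (unfold D; generalize (Rabs_pos sig) (Rabs_pos tau); lra).
  assert (Hs1 : sig <= 1) by (eapply Rle_trans; [exact Hs|apply Rmin_l]).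
  assert (s2 : 0 <= (sig - a) * (sig - a) + tau * tau) by (generalize (Rle_0_sqr (sig - a)) (Rle_0_sqr tau); unfold Rsqr; lra).
  set (r := sqrt ((sig - a) * (sig - a) + tau * tau)).
  assert (Er : r * r = (sig - a) * (sig - a) + tau * tau) by (unfold r; apply sqrt_sqrt; auto).
  assert (r0 : 0 <= r) by apply sqrt_pos.
  assert (sq : forall w, w * w <= r * r -> Rabs w <= r).
  { intros w Hw. unfold Rabs; destruct Rcase_abs; nra. }
  assert (Hps : Rabs (sig - a) <= r) by (apply sq; generalize (Rle_0_sqr tau); unfold Rsqr; lra).
  assert (Hpt : Rabs tau <= r) by (apply sq; generalize (Rle_0_sqr (sig - a)); unfold Rsqr; lra).
  assert (HDr : D <= 1 + Rabs a + 2 * r).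
  { unfold D. assert (Rabs sig <= Rabs (sig - a) + Rabs a); [|lra].
    replace sig with ((sig - a) + a) at 1 by ring. apply Rabs_triang. }
  assert (fin : forall c B, 0 <= c -> c * D <= 1 + M * Q + 2 * b0 * Q -> is_resolvent A (sig, tau) B ->
     (forall x, norm (B x) <= c * norm x) -> exists B, is_resolvent A (sig, tau) B /\
     forall x, norm (B x) <= (1 + M * Q + 2 * b0 * Q) / D * norm x).
  { intros c B Hc HcD HB Nb. exists B. split; auto. intros x. eapply Rle_trans; [apply Nb|].
    apply Rmult_le_compat_r; [apply norm_ge_0|]. apply Rmult_le_reg_r with D; [lra|].
    replace ((1 + M * Q + 2 * b0 * Q) / D * D) with (1 + M * Q + 2 * b0 * Q) by (field; lra). lra. }
  destruct (Rle_dec rho r) as [L|L].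
  - assert (0 < r) by lra. destruct (far sig tau r) as [B [HB1 HB2]]; auto.
    apply fin with (M / r) B; auto.
    + apply Rlt_le, Rdiv_lt_0_compat; lra.
    + apply Rle_trans with (M * Q); [|nra].
      apply Rle_trans with (M / r * (Q * r)); [|right; field; lra].
      apply Rmult_le_compat_l; [apply Rlt_le, Rdiv_lt_0_compat; lra|]. unfold Q. nra.
  - assert (HDQ : D <= Q) by (unfold Q; lra).
    assert (It : - rho <= tau <= rho) by (revert Hpt; unfold Rabs; destruct Rcase_abs; lra).
    assert (Is : a - rho <= sig) by (revert Hps; unfold Rabs; destruct Rcase_abs; lra).
    destruct (Rle_dec sig 0) as [L0|L0].
    + destruct (cpt sig tau) as [B [HB1 HB2]]; auto. apply fin with b0 B; auto; nra.
    + destruct (cpt 0 tau) as [B [HB1 HB2]]; auto.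
      { generalize (Rle_abs a); lra. }
      destruct (resolvent_neumann A (0, tau) (sig, tau) B b0 HB1 b0p HB2) as [B' [H1 H2]].
      * eapply Rle_trans; [apply Rmult_le_compat_r; [lra|apply Cmod_le_abs]|]. cbn.
        replace (sig + - 0) with sig by ring. replace (tau + - tau) with 0 by ring.
        rewrite Rabs_R0, Rplus_0_r, Rabs_right by lra.
        apply Rle_trans with (/ (2 * b0) * b0); [|right; field; lra].
        apply Rmult_le_compat_r; [lra|]. eapply Rle_trans; [exact Hs|apply Rmin_r].
      * apply fin with (2 * b0) B'; auto; nra.
Qed.

End HalfPlane.

(** The majorant enters through an antiderivative G. Singular and improper bounds thereby reduce to
    values of G at the ends of a proper interval. *)
Lemma RInt_norm_le_deriv {V : CompleteNormedModule R_AbsRing} (f : R -> V) (G g : R -> R) a b : a <= b ->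
  cont_on a b f -> (forall t, a <= t <= b -> is_derive G t (g t)) ->
  (forall t, a <= t <= b -> continuous g t) -> (forall t, a <= t <= b -> norm (f t) <= g t) ->
  norm (RInt f a b) <= G b - G a.
Proof.
  intros Hab C D Cg N.
  apply (norm_RInt_le f g a b (RInt f a b) (G b - G a)); auto.
  - apply RInt_correct. apply ex_RInt_cont_on; auto.
  - apply (is_RInt_derive G g); intros x Hx; rewrite Rmin_left, Rmax_right in Hx by auto; auto.
Qed.

(** Equivalent to 1 + |l|, but separate in the two coordinates, so that it is easily bounded along
    vertical lines. *)
Definition nu (l : C) : R := 1 + Rabs (fst l) + Rabs (snd l).

Lemma nu_ge1 l : 1 <= nu l.
Proof. unfold nu. generalize (Rabs_pos (fst l)) (Rabs_pos (snd l)); lra. Qed.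

Lemma div_nu_le K l : 0 <= K -> 0 <= K / nu l <= K.
Proof.
  intros HK. generalize (nu_ge1 l); intros. split.
  - apply Rmult_le_pos; auto. apply Rlt_le, Rinv_0_lt_compat; lra.
  - apply Rmult_le_reg_r with (nu l); [lra|]. replace (K / nu l * nu l) with K by (field; lra). nra.
Qed.

(** * Inversion of the Laplace transform *)

Section Family.
Context {X : CompleteNormedModule C_AbsRing}.
Implicit Types x y z : real_space X.

(** The properties of a resolvent on a half-plane that the integrals along vertical lines use. The
    resolvent of A and the scalar resolvent [scalar_res] both have them, and are compared in
    [shift_bound]. *)
Definition res_family (om K : R) (F : C -> real_space X -> real_space X) : Prop :=
  0 <= K /\
  (forall l, fst l <= om -> bounded_linear (F l)) /\
  (forall l m x, fst l <= om -> fst m <= om -> minus (F l x) (F m x) = cscal (m - l)%C (F l (F m x))) /\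
  (forall l x, fst l <= om -> norm (F l x) <= K / nu l * norm x).

Variables (om K : R) (F : C -> real_space X -> real_space X).
Hypothesis HF : res_family om K F.

Let K0 : 0 <= K. Proof. apply HF. Qed.
Let Flin l : fst l <= om -> bounded_linear (F l). Proof. apply HF. Qed.
Let Fid l m x : fst l <= om -> fst m <= om -> minus (F l x) (F m x) = cscal (m - l)%C (F l (F m x)).
Proof. apply HF. Qed.

Lemma fam_bound l x : fst l <= om -> norm (F l x) <= K / nu l * norm x.
Proof. apply HF. Qed.

Lemma fam_bound_K l x : fst l <= om -> norm (F l x) <= K * norm x.
Proof.
  intros H. eapply Rle_trans; [apply fam_bound; auto|].
  apply Rmult_le_compat_r; [apply norm_ge_0|]. apply div_nu_le; auto.
Qed.

(** Two applications of the resolvent identity write the remainder of the first-order expansion as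
    (l - m)^2 F(m) F(l) F(l) x. *)
Lemma fam_remainder l m x : fst l <= om -> fst m <= om ->
  norm (plus (minus (F m x) (F l x)) (cscal (m - l)%C (F l (F l x)))) <= K * K * K * (Cmod (m - l)%C * Cmod (m - l)%C) * norm x.
Proof.
  intros Hl Hm.
  assert (E1 := Fid m l x Hm Hl). assert (E2 := Fid m l (F l x) Hm Hl).
  replace (plus _ _) with (cscal ((l - m) * (l - m))%C (F m (F l (F l x)))).
  - eapply Rle_trans; [apply norm_cscal|]. rewrite Cmod_mult.
    replace (Cmod (l - m)%C) with (Cmod (m - l)%C) by (rewrite <- Cmod_opp; f_equal; ring).
    set (c := Cmod (m - l)%C). assert (0 <= c) by apply Cmod_ge_0.
    replace (K * K * K * (c * c) * norm x) with (c * c * (K * (K * (K * norm x)))) by ring.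
    apply Rmult_le_compat_l; [nra|].
    eapply Rle_trans; [apply fam_bound_K; auto|]. apply Rmult_le_compat_l; auto.
    eapply Rle_trans; [apply fam_bound_K; auto|]. apply Rmult_le_compat_l; auto.
    apply fam_bound_K; auto.
  - rewrite E1. replace (m - l)%C with (- (l - m))%C by ring.
    rewrite (cscal_opp_l (l - m)%C), <- cscal_assoc, <- E2, cscal_minus_r. vec.
Qed.

Lemma fam_deriv (J : R -> Prop) (lam : R -> C) (e : C) t x :
  J t -> (forall r, J r -> fst (lam r) <= om) ->
  (forall r, J r -> (lam r - lam t)%C = (RtoC (r - t) * e)%C) ->
  deriv_in J (fun r => F (lam r) x) t (cscal (- e)%C (F (lam t) (F (lam t) x))).
Proof.
  intros Jt Hl He eps Heps.
  set (M := K * K * K * (Cmod e * Cmod e) * norm x + 1).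
  assert (Ke : 0 <= K * K * K * (Cmod e * Cmod e) * norm x).
  { generalize (Cmod_ge_0 e) (norm_ge_0 x). intros. repeat apply Rmult_le_pos; auto. }
  assert (Mp : 0 < M) by (unfold M; lra).
  exists (eps / M). split; [apply Rdiv_lt_0_compat; auto|].
  intros r Jr Hr. specialize (He r Jr).
  replace (minus _ _) with (plus (minus (F (lam r) x) (F (lam t) x)) (cscal (lam r - lam t)%C (F (lam t) (F (lam t) x)))).
  - eapply Rle_trans; [apply fam_remainder; auto|]. rewrite He, Cmod_mult, Cmod_R.
    set (h := Rabs (r - t)) in *. assert (0 <= h) by apply Rabs_pos.
    replace (K * K * K * (h * Cmod e * (h * Cmod e)) * norm x) with ((M - 1) * h * h) by (unfold M; ring).
    apply Rmult_le_compat_r; auto. apply Rle_trans with (M * h); [nra|].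
    apply Rle_trans with (M * (eps / M)); [|right; field; lra]. apply Rmult_le_compat_l; lra.
  - rewrite He, <- cscal_assoc, cscal_RtoC.
    rewrite (cscal_opp_l e). vec.
Qed.

Lemma fam_deriv_fun (J : R -> Prop) (lam : R -> C) (e : C) t (v : R -> real_space X) d :
  J t -> (forall r, J r -> fst (lam r) <= om) ->
  (forall r, J r -> (lam r - lam t)%C = (RtoC (r - t) * e)%C) -> deriv_in J v t d ->
  deriv_in J (fun r => F (lam r) (v r)) t (plus (cscal (- e)%C (F (lam t) (F (lam t) (v t)))) (F (lam t) d)).
Proof.
  intros Jt Hl He Hv eps Heps.
  assert (D1 := fam_deriv J lam e t (v t) Jt Hl He).
  assert (D2 := deriv_contn _ _ _ _ (fam_deriv J lam e t d Jt Hl He)).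
  destruct (D1 (eps / 3)) as [p1 [Hp1 D1']]; [lra|].
  destruct (D2 (eps / 3)) as [p2 [Hp2 D2']]; [lra|].
  destruct (Hv (eps / 3 / (K + 1))) as [p3 [Hp3 D3']]; [repeat apply Rdiv_lt_0_compat; lra|].
  exists (Rmin p1 (Rmin p2 p3)). split; [repeat apply Rmin_glb_lt; auto|].
  intros r Jr Hr.
  assert (h1 : Rabs (r - t) < p1) by (eapply Rlt_le_trans; [exact Hr|apply Rmin_l]).
  assert (h2 : Rabs (r - t) < p2).
  { eapply Rlt_le_trans; [exact Hr|]. eapply Rle_trans; [apply Rmin_r|apply Rmin_l]. }
  assert (h3 : Rabs (r - t) < p3).
  { eapply Rlt_le_trans; [exact Hr|]. eapply Rle_trans; [apply Rmin_r|apply Rmin_r]. }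
  specialize (D1' r Jr h1). specialize (D2' r Jr h2). specialize (D3' r Jr h3).
  set (h := Rabs (r - t)) in *. assert (Hh : 0 <= h) by apply Rabs_pos.
  replace (eps * h) with (eps / 3 * h + (h * (eps / 3) + eps / 3 * h)) by field.
  assert (Lr := Flin (lam r) (Hl r Jr)).
  apply norm_le_plus with
    (minus (minus (F (lam r) (v t)) (F (lam t) (v t))) (scal (r - t) (cscal (- e)%C (F (lam t) (F (lam t) (v t))))))
    (plus (scal (r - t) (minus (F (lam r) d) (F (lam t) d))) (F (lam r) (minus (minus (v r) (v t)) (scal (r - t) d)))); auto.
  - rewrite !(lin_minus _ Lr), (lin_scal _ Lr). vec.
  - eapply norm_le_plus; [reflexivity| |].
    + apply norm_scal_bound; [apply Rle_refl|auto].
    + eapply Rle_trans; [apply fam_bound_K; auto|].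
      apply Rle_trans with (K * (eps / 3 / (K + 1) * h)); [apply Rmult_le_compat_l; auto|].
      apply Rle_trans with ((K + 1) * (eps / 3 / (K + 1) * h)); [|right; field; lra].
      apply Rmult_le_compat_r; [|lra]. apply Rmult_le_pos; auto.
      apply Rlt_le. repeat apply Rdiv_lt_0_compat; lra.
Qed.

(* The line [Re l = sig] is traversed symmetrically: upwards by [lu], downwards by [ld]. *)
Definition lu (sig tau : R) : C := (sig, tau).
Definition ld (sig tau : R) : C := (sig, - tau).

Definition sym (k : C -> real_space X) (sig tau : R) : real_space X := plus (k (lu sig tau)) (k (ld sig tau)).

Lemma lu_step sig r t : (lu sig r - lu sig t)%C = (RtoC (r - t) * Ci)%C.
Proof. unfold lu, RtoC, Ci, Cminus, Cplus, Copp, Cmult; cbn; f_equal; ring. Qed.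

Lemma ld_step sig r t : (ld sig r - ld sig t)%C = (RtoC (r - t) * - Ci)%C.
Proof. unfold ld, RtoC, Ci, Cminus, Cplus, Copp, Cmult; cbn; f_equal; ring. Qed.

Lemma cscal_Ci_Ci_opp x : cscal Ci (cscal (- Ci)%C x) = x.
Proof. rewrite cscal_assoc. rewrite <- (cscal_one x) at 2. f_equal. unfold RtoC, Ci, Cmult, Copp; cbn; f_equal; ring. Qed.

Variable sig : R.
Hypothesis Hsig : sig <= om.

Lemma fam_lu_deriv J t v d : J t -> deriv_in J v t d ->
  deriv_in J (fun r => F (lu sig r) (v r)) t (plus (cscal (- Ci)%C (F (lu sig t) (F (lu sig t) (v t)))) (F (lu sig t) d)).
Proof. intros. apply fam_deriv_fun; auto. intros; apply lu_step. Qed.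

Lemma fam_ld_deriv J t v d : J t -> deriv_in J v t d ->
  deriv_in J (fun r => F (ld sig r) (v r)) t (plus (cscal Ci (F (ld sig t) (F (ld sig t) (v t)))) (F (ld sig t) d)).
Proof.
  intros. replace Ci with (- - Ci)%C by ring. apply fam_deriv_fun; auto. intros; apply ld_step.
Qed.

Lemma fam_lu_deriv1 J t x : J t ->
  deriv_in J (fun r => F (lu sig r) x) t (cscal (- Ci)%C (F (lu sig t) (F (lu sig t) x))).
Proof. intros. apply fam_deriv; auto. intros; apply lu_step. Qed.

Lemma fam_ld_deriv1 J t x : J t ->
  deriv_in J (fun r => F (ld sig r) x) t (cscal Ci (F (ld sig t) (F (ld sig t) x))).
Proof. intros. replace Ci with (- - Ci)%C by ring. apply fam_deriv; auto. intros; apply ld_step. Qed.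

Lemma fam_lu_deriv2 J t x : J t ->
  deriv_in J (fun r => F (lu sig r) (F (lu sig r) x)) t
    (scal 2 (cscal (- Ci)%C (F (lu sig t) (F (lu sig t) (F (lu sig t) x))))).
Proof.
  intros Jt. assert (L := Flin (lu sig t) Hsig).
  replace (scal 2 _) with (plus (cscal (- Ci)%C (F (lu sig t) (F (lu sig t) (F (lu sig t) x))))
     (F (lu sig t) (cscal (- Ci)%C (F (lu sig t) (F (lu sig t) x))))).
  - apply (fam_lu_deriv J t (fun r => F (lu sig r) x)); auto. apply fam_lu_deriv1; auto.
  - rewrite (lin_cscal _ L). vec.
Qed.

Lemma fam_ld_deriv2 J t x : J t ->
  deriv_in J (fun r => F (ld sig r) (F (ld sig r) x)) t
    (scal 2 (cscal Ci (F (ld sig t) (F (ld sig t) (F (ld sig t) x))))).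
Proof.
  intros Jt. assert (L := Flin (ld sig t) Hsig).
  replace (scal 2 _) with (plus (cscal Ci (F (ld sig t) (F (ld sig t) (F (ld sig t) x))))
     (F (ld sig t) (cscal Ci (F (ld sig t) (F (ld sig t) x))))).
  - apply (fam_ld_deriv J t (fun r => F (ld sig r) x)); auto. apply fam_ld_deriv1; auto.
  - rewrite (lin_cscal _ L). vec.
Qed.

Lemma fam1_cont a b x : cont_on a b (sym (fun l => F l x) sig).
Proof. intros t It. apply contn_in_plus; eapply deriv_contn; [apply fam_lu_deriv1|apply fam_ld_deriv1]; auto. Qed.

Lemma fam2_cont a b x : cont_on a b (sym (fun l => F l (F l x)) sig).
Proof. intros t It. apply contn_in_plus; eapply deriv_contn; [apply fam_lu_deriv2|apply fam_ld_deriv2]; auto. Qed.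

Lemma fam3_lu_cont a b x : cont_on a b (fun r => F (lu sig r) (F (lu sig r) (F (lu sig r) x))).
Proof.
  intros t It. eapply deriv_contn. apply (fam_lu_deriv (itv a b) t (fun r => F (lu sig r) (F (lu sig r) x))); auto.
  apply fam_lu_deriv2; auto.
Qed.

Lemma fam3_ld_cont a b x : cont_on a b (fun r => F (ld sig r) (F (ld sig r) (F (ld sig r) x))).
Proof.
  intros t It. eapply deriv_contn. apply (fam_ld_deriv (itv a b) t (fun r => F (ld sig r) (F (ld sig r) x))); auto.
  apply fam_ld_deriv2; auto.
Qed.

Lemma fam3_cont a b x : cont_on a b (sym (fun l => F l (F l (F l x))) sig).
Proof. intros t It. apply contn_in_plus; [apply fam3_lu_cont|apply fam3_ld_cont]; auto. Qed.

Lemma ld_lu_0 : ld sig 0 = lu sig 0.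
Proof. unfold ld, lu. f_equal. ring. Qed.

Lemma Ci_bound x y : norm (cscal Ci (minus x y)) <= norm x + norm y.
Proof.
  eapply Rle_trans; [apply norm_Ci|]. rewrite <- (norm_oppV y).
  eapply norm_le_plus; [|apply Rle_refl|apply Rle_refl]. vec.
Qed.

(** F(l)^2 is minus the derivative of F in l, and dl is a multiple of i along the line. The two
    half-lines start at the same point, so only their far ends remain. *)
Lemma RInt_fam2 T x : 0 <= T ->
  RInt (sym (fun l => F l (F l x)) sig) 0 T = cscal Ci (minus (F (lu sig T) x) (F (ld sig T) x)).
Proof.
  intros HT.
  assert (D : forall t, itv 0 T t -> deriv_in (itv 0 T) (fun r => cscal Ci (minus (F (lu sig r) x) (F (ld sig r) x))) t
     (sym (fun l => F l (F l x)) sig t)).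
  { intros t It.
    replace (sym (fun l => F l (F l x)) sig t) with (cscal Ci (minus (cscal (- Ci)%C (F (lu sig t) (F (lu sig t) x))) (cscal Ci (F (ld sig t) (F (ld sig t) x))))).
    - apply (deriv_in_lin (V := real_space X) (W := real_space X)) with (L := cscal Ci) (M := 1).
      + intros; apply cscal_plus_r.
      + intros; apply cscal_scal.
      + intros. rewrite Rmult_1_l. apply norm_Ci.
      + apply deriv_in_minus; [apply fam_lu_deriv1|apply fam_ld_deriv1]; auto.
    - rewrite cscal_minus_r, cscal_Ci_Ci_opp, cscal_Ci2. unfold sym. vec. }
  rewrite <- (ftc_in 0 T (fun r => cscal Ci (minus (F (lu sig r) x) (F (ld sig r) x)))); auto.
  - rewrite ld_lu_0. replace (minus (F (lu sig 0) x) (F (lu sig 0) x)) with (zero : real_space X) by vec.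
    rewrite cscal_zero_r. vec.
  - intros t It. eapply deriv_contn. apply D; auto.
  - apply fam2_cont.
  - intros t It. apply D. unfold itv; lra.
Qed.

Lemma RInt_fam3 T x : 0 <= T ->
  RInt (sym (fun l => F l (F l (F l x))) sig) 0 T =
  scal (/ 2) (cscal Ci (minus (F (lu sig T) (F (lu sig T) x)) (F (ld sig T) (F (ld sig T) x)))).
Proof.
  intros HT.
  set (H := fun r => scal (/2) (cscal Ci (minus (F (lu sig r) (F (lu sig r) x)) (F (ld sig r) (F (ld sig r) x))))).
  assert (D : forall t, itv 0 T t -> deriv_in (itv 0 T) H t
     (sym (fun l => F l (F l (F l x))) sig t)).
  { intros t It.
    replace (sym (fun l => F l (F l (F l x))) sig t) with (scal (/ 2) (cscal Ci (minus (scal 2 (cscal (- Ci)%C (F (lu sig t) (F (lu sig t) (F (lu sig t) x)))) : real_space X) (scal 2 (cscal Ci (F (ld sig t) (F (ld sig t) (F (ld sig t) x)))) : real_space X)))).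
    - unfold H. apply (deriv_in_lin (V := real_space X) (W := real_space X)) with (L := fun y => scal (/2) (cscal Ci y)) (M := /2).
      + intros. rewrite cscal_plus_r. vec.
      + intros. rewrite cscal_scal. vec.
      + intros. apply norm_scal_bound; [rewrite Rabs_right; lra|apply norm_Ci].
      + apply deriv_in_minus; [apply fam_lu_deriv2|apply fam_ld_deriv2]; auto.
    - rewrite cscal_minus_r, !cscal_scal, cscal_Ci_Ci_opp, cscal_Ci2. unfold sym. vec_with ltac:(real_eq; field). }
  rewrite <- (ftc_in 0 T H); auto.
  - unfold H. rewrite ld_lu_0. set (p := F (lu sig 0) (F (lu sig 0) x)).
    replace (minus p p) with (zero : real_space X) by vec.
    rewrite cscal_zero_r. vec.
  - intros t It. eapply deriv_contn. apply D; auto.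
  - apply fam3_cont.
  - intros t It. apply D. unfold itv; lra.
Qed.

Lemma nu_lu T : 0 <= T -> 1 + T <= nu (lu sig T) /\ 1 + T <= nu (ld sig T).
Proof.
  intros H. unfold nu, lu, ld; cbn. rewrite Rabs_Ropp, (Rabs_right T) by lra.
  generalize (Rabs_pos sig); lra.
Qed.

Lemma K_nu_T T l : 0 <= T -> 1 + T <= nu l -> K / nu l <= K / (1 + T).
Proof.
  intros HT H. apply Rmult_le_compat_l; auto. apply Rinv_le_contravar; lra.
Qed.

Lemma fam_bound_lu T x : 0 <= T -> norm (F (lu sig T) x) <= K / (1 + T) * norm x /\ norm (F (ld sig T) x) <= K / (1 + T) * norm x.
Proof.
  intros HT. destruct (nu_lu T HT). split; (eapply Rle_trans; [apply fam_bound; auto|]);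
  (apply Rmult_le_compat_r; [apply norm_ge_0|apply K_nu_T; auto]).
Qed.

(** The integral over the whole line is 0. The rate 1/(1 + T) of its truncations is what
    [abel_bound] turns into smallness of the Abel mean. *)
Lemma RInt_fam2_bound T x : 0 <= T -> norm (RInt (sym (fun l => F l (F l x)) sig) 0 T) <= 2 * K * norm x / (1 + T).
Proof.
  intros HT. rewrite RInt_fam2 by auto. destruct (fam_bound_lu T x HT).
  eapply Rle_trans; [apply Ci_bound|].
  replace (2 * K * norm x / (1 + T)) with (K / (1 + T) * norm x + K / (1 + T) * norm x) by (field; lra). lra.
Qed.

Lemma RInt_fam3_bound T x : 0 <= T -> norm (RInt (sym (fun l => F l (F l (F l x))) sig) 0 T) <= K * K * norm x / (1 + T).
Proof.
  intros HT. rewrite RInt_fam3 by auto.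
  assert (B : forall l, fst l <= om -> 1 + T <= nu l -> norm (F l (F l x)) <= K / (1 + T) * (K * norm x)).
  { intros l Hl Hn. eapply Rle_trans; [apply fam_bound; auto|].
    apply Rmult_le_compat; [apply div_nu_le; auto|apply norm_ge_0|apply K_nu_T; auto|apply fam_bound_K; auto]. }
  destruct (nu_lu T HT).
  apply Rle_trans with (/ 2 * (K / (1 + T) * (K * norm x) + K / (1 + T) * (K * norm x))); [|right; field; lra].
  apply norm_scal_bound; [rewrite Rabs_right; lra|].
  eapply Rle_trans; [apply Ci_bound|]. apply Rplus_le_compat; apply B; auto.
Qed.

End Family.

Lemma norm_scal_eq {V : CompleteNormedModule R_AbsRing} (a : R) (x : V) : norm (scal a x) = Rabs a * norm x.
Proof.
  apply Rle_antisym; [apply norm_scalR|].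
  destruct (Req_dec a 0) as [->|N].
  - rewrite Rabs_R0, Rmult_0_l. apply norm_ge_0.
  - assert (H : norm (scal (/ a) (scal a x)) <= Rabs (/ a) * norm (scal a x)) by apply norm_scalR.
    replace (scal (/ a) (scal a x)) with x in H by (vec_with ltac:(real_eq; field; auto)).
    assert (0 < Rabs a) by (apply Rabs_pos_lt; auto).
    rewrite Rabs_inv in H. apply Rmult_le_compat_l with (r := Rabs a) in H; [|lra].
    replace (Rabs a * (/ Rabs a * norm (scal a x))) with (norm (scal a x)) in H by (field; lra). exact H.
Qed.

(** * Abel means of integrals along a line *)

Section Abel.
Context {V : CompleteNormedModule R_AbsRing}.

(** Truncation at N keeps the integral proper, which the exchange of integrals needs; the weight
    makes the terms arising at N negligible. *)
Definition abel (delta N : R) (h : R -> V) : V := RInt (fun t => scal (exp (- delta * t)) (h t)) 0 N.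

Lemma exp_cont_on a b delta : cont_on (V := R_CompleteNormedModule) a b (fun t => exp (- delta * t)).
Proof.
  intros t _. apply contn_in_real. apply (ex_derive_continuous (fun t => exp (- delta * t))). auto_derive; auto.
Qed.

Lemma abel_cont a b delta (h : R -> V) : cont_on a b h -> cont_on a b (fun t => scal (exp (- delta * t)) (h t)).
Proof. intros H t It. apply contn_in_scal; [apply exp_cont_on; auto|apply H; auto]. Qed.

Lemma exp_neg_le1 x : 0 <= x -> exp (- x) <= 1.
Proof. intros. rewrite <- exp_0. destruct H as [H| <-]; [left; apply exp_increasing; lra|right; f_equal; ring]. Qed.

(** By parts, the mean is e^(-delta N) H(N) plus delta times the weighted integral of the primitive
    H. In it 1/(1+t) <= eps + 1/(4 eps (1+t)^2): the first term contributes at most eps, the second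
    at most delta/(4 eps) <= eps. *)
Lemma abel_bound delta N (h : R -> V) C eps : 0 < delta -> 0 <= N -> 0 <= C -> 0 < eps -> delta <= 4 * eps * eps ->
  cont_on 0 N h -> (forall t, 0 <= t <= N -> norm (RInt h 0 t) <= C / (1 + t)) ->
  norm (abel delta N h) <= C * (exp (- delta * N) + 2 * eps).
Proof.
  intros Hd HN HC He Hde Ch HH.
  set (H := fun t => RInt h 0 t).
  assert (CH : cont_on 0 N H) by (intros t It; eapply deriv_contn; apply deriv_RInt; auto).
  set (g := (fun t => scal (- delta * exp (- delta * t)) (H t)) : R -> V).
  assert (Cg : cont_on 0 N g).
  { intros t It. apply contn_in_scal; [|apply CH; auto].
    apply contn_in_real. apply (ex_derive_continuous (fun t => - delta * exp (- delta * t))). auto_derive; auto. }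
  assert (E : abel delta N h = minus (scal (exp (- delta * N)) (H N) : V) (RInt g 0 N)).
  { assert (F : minus (scal (exp (- delta * N)) (H N) : V) (scal (exp (- delta * 0)) (H 0)) =
       RInt (fun t => plus (g t) (scal (exp (- delta * t)) (h t) : V)) 0 N).
    { apply (ftc_in 0 N (fun t => scal (exp (- delta * t)) (H t))); auto.
      - apply abel_cont; auto.
      - intros t It. apply contn_in_plus; [apply Cg; auto|apply abel_cont; auto].
      - intros t It. apply (deriv_in_scal (itv 0 N) (fun t => exp (- delta * t)) H t (- delta * exp (- delta * t)) (h t)).
        + apply deriv_in_real. auto_derive; auto. ring.
        + apply deriv_RInt; auto. unfold itv; lra. }
    rewrite RInt_plus_on in F; auto using abel_cont.
    unfold H in F at 2. rewrite RInt_point in F. unfold abel.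
    transitivity (minus (plus (RInt g 0 N) (RInt (fun t => scal (exp (- delta * t)) (h t)) 0 N)) (RInt g 0 N)); [vec|].
    rewrite <- F. vec. }
  rewrite E.
  set (G := fun t => C * (- eps * exp (- delta * t) - delta / (4 * eps) / (1 + t))).
  assert (B2 : norm (RInt g 0 N) <= G N - G 0).
  { apply RInt_norm_le_deriv with (fun t => C * (eps * delta * exp (- delta * t) + delta / (4 * eps) / (1 + t) / (1 + t))); auto.
    - intros t Ht. unfold G. auto_derive; [lra|]. field. lra.
    - intros t Ht. apply (ex_derive_continuous (fun t => C * (eps * delta * exp (- delta * t) + delta / (4 * eps) / (1 + t) / (1 + t)))).
      auto_derive. lra.
    - intros t Ht. unfold g. eapply Rle_trans; [apply norm_scal_bound; [apply Rle_refl|apply HH; auto]|].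
      assert (Ep := exp_pos (- delta * t)).
      assert (E1 : exp (- delta * t) <= 1) by (replace (- delta * t) with (- (delta * t)) by ring; apply exp_neg_le1; nra).
      rewrite Rabs_mult, Rabs_Ropp, Rabs_right, Rabs_right by lra.
      set (e := exp (- delta * t)) in *. set (y := / (1 + t)).
      assert (Y : 0 < y) by (apply Rinv_0_lt_compat; lra).
      assert (AG : y <= eps + y * y / (4 * eps)).
      { apply Rmult_le_reg_r with (4 * eps); [lra|].
        replace ((eps + y * y / (4 * eps)) * (4 * eps)) with (4 * eps * eps + y * y) by (field; lra).
        generalize (Rle_0_sqr (y - 2 * eps)). unfold Rsqr. lra. }
      unfold Rdiv. fold y. fold (delta / (4 * eps)).
      apply Rle_trans with (C * (delta * e * (eps + y * y / (4 * eps)))).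
      + replace (delta * e * (C * y)) with (C * (delta * e * y)) by ring.
        apply Rmult_le_compat_l; auto. apply Rmult_le_compat_l; auto. nra.
      + apply Rmult_le_compat_l; auto.
        replace (delta * e * (eps + y * y / (4 * eps))) with (eps * delta * e + e * (delta / (4 * eps) * y * y)) by (field; lra).
        assert (0 <= delta / (4 * eps) * y * y).
        { repeat apply Rmult_le_pos; try lra. apply Rlt_le, Rinv_0_lt_compat; lra. }
        nra. }
  assert (B1 : norm (scal (exp (- delta * N)) (H N)) <= exp (- delta * N) * C).
  { apply norm_scal_bound.
    - rewrite Rabs_right; [lra|]. generalize (exp_pos (- delta * N)); lra.
    - eapply Rle_trans; [apply HH; lra|]. apply Rmult_le_reg_r with (1 + N); [lra|].
      replace (C / (1 + N) * (1 + N)) with C by (field; lra). nra. }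
  assert (B3 : G N - G 0 <= C * (2 * eps)).
  { unfold G. replace (- delta * 0) with 0 by ring. rewrite exp_0.
    rewrite <- Rmult_minus_distr_l. apply Rmult_le_compat_l; auto.
    assert (0 <= delta / (4 * eps) / (1 + N)).
    { apply Rmult_le_pos; [apply Rlt_le, Rdiv_lt_0_compat; lra|apply Rlt_le, Rinv_0_lt_compat; lra]. }
    assert (delta / (4 * eps) <= eps).
    { apply Rmult_le_reg_r with (4 * eps); [lra|]. replace (delta / (4 * eps) * (4 * eps)) with delta by (field; lra). lra. }
    assert (0 < exp (- delta * N)) by apply exp_pos.
    replace (delta / (4 * eps) / (1 + 0)) with (delta / (4 * eps)) by (field; lra). nra. }
  apply Rle_trans with (exp (- delta * N) * C + C * (2 * eps)); [|lra].
  rewrite <- norm_oppV in B2. eapply norm_le_plus; [|exact B1|eapply Rle_trans; [exact B2|exact B3]]. vec.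
Qed.

End Abel.

(** The first term is the Poisson kernel at r; the second is the contribution of the end N. *)
Lemma abel_kernel delta N r : 0 < delta ->
  RInt (V := R_CompleteNormedModule) (fun t => exp (- delta * t) * (2 * cos (t * r))) 0 N =
  2 * delta / (delta * delta + r * r) + exp (- delta * N) * (2 * (r * sin (N * r) - delta * cos (N * r)) / (delta * delta + r * r)).
Proof.
  intros Hd. assert (P : 0 < delta * delta + r * r) by nra.
  apply is_RInt_unique.
  set (G := fun t => exp (- delta * t) * (2 * (r * sin (t * r) - delta * cos (t * r)) / (delta * delta + r * r))).
  replace (_ + _) with (minus (G N) (G 0)).
  - apply (is_RInt_derive (V := R_CompleteNormedModule)).
    + intros t _. unfold G. auto_derive; auto. field. lra.
    + intros t _. apply (ex_derive_continuous (fun t => exp (- delta * t) * (2 * cos (t * r)))). auto_derive; auto.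
  - unfold G, minus, plus, opp; cbn. rewrite Rmult_0_l, sin_0, cos_0, Rmult_0_r, exp_0. field. lra.
Qed.

Section Shift.
Context {X : CompleteNormedModule C_AbsRing}.
Variables (om K1 K2 : R) (F Q : C -> real_space X -> real_space X) (x : real_space X) (c : R).
Hypothesis HF : res_family om K1 F.
Hypothesis HQ : res_family om K2 Q.
Hypothesis c0 : 0 <= c.
Hypothesis Hk : forall l, fst l <= om -> norm (minus (F l x) (Q l x)) <= c / (nu l * nu l).

Let k (l : C) : real_space X := minus (F l x) (Q l x).

Lemma shift_cont sig a b : sig <= om -> cont_on a b (sym k sig).
Proof.
  intros Hs. apply cont_on_ext with (fun t => minus (sym (fun l => F l x) sig t) (sym (fun l => Q l x) sig t)).
  - intros. unfold sym, k. vec.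
  - intros t It. apply contn_in_minus; [eapply fam1_cont|eapply fam1_cont]; eauto.
Qed.

Lemma k_bound l M : fst l <= om -> 0 < M -> M <= nu l -> norm (k l) <= c / (M * M).
Proof.
  intros Hl HM H. eapply Rle_trans; [apply Hk; auto|].
  apply Rmult_le_compat_l; auto. apply Rinv_le_contravar; nra.
Qed.

(* Moving the line to the left does not change the limit of the integral, which tends to 0 at [-oo]. *)
Lemma shift_bound sig T : sig <= om -> 0 <= T ->
  norm (RInt (sym k sig) 0 T) <= (2 * c + 2 * c * ((1 + Rabs sig) * (1 + Rabs sig))) / (1 + T).
Proof.
  intros Hs HT.
  set (k2 := fun l => minus (F l (F l x)) (Q l (Q l x))).
  assert (C2 : forall s, s <= om -> cont_on 0 T (sym k2 s)).
  { intros s Hs'. apply cont_on_ext with (fun t => minus (sym (fun l => F l (F l x)) s t) (sym (fun l => Q l (Q l x)) s t)).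
    - intros. unfold sym, k2. vec.
    - intros t It. apply contn_in_minus; [eapply fam2_cont|eapply fam2_cont]; eauto. }
  assert (I2 : forall s, s <= om -> RInt (sym k2 s) 0 T = cscal Ci (minus (k (lu s T)) (k (ld s T)))).
  { intros s Hs'.
    rewrite (RInt_ext_on 0 T (sym k2 s) (fun t => minus (sym (fun l => F l (F l x)) s t) (sym (fun l => Q l (Q l x)) s t))); auto.
    2: intros; unfold sym, k2; vec.
    rewrite RInt_minus_on; auto; [|eapply fam2_cont; eauto|eapply fam2_cont; eauto].
    rewrite (RInt_fam2 om K1 F HF), (RInt_fam2 om K2 Q HQ) by auto.
    rewrite <- cscal_minus_r. f_equal. unfold k. vec. }
  assert (M1 : 0 <= K1 * K1 * K1 * norm x + K2 * K2 * K2 * norm x).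
  { destruct HF as [h1 _]. destruct HQ as [h2 _]. generalize (norm_ge_0 x). intros.
    apply Rplus_le_le_0_compat; repeat apply Rmult_le_pos; auto. }
  set (M := K1 * K1 * K1 * norm x + K2 * K2 * K2 * norm x) in *.
  assert (rem : forall l m, fst l <= om -> fst m <= om ->
     norm (plus (minus (k m) (k l)) (cscal (m - l)%C (k2 l))) <= M * (Cmod (m - l)%C * Cmod (m - l)%C)).
  { intros l m Hl Hm. unfold M. rewrite Rmult_plus_distr_r.
    assert (A1 := fam_remainder om K1 F HF l m x Hl Hm). assert (A2 := fam_remainder om K2 Q HQ l m x Hl Hm).
    rewrite <- norm_oppV in A2.
    eapply norm_le_plus; [|eapply Rle_trans; [exact A1|right; ring]|eapply Rle_trans; [exact A2|right; ring]].
    unfold k, k2. rewrite cscal_minus_r. vec. }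
  (* In place of Cauchy's theorem the integral is differentiated in the abscissa. The derivative is
     minus the integral of [k2], which [I2] has reduced to the values of k at the heights T and
     -T. *)
  assert (D : forall s, s <= om -> deriv_in (fun r => r <= om) (fun s => RInt (sym k s) 0 T) s (opp (RInt (sym k2 s) 0 T))).
  { intros s Hs' e He. set (B := 2 * M * T + 1).
    assert (HB : 0 < B) by (unfold B; assert (0 <= M * T) by (apply Rmult_le_pos; auto); lra).
    exists (e / B). split; [apply Rdiv_lt_0_compat; auto|].
    intros r Hr Hrs.
    replace (minus _ _) with (RInt (fun t => plus (minus (sym k r t) (sym k s t) : real_space X) (scal (r - s) (sym k2 s t) : real_space X)) 0 T).
    - apply Rle_trans with ((2 * M * (Rabs (r - s) * Rabs (r - s))) * (T - 0)).
      + apply RInt_norm_le; auto.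
        * intros t It. apply contn_in_plus; [apply contn_in_minus; apply shift_cont; auto|].
          apply contn_in_scal; [apply (contn_in_const (V := R_CompleteNormedModule))|apply C2; auto].
        * intros t It.
          assert (U : forall tau, norm (plus (minus (k (r, tau)) (k (s, tau))) (scal (r - s) (k2 (s, tau)))) <= M * (Rabs (r - s) * Rabs (r - s))).
          { intros tau. specialize (rem (s, tau) (r, tau) Hs' Hr).
            replace ((r, tau) - (s, tau))%C with (RtoC (r - s)) in rem
              by (unfold RtoC, Cminus, Cplus, Copp; cbn; f_equal; ring).
            rewrite Cmod_R, cscal_RtoC in rem. exact rem. }
          replace (2 * M * (Rabs (r - s) * Rabs (r - s))) with (M * (Rabs (r - s) * Rabs (r - s)) + M * (Rabs (r - s) * Rabs (r - s))) by ring.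
          eapply norm_le_plus; [|apply (U t)|apply (U (- t))]. unfold sym, lu, ld. vec.
      + set (h := Rabs (r - s)) in *. assert (0 <= h) by apply Rabs_pos.
        replace (2 * M * (h * h) * (T - 0)) with ((B - 1) * h * h) by (unfold B; ring).
        apply Rmult_le_compat_r; auto. apply Rle_trans with (B * h); [nra|].
        apply Rle_trans with (B * (e / B)); [|right; field; lra]. apply Rmult_le_compat_l; lra.
    - rewrite RInt_plus_on; auto.
      + rewrite RInt_minus_on, RInt_scal_on; auto using shift_cont. vec.
      + intros t It. apply contn_in_minus; apply shift_cont; auto.
      + intros t It. apply contn_in_scal; [apply (contn_in_const (V := R_CompleteNormedModule))|apply C2; auto]. }
  assert (Np : 0 < 1 + T) by lra.
  set (B := 2 * c / ((1 + T) * (1 + T))).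
  (* The line is moved left by exactly T. The horizontal sides have length T and carry k =
     O((1+T)^-2); on the new vertical line, over a length T as well, [nu] is at least (1+T)/P. Both
     parts are thus O(1/(1+T)). *)
  assert (MV : norm (minus (RInt (sym k sig) 0 T) (RInt (sym k (sig - T)) 0 T)) <= B * (sig - (sig - T))).
  { apply (mean_value_closed (fun s => RInt (sym k s) 0 T)); [lra|].
    intros s Is. unfold itv in Is. exists (opp (RInt (sym k2 s) 0 T)). split.
    - apply deriv_in_sub with (fun r => r <= om); [unfold itv; intros; lra|]. apply D. lra.
    - rewrite norm_oppV, I2 by lra. eapply Rle_trans; [apply Ci_bound|].
      destruct (nu_lu s T HT).
      replace B with (c / ((1 + T) * (1 + T)) + c / ((1 + T) * (1 + T))) by (unfold B; field; lra).
      apply Rplus_le_compat; apply k_bound; auto; cbn; lra. }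
  set (P := 1 + Rabs sig). assert (HP : 1 <= P) by (unfold P; generalize (Rabs_pos sig); lra).
  assert (far : norm (RInt (sym k (sig - T)) 0 T) <= (2 * c * (P * P) / ((1 + T) * (1 + T))) * (T - 0)).
  { apply RInt_norm_le; auto; [apply shift_cont; lra|]. intros t Ht.
    assert (nb : forall l, fst l = sig - T -> (1 + T) / P <= nu l).
    { intros l El. unfold nu. rewrite El. apply Rmult_le_reg_r with P; [lra|].
      replace ((1 + T) / P * P) with (1 + T) by (field; lra).
      assert (T <= Rabs (sig - T) + Rabs sig).
      { replace T with (- (sig - T) + sig) at 1 by ring. eapply Rle_trans; [apply Rle_abs|].
        eapply Rle_trans; [apply Rabs_triang|]. rewrite Rabs_Ropp. lra. }
      generalize (Rabs_pos (sig - T)) (Rabs_pos (snd l)). unfold P. intros.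
      generalize (Rabs_pos sig); nra. }
    assert (q0 : 0 < (1 + T) / P) by (apply Rdiv_lt_0_compat; lra).
    replace (2 * c * (P * P) / ((1 + T) * (1 + T))) with (c / ((1 + T) / P * ((1 + T) / P)) + c / ((1 + T) / P * ((1 + T) / P))) by (field; lra).
    eapply norm_le_plus; [unfold sym; reflexivity| |]; apply k_bound; auto; cbn; lra. }
  replace ((2 * c + 2 * c * (P * P)) / (1 + T)) with (2 * c / (1 + T) + 2 * c * (P * P) / (1 + T)) by (field; lra).
  assert (fr : forall q, 0 <= q -> q / ((1 + T) * (1 + T)) * T <= q / (1 + T)).
  { intros q Hq. replace (q / ((1 + T) * (1 + T)) * T) with (q / (1 + T) * (T / (1 + T))) by (field; lra).
    rewrite <- (Rmult_1_r (q / (1 + T))) at 2. apply Rmult_le_compat_l.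
    - apply Rmult_le_pos; auto. apply Rlt_le, Rinv_0_lt_compat; lra.
    - apply Rmult_le_reg_r with (1 + T); [lra|]. replace (T / (1 + T) * (1 + T)) with T by (field; lra). lra. }
  eapply norm_le_plus with (y := minus (RInt (sym k sig) 0 T) (RInt (sym k (sig - T)) 0 T)); [|eapply Rle_trans; [exact MV|]|eapply Rle_trans; [exact far|]].
  - vec.
  - unfold B. replace (sig - (sig - T)) with T by ring. apply fr. lra.
  - rewrite Rminus_0_r. apply fr. nra.
Qed.

End Shift.

(** This is e^(l r). *)
Definition cis (l : C) (r : R) : C := (exp (fst l * r) * cos (snd l * r), exp (fst l * r) * sin (snd l * r)).

Lemma Cmod_cis l r : Cmod (cis l r) = exp (fst l * r).
Proof.
  unfold cis, Cmod; cbn [fst snd].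
  replace ((exp (fst l * r) * cos (snd l * r)) ^ 2 + (exp (fst l * r) * sin (snd l * r)) ^ 2) with ((exp (fst l * r))²).
  - apply sqrt_Rsqr. apply Rlt_le, exp_pos.
  - assert (H := sin2_cos2 (snd l * r)). unfold Rsqr in *. cbn.
    set (e := exp (fst l * r)) in *. set (a := cos (snd l * r)) in *. set (b := sin (snd l * r)) in *.
    transitivity (e * e * (b * b + a * a)); [rewrite H|]; ring.
Qed.

Lemma cis_0 l : cis l 0 = 1%C.
Proof. unfold cis. rewrite !Rmult_0_r, exp_0, cos_0, sin_0. unfold RtoC. f_equal; ring. Qed.

Lemma cos_lip a b : Rabs (cos a - cos b) <= Rabs (a - b).
Proof.
  assert (H : forall p q, p <= q -> Rabs (cos q - cos p) <= q - p).
  { intros p q Hpq.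
    assert (M := mean_value_closed (V := R_CompleteNormedModule) cos p q 1 Hpq). rewrite Rmult_1_l in M. apply M.
    intros t _. exists (- sin t). split.
    - apply deriv_in_real. auto_derive; auto; ring.
    - change (Rabs (- sin t) <= 1). rewrite Rabs_Ropp. apply Rabs_le. apply SIN_bound. }
  destruct (Rle_dec b a).
  - rewrite (Rabs_right (a - b)) by lra. auto.
  - rewrite Rabs_minus_sym, (Rabs_minus_sym a), (Rabs_right (b - a)) by lra. apply H; lra.
Qed.

Lemma exp_neg_lip delta a b : 0 <= delta -> 0 <= a -> 0 <= b ->
  Rabs (exp (- delta * a) - exp (- delta * b)) <= delta * Rabs (a - b).
Proof.
  intros Hd.
  assert (H : forall p q, 0 <= p -> p <= q -> Rabs (exp (- delta * q) - exp (- delta * p)) <= delta * (q - p)).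
  { intros p q Hp Hpq.
    apply (mean_value_closed (V := R_CompleteNormedModule) (fun t => exp (- delta * t)) p q delta Hpq).
    intros t Ht. unfold itv in Ht. exists (- delta * exp (- delta * t)). split.
    - apply deriv_in_real. auto_derive; auto; ring.
    - change (Rabs (- delta * exp (- delta * t)) <= delta).
      assert (E1 : exp (- delta * t) <= 1) by (replace (- delta * t) with (- (delta * t)) by ring; apply exp_neg_le1; nra).
      generalize (exp_pos (- delta * t)); intros.
      rewrite Rabs_mult, Rabs_Ropp, !Rabs_right by lra. nra. }
  intros Ha Hb. destruct (Rle_dec b a).
  - rewrite (Rabs_right (a - b)) by lra. auto.
  - rewrite Rabs_minus_sym, (Rabs_minus_sym a), (Rabs_right (b - a)) by lra. apply H; lra.
Qed.

(** * Semigroup and powers of the resolvent *)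

Section Inversion.
Context {X : CompleteNormedModule C_AbsRing}.
Variables (A : operator X) (S : R -> real_space X -> real_space X).
Hypothesis C0 : C0_semigroup S.
Hypothesis SA : semigroup_of A S.
Variables (om K : R) (F : C -> real_space X -> real_space X).
Hypothesis HF : res_family om K F.
Hypothesis Hres : forall l, fst l <= om -> is_resolvent A l (F l).
Implicit Types x y z : real_space X.

Lemma cis_deriv (J : R -> Prop) l t (v : R -> real_space X) s d : deriv_in J v s d ->
  deriv_in J (fun r => cscal (cis l (r - t)) (v r)) s (cscal (cis l (s - t)) (plus (cscal l (v s)) d)).
Proof.
  intros Hv. destruct l as [a b].
  set (p := fun r => exp (a * (r - t)) * cos (b * (r - t))).
  set (q := fun r => exp (a * (r - t)) * sin (b * (r - t))).
  assert (Hi : deriv_in J (fun r => cscal Ci (v r)) s (cscal Ci d)).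
  { apply (deriv_in_lin (V := real_space X) (W := real_space X)) with (L := cscal Ci) (M := 1); auto.
    - intros; apply cscal_plus_r.
    - intros; apply cscal_scal.
    - intros. rewrite Rmult_1_l. apply norm_Ci. }
  assert (G : deriv_in J (fun r => plus (scal (p r) (v r) : real_space X) (scal (q r) (cscal Ci (v r)))) s
     (plus (plus (scal (a * p s - b * q s) (v s) : real_space X) (scal (p s) d))
           (plus (scal (a * q s + b * p s) (cscal Ci (v s)) : real_space X) (scal (q s) (cscal Ci d))))).
  { apply deriv_in_plus.
    - apply (deriv_in_scal (V := real_space X) J p v s (a * p s - b * q s) d); auto.
      apply deriv_in_real. unfold p, q. auto_derive; auto. unfold Rminus. ring.
    - apply (deriv_in_scal (V := real_space X) J q (fun r => cscal Ci (v r)) s (a * q s + b * p s) (cscal Ci d)); auto.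
      apply deriv_in_real. unfold p, q. auto_derive; auto. unfold Rminus. ring. }
  assert (E1 : forall r, cscal (cis (a, b) (r - t)) (v r) = plus (scal (p r) (v r)) (scal (q r) (cscal Ci (v r)))).
  { intros r. unfold cis; cbn [fst snd]. rewrite cscal_pair. reflexivity. }
  assert (E2 : cscal (cis (a, b) (s - t)) (plus (cscal (a, b) (v s)) d) =
     plus (plus (scal (a * p s - b * q s) (v s) : real_space X) (scal (p s) d))
           (plus (scal (a * q s + b * p s) (cscal Ci (v s)) : real_space X) (scal (q s) (cscal Ci d)))).
  { unfold cis; cbn [fst snd]. fold (p s). fold (q s).
    rewrite cscal_pair, (cscal_pair a b), !cscal_plus_r, !cscal_scal, cscal_Ci2. vec. }
  rewrite E2. intros e He. destruct (G e He) as [dl [Hd D]]. exists dl. split; auto.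
  intros r Jr Hr. rewrite !E1. apply D; auto.
Qed.

(** Chosen so that v(s) = S(s) [rpoly l s x] satisfies v' = (s^2/2) S(s)x - l v and v(0) = R^3 x.
    With R^2 as the last term the remainder belonging to A x would be of order 1/|l|, which is not
    integrable along a line. *)
Definition rpoly (l : C) (s : R) (x : real_space X) : real_space X :=
  plus (minus (scal (s * s / 2) (F l x) : real_space X) (scal s (F l (F l x))) : real_space X) (F l (F l (F l x))).

Let Flin l : fst l <= om -> bounded_linear (F l). Proof. apply HF. Qed.

Lemma orbit_deriv l s x : fst l <= om -> 0 <= s ->
  deriv_in (fun r => 0 <= r) (fun r => S r (F l x)) s (minus (S s x) (cscal l (S s (F l x)))).
Proof.
  intros Hl Hs. destruct (Hres l Hl) as (_ & H & _). destruct (H x) as [D E].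
  replace (minus (S s x) (cscal l (S s (F l x)))) with (opp (S s (A (F l x)))).
  - apply sg_deriv with (A := A); auto.
  - assert (Ls := sg_lin S C0 s Hs). rewrite <- (lin_cscal _ Ls), <- (lin_minus _ Ls), <- (lin_opp _ Ls).
    f_equal. rewrite <- E at 2. vec.
Qed.

Lemma rpoly_S l s t x : 0 <= t -> S t (rpoly l s x) =
  plus (minus (scal (s * s / 2) (S t (F l x)) : real_space X) (scal s (S t (F l (F l x)))) : real_space X) (S t (F l (F l (F l x)))).
Proof.
  intros Ht. assert (L := sg_lin S C0 t Ht). unfold rpoly.
  rewrite (lin_plus _ L), (lin_minus _ L), !(lin_scal _ L). reflexivity.
Qed.

Definition wgt (s : R) x : real_space X := scal (s * s / 2) (S s x).

Lemma S_cont_on a b x : 0 <= a -> cont_on a b (fun s => S s x).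
Proof.
  intros Ha s Hs. apply contn_in_sub with (fun r => 0 <= r); [unfold itv; intros; lra|].
  apply sg_cont; auto. unfold itv in Hs. lra.
Qed.

Lemma wgt_cont a b x : 0 <= a -> cont_on a b (fun s => wgt s x).
Proof.
  intros Ha s Hs. apply contn_in_scal; [|apply S_cont_on; auto].
  apply contn_in_real. apply (ex_derive_continuous (fun s => s * s / 2)). auto_derive; auto.
Qed.

Lemma duhamel l t x : fst l <= om -> 0 <= t ->
  minus (S t (rpoly l t x)) (cscal (cis l (- t)) (F l (F l (F l x)))) =
  RInt (fun s => cscal (cis l (s - t)) (wgt s x)) 0 t.
Proof.
  intros Hl Ht.
  set (a := F l x). set (b := F l a). set (c := F l b).
  set (v := fun s => plus (minus (scal (s * s / 2) (S s a) : real_space X) (scal s (S s b)) : real_space X) (S s c)).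
  assert (Dv : forall s, itv 0 t s -> deriv_in (itv 0 t) v s (minus (wgt s x) (cscal l (v s)))).
  { intros s Is.
    (* The derivatives of the coefficients s^2/2 and s produce s S(s)a and S(s)b, which cancel
       against the terms contributed by the next higher power of F. *)
    replace (minus (wgt s x) (cscal l (v s))) with
      (plus (minus (plus (scal s (S s a) : real_space X) (scal (s * s / 2) (minus (S s x) (cscal l (S s a)))) : real_space X)
                   (plus (scal 1 (S s b) : real_space X) (scal s (minus (S s a) (cscal l (S s b))))) : real_space X)
            (minus (S s b) (cscal l (S s c)))).
    - assert (sub : forall f d, deriv_in (V := real_space X) (fun r => 0 <= r) f s d -> deriv_in (itv 0 t) f s d).
      { intros f d. apply deriv_in_sub. unfold itv; intros; lra. }
      unfold itv in Is.
      apply deriv_in_plus; [apply deriv_in_minus|].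
      + apply (deriv_in_scal (V := real_space X) (itv 0 t) (fun s => s * s / 2) (fun s => S s a)).
        * apply deriv_in_real. auto_derive; auto. field.
        * apply sub. apply orbit_deriv; auto. lra.
      + apply (deriv_in_scal (V := real_space X) (itv 0 t) (fun s => s) (fun s => S s b)).
        * apply deriv_in_real. auto_derive; auto.
        * apply sub. apply orbit_deriv; auto. lra.
      + apply sub. apply orbit_deriv; auto. lra.
    - unfold v, wgt. rewrite cscal_plus_r, cscal_minus_r, !cscal_scal. vec. }
  assert (D : forall s, itv 0 t s -> deriv_in (itv 0 t) (fun s => cscal (cis l (s - t)) (v s)) s (cscal (cis l (s - t)) (wgt s x))).
  { intros s Is. replace (wgt s x) with (plus (cscal l (v s)) (minus (wgt s x) (cscal l (v s)))) by vec.
    apply cis_deriv. apply Dv; auto. }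
  assert (Ck : cont_on 0 t (fun s => cscal (cis l (s - t)) (wgt s x))).
  { intros s Is.
    apply contn_in_ext with (fun s => plus (scal (exp (fst l * (s - t)) * cos (snd l * (s - t))) (wgt s x) : real_space X)
       (scal (exp (fst l * (s - t)) * sin (snd l * (s - t))) (cscal Ci (wgt s x)))); auto.
    - intros r _. unfold cis. rewrite cscal_pair. reflexivity.
    - apply contn_in_plus; apply contn_in_scal.
      + apply contn_in_real. apply (ex_derive_continuous (fun s => exp (fst l * (s - t)) * cos (snd l * (s - t)))). auto_derive; auto.
      + apply wgt_cont; auto; lra.
      + apply contn_in_real. apply (ex_derive_continuous (fun s => exp (fst l * (s - t)) * sin (snd l * (s - t)))). auto_derive; auto.
      + apply (contn_in_lin (V := real_space X) (W := real_space X)) with (L := cscal Ci) (M := 1).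
        * intros; apply cscal_minus_r.
        * intros. rewrite Rmult_1_l. apply norm_Ci.
        * apply wgt_cont; auto; lra. }
  rewrite <- (ftc_in 0 t (fun s => cscal (cis l (s - t)) (v s))); auto.
  - rewrite Rminus_diag_eq, cis_0, cscal_one by auto. rewrite rpoly_S by auto. unfold Rminus. rewrite Rplus_0_l.
    f_equal. f_equal. unfold v. rewrite !(sg_zero S C0). vec_with ltac:(real_eq; field).
  - intros s Is. eapply deriv_contn. apply D; auto.
  - intros s Is. apply D. unfold itv; lra.
Qed.

Definition lsym (sig t : R) x (tau : R) : real_space X :=
  plus (cscal (cis (lu sig tau) (- t)) (F (lu sig tau) (F (lu sig tau) (F (lu sig tau) x))))
       (cscal (cis (ld sig tau) (- t)) (F (ld sig tau) (F (ld sig tau) (F (ld sig tau) x)))).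

Definition wexp (sig t : R) x (s : R) : real_space X := scal (exp (sig * (s - t))) (wgt s x).

Lemma wexp_cont sig t x a b : 0 <= a -> cont_on a b (wexp sig t x).
Proof.
  intros Ha s Hs. apply contn_in_scal; [|apply wgt_cont; auto].
  apply contn_in_real. apply (ex_derive_continuous (fun s => exp (sig * (s - t)))). auto_derive; auto.
Qed.

Lemma cis_cont sig t a b : cont_on (V := R_CompleteNormedModule) a b (fun tau => exp (sig * - t) * cos (tau * - t)) /\
  cont_on (V := R_CompleteNormedModule) a b (fun tau => exp (sig * - t) * sin (tau * - t)).
Proof.
  split; intros s _; apply contn_in_real.
  - apply (ex_derive_continuous (fun tau => exp (sig * - t) * cos (tau * - t))). auto_derive; auto.
  - apply (ex_derive_continuous (fun tau => exp (sig * - t) * sin (tau * - t))). auto_derive; auto.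
Qed.

Lemma lsym_cont sig t x a b : sig <= om -> cont_on a b (lsym sig t x).
Proof.
  intros Hs s Is.
  assert (LC : forall f, contn_in (V := real_space X) (itv a b) f s -> contn_in (V := real_space X) (itv a b) (fun r => cscal Ci (f r)) s).
  { intros f Hf. apply (contn_in_lin (V := real_space X) (W := real_space X)) with (L := cscal Ci) (M := 1); auto.
    - intros; apply cscal_minus_r.
    - intros. rewrite Rmult_1_l. apply norm_Ci. }
  destruct (cis_cont sig t a b) as [c1 c2].
  assert (cu := fam3_lu_cont om K F HF sig Hs a b x). assert (cd := fam3_ld_cont om K F HF sig Hs a b x).
  apply contn_in_ext with (fun tau => plus
     (plus (scal (exp (sig * - t) * cos (tau * - t)) (F (lu sig tau) (F (lu sig tau) (F (lu sig tau) x))) : real_space X)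
           (scal (exp (sig * - t) * sin (tau * - t)) (cscal Ci (F (lu sig tau) (F (lu sig tau) (F (lu sig tau) x))))))
     (minus (scal (exp (sig * - t) * cos (tau * - t)) (F (ld sig tau) (F (ld sig tau) (F (ld sig tau) x))) : real_space X)
           (scal (exp (sig * - t) * sin (tau * - t)) (cscal Ci (F (ld sig tau) (F (ld sig tau) (F (ld sig tau) x)))))) ); auto.
  - intros r _. unfold lsym, cis. rewrite !cscal_pair. cbn [lu ld fst snd].
    replace (- r * - t) with (- (r * - t)) by ring. rewrite cos_neg, sin_neg. vec.
  - apply contn_in_plus; [apply contn_in_plus|apply contn_in_minus]; apply contn_in_scal; auto.
Qed.

(** Adding the identities at the heights tau and -tau replaces the complex exponentials on the right
    by the real factor 2 cos(tau (t - s)), so that real integration suffices from here on. *)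
Lemma duhamel_sym sig tau t x : sig <= om -> 0 <= t ->
  minus (S t (plus (minus (scal (t * t / 2) (sym (fun l => F l x) sig tau) : real_space X) (scal t (sym (fun l => F l (F l x)) sig tau)) : real_space X)
                   (sym (fun l => F l (F l (F l x))) sig tau)))
        (lsym sig t x tau) =
  RInt (fun s => scal (2 * cos (tau * (t - s))) (wexp sig t x s)) 0 t.
Proof.
  intros Hs Ht. assert (L := sg_lin S C0 t Ht).
  assert (Eu := duhamel (lu sig tau) t x Hs Ht). assert (Ed := duhamel (ld sig tau) t x Hs Ht).
  assert (Cg : forall (l : C), cont_on 0 t (fun s => cscal (cis l (s - t)) (wgt s x))).
  { intros l s Is.
    apply contn_in_ext with (fun s => plus (scal (exp (fst l * (s - t)) * cos (snd l * (s - t))) (wgt s x) : real_space X)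
       (scal (exp (fst l * (s - t)) * sin (snd l * (s - t))) (cscal Ci (wgt s x)))); auto.
    - intros r _. unfold cis. rewrite cscal_pair. reflexivity.
    - apply contn_in_plus; apply contn_in_scal.
      + apply contn_in_real. apply (ex_derive_continuous (fun s => exp (fst l * (s - t)) * cos (snd l * (s - t)))). auto_derive; auto.
      + apply wgt_cont; auto; lra.
      + apply contn_in_real. apply (ex_derive_continuous (fun s => exp (fst l * (s - t)) * sin (snd l * (s - t)))). auto_derive; auto.
      + apply (contn_in_lin (V := real_space X) (W := real_space X)) with (L := cscal Ci) (M := 1).
        * intros; apply cscal_minus_r.
        * intros. rewrite Rmult_1_l. apply norm_Ci.
        * apply wgt_cont; auto; lra. }
  transitivity (plus (RInt (fun s => cscal (cis (lu sig tau) (s - t)) (wgt s x)) 0 t) (RInt (fun s => cscal (cis (ld sig tau) (s - t)) (wgt s x)) 0 t)).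
  - rewrite <- Eu, <- Ed.
    transitivity (minus (S t (plus (rpoly (lu sig tau) t x) (rpoly (ld sig tau) t x))) (lsym sig t x tau)).
    + f_equal. f_equal. unfold rpoly, sym. vec.
    + rewrite (lin_plus _ L). unfold lsym. vec.
  - rewrite <- RInt_plus_on; auto. apply RInt_ext_on; auto. intros s Hs'.
    unfold cis, wexp. rewrite !cscal_pair. cbn [lu ld fst snd].
    replace (- tau * (s - t)) with (- (tau * (s - t))) by ring. rewrite cos_neg, sin_neg.
    replace (tau * (t - s)) with (- (tau * (s - t))) by ring. rewrite cos_neg. vec.
Qed.

End Inversion.

Section ScalarFamily.
Context {X : CompleteNormedModule C_AbsRing}.
Variables (om mu : R).
Hypothesis Hmu : om + 1 <= mu.
Implicit Types x : real_space X.

(** The resolvent of mu times the identity, with mu to the right of the half-plane. It carries the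
    leading 1/|l| behaviour of F(l)x and has an explicit integral along the line. *)
Definition scalar_res (l : C) (x : real_space X) : real_space X := cscal (/ (l - RtoC mu))%C x.

Lemma scalar_res_neq l : fst l <= om -> (l - RtoC mu)%C <> 0%C.
Proof.
  intros H E. apply (f_equal fst) in E. unfold RtoC, Cminus, Cplus, Copp in E; cbn in E. lra.
Qed.

Lemma scalar_res_family : exists K, res_family om K scalar_res.
Proof.
  exists (2 * (2 + Rabs mu)). assert (Hm := Rabs_pos mu).
  split; [lra|]. split; [|split].
  - intros l Hl. apply (Build_is_linear (K := C_AbsRing) (U := X) (V := X)).
    + intros x y. exact (cscal_plus_r (X := X) _ x y).
    + intros k x.
      assert (E : cscal (/ (l - RtoC mu))%C (cscal k (x : real_space X)) = cscal k (cscal (/ (l - RtoC mu))%C x)).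
      { rewrite !cscal_assoc. f_equal. apply Cmult_comm. }
      exact E.
    + exists (Cmod (/ (l - RtoC mu))%C + 1). split; [generalize (Cmod_ge_0 (/ (l - RtoC mu))%C); lra|].
      intros x. eapply Rle_trans; [exact (norm_cscal (X := X) (/ (l - RtoC mu))%C x)|].
      apply Rmult_le_compat_r; [apply norm_ge_0|lra].
  - intros l m x Hl Hm'. unfold scalar_res. rewrite <- cscal_minus_l, !cscal_assoc. f_equal.
    assert (N1 := scalar_res_neq l Hl). assert (N2 := scalar_res_neq m Hm'). field. auto.
  - intros l x Hl. unfold scalar_res. eapply Rle_trans; [apply norm_cscal|].
    apply Rmult_le_compat_r; [apply norm_ge_0|].
    assert (N := scalar_res_neq l Hl). rewrite Cmod_inv by auto.
    assert (P : 0 < Cmod (l - RtoC mu)%C) by (apply Cmod_gt_0; auto).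
    assert (M := Rmax_Cmod (l - RtoC mu)%C).
    assert (M1 := Rle_trans _ _ _ (Rmax_l _ _) M). assert (M2 := Rle_trans _ _ _ (Rmax_r _ _) M).
    set (c := Cmod (l - RtoC mu)%C) in *. clearbody c.
    destruct l as [a b]. unfold RtoC, Cminus, Cplus, Copp in M1, M2; cbn in *.
    replace (b + - 0) with b in M2 by ring. rewrite Rabs_left in M1 by lra.
    assert (nu (a, b) <= 2 * (2 + Rabs mu) * c).
    { unfold nu; cbn. assert (Rabs a <= (mu - a) + Rabs mu).
      { replace a with (mu - (mu - a)) at 1 by ring. eapply Rle_trans; [apply Rabs_triang|].
        rewrite Rabs_Ropp, (Rabs_right (mu - a)) by lra. lra. }
      assert (1 <= c) by lra. assert (0 <= Rabs mu * (c - 1)) by (apply Rmult_le_pos; lra). lra. }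
    apply Rmult_le_reg_r with c; auto. rewrite Rinv_l by lra.
    assert (n1 := nu_ge1 (a, b)). apply Rmult_le_reg_r with (nu (a, b)); [lra|].
    replace (2 * (2 + Rabs mu) / nu (a, b) * c * nu (a, b)) with (2 * (2 + Rabs mu) * c) by (field; lra). lra.
Qed.

Lemma scalar_res_sym sig tau x : sig <= om ->
  sym (fun l => scalar_res l x) sig tau = scal (- (2 * (mu - sig) / ((mu - sig) * (mu - sig) + tau * tau))) x.
Proof.
  intros H. unfold sym, scalar_res. rewrite <- cscal_plus_l, <- cscal_RtoC. f_equal.
  assert (0 < (mu - sig) * (mu - sig) + tau * tau) by nra.
  unfold lu, ld, RtoC, Cinv, Cminus, Cplus, Copp; cbn. f_equal; field; nra.
Qed.

End ScalarFamily.

Section InversionBound.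
Context {X : CompleteNormedModule C_AbsRing}.
Variables (A : operator X) (S : R -> real_space X -> real_space X).
Hypothesis C0 : C0_semigroup S.
Variables (om K : R) (F : C -> real_space X -> real_space X).
Hypothesis HF : res_family om K F.
Hypothesis Hres : forall l, fst l <= om -> is_resolvent A l (F l).
Implicit Types x y z : real_space X.

Lemma RInt_scal_vec (q : R -> R) a b x : a <= b -> cont_on (V := R_CompleteNormedModule) a b q ->
  RInt (fun t => scal (q t) x) a b = scal (RInt (V := R_CompleteNormedModule) q a b) x.
Proof.
  intros Hab C. symmetry.
  apply (RInt_lin (V := R_CompleteNormedModule) (W := real_space X) (fun r => scal r x) (norm x) a b q); auto.
  - intros r s. change (scal (r + s) x = plus (scal r x) (scal s x)). vec.
  - intros r s. change (scal (r * s) x = scal r (scal s x)). vec.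
  - intros r. rewrite Rmult_comm. apply norm_scalR.
Qed.

(** With mu = om + 1 the difference equals F(l)(A x - mu x)/(l - mu): two decaying factors, at the
    price of x being in the domain. *)
Lemma difference_decay x : dom A x -> exists c, 0 <= c /\
  forall l, fst l <= om -> norm (minus (F l x) (scalar_res (om + 1) l x)) <= c / (nu l * nu l).
Proof.
  intros Dx. destruct (scalar_res_family (X := X) om (om + 1) (Rle_refl _)) as [K2 HQ].
  set (z := minus (A x) (scal (om + 1) x)).
  assert (k1 : 0 <= K) by apply HF. assert (k2 : 0 <= K2) by apply HQ.
  exists (K2 * (K * norm z)). split.
  { generalize (norm_ge_0 z); intros. repeat apply Rmult_le_pos; auto. }
  intros l Hl. destruct (Hres l Hl) as (L & _ & H2). specialize (H2 x Dx).
  assert (N := scalar_res_neq om (om + 1) (Rle_refl _) l Hl).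
  replace (minus _ _) with (scalar_res (om + 1) l (F l z)).
  - eapply Rle_trans; [apply (fam_bound om K2 _ HQ); auto|].
    assert (n1 := nu_ge1 l).
    replace (K2 * (K * norm z) / (nu l * nu l)) with (K2 / nu l * (K / nu l * norm z)) by (field; lra).
    apply Rmult_le_compat_l; [apply div_nu_le; auto|]. apply (fam_bound om K F HF); auto.
  - unfold scalar_res.
    assert (E : F l z = minus (cscal (l - RtoC (om + 1))%C (F l x)) x).
    { rewrite <- H2 at 2. unfold z. rewrite !(lin_minus _ L), (lin_scal _ L), (lin_cscal _ L), cscal_minus_l, cscal_RtoC. vec. }
    rewrite E, cscal_minus_r, cscal_assoc, Cinv_l, cscal_one by auto. reflexivity.
Qed.

Lemma kernel_equicont (delta t N : R) (w : R -> real_space X) : 0 < delta -> 0 <= t -> 0 <= N -> cont_on 0 t w ->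
  (exists W, forall s, 0 <= s <= t -> norm (w s) <= W) ->
  equicont_snd 0 t 0 N (fun s tau => scal (exp (- delta * tau) * (2 * cos (tau * (t - s)))) (w s)) /\
  equicont_snd 0 N 0 t (fun tau s => scal (exp (- delta * tau) * (2 * cos (tau * (t - s)))) (w s)).
Proof.
  intros Hd Ht HN Cw [W HW].
  assert (W0 : 0 <= W) by (eapply Rle_trans; [apply (norm_ge_0 (w 0))|apply (HW 0); lra]).
  assert (eb : forall tau, 0 <= tau -> Rabs (exp (- delta * tau)) <= 1).
  { intros tau H. rewrite Rabs_right by (generalize (exp_pos (- delta * tau)); lra).
    replace (- delta * tau) with (- (delta * tau)) by ring. apply exp_neg_le1. nra. }
  assert (cb : forall r, Rabs (cos r) <= 1) by (intros; apply Rabs_le; apply COS_bound).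
  split.
  - intros tau It e He. set (B := (2 * delta + 2 * t) * W + 1).
    assert (0 <= (2 * delta + 2 * t) * W) by (apply Rmult_le_pos; lra).
    assert (HB : 0 < B) by (unfold B; lra).
    exists (e / B). split; [apply Rdiv_lt_0_compat; auto|].
    intros tau' It' Hr s Is. unfold itv in *.
    set (q := fun r => exp (- delta * r) * (2 * cos (r * (t - s)))).
    replace (minus _ _) with (scal (q tau' - q tau) (w s)) by (unfold q; vec).
    set (h := Rabs (tau' - tau)) in *. assert (0 <= h) by apply Rabs_pos.
    assert (Q : Rabs (q tau' - q tau) <= (2 * delta + 2 * t) * h).
    { replace (q tau' - q tau) with ((exp (- delta * tau') - exp (- delta * tau)) * (2 * cos (tau' * (t - s))) +
         exp (- delta * tau) * (2 * (cos (tau' * (t - s)) - cos (tau * (t - s))))) by (unfold q; ring).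
      eapply Rle_trans; [apply Rabs_triang|].
      rewrite !Rabs_mult, !(Rabs_right 2) by lra.
      assert (a1 := exp_neg_lip delta tau' tau (Rlt_le _ _ Hd) (proj1 It') (proj1 It)).
      assert (a2 := cos_lip (tau' * (t - s)) (tau * (t - s))).
      replace (tau' * (t - s) - tau * (t - s)) with ((tau' - tau) * (t - s)) in a2 by ring.
      rewrite Rabs_mult, (Rabs_right (t - s)) in a2 by lra. fold h in a1, a2.
      specialize (eb tau (proj1 It)). specialize (cb (tau' * (t - s))).
      set (u1 := Rabs (exp (- delta * tau') - exp (- delta * tau))) in *.
      set (u2 := Rabs (cos (tau' * (t - s)) - cos (tau * (t - s)))) in *.
      assert (0 <= u1) by apply Rabs_pos. assert (0 <= u2) by apply Rabs_pos.
      assert (u2 <= h * t) by (eapply Rle_trans; [exact a2|]; apply Rmult_le_compat_l; lra).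
      generalize (Rabs_pos (cos (tau' * (t - s)))) (Rabs_pos (exp (- delta * tau))). intros. nra. }
    apply Rle_trans with ((2 * delta + 2 * t) * h * W).
    + apply norm_scal_bound; auto.
    + apply Rle_trans with (B * h); [unfold B; nra|].
      apply Rle_trans with (B * (e / B)); [|right; field; lra]. apply Rmult_le_compat_l; lra.
  - intros s Is e He. set (B := 2 * N * W + 1).
    assert (0 <= 2 * N * W) by (apply Rmult_le_pos; lra).
    assert (HB : 0 < B) by (unfold B; lra).
    destruct (Cw s Is (e / 4)) as [p [Hp Dp]]; [lra|].
    exists (Rmin p (e / 2 / B)). split; [apply Rmin_glb_lt; auto; repeat apply Rdiv_lt_0_compat; lra|].
    intros s' Is' Hr tau It. unfold itv in *.
    assert (h1 : Rabs (s' - s) < p) by (eapply Rlt_le_trans; [exact Hr|apply Rmin_l]).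
    assert (h2 : Rabs (s' - s) < e / 2 / B) by (eapply Rlt_le_trans; [exact Hr|apply Rmin_r]).
    set (q := fun r => exp (- delta * tau) * (2 * cos (tau * (t - r)))).
    set (h := Rabs (s' - s)) in *. assert (0 <= h) by apply Rabs_pos.
    specialize (eb tau (proj1 It)). assert (ep := Rabs_pos (exp (- delta * tau))).
    assert (Q : Rabs (q s' - q s) <= 2 * N * h).
    { replace (q s' - q s) with (exp (- delta * tau) * (2 * (cos (tau * (t - s')) - cos (tau * (t - s))))) by (unfold q; ring).
      rewrite !Rabs_mult, !(Rabs_right 2) by lra.
      assert (a2 := cos_lip (tau * (t - s')) (tau * (t - s))).
      replace (tau * (t - s') - tau * (t - s)) with (- (tau * (s' - s))) in a2 by ring.
      rewrite Rabs_Ropp, Rabs_mult, (Rabs_right tau) in a2 by lra. fold h in a2.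
      set (u2 := Rabs (cos (tau * (t - s')) - cos (tau * (t - s)))) in *.
      assert (0 <= u2) by apply Rabs_pos. nra. }
    assert (Q1 : Rabs (q s') <= 2).
    { unfold q. rewrite !Rabs_mult, (Rabs_right 2) by lra. specialize (cb (tau * (t - s'))).
      generalize (Rabs_pos (cos (tau * (t - s')))). nra. }
    apply Rle_trans with (2 * (e / 4) + 2 * N * h * W).
    + apply norm_le_plus with (scal (q s') (minus (w s') (w s))) (scal (q s' - q s) (w s)); [unfold q; vec| |].
      * apply norm_scal_bound; auto.
      * apply norm_scal_bound; auto.
    + assert (2 * N * h * W <= e / 2); [|lra].
      apply Rle_trans with (B * h); [unfold B; nra|].
      apply Rle_trans with (B * (e / 2 / B)); [|right; field; lra]. apply Rmult_le_compat_l; lra.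
Qed.

Lemma sumsq_pos a b : 0 < a -> 0 < a * a + b * b.
Proof. intros H. generalize (Rle_0_sqr b) (Rmult_lt_0_compat a a H H). unfold Rsqr. lra. Qed.

Lemma atan_kernel delta t : 0 < delta -> 0 <= t ->
  RInt (V := R_CompleteNormedModule) (fun s => 2 * delta / (delta * delta + (t - s) * (t - s))) 0 t = 2 * atan (t / delta).
Proof.
  intros Hd Ht. apply is_RInt_unique.
  replace (2 * atan (t / delta)) with (minus (- (2 * atan ((t - t) / delta))) (- (2 * atan ((t - 0) / delta)))).
  - apply (is_RInt_derive (V := R_CompleteNormedModule) (fun s => - (2 * atan ((t - s) / delta)))).
    + intros s _. assert (P : 0 < delta * delta + (t - s) * (t - s)) by (apply sumsq_pos; auto).
      auto_derive; auto. field. split; lra.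
    + intros s _. assert (P : 0 < delta * delta + (t - s) * (t - s)) by (apply sumsq_pos; auto). apply (ex_derive_continuous (fun s => 2 * delta / (delta * delta + (t - s) * (t - s)))).
      auto_derive. lra.
  - unfold minus, plus, opp; cbn. rewrite Rminus_diag_eq, Rminus_0_r by auto.
    unfold Rdiv at 1. rewrite Rmult_0_l, atan_0. ring.
Qed.

Lemma RInt_bound_ex (w : R -> real_space X) a b : cont_on a b w -> a <= b -> exists W, 0 <= W /\ forall s, a <= s <= b -> norm (w s) <= W.
Proof.
  intros C Hab.
  assert (C' : forall t, contn_in (fun _ => True) (fun r => w (clamp a b r)) t).
  { intros t e He. destruct (C (clamp a b t) (clamp_itv a b t Hab) e He) as [d [Hd D]].
    exists d. split; auto. intros r _ Hr. apply D; [apply clamp_itv; auto|].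
    eapply Rle_lt_trans; [apply clamp_lip|auto]. }
  destruct (uniform_cont (fun r => w (clamp a b r)) a b C' 1 Rlt_0_1) as [d [Hd D]].
  assert (P : forall n : nat, forall s, a <= s <= b -> s <= a + INR n * (d / 2) -> norm (w s) <= norm (w a) + INR n).
  { induction n; intros s Hs Hn.
    - cbn in *. replace s with a by lra. lra.
    - rewrite S_INR in *. destruct (Rle_dec s (a + INR n * (d / 2))) as [L|L]; [specialize (IHn s Hs L); lra|].
      set (s' := Rmax a (s - d / 2)).
      assert (Hs' : a <= s' <= b) by (unfold s'; split; [apply Rmax_l|apply Rmax_lub; lra]).
      assert (N1 : norm (w s') <= norm (w a) + INR n).
      { apply IHn; auto. unfold s'. apply Rmax_lub; [generalize (pos_INR n); nra|lra]. }
      assert (N2 : norm (minus (w s) (w s')) <= 1).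
      { rewrite <- (clamp_id a b s Hs), <- (clamp_id a b s' Hs') at 1. apply (D s' s); [exact Hs'|].
        unfold s', Rmax. destruct Rle_dec; rewrite Rabs_right; lra. }
      replace (norm (w a) + (INR n + 1)) with (1 + (norm (w a) + INR n)) by ring.
      eapply norm_le_plus; [|exact N2|exact N1]. vec. }
  destruct (nfloor_ex ((b - a) / (d / 2))) as [n [_ Hn]].
  { apply Rmult_le_pos; [lra|]. apply Rlt_le, Rinv_0_lt_compat; lra. }
  exists (norm (w a) + INR (Datatypes.S n)). split; [generalize (norm_ge_0 (w a)) (pos_INR (Datatypes.S n)); lra|].
  intros s Hs. apply P; auto. rewrite S_INR.
  assert ((b - a) / (d / 2) * (d / 2) <= (INR n + 1) * (d / 2)) by (apply Rmult_le_compat_r; lra).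
  replace ((b - a) / (d / 2) * (d / 2)) with (b - a) in H by (field; lra). lra.
Qed.

End InversionBound.

Section InversionFinal.
Context {X : CompleteNormedModule C_AbsRing}.
Variables (A : operator X) (S : R -> real_space X -> real_space X).
Hypothesis C0 : C0_semigroup S.
Hypothesis SA : semigroup_of A S.
Variables (om K : R) (F : C -> real_space X -> real_space X).
Hypothesis HF : res_family om K F.
Hypothesis Hres : forall l, fst l <= om -> is_resolvent A l (F l).
Implicit Types x y z : real_space X.

Let s1 sig x := sym (fun l => F l x) sig.
Let s2 sig x := sym (fun l => F l (F l x)) sig.
Let s3 sig x := sym (fun l => F l (F l (F l x))) sig.

(** [duhamel_sym] is multiplied by the Abel weight and integrated over tau. After the exchange of
    integrals the tau-integral is innermost and [abel_kernel] evaluates it. *)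
Lemma weighted_identity sig t x delta N : sig <= om -> 0 <= t -> 0 < delta -> 0 <= N ->
  plus (minus (scal (t * t / 2) (S t (abel delta N (s1 sig x))) : real_space X) (scal t (S t (abel delta N (s2 sig x)))) : real_space X)
       (S t (abel delta N (s3 sig x))) =
  plus (abel delta N (lsym F sig t x))
    (plus (RInt (fun s => scal (2 * delta / (delta * delta + (t - s) * (t - s))) (wexp S sig t x s)) 0 t)
          (RInt (fun s => scal (exp (- delta * N) * (2 * ((t - s) * sin (N * (t - s)) - delta * cos (N * (t - s))) / (delta * delta + (t - s) * (t - s)))) (wexp S sig t x s)) 0 t)).
Proof.
  intros Hs Ht Hd HN. assert (L := sg_lin S C0 t Ht).
  destruct (lin_bound _ L) as [M [HM BM]].
  assert (Cw := wexp_cont S C0 sig t x 0 t (Rle_refl 0)).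
  destruct (RInt_bound_ex _ 0 t Cw Ht) as [W [HW BW]].
  destruct (kernel_equicont delta t N _ Hd Ht HN Cw (ex_intro _ W BW)) as [E1 E2].
  assert (c1 : cont_on 0 N (fun tau => scal (exp (- delta * tau)) (s1 sig x tau))) by (apply abel_cont; eapply fam1_cont; eauto).
  assert (c2 : cont_on 0 N (fun tau => scal (exp (- delta * tau)) (s2 sig x tau))) by (apply abel_cont; eapply fam2_cont; eauto).
  assert (c3 : cont_on 0 N (fun tau => scal (exp (- delta * tau)) (s3 sig x tau))) by (apply abel_cont; eapply fam3_cont; eauto).
  assert (c4 : cont_on 0 N (fun tau => scal (exp (- delta * tau)) (lsym F sig t x tau)))
    by (apply abel_cont; eapply lsym_cont; eauto).
  assert (SI : forall f, cont_on 0 N f -> cont_on (V := real_space X) 0 N (fun tau => S t (f tau)) /\ S t (RInt f 0 N) = RInt (fun tau => S t (f tau)) 0 N).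
  { intros f Cf. split.
    - intros tau It. apply (contn_in_lin (V := real_space X) (W := real_space X)) with (L := S t) (M := M); [intros; apply lin_minus; auto|exact BM|apply Cf; auto].
    - apply (RInt_lin (V := real_space X) (W := real_space X)) with (M := M); auto.
      + intros; apply (lin_plus _ L).
      + intros; apply (lin_scal _ L). }
  destruct (SI _ c1) as [d1 e1]. destruct (SI _ c2) as [d2 e2]. destruct (SI _ c3) as [d3 e3].
  set (k := fun s tau => scal (exp (- delta * tau) * (2 * cos (tau * (t - s)))) (wexp S sig t x s) : real_space X).
  assert (Ck : forall tau, itv 0 N tau -> cont_on 0 t (fun s => k s tau)).
  { intros tau It s Is e He. destruct (E2 s Is e He) as [p [Hp D]]. exists p. split; [auto|]. intros r Ir Hr. exact (D r Ir Hr tau It). }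
  assert (CI : cont_on 0 N (fun tau => RInt (fun s => k s tau) 0 t)) by (apply cont_on_RInt_param; auto).
  assert (Id : RInt (fun tau => RInt (fun s => k s tau) 0 t) 0 N =
     minus (plus (minus (scal (t * t / 2) (S t (abel delta N (s1 sig x))) : real_space X) (scal t (S t (abel delta N (s2 sig x)))) : real_space X)
       (S t (abel delta N (s3 sig x)))) (abel delta N (lsym F sig t x))).
  { unfold abel. rewrite e1, e2, e3.
    rewrite <- !RInt_scal_on by auto.
    assert (sc : forall r f, cont_on (V := real_space X) 0 N f -> cont_on 0 N (fun tau => scal r (f tau))).
    { intros r f Hf tau It. apply contn_in_scal; [apply (contn_in_const (V := R_CompleteNormedModule))|apply Hf; auto]. }
    rewrite <- (RInt_minus_on (V := real_space X)) by auto.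
    rewrite <- (RInt_plus_on (V := real_space X)); auto.
    2: { intros tau It. apply contn_in_minus; apply sc; auto. }
    rewrite <- (RInt_minus_on (V := real_space X)); auto.
    2: { intros tau It. apply contn_in_plus; [apply contn_in_minus; apply sc; auto|apply d3; auto]. }
    apply RInt_ext_on; auto. intros tau It.
    transitivity (scal (exp (- delta * tau)) (RInt (fun s => scal (2 * cos (tau * (t - s))) (wexp S sig t x s)) 0 t)).
    - rewrite <- RInt_scal_on; auto.
      + apply RInt_ext_on; auto. intros s Is. unfold k. vec.
      + intros s Is. apply contn_in_scal; [|apply Cw; auto]. apply contn_in_real.
        apply (ex_derive_continuous (fun s => 2 * cos (tau * (t - s)))). auto_derive; auto.
    - rewrite <- (duhamel_sym A S C0 SA om F Hres sig tau t x Hs Ht).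
      fold (s1 sig x tau). fold (s2 sig x tau). fold (s3 sig x tau).
      rewrite (lin_plus _ L), (lin_minus _ L), !(lin_scal _ L). vec. }
  rewrite (RInt_swap_on (V := real_space X)) in Id; auto.
  assert (cosc : forall s, cont_on (V := R_CompleteNormedModule) 0 N (fun tau => exp (- delta * tau) * (2 * cos (tau * (t - s))))).
  { intros s tau _. apply contn_in_real.
    apply (ex_derive_continuous (fun tau => exp (- delta * tau) * (2 * cos (tau * (t - s))))). auto_derive; auto. }
  rewrite (RInt_ext_on 0 t _ (fun s => plus (scal (2 * delta / (delta * delta + (t - s) * (t - s))) (wexp S sig t x s) : real_space X)
     (scal (exp (- delta * N) * (2 * ((t - s) * sin (N * (t - s)) - delta * cos (N * (t - s))) / (delta * delta + (t - s) * (t - s)))) (wexp S sig t x s)))) in Id; auto.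
  2: { intros s Is. unfold k. rewrite (RInt_scal_vec (fun tau => exp (- delta * tau) * (2 * cos (tau * (t - s))))) by auto.
       rewrite abel_kernel by auto. vec. }
  rewrite RInt_plus_on in Id; auto.
  - rewrite Id. vec.
  - intros s Is. apply contn_in_scal; [|apply Cw; auto]. apply contn_in_real.
    assert (P := sumsq_pos delta (t - s) Hd).
    apply (ex_derive_continuous (fun s => 2 * delta / (delta * delta + (t - s) * (t - s)))). auto_derive; lra.
  - intros s Is. apply contn_in_scal; [|apply Cw; auto]. apply contn_in_real.
    assert (P := sumsq_pos delta (t - s) Hd).
    apply (ex_derive_continuous (fun s => exp (- delta * N) * (2 * ((t - s) * sin (N * (t - s)) - delta * cos (N * (t - s))) / (delta * delta + (t - s) * (t - s))))). auto_derive; lra.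
Qed.

Lemma wexp_end sig t x : wexp S sig t x t = scal (t * t / 2) (S t x).
Proof. unfold wexp, wgt. rewrite Rminus_diag_eq, Rmult_0_r, exp_0 by auto. vec. Qed.

(* The Poisson kernel [2 delta / (delta^2 + (t - s)^2)] concentrates at [s = t]. *)
Lemma poisson_limit sig t x delta eps rho W : 0 <= t -> 0 < delta -> 0 < eps -> 0 < rho ->
  (forall s, 0 <= s <= t -> norm (wexp S sig t x s) <= W) ->
  (forall s, 0 <= s <= t -> t - s < rho -> norm (minus (wexp S sig t x s) (wexp S sig t x t)) <= eps) ->
  norm (minus (RInt (fun s => scal (2 * delta / (delta * delta + (t - s) * (t - s))) (wexp S sig t x s)) 0 t)
              (scal (2 * atan (t / delta)) (wexp S sig t x t))) <= PI * eps + 4 * W * delta * t / (rho * rho).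
Proof.
  intros Ht Hd He Hr HW Hm.
  set (w := wexp S sig t x) in *. assert (Cw : cont_on 0 t w) by (apply (wexp_cont S C0); lra).
  assert (W0 : 0 <= W) by (eapply Rle_trans; [apply (norm_ge_0 (w t))|apply HW; lra]).
  set (q := fun s => 2 * delta / (delta * delta + (t - s) * (t - s))).
  assert (P := fun s => sumsq_pos delta (t - s) Hd).
  assert (Cq : cont_on (V := R_CompleteNormedModule) 0 t q).
  { intros s _. apply contn_in_real. apply (ex_derive_continuous q). unfold q. specialize (P s). auto_derive; lra. }
  assert (C1 : cont_on 0 t (fun s => scal (q s) (w s))) by (intros s Is; apply contn_in_scal; auto).
  assert (C2 : cont_on 0 t (fun s => scal (q s) (w t))).
  { intros s Is; apply contn_in_scal; auto. apply contn_in_const. }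
  replace (scal (2 * atan (t / delta)) (w t)) with (RInt (fun s => scal (q s) (w t)) 0 t).
  2: { rewrite (RInt_scal_vec q) by auto. f_equal. apply atan_kernel; auto. }
  rewrite <- RInt_minus_on; auto.
  (* G integrates the majorant: eps times the kernel, of total mass 2 atan(t/delta) <= PI, plus a
     constant for points at distance at least rho from t, where the kernel is at most 2 delta/rho^2
     and the values differ by at most 2W. *)
  set (G := fun s => - (2 * atan ((t - s) / delta)) * eps + 4 * W * delta * s / (rho * rho)).
  assert (rr : 0 < rho * rho) by nra.
  apply Rle_trans with (G t - G 0).
  - apply RInt_norm_le_deriv with (fun s => eps * q s + 4 * W * delta / (rho * rho)); auto.
    + intros s Is. apply contn_in_minus; auto.
    + intros s _. unfold G, q. specialize (P s). auto_derive; auto. field. repeat split; lra.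
    + intros s _. apply (ex_derive_continuous (fun s => eps * q s + 4 * W * delta / (rho * rho))).
      unfold q. specialize (P s). auto_derive. lra.
    + intros s Is. specialize (P s).
      replace (minus _ _) with (scal (q s) (minus (w s) (w t))) by (unfold q; vec).
      assert (q0 : 0 < q s) by (unfold q; apply Rdiv_lt_0_compat; lra).
      destruct (Rlt_dec (t - s) rho) as [L|L].
      * apply Rle_trans with (q s * eps).
        -- apply norm_scal_bound; [rewrite Rabs_right; lra|auto].
        -- assert (0 <= 4 * W * delta / (rho * rho)); [|lra].
           apply Rmult_le_pos; [repeat apply Rmult_le_pos; lra|apply Rlt_le, Rinv_0_lt_compat; auto].
      * apply Rle_trans with (q s * (W + W)).
        -- apply norm_scal_bound; [rewrite Rabs_right; lra|].
           apply norm_le_plus with (w s) (opp (w t)); [vec|apply HW; auto|rewrite norm_oppV; apply HW; lra].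
        -- apply Rnot_lt_le in L.
           assert (q s <= 2 * delta / (rho * rho)).
           { unfold q. apply Rmult_le_compat_l; [lra|]. apply Rinv_le_contravar; auto. nra. }
           assert (q s * (W + W) <= 2 * delta / (rho * rho) * (W + W)) by (apply Rmult_le_compat_r; lra).
           replace (4 * W * delta / (rho * rho)) with (2 * delta / (rho * rho) * (W + W)) by (field; lra). nra.
  - unfold G. rewrite (Rminus_diag_eq t t eq_refl), (Rminus_0_r t). unfold Rdiv at 1. rewrite Rmult_0_l, atan_0.
    assert (B := atan_bound (t / delta)).
    replace (4 * W * delta * 0 / (rho * rho)) with 0 by (field; lra).
    assert (2 * atan (t / delta) * eps <= PI * eps) by (apply Rmult_le_compat_r; lra). lra.
Qed.

Lemma exp_neg_small (delta y : R) : 0 < delta -> 0 < y -> exists N, 0 <= N /\ exp (- delta * N) <= y.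
Proof.
  intros Hd Hy. exists (/ (delta * y)). split.
  - apply Rlt_le, Rinv_0_lt_compat. nra.
  - replace (- delta * / (delta * y)) with (- / y) by (field; lra).
    rewrite exp_Ropp. rewrite <- (Rinv_inv y) at 2. assert (0 < / y) by (apply Rinv_0_lt_compat; auto).
    apply Rinv_le_contravar; auto. generalize (exp_ineq1_le (/ y)). lra.
Qed.

(** In [weighted_identity] the Poisson integral tends to a multiple of (t^2/2) S(t)x, and the terms
    with F, F^2, F^3 on the left vanish, except for the scalar part of F. That part is a nonnegative
    multiple [kap] of the same vector and enters with the same sign, so it is simply dropped from
    the lower bound. *)
Lemma inversion_bound sig t x Gam : dom A x -> sig <= om -> 0 < t ->
  (forall delta N, 0 < delta -> 0 <= N -> norm (abel delta N (lsym F sig t x)) <= Gam) ->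
  PI / 2 * (t * t / 2) * norm (S t x) <= Gam.
Proof.
  intros Dx Hs Ht HG. apply le_epsilon. intros eta Heta.
  assert (L := sg_lin S C0 t (Rlt_le _ _ Ht)). destruct (lin_bound _ L) as [M [HM BM]].
  destruct (difference_decay A om K F HF Hres x Dx) as [c [c0 Hc]].
  destruct (scalar_res_family (X := X) om (om + 1) (Rle_refl _)) as [K2 HQ].
  set (Q := scalar_res (X := X) (om + 1)) in *.
  set (k := sym (fun l => minus (F l x) (Q l x)) sig).
  set (c1 := 2 * c + 2 * c * ((1 + Rabs sig) * (1 + Rabs sig))).
  assert (Kp : 0 <= K) by apply HF. assert (nx := norm_ge_0 x).
  assert (c1p : 0 <= c1).
  { unfold c1. generalize (Rabs_pos sig). intros. assert (0 <= c * ((1 + Rabs sig) * (1 + Rabs sig))) by (apply Rmult_le_pos; nra). lra. }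
  set (c2 := 2 * K * norm x). set (c3 := K * K * norm x).
  assert (c2p : 0 <= c2) by (unfold c2; repeat apply Rmult_le_pos; lra).
  assert (c3p : 0 <= c3) by (unfold c3; repeat apply Rmult_le_pos; lra).
  set (w := wexp S sig t x).
  assert (Cw : cont_on 0 t w) by (apply (wexp_cont S C0); lra).
  destruct (RInt_bound_ex w 0 t Cw (Rlt_le _ _ Ht)) as [W [W0 HW]].
  set (Ct := M * (t * t / 2 * c1 + t * c2 + c3)).
  assert (Ctp : 0 <= Ct).
  { unfold Ct. apply Rmult_le_pos; [lra|]. assert (0 <= t * t / 2 * c1) by (apply Rmult_le_pos; nra).
    assert (0 <= t * c2) by (apply Rmult_le_pos; lra). lra. }
  assert (Pi := PI_RGT_0).
  set (eps := eta / (4 * (2 * Ct + PI + 1))).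
  assert (He : 0 < eps) by (apply Rdiv_lt_0_compat; lra).
  destruct (Cw t (conj (Rlt_le _ _ Ht) (Rle_refl t)) eps He) as [rho [Hrho Drho]].
  (* The three bounds serve [abel_bound], the inequality atan(t/delta) >= PI/4, and the tail of the
     Poisson kernel, which becomes at most eta/4. *)
  set (delta := Rmin (4 * eps * eps) (Rmin t (eta * (rho * rho) / (4 * (4 * W * t + 1))))).
  assert (Wt : 0 <= 4 * W * t) by (repeat apply Rmult_le_pos; lra).
  assert (rr : 0 < rho * rho) by nra.
  assert (Hd : 0 < delta).
  { unfold delta. repeat apply Rmin_glb_lt; auto; [nra|]. apply Rdiv_lt_0_compat; [apply Rmult_lt_0_compat; auto|lra]. }
  assert (d1 : delta <= 4 * eps * eps) by apply Rmin_l.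
  assert (d2 : delta <= t) by (eapply Rle_trans; [apply Rmin_r|apply Rmin_l]).
  assert (d3 : delta <= eta * (rho * rho) / (4 * (4 * W * t + 1))) by (eapply Rle_trans; [apply Rmin_r|apply Rmin_r]).
  set (c4 := t * (2 * (t + delta) / (delta * delta) * W)).
  assert (dd : 0 < delta * delta) by nra.
  assert (c4p : 0 <= c4).
  { unfold c4. repeat apply Rmult_le_pos; try lra. apply Rlt_le, Rinv_0_lt_compat; auto. }
  (* N is chosen after delta: the terms at the end N carry the factor e^(-delta N), but also the
     factor 1/delta^2 contained in [c4]. *)
  destruct (exp_neg_small delta (eta / (4 * (Ct + c4 + 1))) Hd) as [N [HN EN]].
  { apply Rdiv_lt_0_compat; lra. }
  set (eN := exp (- delta * N)) in *. assert (eN0 : 0 < eN) by apply exp_pos.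
  set (kap := RInt (V := R_CompleteNormedModule) (fun tau => exp (- delta * tau) * (2 * (om + 1 - sig) / ((om + 1 - sig) * (om + 1 - sig) + tau * tau))) 0 N).
  set (d := om + 1 - sig) in *. assert (dp : 0 < d) by (unfold d; lra).
  assert (Pd := fun tau => sumsq_pos d tau dp).
  assert (Ckap : cont_on (V := R_CompleteNormedModule) 0 N (fun tau => exp (- delta * tau) * (2 * d / (d * d + tau * tau)))).
  { intros tau _. apply contn_in_real. specialize (Pd tau).
    apply (ex_derive_continuous (fun tau => exp (- delta * tau) * (2 * d / (d * d + tau * tau)))). auto_derive; lra. }
  assert (kap0 : 0 <= kap).
  { apply RInt_ge_0; auto.
    - apply (ex_RInt_cont_on (V := R_CompleteNormedModule)); auto.
    - intros tau _. specialize (Pd tau). generalize (exp_pos (- delta * tau)). intros.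
      apply Rmult_le_pos; [lra|]. apply Rlt_le, Rdiv_lt_0_compat; lra. }
  assert (Ca1 : cont_on 0 N k) by (apply (shift_cont om K K2 F Q x HF HQ); auto).
  assert (A1 : norm (abel delta N k) <= c1 * (eN + 2 * eps)).
  { apply abel_bound; auto. intros T HT. apply (shift_bound om K K2 F Q x c HF HQ c0 Hc); auto; lra. }
  assert (A2 : norm (abel delta N (s2 sig x)) <= c2 * (eN + 2 * eps)).
  { apply abel_bound; auto; [eapply fam2_cont; eauto|]. intros T HT. apply (RInt_fam2_bound om K F HF); auto; lra. }
  assert (A3 : norm (abel delta N (s3 sig x)) <= c3 * (eN + 2 * eps)).
  { apply abel_bound; auto; [eapply fam3_cont; eauto|]. intros T HT. apply (RInt_fam3_bound om K F HF); auto; lra. }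
  assert (E1 : abel delta N (s1 sig x) = minus (abel delta N k) (scal kap x)).
  { unfold kap. rewrite <- RInt_scal_vec by auto. unfold abel. rewrite <- RInt_minus_on; auto.
    - apply RInt_ext_on; auto. intros tau It. unfold k, s1, d.
      assert (E := scalar_res_sym om (om + 1) (Rle_refl _) sig tau x Hs). fold Q in E.
      transitivity (scal (exp (- delta * tau)) (plus (sym (fun l => minus (F l x) (Q l x)) sig tau) (sym (fun l => Q l x) sig tau))).
      + f_equal. unfold sym. vec.
      + rewrite E. vec.
    - apply abel_cont; auto.
    - intros tau It. apply contn_in_scal; auto. apply contn_in_const. }
  assert (WI := weighted_identity sig t x delta N Hs (Rlt_le _ _ Ht) Hd HN).
  rewrite E1, (lin_minus _ L), (lin_scal _ L) in WI. fold w in WI.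
  set (J1 := RInt (fun s => scal (2 * delta / (delta * delta + (t - s) * (t - s))) (w s)) 0 t) in WI.
  set (J2 := RInt (fun s => scal (exp (- delta * N) * (2 * ((t - s) * sin (N * (t - s)) - delta * cos (N * (t - s))) / (delta * delta + (t - s) * (t - s)))) (w s)) 0 t) in WI.
  assert (B1 : norm (minus J1 (scal (2 * atan (t / delta)) (w t))) <= PI * eps + 4 * W * delta * t / (rho * rho)).
  { apply poisson_limit; auto; try lra. intros s Is Hst. apply Drho; [exact Is|].
    rewrite Rabs_left1 by lra. lra. }
  assert (B2 : norm J2 <= eN * c4).
  { replace (eN * c4) with (eN * (2 * (t + delta) / (delta * delta)) * W * (t - 0)) by (unfold c4; field; lra).
    apply RInt_norm_le; [lra| |].
    - intros s Is. apply contn_in_scal; [|apply Cw; auto]. apply contn_in_real.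
      assert (P := sumsq_pos delta (t - s) Hd).
      apply (ex_derive_continuous (fun s => exp (- delta * N) * (2 * ((t - s) * sin (N * (t - s)) - delta * cos (N * (t - s))) / (delta * delta + (t - s) * (t - s))))). auto_derive; lra.
    - intros s Is. apply norm_scal_bound; [|apply HW; auto].
      assert (P := sumsq_pos delta (t - s) Hd). fold eN.
      rewrite Rabs_mult, (Rabs_right eN) by lra. apply Rmult_le_compat_l; [lra|].
      unfold Rdiv. rewrite Rabs_mult, Rabs_mult, (Rabs_right 2) by lra.
      rewrite (Rabs_right (/ _)) by (apply Rle_ge, Rlt_le, Rinv_0_lt_compat; auto).
      apply Rmult_le_compat.
      + generalize (Rabs_pos ((t - s) * sin (N * (t - s)) - delta * cos (N * (t - s)))); lra.
      + apply Rlt_le, Rinv_0_lt_compat; auto.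
      + assert (S1 : Rabs (sin (N * (t - s))) <= 1) by (apply Rabs_le; apply SIN_bound).
        assert (S2 : Rabs (cos (N * (t - s))) <= 1) by (apply Rabs_le; apply COS_bound).
        apply Rmult_le_compat_l; [lra|]. eapply Rle_trans; [apply Rabs_triang|].
        rewrite Rabs_Ropp, !Rabs_mult, (Rabs_right (t - s)), (Rabs_right delta) by lra.
        generalize (Rabs_pos (sin (N * (t - s)))) (Rabs_pos (cos (N * (t - s)))). intros. nra.
      + apply Rinv_le_contravar; auto. generalize (Rle_0_sqr (t - s)); unfold Rsqr; lra. }
  assert (at1 : PI / 2 <= 2 * atan (t / delta)).
  { assert (PI / 4 <= atan (t / delta)); [|lra]. rewrite <- atan_1.
    assert (1 <= t / delta).
    { apply Rmult_le_reg_r with delta; auto. replace (t / delta * delta) with t by (field; lra). lra. }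
    destruct H as [H|<-]; [left; apply atan_increasing; auto|right; auto]. }
  assert (wt : w t = scal (t * t / 2) (S t x)) by apply wexp_end.
  assert (main : norm (scal (kap + 2 * atan (t / delta)) (w t)) <=
     Gam + (Ct * (eN + 2 * eps) + ((PI * eps + 4 * W * delta * t / (rho * rho)) + eN * c4))).
  { apply norm_le_plus with (opp (abel delta N (lsym F sig t x)))
      (plus (plus (minus (scal (t * t / 2) (S t (abel delta N k)) : real_space X) (scal t (S t (abel delta N (s2 sig x)))) : real_space X) (S t (abel delta N (s3 sig x))))
            (minus (opp (minus J1 (scal (2 * atan (t / delta)) (w t)))) J2)).
    - transitivity (plus (scal (2 * atan (t / delta)) (w t)) (plus (scal kap (w t) : real_space X) (plus (minus (plus (minus (scal (t * t / 2) (minus (S t (abel delta N k)) (scal kap (S t x))) : real_space X) (scal t (S t (abel delta N (s2 sig x)))) : real_space X)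
       (S t (abel delta N (s3 sig x)))) (plus (abel delta N (lsym F sig t x)) (plus J1 J2))) (zero : real_space X)))).
      + rewrite WI. vec.
      + rewrite wt. vec.
    - rewrite norm_oppV. auto.
    - eapply norm_le_plus; [reflexivity| |].
      + set (z := eN + 2 * eps) in *. assert (z0 : 0 <= z) by (unfold z; lra).
        replace (Ct * z) with ((t * t / 2 * (M * (c1 * z)) + t * (M * (c2 * z))) + M * (c3 * z)) by (unfold Ct; field).
        assert (bs : forall v q, norm v <= q -> norm (S t v) <= M * q).
        { intros v q Hv. eapply Rle_trans; [apply BM|]. apply Rmult_le_compat_l; lra. }
        eapply norm_le_plus; [reflexivity| |auto].
        eapply norm_le_plus with (y := scal (t * t / 2) (S t (abel delta N k))) (z := opp (scal t (S t (abel delta N (s2 sig x))))); [vec| |].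
        * apply norm_scal_bound; auto. rewrite Rabs_right; nra.
        * apply (Rle_trans _ (norm (scal t (S t (abel delta N (s2 sig x)))))); [right; apply (norm_oppV (V := real_space X))|].
          apply norm_scal_bound; auto. rewrite Rabs_right; lra.
      + eapply norm_le_plus with (y := opp (minus J1 (scal (2 * atan (t / delta)) (w t)))) (z := opp J2); [vec| |].
        * rewrite norm_oppV. exact B1.
        * rewrite norm_oppV. exact B2. }
  rewrite norm_scal_eq, Rabs_right in main by lra.
  assert (wn : norm (w t) = t * t / 2 * norm (S t x)).
  { rewrite wt, norm_scal_eq, Rabs_right; auto. nra. }
  assert (wn0 := norm_ge_0 (w t)).
  assert (low : PI / 2 * norm (w t) <= (kap + 2 * atan (t / delta)) * norm (w t)) by (apply Rmult_le_compat_r; lra).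
  rewrite wn in low at 1.
  assert (f1 : eN * (Ct + c4 + 1) <= eta / 4).
  { apply Rmult_le_compat_r with (r := Ct + c4 + 1) in EN; [|lra].
    replace (eta / (4 * (Ct + c4 + 1)) * (Ct + c4 + 1)) with (eta / 4) in EN by (field; lra). exact EN. }
  assert (f2 : eps * (2 * Ct + PI + 1) = eta / 4) by (unfold eps; field; lra).
  assert (f3 : 4 * W * delta * t / (rho * rho) <= eta / 4).
  { apply Rmult_le_reg_r with (rho * rho); auto.
    replace (4 * W * delta * t / (rho * rho) * (rho * rho)) with (delta * (4 * W * t)) by (field; lra).
    apply Rmult_le_compat_r with (r := 4 * W * t + 1) in d3; [|lra].
    replace (eta * (rho * rho) / (4 * (4 * W * t + 1)) * (4 * W * t + 1)) with (eta / 4 * (rho * rho)) in d3 by (field; lra).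
    lra. }
  nra.
Qed.

End InversionFinal.

Lemma seq_lim_lin {V W : CompleteNormedModule R_AbsRing} (L : V -> W) M (u : nat -> V) l :
  (forall x y, L (minus x y) = minus (L x) (L y)) -> (forall x, norm (L x) <= M * norm x) ->
  seq_lim u l -> seq_lim (fun n => L (u n)) (L l).
Proof.
  intros HL HM H e He. assert (P : 0 < Rabs M + 1) by (generalize (Rabs_pos M); lra).
  destruct (H (e / (Rabs M + 1))) as [N HN]; [apply Rdiv_lt_0_compat; lra|].
  exists N. intros n Hn. rewrite <- HL. eapply Rle_trans; [apply HM|].
  apply Rle_trans with ((Rabs M + 1) * (e / (Rabs M + 1))); [|right; field; lra].
  apply Rle_trans with ((Rabs M + 1) * norm (minus (u n) l)).
  - apply Rmult_le_compat_r; [apply norm_ge_0|generalize (Rle_abs M); lra].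
  - apply Rmult_le_compat_l; [lra|auto].
Qed.

Lemma seq_lim_bound {V W : CompleteNormedModule R_AbsRing} (u : nat -> V) l (v : nat -> W) p c :
  0 <= c -> seq_lim u l -> seq_lim v p -> (forall n, norm (u n) <= c * norm (v n)) -> norm l <= c * norm p.
Proof.
  intros Hc Hu Hv H. apply le_epsilon. intros e He.
  destruct (Hu (e / 2)) as [N1 H1]; [lra|].
  destruct (Hv (e / 2 / (c + 1))) as [N2 H2]; [repeat apply Rdiv_lt_0_compat; lra|].
  set (n := max N1 N2). specialize (H1 n ltac:(lia)). specialize (H2 n ltac:(lia)). specialize (H n).
  assert (norm (v n) <= e / 2 / (c + 1) + norm p) by (eapply norm_le_plus; [|exact H2|apply Rle_refl]; vec).
  assert (norm l <= e / 2 + norm (u n)).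
  { rewrite norm_minus_sym in H1. eapply norm_le_plus; [|exact H1|apply Rle_refl]. vec. }
  assert (c * (e / 2 / (c + 1)) <= e / 2).
  { apply Rle_trans with ((c + 1) * (e / 2 / (c + 1))); [|right; field; lra].
    apply Rmult_le_compat_r; [|lra]. apply Rlt_le. repeat apply Rdiv_lt_0_compat; lra. }
  assert (c * norm (v n) <= c * (e / 2 / (c + 1) + norm p)) by (apply Rmult_le_compat_l; auto). lra.
Qed.

(** * Decay and smoothing of the semigroup *)

Section Estimates.
Context {X : CompleteNormedModule C_AbsRing}.
Variables (A : operator X) (S : R -> real_space X -> real_space X).
Hypothesis sect : sectorial A.
Hypothesis dense : densely_defined A.
Hypothesis spec : forall lam : C, in_spectrum A lam -> 0 < Re lam.
Hypothesis SA : semigroup_of A S.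
Implicit Types x y z : real_space X.

Let C0 : C0_semigroup S. Proof. apply SA. Qed.
Let linA : linear_operator A. Proof. apply sect. Qed.

Lemma dense_seq x : exists u : nat -> real_space X, (forall n, dom A (u n)) /\ seq_lim u x.
Proof.
  (* Density is stated with balls; [nf] relates balls to norms. *)
  set (nf := @norm_factor R_AbsRing (CompleteNormedModule.NormedModule R_AbsRing (real_space X))).
  assert (P : forall n : nat, exists y, dom A y /\ norm (minus y x) <= / (INR n + 1)).
  { intros n. assert (Hn : 0 < INR n + 1) by (generalize (pos_INR n); lra).
    assert (Hf : 0 < nf) by apply norm_factor_gt_0.
    assert (He : 0 < / (INR n + 1) / nf) by (apply Rdiv_lt_0_compat; auto; apply Rinv_0_lt_compat; auto).
    destruct (dense x (mkposreal _ He)) as [y [Dy By]]. exists y. split; auto.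
    apply (norm_compat2 (V := CompleteNormedModule.NormedModule R_AbsRing (real_space X))) in By. fold nf in By. cbn [pos] in By.
    left. eapply Rlt_le_trans; [exact By|]. right. field. lra. }
  exists (fun n => proj1_sig (constructive_indefinite_description _ (P n))). split.
  - intros n. destruct constructive_indefinite_description as [y [D B]]; auto.
  - intros e He. destruct (nfloor_ex (/ e)) as [N [_ HN]]; [apply Rlt_le, Rinv_0_lt_compat; auto|].
    exists N. intros n Hn. destruct constructive_indefinite_description as [y [D B]]; cbn.
    eapply Rle_trans; [exact B|]. rewrite <- (Rinv_inv e). apply Rinv_le_contravar.
    + apply Rinv_0_lt_compat; auto.
    + apply le_INR in Hn. lra.
Qed.

Lemma sg_commute t z : 0 <= t -> dom A z -> dom A (S t z) /\ A (S t z) = S t (A z).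
Proof.
  intros Ht Dz. apply (proj2 SA). apply filterlim_locally. intros eps.
  assert (L := sg_lin S C0 t Ht). destruct (lin_bound _ L) as [M [HM BM]].
  assert (He : 0 < eps / 2 / M) by (repeat apply Rdiv_lt_0_compat; auto; try lra; apply cond_pos).
  destruct (sg_generator S C0 A SA z _ Dz He) as [d [Hd D]].
  exists (mkposreal d Hd). intros h Hh Hp.
  assert (Hh' : h < d).
  { unfold ball in Hh; cbn in Hh. unfold AbsRing_ball, abs, minus, plus, opp in Hh; cbn in Hh.
    rewrite Ropp_0, Rplus_0_r, Rabs_right in Hh; lra. }
  apply (norm_compat1 (V := CompleteNormedModule.NormedModule R_AbsRing (real_space X))).
  specialize (D h (conj (Rlt_le _ _ Hp) Hh')).
  replace (minus _ _) with (scal (/ h) (S t (plus (minus (S h z) z) (scal h (A z))))).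
  - eapply Rle_lt_trans; [apply norm_scal_bound; [apply Rle_refl|apply BM]|].
    rewrite Rabs_right by (apply Rle_ge, Rlt_le, Rinv_0_lt_compat; auto).
    apply Rle_lt_trans with (/ h * (M * (eps / 2 / M * h))).
    + apply Rmult_le_compat_l; [apply Rlt_le, Rinv_0_lt_compat; auto|]. apply Rmult_le_compat_l; lra.
    + replace (/ h * (M * (eps / 2 / M * h))) with (eps / 2) by (field; lra). generalize (cond_pos eps); lra.
  - rewrite (lin_plus _ L), (lin_minus _ L), (lin_scal _ L).
    rewrite <- (sg_plus S C0 t h), (Rplus_comm t h), (sg_plus S C0 h t) by lra.
    vec_with ltac:(real_eq; field; lra).
Qed.

(** The majorant B/(d + tau)^2 has integral B/d. The parameter d is 1 on the imaginary axis and 1/t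
    on the line through -1/t. *)
Lemma abel_lsym_bound (F : C -> real_space X -> real_space X) sig t x delta N B d :
  cont_on 0 N (lsym F sig t x) -> 0 < delta -> 0 <= N -> 0 < d -> 0 <= B ->
  (forall tau, 0 <= tau -> norm (lsym F sig t x tau) <= B / ((d + tau) * (d + tau))) ->
  norm (abel delta N (lsym F sig t x)) <= B / d.
Proof.
  intros C Hd HN Hdp HB H.
  apply Rle_trans with ((fun tau => - (B / (d + tau))) N - (fun tau => - (B / (d + tau))) 0).
  - apply (RInt_norm_le_deriv _ (fun tau => - (B / (d + tau))) (fun tau => B / ((d + tau) * (d + tau)))); auto.
    + apply abel_cont; auto.
    + intros tau Ht. auto_derive; [lra|]. field. lra.
    + intros tau Ht. apply (ex_derive_continuous (fun tau => B / ((d + tau) * (d + tau)))). auto_derive. nra.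
    + intros tau Ht. rewrite <- (Rmult_1_l (B / _)). apply norm_scal_bound; [|apply H; lra].
      rewrite Rabs_right by (generalize (exp_pos (- delta * tau)); lra).
      replace (- delta * tau) with (- (delta * tau)) by ring. apply exp_neg_le1. nra.
  - cbn. rewrite Rplus_0_r. assert (0 <= B / (d + N)); [|lra].
    apply Rmult_le_pos; auto. apply Rlt_le, Rinv_0_lt_compat; lra.
Qed.

Lemma lsym_norm (F : C -> real_space X -> real_space X) sig t x tau b :
  (forall l, fst l = sig -> Rabs (snd l) = Rabs tau -> norm (F l (F l (F l x))) <= b) ->
  norm (lsym F sig t x tau) <= exp (sig * - t) * (b + b).
Proof.
  intros H. rewrite Rmult_plus_distr_l. unfold lsym.
  eapply norm_le_plus; [reflexivity| |]; (eapply Rle_trans; [apply norm_cscal|]); rewrite Cmod_cis; cbn [fst snd lu ld].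
  - apply Rmult_le_compat_l; [apply Rlt_le, exp_pos|]. apply H; auto.
  - apply Rmult_le_compat_l; [apply Rlt_le, exp_pos|]. apply H; auto. cbn. apply Rabs_Ropp.
Qed.

Lemma semigroup_estimates : exists M J, 1 <= M /\ bounded_linear J /\
  (forall x, dom A (J x) /\ A (J x) = x) /\ (forall x, dom A x -> J (A x) = x) /\
  (forall t x, 0 <= t -> norm (S t x) <= M / ((1 + t) * (1 + t)) * norm x) /\
  (forall t x, 0 < t -> dom A x -> norm (S t (A x)) <= M / t * norm x).
Proof.
  destruct (resolvent_half_plane A sect spec) as (om & K & Hom & HK & HR).
  assert (HR' : forall l : C, exists B, fst l <= om -> is_resolvent A l B /\ forall x, norm (B x) <= K / nu l * norm x).
  { intros [a b]. destruct (Rle_dec a om) as [L|L].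
    - destruct (HR a b L) as [B HB]. exists B. intros _. exact HB.
    - exists (fun x => x). intros; contradiction. }
  set (F := fun l => proj1_sig (constructive_indefinite_description _ (HR' l))).
  assert (HF1 : forall l, fst l <= om -> is_resolvent A l (F l) /\ forall x, norm (F l x) <= K / nu l * norm x).
  { intros l. unfold F. destruct constructive_indefinite_description; auto. }
  assert (Hres : forall l, fst l <= om -> is_resolvent A l (F l)) by (intros; apply HF1; auto).
  assert (HF : res_family om K F).
  { split; [lra|]. split; [|split].
    - intros l Hl. apply (Hres l Hl).
    - intros l m x Hl Hm. apply (resolvent_identity A l m); auto.
    - intros l x Hl. apply HF1; auto. }
  assert (PI2 := PI2_1).
  (* The resolvent at 0 is the inverse of -A, hence the sign. *)
  set (J := fun x => opp (F 0%C x)).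
  assert (R0 : is_resolvent A 0%C (F 0%C)) by (apply Hres; cbn; lra).
  assert (L0 : bounded_linear (F 0%C)) by apply R0.
  assert (LJ : bounded_linear J).
  { destruct (lin_bound _ L0) as [b [Hb Bb]].
    assert (j1 : forall x y, J (plus x y) = plus (J x) (J y)) by (intros; unfold J; rewrite (lin_plus _ L0); vec).
    assert (j2 : forall c x, J (cscal c x) = cscal c (J x)).
    { intros. unfold J. rewrite (lin_cscal _ L0). transitivity (minus (cscal c (zero : real_space X)) (cscal c (F 0%C x))).
      - rewrite cscal_zero_r. vec.
      - rewrite <- cscal_minus_r. f_equal. vec. }
    assert (j3 : forall x, norm (J x) <= b * norm x) by (intros; unfold J; rewrite norm_oppV; auto).
    apply (Build_is_linear (K := C_AbsRing) (U := X) (V := X)); [exact j1|exact j2|].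
    exists b. split; [exact Hb|exact j3]. }
  destruct linA as (_ & _ & lA).
  assert (Aopp : forall y, dom A y -> dom A (opp y) /\ A (opp y) = opp (A y)).
  { intros y Dy. destruct (lA (RtoC (-1)) y Dy) as [D E]. rewrite !cscal_RtoC in *.
    replace (opp y) with (scal (-1) y) by vec. split; auto. rewrite E. vec. }
  assert (J1 : forall x, dom A (J x) /\ A (J x) = x).
  { intros x. destruct R0 as (_ & H & _). destruct (H x) as [D E]. destruct (Aopp _ D) as [D' E'].
    unfold J. split; auto. rewrite E'. rewrite <- E at 2. rewrite cscal_zero_l. vec. }
  assert (J2 : forall x, dom A x -> J (A x) = x).
  { intros x Dx. destruct R0 as (_ & _ & H). unfold J. rewrite <- (lin_opp _ L0).
    rewrite <- (H x Dx) at 2. f_equal. rewrite cscal_zero_l. vec. }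
  assert (Ke1 : forall l x, fst l <= om -> norm (F l (F l (F l x))) <= K * K * K / (nu l * nu l * nu l) * norm x).
  { intros l x Hl. assert (n1 := nu_ge1 l). assert (q := div_nu_le K l ltac:(lra)).
    replace (K * K * K / (nu l * nu l * nu l) * norm x) with (K / nu l * (K / nu l * (K / nu l * norm x))) by (field; lra).
    eapply Rle_trans; [apply HF1; auto|]. apply Rmult_le_compat_l; [lra|].
    eapply Rle_trans; [apply HF1; auto|]. apply Rmult_le_compat_l; [lra|]. apply HF1; auto. }
  assert (Ke2 : forall l x, fst l <= om -> norm (F l (F l x)) <= K * K / (nu l * nu l) * norm x).
  { intros l x Hl. assert (n1 := nu_ge1 l). assert (q := div_nu_le K l ltac:(lra)).
    replace (K * K / (nu l * nu l) * norm x) with (K / nu l * (K / nu l * norm x)) by (field; lra).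
    eapply Rle_trans; [apply HF1; auto|]. apply Rmult_le_compat_l; [lra|]. apply HF1; auto. }
  assert (K3 : 1 <= K * K * K) by nra.
  destruct (sg_bounded S C0 1) as (M1 & HM1 & B1).
  (* On the line Re l = 0 the factor e^(-l t) has modulus 1, so the right-hand side is independent
     of t and the weight t^2/2 yields the decay. Times below 1 are left to local boundedness. *)
  assert (est1 : forall t x, 1 <= t -> norm (S t x) <= 16 * (K * K * K) / ((1 + t) * (1 + t)) * norm x).
  { intros t x Ht.
    assert (D1 : forall z, dom A z -> norm (S t z) <= 16 * (K * K * K) / ((1 + t) * (1 + t)) * norm z).
    { intros z Dz. assert (nz := norm_ge_0 z).
      assert (I : PI / 2 * (t * t / 2) * norm (S t z) <= 2 * (K * K * K) * norm z / 1).
      { apply (inversion_bound A S C0 SA om K F HF Hres 0); auto; try lra.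
        intros delta N Hd HN. apply abel_lsym_bound; auto; try lra.
        - apply (lsym_cont om K F HF); lra.
        - apply Rmult_le_pos; [nra|auto].
        - intros tau Htau. eapply Rle_trans; [apply lsym_norm with (b := K * K * K / ((1 + tau) * (1 + tau)) * norm z)|].
          + intros l E1 E2. eapply Rle_trans; [apply Ke1; lra|]. apply Rmult_le_compat_r; auto.
            apply Rmult_le_compat_l; [lra|]. apply Rinv_le_contravar; [nra|].
            assert (1 + tau <= nu l) by (unfold nu; rewrite E2, (Rabs_right tau) by lra; generalize (Rabs_pos (fst l)); lra).
            assert ((1 + tau) * (1 + tau) <= nu l * nu l) by (apply Rmult_le_compat; lra). nra.
          + rewrite Rmult_0_l, exp_0. right. field. lra. }
      assert (nS := norm_ge_0 (S t z)).
      assert (t * t / 2 * norm (S t z) <= 2 * (K * K * K) * norm z).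
      { apply Rle_trans with (PI / 2 * (t * t / 2) * norm (S t z)); [|lra].
        apply Rmult_le_compat_r; auto. nra. }
      apply Rmult_le_reg_r with ((1 + t) * (1 + t)); [nra|].
      replace (16 * (K * K * K) / ((1 + t) * (1 + t)) * norm z * ((1 + t) * (1 + t))) with (8 * (2 * (K * K * K) * norm z)) by (field; lra).
      assert ((1 + t) * (1 + t) <= 4 * (t * t)) by nra.
      assert (norm (S t z) * ((1 + t) * (1 + t)) <= norm (S t z) * (4 * (t * t))) by (apply Rmult_le_compat_l; auto). lra. }
    destruct (dense_seq x) as [u [Du Lu]].
    assert (Lt := sg_lin S C0 t ltac:(lra)). destruct (lin_bound _ Lt) as [b [Hb Bb]].
    apply (seq_lim_bound (V := real_space X) (W := real_space X) (fun n => S t (u n)) (S t x) u x); auto.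
    - apply Rmult_le_pos; [lra|]. apply Rlt_le, Rinv_0_lt_compat; nra.
    - apply seq_lim_lin with b; auto. intros; apply (lin_minus _ Lt). }
  (* F^3 A z = l F^3 z - F^2 z is O(|l|^-2). On the line through -1/t the exponential has modulus e
     and [nu l] is at least 1/t + tau, so the integral is O(t); division by t^2/2 leaves 1/t. *)
  assert (est2 : forall t x, 0 < t -> dom A x -> norm (S t (A x)) <= 4 * exp 1 * (K * K * K + K * K) / t * norm x).
  { intros t x Ht Dx. assert (ep := exp_pos 1).
    assert (D1 : forall z, dom A z -> dom A (A z) -> norm (S t (A z)) <= 4 * exp 1 * (K * K * K + K * K) / t * norm z).
    { intros z Dz DAz. assert (nz := norm_ge_0 z).
      assert (it : 0 < / t) by (apply Rinv_0_lt_compat; auto).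
      assert (I : PI / 2 * (t * t / 2) * norm (S t (A z)) <= 2 * exp 1 * (K * K * K + K * K) * norm z / / t).
      { apply (inversion_bound A S C0 SA om K F HF Hres (- / t)); auto; try lra.
        intros delta N Hd HN. apply abel_lsym_bound; auto; try lra.
        - apply (lsym_cont om K F HF); lra.
        - apply Rmult_le_pos; [apply Rmult_le_pos; [lra|nra]|auto].
        - intros tau Htau. eapply Rle_trans; [apply lsym_norm with (b := (K * K * K + K * K) / ((/ t + tau) * (/ t + tau)) * norm z)|].
          + intros l E1 E2. assert (Hl : fst l <= om) by lra. assert (n1 := nu_ge1 l).
            assert (Ll : bounded_linear (F l)) by apply (Hres l Hl).
            assert (E : F l (A z) = minus (cscal l (F l z)) z).
            { destruct (Hres l Hl) as (_ & _ & H). 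
              transitivity (minus (cscal l (F l z)) (F l (minus (cscal l z) (A z)))); [|rewrite (H z Dz); reflexivity].
              rewrite (lin_minus _ Ll), (lin_cscal _ Ll). vec. }
            rewrite E, !(lin_minus _ Ll), !(lin_cscal _ Ll).
            assert (nl : Cmod l <= nu l).
            { destruct l as [a b]. eapply Rle_trans; [apply Cmod_le_abs|]. unfold nu; cbn. lra. }
            assert (n2 : / t + tau <= nu l).
            { unfold nu. rewrite E1, E2, Rabs_Ropp, !Rabs_right by lra. lra. }
            apply Rle_trans with ((K * K * K + K * K) / (nu l * nu l) * norm z).
            * replace ((K * K * K + K * K) / (nu l * nu l) * norm z) with (nu l * (K * K * K / (nu l * nu l * nu l) * norm z) + K * K / (nu l * nu l) * norm z) by (field; lra).
              apply norm_le_plus with (cscal l (F l (F l (F l z)))) (opp (F l (F l z))); [vec| |rewrite norm_oppV; apply Ke2; auto].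
              eapply Rle_trans; [apply norm_cscal|]. apply Rmult_le_compat; auto using Cmod_ge_0, norm_ge_0.
            * apply Rmult_le_compat_r; auto. apply Rmult_le_compat_l; [nra|].
              apply Rinv_le_contravar; [nra|]. apply Rmult_le_compat; lra.
          + replace (- / t * - t) with 1 by (field; lra). right. field. split; [lra|]. 
            assert (0 < 1 + tau * t) by nra. nra. }
      assert (nS := norm_ge_0 (S t (A z))).
      assert (t * t / 2 * norm (S t (A z)) <= 2 * exp 1 * (K * K * K + K * K) * norm z * t).
      { replace (2 * exp 1 * (K * K * K + K * K) * norm z / / t) with (2 * exp 1 * (K * K * K + K * K) * norm z * t) in I by (field; lra).
        eapply Rle_trans; [|exact I]. apply Rmult_le_compat_r; auto. nra. }
      apply Rmult_le_reg_r with (t * t / 2); [nra|].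
      replace (4 * exp 1 * (K * K * K + K * K) / t * norm z * (t * t / 2)) with (2 * exp 1 * (K * K * K + K * K) * norm z * t) by (field; lra).
      lra. }
    (* [inversion_bound] is applied to A z, which must itself lie in the domain. For z = J(y n) with
       y n in the domain this holds, and J(y n) tends to x when y n tends to A x. *)
    destruct (dense_seq (A x)) as [y [Dy Ly]].
    assert (Lt := sg_lin S C0 t ltac:(lra)). destruct (lin_bound _ Lt) as [b [Hb Bb]]. destruct (lin_bound _ LJ) as [bJ [HbJ BbJ]].
    apply (seq_lim_bound (V := real_space X) (W := real_space X) (fun n => S t (y n)) (S t (A x)) (fun n => J (y n)) x).
    - apply Rmult_le_pos; [nra|]. apply Rlt_le, Rinv_0_lt_compat; lra.
    - apply seq_lim_lin with b; auto. intros; apply (lin_minus _ Lt).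
    - rewrite <- (J2 x Dx). apply seq_lim_lin with bJ; auto. intros; apply (lin_minus _ LJ).
    - intros n. destruct (J1 (y n)) as [d1 d2]. specialize (D1 (J (y n)) d1). rewrite d2 in D1. apply D1. apply Dy. }
  set (M := 16 * (K * K * K) + 4 * M1 + 4 * exp 1 * (K * K * K + K * K)).
  assert (ep := exp_pos 1). assert (KK : 0 <= exp 1 * (K * K * K + K * K)) by (apply Rmult_le_pos; nra).
  exists M, J. split; [unfold M; lra|]. split; auto. split; auto. split; auto. split.
  - intros t x Ht. assert (nx := norm_ge_0 x).
    assert (ti : 0 < / ((1 + t) * (1 + t))) by (apply Rinv_0_lt_compat; nra).
    destruct (Rle_dec 1 t) as [L|L].
    + eapply Rle_trans; [apply est1; auto|]. apply Rmult_le_compat_r; auto.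
      apply Rmult_le_compat_r; [lra|]. unfold M. lra.
    + eapply Rle_trans; [apply B1; lra|]. apply Rmult_le_compat_r; auto.
      apply Rmult_le_reg_r with ((1 + t) * (1 + t)); [nra|].
      replace (M / ((1 + t) * (1 + t)) * ((1 + t) * (1 + t))) with M by (field; lra).
      assert ((1 + t) * (1 + t) <= 4) by nra. apply Rle_trans with (M1 * 4); [apply Rmult_le_compat_l; lra|].
      unfold M. lra.
  - intros t x Ht Dx. eapply Rle_trans; [apply est2; auto|].
    apply Rmult_le_compat_r; [apply norm_ge_0|]. apply Rmult_le_compat_r; [apply Rlt_le, Rinv_0_lt_compat; auto|].
    unfold M. lra.
Qed.

(* [J] is [A^-1], and [y] is [A S(t) x]. *)
Lemma generator_orbit M J : 1 <= M -> bounded_linear J -> (forall x, dom A (J x) /\ A (J x) = x) -> (forall x, dom A x -> J (A x) = x) ->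
  (forall t x, 0 < t -> dom A x -> norm (S t (A x)) <= M / t * norm x) ->
  forall t x, 0 < t -> exists y, J y = S t x /\ forall r, 0 <= r -> norm (S r y) <= M / (t + r) * norm x.
Proof.
  intros HM LJ J1 J2 H t x Ht.
  destruct (dense_seq x) as [u [Du Lu]].
  destruct linA as (_ & lp & ls).
  assert (Am : forall a b, dom A a -> dom A b -> dom A (minus a b) /\ A (minus a b) = minus (A a) (A b)).
  { intros a b Da Db. destruct (ls (RtoC (-1)) b Db) as [D1 E1]. destruct (lp a _ Da D1) as [D2 E2].
    rewrite cscal_RtoC in *. replace (minus a b) with (plus a (scal (-1) b)) by vec. split; auto.
    rewrite E2, E1, cscal_RtoC. vec. }
  assert (Lt := sg_lin S C0 t ltac:(lra)). destruct (lin_bound _ Lt) as [b [Hb Bb]]. destruct (lin_bound _ LJ) as [bJ [HbJ BbJ]].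
  destruct (cauchy_lim (V := real_space X) (fun n => S t (A (u n)))) as [y Ly].
  { intros e He. destruct (Lu (e / (2 * (M / t)))) as [N HN].
    { repeat (apply Rdiv_lt_0_compat || apply Rmult_lt_0_compat); lra. }
    assert (Mt : 0 < M / t) by (apply Rdiv_lt_0_compat; lra).
    exists N. intros n m Hn Hm. destruct (Am _ _ (Du n) (Du m)) as [D E].
    rewrite <- (lin_minus _ Lt), <- E. eapply Rle_trans; [apply H; auto|].
    apply Rle_trans with (M / t * (e / (2 * (M / t)) + e / (2 * (M / t)))); [|right; field; lra].
    apply Rmult_le_compat_l; [lra|].
    apply norm_le_plus with (minus (u n) x) (minus x (u m)); [vec|auto|rewrite norm_minus_sym; auto]. }
  exists y. split.
  - apply (seq_lim_unique (fun n => S t (u n))).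
    + assert (E : forall n, J (S t (A (u n))) = S t (u n)).
      { intros n. destruct (sg_commute t (u n) (Rlt_le _ _ Ht) (Du n)) as [D E]. rewrite <- E. apply J2; auto. }
      intros e He. destruct (seq_lim_lin J bJ (fun n => S t (A (u n))) y (fun p q => lin_minus _ LJ p q) BbJ Ly e He) as [N HN].
      exists N. intros n Hn. rewrite <- E. apply HN; auto.
    + apply seq_lim_lin with b; auto. intros; apply (lin_minus _ Lt).
  - intros r Hr. assert (Lr := sg_lin S C0 r Hr). destruct (lin_bound _ Lr) as [br [Hbr Bbr]].
    apply (seq_lim_bound (V := real_space X) (W := real_space X) (fun n => S r (S t (A (u n)))) (S r y) u x); auto.
    + apply Rlt_le, Rdiv_lt_0_compat; lra.
    + apply (seq_lim_lin (S r) br (fun n => S t (A (u n)))); auto. intros; apply (lin_minus _ Lr).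
    + intros n. rewrite <- (sg_plus S C0 r t) by lra. rewrite (Rplus_comm r t). apply H; auto. lra.
Qed.

End Estimates.

(** * Fractional powers *)

Section Improper.
Context {V : CompleteNormedModule R_AbsRing}.
Implicit Types f : R -> V.

Definition cont_pos (f : R -> V) : Prop := forall a b, 0 < a -> a <= b -> cont_on a b f.

Definition improper (f : R -> V) (l : V) : Prop :=
  forall eps, 0 < eps -> exists a0 b0, 0 < a0 /\ a0 <= b0 /\
    forall a b, 0 < a <= a0 -> b0 <= b -> norm (minus (RInt f a b) l) <= eps.

Lemma improper_RInt_gen f l : cont_pos f -> improper f l ->
  RInt_gen f (at_right 0) (Rbar_locally p_infty) = l.
Proof.
  intros C H. apply is_RInt_gen_unique.
  intros P HP. apply (locally_norm_le_locally l) in HP. destruct HP as [e He].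
  destruct (H (e / 2)) as (a0 & b0 & Ha & Hab & HI); [generalize (cond_pos e); lra|].
  apply Filter_prod with (fun a => 0 < a <= a0) (fun b => b0 <= b).
  - exists (mkposreal a0 Ha). intros y Hy Py. split; auto.
    unfold ball in Hy; cbn in Hy. unfold AbsRing_ball, abs, minus, plus, opp in Hy; cbn in Hy.
    rewrite Ropp_0, Rplus_0_r, Rabs_right in Hy; lra.
  - exists b0. intros y Hy. lra.
  - intros a b Aa Bb. exists (RInt f a b). split.
    + apply RInt_correct, ex_RInt_cont_on; [lra|]. apply C; lra.
    + apply He. eapply Rle_lt_trans; [apply HI; auto|]. generalize (cond_pos e); lra.
Qed.

Lemma improper_unique f l l' : improper f l -> improper f l' -> l = l'.
Proof.
  intros H H'. apply norm_minus_eq0. intros e He.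
  destruct (H (e/2)) as (a & b & Ha & Hab & HI); [lra|].
  destruct (H' (e/2)) as (a' & b' & Ha' & Hab' & HI'); [lra|].
  set (p := Rmin a a'). set (q := Rmax b b').
  assert (Hp : 0 < p) by (unfold p; apply Rmin_glb_lt; auto).
  assert (p <= a /\ p <= a') by (unfold p; split; [apply Rmin_l|apply Rmin_r]).
  assert (b <= q /\ b' <= q) by (unfold q; split; [apply Rmax_l|apply Rmax_r]).
  replace e with (e/2 + e/2) by field.
  apply norm_le_plus with (minus l (RInt f p q)) (minus (RInt f p q) l'); [vec| |apply HI'; lra].
  rewrite norm_minus_sym. apply HI; lra.
Qed.

Lemma improper_plus f g l l' : cont_pos f -> cont_pos g -> improper f l -> improper g l' ->
  improper (fun t => plus (f t) (g t)) (plus l l').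
Proof.
  intros Cf Cg H H' e He.
  destruct (H (e/2)) as (a & b & Ha & Hab & HI); [lra|].
  destruct (H' (e/2)) as (a' & b' & Ha' & Hab' & HI'); [lra|].
  exists (Rmin a a'), (Rmax b b').
  assert (p1 := Rmin_l a a'). assert (p2 := Rmin_r a a'). assert (p3 := Rmax_l b b'). assert (p4 := Rmax_r b b').
  repeat split; [apply Rmin_glb_lt; auto|lra|].
  intros u v Hu Hv. rewrite RInt_plus_on; [|lra|apply Cf; lra|apply Cg; lra].
  replace e with (e/2 + e/2) by field.
  apply norm_le_plus with (minus (RInt f u v) l) (minus (RInt g u v) l'); [vec|apply HI; lra|apply HI'; lra].
Qed.

Lemma improper_bound f l B : improper f l -> (forall a b, 0 < a -> a <= b -> norm (RInt f a b) <= B) -> norm l <= B.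
Proof.
  intros H HB. apply le_epsilon. intros e He. destruct (H e He) as (a & b & Ha & Hab & HI).
  apply norm_le_plus with (RInt f a b) (opp (minus (RInt f a b) l)); [vec|apply HB; auto|].
  rewrite norm_oppV. apply HI; lra.
Qed.

Lemma improper_exists f (G : R -> R) Gm : cont_pos f ->
  (forall a b, 0 < a -> a <= b -> norm (RInt f a b) <= G b - G a) ->
  (forall t, 0 < t -> 0 <= G t <= Gm) -> exists l, improper f l /\ norm l <= Gm.
Proof.
  intros C H HG.
  assert (mono : forall a b, 0 < a -> a <= b -> G a <= G b).
  { intros a b Ha Hab. specialize (H a b Ha Hab). generalize (norm_ge_0 (RInt f a b)). lra. }
  set (E1 := fun y => exists t, 0 < t /\ y = G t). set (E2 := fun y => exists t, 0 < t /\ y = - G t).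
  destruct (completeness E1) as [s1 [U1 L1]].
  { exists Gm. intros y (t & Ht & ->). apply HG; auto. } { exists (G 1), 1. split; [lra|auto]. }
  destruct (completeness E2) as [s2 [U2 L2]].
  { exists 0. intros y (t & Ht & ->). generalize (HG t Ht); lra. } { exists (- G 1), 1. split; [lra|auto]. }
  assert (X1 : forall e, 0 < e -> exists b, 0 < b /\ s1 - e < G b).
  { intros e He. apply NNPP. intros N. assert (s1 <= s1 - e); [|lra]. apply L1.
    intros y (t & Ht & ->). apply Rnot_lt_le. intros Q. apply N. exists t; auto. }
  assert (X2 : forall e, 0 < e -> exists a, 0 < a /\ G a < - s2 + e).
  { intros e He. apply NNPP. intros N. assert (s2 <= s2 - e); [|lra]. apply L2.
    intros y (t & Ht & ->). apply Rnot_lt_le. intros Q. apply N. exists t; split; auto; lra. }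
  assert (cau : forall e, 0 < e -> exists a0 b0, 0 < a0 /\ a0 <= b0 /\
     forall a b a' b', 0 < a <= a0 -> b0 <= b -> 0 < a' <= a0 -> b0 <= b' -> norm (minus (RInt f a b) (RInt f a' b')) <= e).
  { intros e He. destruct (X2 (e / 4)) as [a0 [Ha0 Ga0]]; [lra|]. destruct (X1 (e / 4)) as [b0 [Hb0 Gb0]]; [lra|].
    exists a0, (Rmax a0 b0). repeat split; auto; [apply Rmax_l|].
    assert (m1 := Rmax_l a0 b0). assert (m2 := Rmax_r a0 b0).
    set (b1 := Rmax a0 b0) in *.
    assert (Gb1 : s1 - e / 4 < G b1) by (generalize (mono b0 b1 Hb0 m2); lra).
    assert (P : forall a b, 0 < a <= a0 -> b1 <= b -> norm (minus (RInt f a b) (RInt f a0 b1)) <= e / 2).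
    { intros a b Ha Hb. 
      assert (E : minus (RInt f a b) (RInt f a0 b1) = plus (RInt f a a0) (RInt f b1 b)).
      { rewrite (RInt_Chasles_on a a0 b), (RInt_Chasles_on a0 b1 b); try lra; [vec|apply C; lra|apply C; lra]. }
      rewrite E. replace (e / 2) with (e / 4 + e / 4) by field. eapply norm_le_plus; [reflexivity| |].
      - eapply Rle_trans; [apply H; lra|]. assert (- G a <= s2) by (apply U2; exists a; split; auto; lra). lra.
      - eapply Rle_trans; [apply H; lra|]. assert (G b <= s1) by (apply U1; exists b; split; auto; lra). lra. }
    intros a b a' b' Ha Hb Ha' Hb'. replace e with (e/2 + e/2) by field.
    apply norm_le_plus with (minus (RInt f a b) (RInt f a0 b1)) (minus (RInt f a0 b1) (RInt f a' b')); [vec|apply P; auto|].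
    rewrite norm_minus_sym. apply P; auto. }
  destruct (cauchy_lim (fun n => RInt f (/ (INR n + 1)) (INR n + 1))) as [l Hl].
  { intros e He. destruct (cau e He) as (a0 & b0 & Ha & Hab & HI).
    destruct (nfloor_ex (Rmax b0 (/ a0))) as [N [_ HN]].
    { eapply Rle_trans; [|apply Rmax_l]. lra. }
    assert (m1 := Rmax_l b0 (/ a0)). assert (m2 := Rmax_r b0 (/ a0)).
    assert (Q : forall n, (N <= n)%nat -> 0 < / (INR n + 1) <= a0 /\ b0 <= INR n + 1).
    { intros n Hn. apply le_INR in Hn. assert (0 < / a0) by (apply Rinv_0_lt_compat; auto).
      split; [split|lra]; [apply Rinv_0_lt_compat; lra|].
      rewrite <- (Rinv_inv a0). apply Rinv_le_contravar; lra. }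
    exists N. intros n m Hn Hm. destruct (Q n Hn). destruct (Q m Hm). apply HI; auto. }
  assert (IM : improper f l).
  { intros e He. destruct (cau (e/2)) as (a0 & b0 & Ha & Hab & HI); [lra|].
    exists a0, b0. repeat split; auto. intros a b Ha' Hb'.
    destruct (Hl (e / 2)) as [N1 HN1]; [lra|].
    destruct (nfloor_ex (Rmax b0 (/ a0))) as [N [_ HN]].
    { eapply Rle_trans; [|apply Rmax_l]. lra. }
    assert (m1 := Rmax_l b0 (/ a0)). assert (m2 := Rmax_r b0 (/ a0)).
    set (n := max N N1). assert (Hn : (N <= n)%nat) by lia. apply le_INR in Hn.
    assert (0 < / a0) by (apply Rinv_0_lt_compat; auto).
    replace e with (e/2+e/2) by field.
    apply norm_le_plus with (minus (RInt f a b) (RInt f (/ (INR n + 1)) (INR n + 1))) (minus (RInt f (/ (INR n + 1)) (INR n + 1)) l); [vec| |apply HN1; lia].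
    apply HI; auto; [|lra]. split; [apply Rinv_0_lt_compat; lra|].
    rewrite <- (Rinv_inv a0). apply Rinv_le_contravar; lra. }
  exists l. split; auto. apply (improper_bound f); auto.
  intros a b Ha Hab. eapply Rle_trans; [apply H; auto|]. generalize (HG a Ha) (HG b ltac:(lra)). lra.
Qed.

(* [d/dt (t/(1+t))^beta = beta t^(beta-1) (1+t)^(-beta-1)] dominates [t^(beta-1) (1+t)^-2]. *)
Lemma improper_power (h : R -> V) beta c : 0 < beta <= 1 -> 0 <= c -> cont_pos h ->
  (forall t, 0 < t -> norm (h t) <= c / ((1 + t) * (1 + t))) ->
  cont_pos (fun t => scal (Rpower t (beta - 1)) (h t)) /\
  exists l, improper (fun t => scal (Rpower t (beta - 1)) (h t)) l /\ norm l <= c / beta.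
Proof.
  intros Hb Hc Ch H.
  assert (C : cont_pos (fun t => scal (Rpower t (beta - 1)) (h t))).
  { intros a b Ha Hab t It. apply contn_in_scal; [|apply Ch; auto]. apply contn_in_real.
    unfold itv in It. apply (ex_derive_continuous (fun t => Rpower t (beta - 1))). unfold Rpower. auto_derive. lra. }
  split; auto.
  set (G := fun t => c / beta * exp (beta * (ln t - ln (1 + t)))).
  apply (improper_exists _ G); auto.
  - intros a b Ha Hab.
    apply (RInt_norm_le_deriv _ G (fun t => c * (exp (beta * (ln t - ln (1 + t))) * (/ t - / (1 + t))))); auto.
    + intros t Ht. unfold G. auto_derive; [lra|]. unfold Rminus. field. lra.
    + intros t Ht. apply (ex_derive_continuous (fun t => c * (exp (beta * (ln t - ln (1 + t))) * (/ t - / (1 + t))))).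
      auto_derive. repeat split; lra.
    + intros t Ht. assert (tp : 0 < t) by lra.
      eapply Rle_trans; [apply norm_scal_bound; [apply Rle_refl|apply H; auto]|].
      rewrite Rabs_right by (apply Rle_ge, Rlt_le, exp_pos).
      assert (E1 : Rpower t (beta - 1) = exp (beta * ln t) * / t).
      { unfold Rpower. replace ((beta - 1) * ln t) with (beta * ln t + - ln t) by ring.
        rewrite exp_plus, exp_Ropp, exp_ln by auto. reflexivity. }
      assert (E2 : exp (beta * (ln t - ln (1 + t))) = exp (beta * ln t) * exp (- (beta * ln (1 + t)))).
      { rewrite <- exp_plus. f_equal. ring. }
      assert (E3 : / (1 + t) <= exp (- (beta * ln (1 + t)))).
      { rewrite <- (exp_ln (1 + t)) at 1 by lra. rewrite <- exp_Ropp.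
        assert (0 <= ln (1 + t)) by (rewrite <- ln_1; apply Rcomplements.ln_le; lra).
        destruct (Rle_lt_or_eq_dec (- ln (1 + t)) (- (beta * ln (1 + t)))) as [L|L]; [nra|left; apply exp_increasing; auto|rewrite L; lra]. }
      rewrite E1, E2. set (e1 := exp (beta * ln t)). assert (0 < e1) by apply exp_pos.
      set (e2 := exp (- (beta * ln (1 + t)))) in *.
      replace (/ t - / (1 + t)) with (/ t * / (1 + t)) by (field; lra).
      assert (i1 : 0 < / t) by (apply Rinv_0_lt_compat; lra).
      assert (i2 : 0 < / (1 + t)) by (apply Rinv_0_lt_compat; lra).
      replace (e1 * / t * (c / ((1 + t) * (1 + t)))) with (c * (e1 * / t * / (1 + t)) * / (1 + t)) by (field; lra).
      replace (c * (e1 * e2 * (/ t * / (1 + t)))) with (c * (e1 * / t * / (1 + t)) * e2) by ring.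
      apply Rmult_le_compat_l; auto. repeat apply Rmult_le_pos; lra.
  - intros t Ht. unfold G.
    assert (0 <= c / beta) by (apply Rmult_le_pos; auto; apply Rlt_le, Rinv_0_lt_compat; lra).
    assert (exp (beta * (ln t - ln (1 + t))) <= 1).
    { assert (ln t <= ln (1 + t)) by (apply Rcomplements.ln_le; lra).
      replace (beta * (ln t - ln (1 + t))) with (- (beta * (ln (1 + t) - ln t))) by ring. apply exp_neg_le1. nra. }
    generalize (exp_pos (beta * (ln t - ln (1 + t)))). nra.
Qed.

(* Antiderivative of a majorant of [r^(beta-1) / (t + r)], built from the two powers matching its behaviour at 0 and at infinity. *)
Lemma improper_orbit (h : R -> V) beta c t : 0 < beta < 1 -> 0 <= c -> 0 < t -> cont_pos h ->
  (forall r, 0 < r -> norm (h r) <= c / (t + r)) ->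
  exists l, improper (fun r => scal (Rpower r (beta - 1)) (h r)) l /\
    norm l <= c * (2 / beta + 2 / (1 - beta)) * Rpower t (beta - 1).
Proof.
  intros Hb Hc Ht Ch H.
  assert (C : cont_pos (fun t => scal (Rpower t (beta - 1)) (h t))).
  { intros a b Ha Hab r Ir. apply contn_in_scal; [|apply Ch; auto]. apply contn_in_real.
    unfold itv in Ir. apply (ex_derive_continuous (fun t => Rpower t (beta - 1))). unfold Rpower. auto_derive. lra. }
  set (T := Rpower t (beta - 1)). assert (Tp : 0 < T) by apply exp_pos.
  set (G := fun r => c * T * (2 / beta * exp (beta * (ln r - ln (t + r))) + 2 / (1 - beta) * (1 - exp ((1 - beta) * (ln t - ln (t + r)))))).
  set (g := fun r => c * T * (2 * (exp (beta * (ln r - ln (t + r))) * (/ r - / (t + r))) + 2 * (exp ((1 - beta) * (ln t - ln (t + r))) * / (t + r)))).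
  assert (b1 : 0 < 2 / beta) by (apply Rdiv_lt_0_compat; lra).
  assert (b2 : 0 < 2 / (1 - beta)) by (apply Rdiv_lt_0_compat; lra).
  apply (improper_exists _ G); auto.
  - intros a b Ha Hab.
    apply (RInt_norm_le_deriv _ G g); auto.
    + intros r Hr. unfold G, g. auto_derive; [lra|]. unfold Rminus. field. lra.
    + intros r Hr. apply (ex_derive_continuous g). unfold g. auto_derive. repeat split; lra.
    + intros r Hr. assert (rp : 0 < r) by lra.
      eapply Rle_trans; [apply norm_scal_bound; [apply Rle_refl|apply H; auto]|].
      rewrite Rabs_right by (apply Rle_ge, Rlt_le, exp_pos).
      set (u := t + r). assert (up : 0 < u) by (unfold u; lra).
      assert (i1 : 0 < / r) by (apply Rinv_0_lt_compat; lra).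
      assert (i2 : 0 < / u) by (apply Rinv_0_lt_compat; lra).
      assert (half : forall p q a, 0 < p -> 0 < q -> q <= 2 * p -> 0 <= a <= 1 -> exp (a * ln q) <= 2 * exp (a * ln p)).
      { intros p q k Hp Hq Hpq Hk.
        assert (ln q <= ln 2 + ln p) by (rewrite <- ln_mult by lra; apply Rcomplements.ln_le; lra).
        assert (0 < ln 2) by (rewrite <- ln_1; apply ln_increasing; lra).
        rewrite <- (exp_ln 2) at 1 by lra. rewrite <- exp_plus.
        assert (k * ln q <= ln 2 + k * ln p) by nra.
        destruct H2 as [L|L]; [left; apply exp_increasing; auto|rewrite L; lra]. }
      set (p1 := exp (beta * (ln r - ln u)) * (/ r - / u)).
      set (p2 := exp ((1 - beta) * (ln t - ln u)) * / u).
      assert (q1 : 0 <= p1).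
      { unfold p1. apply Rmult_le_pos; [apply Rlt_le, exp_pos|]. assert (/ u <= / r); [|lra].
        apply Rinv_le_contravar; auto. unfold u; lra. }
      assert (q2 : 0 <= p2) by (unfold p2; apply Rmult_le_pos; [apply Rlt_le, exp_pos|lra]).
      assert (key : Rpower r (beta - 1) * / u <= T * (2 * p1 + 2 * p2)).
      { assert (Ti : T = exp (beta * ln t) * / t).
        { unfold T, Rpower. replace ((beta - 1) * ln t) with (beta * ln t + - ln t) by ring.
          rewrite exp_plus, exp_Ropp, exp_ln by auto. reflexivity. }
        assert (Ri : Rpower r (beta - 1) = exp (beta * ln r) * / r).
        { unfold Rpower. replace ((beta - 1) * ln r) with (beta * ln r + - ln r) by ring.
          rewrite exp_plus, exp_Ropp, exp_ln by auto. reflexivity. }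
        (* For r <= t one has u = t + r <= 2t, otherwise u <= 2r. [half] pays a factor 2 for
           replacing u by the larger of t and r in a power with exponent in [0, 1]. *)
        destruct (Rle_dec r t) as [L|L].
        - apply Rle_trans with (T * (2 * p1)); [|nra].
          unfold p1. replace (/ r - / u) with (t * (/ r * / u)) by (unfold u; field; split; lra).
          replace (beta * (ln r - ln u)) with (beta * ln r + - (beta * ln u)) by ring.
          rewrite exp_plus, exp_Ropp, Ti, Ri.
          assert (h1 : exp (beta * ln u) <= 2 * exp (beta * ln t)) by (apply half; unfold u; lra).
          set (eu := exp (beta * ln u)) in *. set (et := exp (beta * ln t)) in *. set (er := exp (beta * ln r)) in *.
          assert (0 < eu) by apply exp_pos. assert (0 < er) by apply exp_pos.
          replace (et * / t * (2 * (er * / eu * (t * (/ r * / u))))) with (er * / r * / u * (2 * et * / eu)) by (field; lra).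
          rewrite <- (Rmult_1_r (er * / r * / u)) at 1. apply Rmult_le_compat_l; [repeat apply Rmult_le_pos; lra|].
          apply Rmult_le_reg_r with eu; auto. replace (2 * et * / eu * eu) with (2 * et) by (field; lra). lra.
        - apply Rle_trans with (T * (2 * p2)); [|nra].
          unfold p2. unfold T, Rpower.
          replace ((1 - beta) * (ln t - ln u)) with (- ((beta - 1) * ln t) + - ((1 - beta) * ln u)) by ring.
          rewrite exp_plus, !exp_Ropp.
          assert (h1 : exp ((1 - beta) * ln u) <= 2 * exp ((1 - beta) * ln r)) by (apply half; unfold u; lra).
          replace ((beta - 1) * ln r) with (- ((1 - beta) * ln r)) by ring. rewrite exp_Ropp.
          set (eu := exp ((1 - beta) * ln u)) in *. set (et := exp ((beta - 1) * ln t)) in *. set (er := exp ((1 - beta) * ln r)) in *.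
          assert (0 < eu) by apply exp_pos. assert (0 < er) by apply exp_pos. assert (0 < et) by apply exp_pos.
          replace (et * (2 * (/ et * / eu * / u))) with (2 * / eu * / u) by (field; lra).
          apply Rmult_le_compat_r; [lra|].
          apply Rmult_le_reg_r with (er * eu); [nra|].
          replace (/ er * (er * eu)) with eu by (field; lra). replace (2 * / eu * (er * eu)) with (2 * er) by (field; lra). auto. }
      unfold g. fold u. fold p1. fold p2.
      replace (Rpower r (beta - 1) * (c / u)) with (c * (Rpower r (beta - 1) * / u)) by (unfold Rdiv; ring).
      rewrite Rmult_assoc. apply Rmult_le_compat_l; auto.
  - intros r Hr. unfold G.
    assert (e1 : exp (beta * (ln r - ln (t + r))) <= 1).
    { assert (ln r <= ln (t + r)) by (apply Rcomplements.ln_le; lra).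
      replace (beta * (ln r - ln (t + r))) with (- (beta * (ln (t + r) - ln r))) by ring. apply exp_neg_le1. nra. }
    assert (e2 : exp ((1 - beta) * (ln t - ln (t + r))) <= 1).
    { assert (ln t <= ln (t + r)) by (apply Rcomplements.ln_le; lra).
      replace ((1 - beta) * (ln t - ln (t + r))) with (- ((1 - beta) * (ln (t + r) - ln t))) by ring. apply exp_neg_le1. nra. }
    generalize (exp_pos (beta * (ln r - ln (t + r)))) (exp_pos ((1 - beta) * (ln t - ln (t + r)))). intros.
    assert (cT : 0 <= c * T) by (apply Rmult_le_pos; lra).
    set (e := exp (beta * (ln r - ln (t + r)))) in *. set (e' := exp ((1 - beta) * (ln t - ln (t + r)))) in *.
    assert (0 <= 2 / beta * e + 2 / (1 - beta) * (1 - e') <= 2 / beta + 2 / (1 - beta)) by (split; nra).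
    split; [apply Rmult_le_pos; lra|].
    replace (c * (2 / beta + 2 / (1 - beta)) * T) with (c * T * (2 / beta + 2 / (1 - beta))) by ring.
    apply Rmult_le_compat_l; lra.
Qed.

End Improper.

Lemma improper_lin {V W : CompleteNormedModule R_AbsRing} (L : V -> W) M f l :
  (forall x y, L (plus x y) = plus (L x) (L y)) -> (forall r x, L (scal r x) = scal r (L x)) ->
  (forall x, norm (L x) <= M * norm x) -> cont_pos f -> improper f l -> improper (fun t => L (f t)) (L l).
Proof.
  intros H1 H2 HM C H e He.
  assert (Hm : forall x y, L (minus x y) = minus (L x) (L y)).
  { intros. replace (minus x y) with (plus x (scal (-1) y)) by vec. rewrite H1, H2. vec. }
  assert (P : 0 < Rabs M + 1) by (generalize (Rabs_pos M); lra).
  destruct (H (e / (Rabs M + 1))) as (a0 & b0 & Ha & Hab & HI); [apply Rdiv_lt_0_compat; lra|].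
  exists a0, b0. repeat split; auto. intros a b Ha' Hb'.
  rewrite <- (RInt_lin L M a b f); auto; [|lra|apply C; lra]. rewrite <- Hm.
  eapply Rle_trans; [apply HM|].
  apply Rle_trans with ((Rabs M + 1) * (e / (Rabs M + 1))); [|right; field; lra].
  apply Rle_trans with ((Rabs M + 1) * norm (minus (RInt f a b) l)).
  - apply Rmult_le_compat_r; [apply norm_ge_0|generalize (Rle_abs M); lra].
  - apply Rmult_le_compat_l; [lra|auto].
Qed.

(** This makes the factor in [neg_frac_pow] invertible. The integrand is positive, so its part over
    [1, 2] bounds the integral from below; convergence uses e^t >= (1 + t/2)^2. *)
Lemma Gamma_fun_pos a : 0 < a < 1 -> Gamma_fun a <> 0.
Proof.
  intros Ha.
  destruct (improper_power (V := R_CompleteNormedModule) (fun t => exp (- t)) a 4) as [C [l [Hl _]]]; try lra.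
  - intros p q _ _ t _. apply contn_in_real. apply (ex_derive_continuous (fun t => exp (- t))). auto_derive; auto.
  - intros t Ht. change (Rabs (exp (- t)) <= 4 / ((1 + t) * (1 + t))).
    rewrite Rabs_right by (apply Rle_ge, Rlt_le, exp_pos). rewrite exp_Ropp.
    assert (E : exp t = exp (t / 2) * exp (t / 2)) by (rewrite <- exp_plus; f_equal; field).
    assert (E1 := exp_ineq1_le (t / 2)).
    assert ((1 + t / 2) * (1 + t / 2) <= exp t) by (rewrite E; apply Rmult_le_compat; lra).
    replace (4 / ((1 + t) * (1 + t))) with (/ ((1 + t) * (1 + t) / 4)) by (field; lra).
    apply Rinv_le_contravar; nra.
  - assert (EG : Gamma_fun a = l) by (exact (improper_RInt_gen (V := R_CompleteNormedModule) _ l C Hl)). rewrite EG.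
    set (f := fun t => scal (Rpower t (a - 1)) (exp (- t)) : R) in *.
    assert (fp : forall t, 0 < f t) by (intros; apply Rmult_lt_0_compat; apply exp_pos).
    assert (low : / 2 * exp (- 2) <= RInt (V := R_CompleteNormedModule) f 1 2).
    { replace (/ 2 * exp (- 2)) with (RInt (V := R_CompleteNormedModule) (fun _ => / 2 * exp (- 2)) 1 2).
      2: { rewrite (RInt_const (V := R_CompleteNormedModule)). unfold scal; cbn. unfold mult; cbn. ring. }
      apply RInt_le; [lra| |apply (ex_RInt_cont_on (V := R_CompleteNormedModule)); [lra|apply C; lra]|].
      - apply (ex_RInt_const (V := R_CompleteNormedModule)).
      - intros t Ht. change (/ 2 * exp (- 2) <= Rpower t (a - 1) * exp (- t)).
        apply Rmult_le_compat; [lra|apply Rlt_le, exp_pos| |left; apply exp_increasing; lra].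
        rewrite <- (exp_ln 2) by lra. rewrite <- exp_Ropp. unfold Rpower.
        assert (0 <= ln t) by (rewrite <- ln_1; apply Rcomplements.ln_le; lra).
        assert (ln t < ln 2) by (apply ln_increasing; lra). left. apply exp_increasing. nra. }
    assert (ep := exp_pos (-2)).
    destruct (Hl (/ 4 * exp (- 2))) as (p & q & Hp & Hpq & HI); [lra|].
    set (p1 := Rmin p 1). set (q1 := Rmax q 2).
    assert (0 < p1 <= p) by (unfold p1; split; [apply Rmin_glb_lt; lra|apply Rmin_l]).
    assert (p1 <= 1) by apply Rmin_r. assert (q <= q1) by apply Rmax_l. assert (2 <= q1) by apply Rmax_r.
    assert (HI' := HI p1 q1 H H1). fold f in HI'.
    change (Rabs (RInt (V := R_CompleteNormedModule) f p1 q1 - l) <= / 4 * exp (-2)) in HI'.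
    rewrite (RInt_Chasles_on (V := R_CompleteNormedModule) p1 1 q1 f) in HI'; [|lra|apply C; lra].
    rewrite (RInt_Chasles_on (V := R_CompleteNormedModule) 1 2 q1 f) in HI'; [|lra|apply C; lra].
    assert (g1 : 0 <= RInt (V := R_CompleteNormedModule) f p1 1).
    { apply RInt_ge_0; [lra|apply (ex_RInt_cont_on (V := R_CompleteNormedModule)); [lra|apply C; lra]|intros; left; apply fp]. }
    assert (g2 : 0 <= RInt (V := R_CompleteNormedModule) f 2 q1).
    { apply RInt_ge_0; [lra|apply (ex_RInt_cont_on (V := R_CompleteNormedModule)); [lra|apply C; lra]|intros; left; apply fp]. }
    change (Rabs (RInt (V := R_CompleteNormedModule) f p1 1 + (RInt (V := R_CompleteNormedModule) f 1 2 + RInt (V := R_CompleteNormedModule) f 2 q1) - l) <= / 4 * exp (-2)) in HI'.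
    intros E. change (l = 0) in E. rewrite E in HI'. rewrite Rabs_right in HI' by lra. lra.
Qed.

Lemma deriv_in_comp_scale {V : CompleteNormedModule R_AbsRing} (J J' : R -> Prop) (f : R -> V) c t d :
  (forall r, J' r -> J (r * c)) -> deriv_in J f (t * c) d -> deriv_in J' (fun r => f (r * c)) t (scal c d).
Proof.
  intros HJ H e He. assert (P : 0 < Rabs c + 1) by (generalize (Rabs_pos c); lra).
  destruct (H (e / (Rabs c + 1))) as [p [Hp D]]; [apply Rdiv_lt_0_compat; lra|].
  exists (p / (Rabs c + 1)). split; [apply Rdiv_lt_0_compat; lra|].
  intros r Hr Hrt.
  assert (E : Rabs (r * c - t * c) = Rabs (r - t) * Rabs c) by (rewrite <- Rabs_mult; f_equal; ring).
  assert (L : Rabs (r * c - t * c) < p).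
  { rewrite E. apply Rle_lt_trans with (Rabs (r - t) * (Rabs c + 1)).
    - apply Rmult_le_compat_l; [apply Rabs_pos|lra].
    - apply Rmult_lt_compat_r with (r := Rabs c + 1) in Hrt; auto.
      replace (p / (Rabs c + 1) * (Rabs c + 1)) with p in Hrt by (field; lra). auto. }
  specialize (D (r * c) (HJ r Hr) L).
  replace (scal (r - t) (scal c d)) with (scal (r * c - t * c) d) by vec.
  eapply Rle_trans; [exact D|]. rewrite E. assert (hp := Rabs_pos (r - t)).
  replace (e / (Rabs c + 1) * (Rabs (r - t) * Rabs c)) with (Rabs (r - t) * (e / (Rabs c + 1) * Rabs c)) by ring.
  rewrite (Rmult_comm e). apply Rmult_le_compat_l; auto.
  apply Rle_trans with (e / (Rabs c + 1) * (Rabs c + 1)); [|right; field; lra].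
  apply Rmult_le_compat_l; [apply Rlt_le, Rdiv_lt_0_compat; lra|lra].
Qed.

Lemma Rpower_mult_base a b p : 0 < a -> 0 < b -> Rpower (a * b) p = Rpower a p * Rpower b p.
Proof. intros. unfold Rpower. rewrite ln_mult by auto. rewrite <- exp_plus. f_equal. ring. Qed.

Lemma Rpower_cont p a b : 0 < a -> cont_on (V := R_CompleteNormedModule) a b (fun t => Rpower t p).
Proof.
  intros Ha t It. unfold itv in It. apply contn_in_real.
  apply (ex_derive_continuous (fun t => Rpower t p)). unfold Rpower. auto_derive. lra.
Qed.

Section FracPower.
Context {X : CompleteNormedModule C_AbsRing}.
Variables (S : R -> real_space X -> real_space X) (J : real_space X -> real_space X) (M : R).
Hypothesis C0 : C0_semigroup S.
Hypothesis HM : 1 <= M.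
Hypothesis HS : forall t x, 0 <= t -> norm (S t x) <= M / ((1 + t) * (1 + t)) * norm x.
Hypothesis J_deriv : forall x t, 0 <= t -> deriv_in (fun r => 0 <= r) (fun r => S r (J x)) t (opp (S t x)).
Implicit Types x y : real_space X.

Lemma sg_norm_M t x : 0 <= t -> norm (S t x) <= M * norm x.
Proof.
  intros Ht. eapply Rle_trans; [apply HS; auto|]. apply Rmult_le_compat_r; [apply norm_ge_0|].
  apply Rmult_le_reg_r with ((1 + t) * (1 + t)); [nra|].
  replace (M / ((1 + t) * (1 + t)) * ((1 + t) * (1 + t))) with M by (field; lra). nra.
Qed.

Definition kf (beta : R) (x : real_space X) (t : R) : real_space X := scal (Rpower t (beta - 1)) (S t x).

Lemma S_cont_pos x : cont_pos (V := real_space X) (fun t => S t x).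
Proof. intros a b Ha Hab. apply S_cont_on; auto. lra. Qed.

(** Gamma(beta) A^(-beta) without normalisation: no functional equation of the Gamma function is
    then required, only that the constants are nonzero. *)
Definition Kpow (beta : R) (x : real_space X) : real_space X :=
  RInt_gen (kf beta x) (at_right 0) (Rbar_locally p_infty).

Lemma Kpow_spec beta x : 0 < beta <= 1 ->
  cont_pos (kf beta x) /\ improper (kf beta x) (Kpow beta x) /\ norm (Kpow beta x) <= M / beta * norm x.
Proof.
  intros Hb.
  destruct (improper_power (V := real_space X) (fun t => S t x) beta (M * norm x)) as [C [l [I N]]]; auto.
  - apply Rmult_le_pos; [lra|apply norm_ge_0].
  - apply S_cont_pos.
  - intros t Ht. eapply Rle_trans; [apply HS; lra|]. right. field. lra.
  - split; [exact C|]. unfold Kpow. rewrite (improper_RInt_gen (kf beta x) l C I).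
    split; auto. eapply Rle_trans; [exact N|]. right. field. lra.
Qed.

Lemma Kpow_plus beta x y : 0 < beta <= 1 -> Kpow beta (plus x y) = plus (Kpow beta x) (Kpow beta y).
Proof.
  intros Hb. destruct (Kpow_spec beta x Hb) as (C1 & I1 & _). destruct (Kpow_spec beta y Hb) as (C2 & I2 & _).
  destruct (Kpow_spec beta (plus x y) Hb) as (C3 & I3 & _).
  apply (improper_unique (kf beta (plus x y))); auto.
  intros e He. destruct (improper_plus _ _ _ _ C1 C2 I1 I2 e He) as (a & b & Ha & Hab & H).
  exists a, b. repeat split; auto. intros p q Hp Hq.
  rewrite (RInt_ext_on p q (kf beta (plus x y)) (fun t => plus (kf beta x t) (kf beta y t))); [apply H; auto|lra|].
  intros t Ht. unfold kf. rewrite (lin_plus _ (sg_lin S C0 t ltac:(lra))). vec.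
Qed.

Lemma Kpow_lin_op (L : real_space X -> real_space X) beta x : bounded_linear L ->
  (forall t y, 0 <= t -> L (S t y) = S t (L y)) -> 0 < beta <= 1 -> L (Kpow beta x) = Kpow beta (L x).
Proof.
  intros HL HC Hb. destruct (Kpow_spec beta x Hb) as (C1 & I1 & _). destruct (Kpow_spec beta (L x) Hb) as (C2 & I2 & _).
  destruct (lin_bound _ HL) as [b [Hb0 Bb]].
  apply (improper_unique (kf beta (L x))); auto.
  intros e He. destruct (improper_lin L b _ _ (lin_plus _ HL) (fun r z => lin_scal _ HL r z) Bb C1 I1 e He) as (p & q & Hp & Hpq & H).
  exists p, q. repeat split; auto. intros u v Hu Hv.
  rewrite (RInt_ext_on u v (kf beta (L x)) (fun t => L (kf beta x t))); [apply H; auto|lra|].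
  intros t Ht. unfold kf. rewrite (lin_scal _ HL), HC by lra. reflexivity.
Qed.

Lemma scal_bounded_linear (r : R) : bounded_linear (fun x : real_space X => scal r x).
Proof.
  assert (p1 : forall x y, scal r (plus x y) = plus (scal r x) (scal r y)) by (intros; vec).
  assert (p2 : forall c x, scal r (cscal c x) = cscal c (scal r x)) by (intros; rewrite cscal_scal; auto).
  apply (Build_is_linear (K := C_AbsRing) (U := X) (V := X)); [exact p1|exact p2|].
  exists (Rabs r + 1). split; [generalize (Rabs_pos r); lra|].
  assert (p3 : forall x, norm (scal r x) <= (Rabs r + 1) * norm x).
  { intros x. eapply Rle_trans; [apply norm_scalR|]. apply Rmult_le_compat_r; [apply norm_ge_0|lra]. }
  exact p3.
Qed.

Lemma Kpow_scal beta r x : 0 < beta <= 1 -> Kpow beta (scal r x) = scal r (Kpow beta x).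
Proof.
  intros Hb. symmetry. apply (Kpow_lin_op (fun z => scal r z)); auto using scal_bounded_linear.
  intros t y Ht. rewrite (lin_scal _ (sg_lin S C0 t Ht)). reflexivity.
Qed.

Lemma Kpow_sg beta t x : 0 < beta <= 1 -> 0 <= t -> S t (Kpow beta x) = Kpow beta (S t x).
Proof.
  intros Hb Ht. apply Kpow_lin_op; auto using sg_lin.
  intros r y Hr. rewrite <- !(sg_plus S C0) by auto. f_equal. ring.
Qed.

(** Formally K_(1-beta) K_beta x is the double integral of t^(-beta) r^(beta-1) S(t + r)x.
    Substituting r = t v gives this integrand in v and t; integration over t first yields Jx/(1 +
    v), and the integral of v^(beta-1)/(1 + v) is left. *)
Definition Tf (beta : R) (x : real_space X) (t v : R) : real_space X := scal (Rpower v (beta - 1)) (S (t * (1 + v)) x).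

Lemma orbit_scale_cont (c : R) x a b : 0 <= a -> 0 <= c -> cont_on a b (fun t => S (t * c) x).
Proof.
  intros Ha Hc t It. unfold itv in It. assert (0 <= t * c) by nra.
  intros e He. destruct (sg_cont S C0 x (t * c) H e He) as [d [Hd D]].
  exists (d / (c + 1)). split; [apply Rdiv_lt_0_compat; lra|].
  intros r Hr Hrt. unfold itv in Hr. apply D; [nra|].
  replace (r * c - t * c) with ((r - t) * c) by ring. rewrite Rabs_mult, (Rabs_right c) by lra.
  apply Rmult_lt_compat_r with (r := c + 1) in Hrt; [|lra].
  replace (d / (c + 1) * (c + 1)) with d in Hrt by (field; lra). generalize (Rabs_pos (r - t)); nra.
Qed.

Lemma Tf_cont beta x t a b : 0 < a -> 0 <= t -> cont_on a b (Tf beta x t).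
Proof.
  intros Ha Ht. apply cont_on_ext with (fun v => scal (Rpower v (beta - 1)) (S (v * t) (S t x))).
  - intros v Hv. unfold Tf. rewrite <- (sg_plus S C0) by nra. do 2 f_equal. ring.
  - intros v Iv. apply contn_in_scal; [apply Rpower_cont; auto|]. apply orbit_scale_cont; auto; lra.
Qed.

(* [int_a^b S(t(1+v))x dt], since [-S(.)Jx] is an antiderivative of [S(.)x]. *)
Lemma orbit_integral x a b v : 0 <= a -> a <= b -> 0 <= v ->
  RInt (fun t => S (t * (1 + v)) x) a b = scal (/ (1 + v)) (minus (S (a * (1 + v)) (J x)) (S (b * (1 + v)) (J x))).
Proof.
  intros Ha Hab Hv.
  assert (D : forall t, itv a b t -> deriv_in (itv a b) (fun t => scal (- / (1 + v)) (S (t * (1 + v)) (J x))) t (S (t * (1 + v)) x)).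
  { intros t It. unfold itv in It.
    replace (S (t * (1 + v)) x) with (scal (- / (1 + v)) (scal (1 + v) (opp (S (t * (1 + v)) x)))) by (vec_with ltac:(real_eq; field; lra)).
    apply (deriv_in_lin (V := real_space X) (W := real_space X)) with (L := fun y => scal (- / (1 + v)) y) (M := Rabs (- / (1 + v))).
    - intros; vec.
    - intros; vec.
    - intros; apply norm_scalR.
    - apply (deriv_in_comp_scale (V := real_space X) (fun r => 0 <= r) (itv a b) (fun r => S r (J x)) (1 + v) t); [unfold itv; intros; nra|]. apply J_deriv. nra. }
  rewrite <- (ftc_in a b (fun t => scal (- / (1 + v)) (S (t * (1 + v)) (J x)))); auto.
  - vec.
  - intros t It. eapply deriv_contn. apply D; auto.
  - apply orbit_scale_cont; auto; lra.
  - intros t It. apply D. unfold itv; lra.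
Qed.

Lemma Tf_equicont beta x a b e0 V0 : 0 < a -> a <= b -> 0 < e0 -> e0 <= V0 ->
  equicont_snd e0 V0 a b (fun v t => Tf beta x t v) /\ equicont_snd a b e0 V0 (fun t v => Tf beta x t v).
Proof.
  intros Ha Hab He0 HeV.
  assert (U : forall e, 0 < e -> exists d, 0 < d /\ forall r r', 0 <= r -> 0 <= r' -> r <= b * (1 + V0) -> Rabs (r' - r) < d -> norm (minus (S r' x) (S r x)) <= e).
  { intros e He. destruct (uniform_cont (V := real_space X) (fun r => Sp S r x) 0 (b * (1 + V0)) (fun t => Sp_cont S C0 x t) e He) as [d [Hd D]].
    exists d. split; auto. intros r r' Hr Hr' Hb' Hrr. rewrite <- !(Sp_eq S) by auto. apply D; auto. unfold itv; lra. }
  assert (Rb : exists m, 0 <= m /\ forall v, e0 <= v <= V0 -> Rpower v (beta - 1) <= m).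
  { assert (C := Rpower_cont (beta - 1) e0 V0 He0).
    destruct (continuity_ab_maj (fun v => Rpower v (beta - 1)) e0 V0 HeV) as [m [Hm _]].
    - intros v Hv. apply continuity_pt_filterlim. apply (ex_derive_continuous (fun t => Rpower t (beta - 1))). unfold Rpower. auto_derive. lra.
    - exists (Rpower m (beta - 1)). split; [apply Rlt_le, exp_pos|auto]. }
  destruct Rb as [m [Hm Bm]].
  assert (nx := norm_ge_0 x).
  assert (Vp : 0 < 1 + V0) by lra. assert (bp : 0 < b) by lra.
  split.
  - intros t It e He. unfold itv in *.
    destruct (U (e / (m + 1))) as [d [Hd D]]; [apply Rdiv_lt_0_compat; lra|].
    exists (d / (1 + V0)). split; [apply Rdiv_lt_0_compat; lra|].
    intros t' It' Htt v Iv. unfold Tf.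
    replace (minus _ _) with (scal (Rpower v (beta - 1)) (minus (S (t' * (1 + v)) x) (S (t * (1 + v)) x))) by vec.
    apply Rle_trans with (m * (e / (m + 1))).
    + apply norm_scal_bound.
      * rewrite Rabs_right by (apply Rle_ge, Rlt_le, exp_pos). auto.
      * apply D; try nra. replace (t' * (1 + v) - t * (1 + v)) with ((t' - t) * (1 + v)) by ring.
        rewrite Rabs_mult, (Rabs_right (1 + v)) by lra.
        apply Rmult_lt_compat_r with (r := 1 + V0) in Htt; auto.
        replace (d / (1 + V0) * (1 + V0)) with d in Htt by (field; lra). generalize (Rabs_pos (t' - t)); nra.
    + apply Rle_trans with ((m + 1) * (e / (m + 1))); [|right; field; lra].
      apply Rmult_le_compat_r; [apply Rlt_le, Rdiv_lt_0_compat; lra|lra].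
  - intros v Iv e He.
    set (B := M * norm x + 1). assert (HB : 0 < B) by (unfold B; nra).
    destruct (U (e / 2 / (m + 1))) as [d [Hd D]]; [repeat apply Rdiv_lt_0_compat; lra|].
    destruct (Rpower_cont (beta - 1) e0 V0 He0 v Iv (e / 2 / B)) as [d2 [Hd2 D2]]; [repeat apply Rdiv_lt_0_compat; lra|].
    exists (Rmin (d / b) d2). split; [apply Rmin_glb_lt; auto; apply Rdiv_lt_0_compat; lra|].
    intros v' Iv' Hvv t It.
    assert (h1 : Rabs (v' - v) < d / b) by (eapply Rlt_le_trans; [exact Hvv|apply Rmin_l]).
    assert (h2 : Rabs (v' - v) < d2) by (eapply Rlt_le_trans; [exact Hvv|apply Rmin_r]).
    specialize (D2 v' Iv' h2). change (Rabs (Rpower v' (beta - 1) - Rpower v (beta - 1)) <= e / 2 / B) in D2.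
    unfold itv in *.
    apply Rle_trans with (m * (e / 2 / (m + 1)) + e / 2 / B * (M * norm x)).
    + apply norm_le_plus with (scal (Rpower v' (beta - 1)) (minus (S (t * (1 + v')) x) (S (t * (1 + v)) x)))
         (scal (Rpower v' (beta - 1) - Rpower v (beta - 1)) (S (t * (1 + v)) x)); [unfold Tf; vec| |].
      * apply norm_scal_bound; [rewrite Rabs_right by (apply Rle_ge, Rlt_le, exp_pos); auto|].
        apply D; try nra. replace (t * (1 + v') - t * (1 + v)) with ((v' - v) * t) by ring.
        rewrite Rabs_mult, (Rabs_right t) by lra.
        apply Rmult_lt_compat_r with (r := b) in h1; auto.
        replace (d / b * b) with d in h1 by (field; lra). generalize (Rabs_pos (v' - v)); nra.
      * apply norm_scal_bound; auto. apply sg_norm_M. nra.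
    + assert (m * (e / 2 / (m + 1)) <= e / 2).
      { apply Rle_trans with ((m + 1) * (e / 2 / (m + 1))); [|right; field; lra].
        apply Rmult_le_compat_r; [apply Rlt_le; repeat apply Rdiv_lt_0_compat; lra|lra]. }
      assert (e / 2 / B * (M * norm x) <= e / 2).
      { apply Rle_trans with (e / 2 / B * B); [|right; field; lra].
        apply Rmult_le_compat_l; [apply Rlt_le; repeat apply Rdiv_lt_0_compat; lra|unfold B; lra]. }
      lra.
Qed.

(** Its integral over (0, oo) is the constant of [product_formula]. Written with [scal], it is an
    instance of the integrands in [improper_orbit]. *)
Definition bker (beta v : R) : R := scal (Rpower v (beta - 1)) (/ (1 + v)).

Lemma bker_cont beta : cont_pos (V := R_CompleteNormedModule) (bker beta).
Proof.
  intros a b Ha Hab v Iv. unfold itv in Iv. apply contn_in_real.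
  apply (ex_derive_continuous (fun v => Rpower v (beta - 1) * / (1 + v))). unfold Rpower. auto_derive. repeat split; lra.
Qed.

Lemma Tf_double_integral beta x a b e0 V0 : 0 < a -> a <= b -> 0 < e0 -> e0 <= V0 ->
  cont_on a b (fun t => RInt (Tf beta x t) e0 V0) /\
  RInt (fun t => RInt (Tf beta x t) e0 V0) a b =
  RInt (fun v => scal (bker beta v) (minus (S (a * (1 + v)) (J x)) (S (b * (1 + v)) (J x)))) e0 V0.
Proof.
  intros Ha Hab He0 HeV. destruct (Tf_equicont beta x a b e0 V0) as [E1 E2]; auto.
  split.
  - apply (cont_on_RInt_param (V := real_space X) e0 V0 a b (fun v t => Tf beta x t v)); auto.
    intros t It. apply Tf_cont; auto. unfold itv in It; lra.
    etransitivity; [exact (RInt_swap_on (V := real_space X) e0 V0 a b (fun v t => Tf beta x t v) HeV Hab E1 E2)|].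
    apply RInt_ext_on; auto. intros v Hv. unfold Tf.
    rewrite RInt_scal_on; auto; [|apply orbit_scale_cont; auto; lra].
    rewrite orbit_integral by lra.
    transitivity (scal (Rpower v (beta - 1) * / (1 + v)) (minus (S (a * (1 + v)) (J x)) (S (b * (1 + v)) (J x)))); [vec|reflexivity].
Qed.

Lemma Rpower_deriv_pos p t : 0 < t -> is_derive (fun r => Rpower r p) t (p * Rpower t (p - 1)).
Proof.
  intros Ht. unfold Rpower. auto_derive; auto.
  replace ((p - 1) * ln t) with (p * ln t + - ln t) by ring. rewrite exp_plus, exp_Ropp, exp_ln by auto. field. lra.
Qed.

(** The error of cutting the inner integral down to [e0, V0], in a form integrable over t > 0. For
    the tail put theta = (1 + beta)/2 and y = 1 + t(1 + v); then y^2 >= (t v)^theta (1 + t)^(2 -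
    theta). As theta > beta the v-integral converges at infinity, and as theta < 1 the factor
    t^(-theta) is integrable at 0. *)
Lemma Theta_approx beta x t e0 V0 : 0 < beta < 1 -> 0 < t -> 0 < e0 -> e0 <= V0 ->
  norm (minus (scal (Rpower t (- beta)) (S t (Kpow beta x))) (RInt (Tf beta x t) e0 V0)) <=
  M * norm x * (Rpower e0 beta / beta * / ((1 + t) * (1 + t)) +
     2 / (1 - beta) * Rpower V0 (- ((1 - beta) / 2)) * (Rpower t (- ((1 + beta) / 2)) * Rpower (1 + t) ((1 + beta) / 2 - 2))).
Proof.
  intros Hb Ht He0 HeV. apply le_epsilon. intros eta Heta.
  set (th := (1 + beta) / 2).
  destruct (Kpow_spec beta x) as (C & I & _); [lra|].
  assert (Lt := sg_lin S C0 t ltac:(lra)). destruct (lin_bound _ Lt) as [m [Hm Bm]].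
  assert (nx := norm_ge_0 x). assert (Mx : 0 <= M * norm x) by nra.
  assert (tb : 0 < Rpower t (- beta)) by apply exp_pos.
  destruct (I (eta / (Rpower t (- beta) * m))) as (a0 & b0 & Ha0 & Hab0 & HI).
  { apply Rdiv_lt_0_compat; auto. apply Rmult_lt_0_compat; auto. }
  (* [p, q] is wide enough for the improper integral and contains [t e0, t V0], the image of
     [e0, V0] under r = t v. *)
  set (p := Rmin a0 (t * e0)). set (q := Rmax b0 (t * V0)).
  assert (te : 0 < t * e0) by nra.
  assert (Hp : 0 < p) by (unfold p; apply Rmin_glb_lt; auto).
  assert (p1 : p <= a0) by apply Rmin_l. assert (p2 : p <= t * e0) by apply Rmin_r.
  assert (q1 : b0 <= q) by apply Rmax_l. assert (q2 : t * V0 <= q) by apply Rmax_r.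
  assert (teV : t * e0 <= t * V0) by nra.
  assert (Sub : scal (Rpower t (- beta)) (S t (RInt (kf beta x) p q)) = RInt (Tf beta x t) (p / t) (q / t)).
  { rewrite (RInt_lin (V := real_space X) (W := real_space X) (S t) m p q (kf beta x)); auto; [|apply (lin_plus _ Lt)|intros; apply (lin_scal _ Lt)|lra|apply C; lra].
    rewrite <- RInt_scal_on; [|lra|].
    2: { intros r Ir. apply (contn_in_lin (V := real_space X) (W := real_space X)) with (L := S t) (M := m); auto.
         - intros; apply (lin_minus _ Lt).
         - apply (C p q); auto. lra. }
    set (h := fun r => scal (Rpower t (- beta)) (S t (kf beta x r)) : real_space X).
    assert (Ch : cont_on p q h).
    { intros r Ir. apply contn_in_scal; [apply (contn_in_const (V := R_CompleteNormedModule))|].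
      apply (contn_in_lin (V := real_space X) (W := real_space X)) with (L := S t) (M := m); auto.
      - intros; apply (lin_minus _ Lt).
      - apply (C p q); auto. lra. }
    change (RInt h p q = RInt (Tf beta x t) (p / t) (q / t)).
    replace (RInt h p q) with (RInt h (t * (p / t) + 0) (t * (q / t) + 0)) by (f_equal; field; lra).
    assert (Epq : p / t <= q / t) by (apply Rmult_le_compat_r; [apply Rlt_le, Rinv_0_lt_compat; auto|lra]).
    rewrite <- RInt_comp_lin.
    - apply RInt_ext_on; auto. intros v Hv. rewrite Rplus_0_r.
      assert (Hv0 : 0 < v) by (eapply Rlt_le_trans; [|apply Hv]; apply Rdiv_lt_0_compat; auto).
      unfold h, kf, Tf. rewrite (lin_scal _ Lt), <- (sg_plus S C0) by nra.
      rewrite Rpower_mult_base by auto.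
      replace (t * (1 + v)) with (t + t * v) by ring.
      assert (E : t * (Rpower t (- beta) * Rpower t (beta - 1)) = 1).
      { rewrite <- Rpower_plus. replace (- beta + (beta - 1)) with (Ropp 1) by ring.
        rewrite Rpower_Ropp, Rpower_1 by auto. field. lra. }
      transitivity (scal (t * (Rpower t (- beta) * Rpower t (beta - 1)) * Rpower v (beta - 1)) (S (t + t * v) x)).
      + vec.
      + rewrite E. vec.
    - replace (t * (p / t) + 0) with p by (field; lra). replace (t * (q / t) + 0) with q by (field; lra).
      apply ex_RInt_cont_on; auto. lra. }
  assert (pt : 0 < p / t) by (apply Rdiv_lt_0_compat; auto).
  assert (pe : p / t <= e0).
  { apply Rmult_le_reg_r with t; auto. replace (p / t * t) with p by (field; lra). lra. }
  assert (Vq : V0 <= q / t).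
  { apply Rmult_le_reg_r with t; auto. replace (q / t * t) with q by (field; lra). lra. }
  assert (Split : RInt (Tf beta x t) (p / t) (q / t) =
     plus (RInt (Tf beta x t) (p / t) e0) (plus (RInt (Tf beta x t) e0 V0) (RInt (Tf beta x t) V0 (q / t)))).
  { rewrite (RInt_Chasles_on (p / t) e0 (q / t)); [|lra|apply Tf_cont; lra].
    rewrite (RInt_Chasles_on e0 V0 (q / t)); [reflexivity|lra|apply Tf_cont; lra]. }
  assert (N1 : norm (RInt (Tf beta x t) (p / t) e0) <= M * norm x * (Rpower e0 beta / beta * / ((1 + t) * (1 + t)))).
  { set (w := / ((1 + t) * (1 + t))). assert (w0 : 0 < w) by (unfold w; apply Rinv_0_lt_compat; nra).
    set (G := fun v => M * norm x * w / beta * Rpower v beta).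
    apply Rle_trans with (G e0 - G (p / t)).
    - apply (RInt_norm_le_deriv _ G (fun v => M * norm x * w * Rpower v (beta - 1))); auto.
      + apply Tf_cont; lra.
      + intros v Hv. replace (M * norm x * w * Rpower v (beta - 1)) with (M * norm x * w / beta * (beta * Rpower v (beta - 1))) by (field; lra).
        apply (is_derive_scal (fun v => Rpower v beta)). apply Rpower_deriv_pos. lra.
      + intros v Hv. apply (ex_derive_continuous (fun v => M * norm x * w * Rpower v (beta - 1))). unfold Rpower. auto_derive. lra.
      + intros v Hv. unfold Tf. rewrite (Rmult_comm (M * norm x * w)). apply norm_scal_bound.
        * rewrite Rabs_right; [lra|]. apply Rle_ge, Rlt_le, exp_pos.
        * eapply Rle_trans; [apply HS; nra|].
          replace (M * norm x * w) with (M * w * norm x) by ring. apply Rmult_le_compat_r; auto.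
          apply Rmult_le_compat_l; [lra|]. unfold w. apply Rinv_le_contravar; [nra|].
          assert (1 + t <= 1 + t * (1 + v)) by nra. nra.
    - unfold G. assert (0 < Rpower (p / t) beta) by apply exp_pos.
      assert (0 <= M * norm x * w / beta * Rpower (p / t) beta).
      { repeat apply Rmult_le_pos; try lra. apply Rlt_le, Rinv_0_lt_compat; lra. }
      replace (M * norm x * (Rpower e0 beta / beta * w)) with (M * norm x * w / beta * Rpower e0 beta) by (field; lra). lra. }
  assert (N2 : norm (RInt (Tf beta x t) V0 (q / t)) <= M * norm x * (2 / (1 - beta) * Rpower V0 (- ((1 - beta) / 2)) * (Rpower t (- th) * Rpower (1 + t) (th - 2)))).
  { set (w := Rpower t (- th) * Rpower (1 + t) (th - 2)).
    assert (w0 : 0 < w) by (unfold w; apply Rmult_lt_0_compat; apply exp_pos).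
    set (de := (1 - beta) / 2). assert (dep : 0 < de) by (unfold de; lra).
    set (G := fun v => - (M * norm x * w / de) * Rpower v (- de)).
    apply Rle_trans with (G (q / t) - G V0).
    - apply (RInt_norm_le_deriv _ G (fun v => M * norm x * w * Rpower v (- de - 1))); auto.
      + apply Tf_cont; lra.
      + intros v Hv. replace (M * norm x * w * Rpower v (- de - 1)) with (- (M * norm x * w / de) * (- de * Rpower v (- de - 1))) by (field; lra).
        apply (is_derive_scal (fun v => Rpower v (- de))). apply Rpower_deriv_pos. lra.
      + intros v Hv. apply (ex_derive_continuous (fun v => M * norm x * w * Rpower v (- de - 1))). unfold Rpower. auto_derive. lra.
      + intros v Hv. unfold Tf.
        assert (vp : 0 < v) by lra.
        replace (M * norm x * w * Rpower v (- de - 1)) with (Rpower v (beta - 1) * (M * (Rpower v (- th) * w) * norm x)).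
        2: { replace (- de - 1) with ((beta - 1) + - th) by (unfold de, th; field). rewrite Rpower_plus. ring. }
        apply norm_scal_bound.
        * rewrite Rabs_right; [lra|]. apply Rle_ge, Rlt_le, exp_pos.
        * eapply Rle_trans; [apply HS; nra|]. apply Rmult_le_compat_r; auto.
          apply Rmult_le_compat_l; [lra|].
          assert (y1 : t * v <= 1 + t * (1 + v)) by nra. assert (y2 : 1 + t <= 1 + t * (1 + v)) by nra.
          assert (tv : 0 < t * v) by nra.
          set (y := 1 + t * (1 + v)) in *.
          assert (yp : 0 < y) by lra.
          replace (y * y) with (Rpower y th * Rpower y (2 - th)).
          2: { rewrite <- Rpower_plus. replace (th + (2 - th)) with (1 + 1) by ring. rewrite Rpower_plus, Rpower_1 by lra. ring. }
          replace (Rpower v (- th) * w) with (/ (Rpower (t * v) th * Rpower (1 + t) (2 - th))).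
          2: { unfold w. rewrite Rpower_mult_base by auto. rewrite !Rpower_Ropp.
               replace (th - 2) with (- (2 - th)) by ring. rewrite Rpower_Ropp.
               field. repeat split; apply Rgt_not_eq, exp_pos. }
          apply Rinv_le_contravar; [apply Rmult_lt_0_compat; apply exp_pos|].
          apply Rmult_le_compat; try (apply Rlt_le, exp_pos); apply Rle_Rpower_l; unfold th in *; lra.
    - unfold G. assert (0 < Rpower (q / t) (- de)) by apply exp_pos.
      assert (0 <= M * norm x * w / de * Rpower (q / t) (- de)).
      { apply Rmult_le_pos; [|lra]. apply Rmult_le_pos; [apply Rmult_le_pos; lra|apply Rlt_le, Rinv_0_lt_compat; lra]. }
      replace (M * norm x * (2 / (1 - beta) * Rpower V0 (- de) * w)) with (M * norm x * w / de * Rpower V0 (- de)) by (unfold de; field; lra). lra. }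
  assert (N3 : norm (minus (scal (Rpower t (- beta)) (S t (Kpow beta x))) (scal (Rpower t (- beta)) (S t (RInt (kf beta x) p q)))) <= eta).
  { replace (minus _ _) with (scal (Rpower t (- beta)) (S t (minus (Kpow beta x) (RInt (kf beta x) p q)))).
    2: { rewrite (lin_minus _ Lt). vec. }
    apply Rle_trans with (Rpower t (- beta) * (m * (eta / (Rpower t (- beta) * m)))); [|right; field; lra].
    apply norm_scal_bound; [rewrite Rabs_right; lra|]. eapply Rle_trans; [apply Bm|].
    apply Rmult_le_compat_l; [lra|]. rewrite norm_minus_sym. apply HI; lra. }
  rewrite Sub, Split in N3. fold th.
  rewrite Rmult_plus_distr_l, Rplus_comm.
  eapply norm_le_plus; [|exact N3|eapply norm_le_plus; [reflexivity|exact N1|exact N2]]. vec.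
Qed.

End FracPower.

Lemma improper_pos (f : R -> R) l : cont_pos (V := R_CompleteNormedModule) f ->
  improper (V := R_CompleteNormedModule) f l -> (forall t, 0 < t -> continuous f t) -> (forall t, 0 < t -> 0 < f t) -> 0 < l.
Proof.
  intros C I Cf P.
  assert (low : 0 < RInt (V := R_CompleteNormedModule) f 1 2).
  { apply RInt_gt_0; [lra|intros; apply P; lra|intros; apply Cf; lra]. }
  set (c := RInt (V := R_CompleteNormedModule) f 1 2) in *.
  destruct (I (c / 2)) as (p & q & Hp & Hpq & HI); [lra|].
  set (p1 := Rmin p 1). set (q1 := Rmax q 2).
  assert (H : 0 < p1 <= p) by (unfold p1; split; [apply Rmin_glb_lt; lra|apply Rmin_l]).
  assert (p1 <= 1) by apply Rmin_r. assert (H1 : q <= q1) by apply Rmax_l. assert (2 <= q1) by apply Rmax_r.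
  assert (HI' := HI p1 q1 H H1).
  rewrite (RInt_Chasles_on (V := R_CompleteNormedModule) p1 1 q1 f) in HI'; [|lra|apply C; lra].
  rewrite (RInt_Chasles_on (V := R_CompleteNormedModule) 1 2 q1 f) in HI'; [|lra|apply C; lra].
  assert (g1 : 0 <= RInt (V := R_CompleteNormedModule) f p1 1).
  { apply RInt_ge_0; [lra|apply (ex_RInt_cont_on (V := R_CompleteNormedModule)); [lra|apply C; lra]|intros; left; apply P; lra]. }
  assert (g2 : 0 <= RInt (V := R_CompleteNormedModule) f 2 q1).
  { apply RInt_ge_0; [lra|apply (ex_RInt_cont_on (V := R_CompleteNormedModule)); [lra|apply C; lra]|intros; left; apply P; lra]. }
  change (Rabs (RInt (V := R_CompleteNormedModule) f p1 1 + (c + RInt (V := R_CompleteNormedModule) f 2 q1) - l) <= c / 2) in HI'.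
  apply Rnot_le_lt. intros L. rewrite Rabs_right in HI' by lra. lra.
Qed.

Lemma Rpower_small p y : 0 < p -> 0 < y -> exists e, 0 < e /\ forall t, 0 < t <= e -> Rpower t p <= y.
Proof.
  intros Hp Hy. exists (Rpower y (/ p)). split; [apply exp_pos|]. intros t Ht.
  apply Rle_trans with (Rpower (Rpower y (/ p)) p).
  - apply Rle_Rpower_l; lra.
  - rewrite Rpower_mult, Rinv_l, Rpower_1; lra.
Qed.

(** * Products of complementary powers and smoothing in V *)

Section Product.
Context {X : CompleteNormedModule C_AbsRing}.
Variables (S : R -> real_space X -> real_space X) (J : real_space X -> real_space X) (M : R).
Hypothesis C0 : C0_semigroup S.
Hypothesis HM : 1 <= M.
Hypothesis HS : forall t x, 0 <= t -> norm (S t x) <= M / ((1 + t) * (1 + t)) * norm x.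
Hypothesis J_inj : forall x, J x = zero -> x = zero.
Hypothesis J_deriv : forall x t, 0 <= t -> deriv_in (fun r => 0 <= r) (fun r => S r (J x)) t (opp (S t x)).
Hypothesis orbit : forall t x, 0 < t -> exists y, J y = S t x /\ forall r, 0 <= r -> norm (S r y) <= M / (t + r) * norm x.
Implicit Types x y : real_space X.

(** The bound is uniform in a and b, so e0 and V0 can be fixed before a tends to 0 and b to
    infinity. The last factor 2/(1 - beta) is 1/(1 - theta), the total integral of t^(-theta) (1 +
    t)^(theta - 2). *)
Lemma Theta_integral_approx beta x a b e0 V0 : 0 < beta < 1 -> 0 < a -> a <= b -> 0 < e0 -> e0 <= V0 ->
  norm (minus (RInt (kf S (1 - beta) (Kpow S beta x)) a b) (RInt (fun t => RInt (Tf S beta x t) e0 V0) a b)) <=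
  M * norm x * (Rpower e0 beta / beta + 2 / (1 - beta) * Rpower V0 (- ((1 - beta) / 2)) * (2 / (1 - beta))).
Proof.
  intros Hb Ha Hab He0 HeV.
  destruct (Tf_double_integral S J M C0 HM HS J_deriv beta x a b e0 V0) as [CT _]; auto.
  destruct (Kpow_spec S M C0 HM HS (1 - beta) (Kpow S beta x)) as (CK & _ & _); [lra|].
  rewrite <- RInt_minus_on; auto.
  assert (nx := norm_ge_0 x). assert (Mx : 0 <= M * norm x) by nra.
  set (th := (1 + beta) / 2). set (c1 := Rpower e0 beta / beta). set (c2 := 2 / (1 - beta) * Rpower V0 (- ((1 - beta) / 2))).
  assert (c1p : 0 <= c1) by (apply Rlt_le, Rdiv_lt_0_compat; [apply exp_pos|lra]).
  assert (c2p : 0 <= c2) by (apply Rmult_le_pos; [apply Rlt_le, Rdiv_lt_0_compat; lra|apply Rlt_le, exp_pos]).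
  set (G := fun t => M * norm x * (c1 * - / (1 + t) + c2 * (exp ((1 - th) * (ln t - ln (1 + t))) / (1 - th)))).
  set (g := fun t => M * norm x * (c1 * / ((1 + t) * (1 + t)) + c2 * (exp ((1 - th) * (ln t - ln (1 + t))) * (/ t - / (1 + t))))).
  assert (th1 : 0 < 1 - th) by (unfold th; lra).
  apply Rle_trans with (G b - G a).
  - apply (RInt_norm_le_deriv _ G g); auto.
    + intros t It. apply contn_in_minus; [apply (CK a b); auto|apply CT; auto].
    + intros t Ht. unfold G, g. auto_derive; [lra|]. unfold Rminus in *. field. repeat split; lra.
    + intros t Ht. apply (ex_derive_continuous g). unfold g. auto_derive. repeat split; try lra; nra.
    + intros t Ht. assert (tp : 0 < t) by lra.
      assert (K := Theta_approx S M C0 HM HS beta x t e0 V0 Hb tp He0 HeV). fold th c1 c2 in K.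
      assert (E : kf S (1 - beta) (Kpow S beta x) t = scal (Rpower t (- beta)) (S t (Kpow S beta x))).
      { unfold kf. do 2 f_equal. ring. }
      rewrite E. eapply Rle_trans; [exact K|]. right. unfold g. do 3 f_equal.
      assert (E2 : exp ((1 - th) * (ln t - ln (1 + t))) * (/ t - / (1 + t)) = Rpower t (- th) * Rpower (1 + t) (th - 2)).
      { replace (/ t - / (1 + t)) with (/ t * / (1 + t)) by (field; lra).
        assert (i1 : / t = exp (- ln t)) by (rewrite exp_Ropp, exp_ln; auto).
        assert (i2 : / (1 + t) = exp (- ln (1 + t))) by (rewrite exp_Ropp, exp_ln; auto; lra).
        rewrite i1, i2. unfold Rpower. rewrite <- !exp_plus. f_equal. ring. }
      rewrite E2. reflexivity.
  - unfold G. rewrite <- Rmult_minus_distr_l. apply Rmult_le_compat_l; auto.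
    assert (i1 : 0 < / (1 + b)) by (apply Rinv_0_lt_compat; lra).
    assert (i2 : / (1 + a) <= 1) by (rewrite <- Rinv_1; apply Rinv_le_contravar; lra).
    assert (ex1 : exp ((1 - th) * (ln b - ln (1 + b))) <= 1).
    { assert (ln b <= ln (1 + b)) by (apply Rcomplements.ln_le; lra).
      replace ((1 - th) * (ln b - ln (1 + b))) with (- ((1 - th) * (ln (1 + b) - ln b))) by ring. apply exp_neg_le1. nra. }
    assert (ex0 := exp_pos ((1 - th) * (ln a - ln (1 + a)))).
    set (eb := exp ((1 - th) * (ln b - ln (1 + b)))) in *. set (ea := exp ((1 - th) * (ln a - ln (1 + a)))) in *.
    assert (D : (eb - ea) / (1 - th) <= 2 / (1 - beta)).
    { replace (2 / (1 - beta)) with (1 / (1 - th)) by (unfold th; field; lra).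
      apply Rmult_le_compat_r; [apply Rlt_le, Rinv_0_lt_compat; lra|lra]. }
    assert (c2 * ((eb - ea) / (1 - th)) <= c2 * (2 / (1 - beta))) by (apply Rmult_le_compat_l; auto).
    replace (c2 * (eb / (1 - th)) ) with (c2 * ((eb - ea) / (1 - th)) + c2 * (ea / (1 - th))) by (field; lra).
    assert (c1 * - / (1 + b) <= 0) by nra. assert (c1 * / (1 + a) <= c1 * 1) by (apply Rmult_le_compat_l; auto). nra.
Qed.

(** The limits are taken in two stages. First e0 and V0 make the truncation error small; then a and
    b are chosen depending on V0, so that the t-integrals are close to Jx/(1 + v) uniformly for v in
    [e0, V0]. *)
Lemma product_formula beta : 0 < beta < 1 -> exists B, 0 < B /\
  forall x, Kpow S (1 - beta) (Kpow S beta x) = scal B (J x).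
Proof.
  intros Hb.
  destruct (improper_orbit (V := R_CompleteNormedModule) (fun v => / (1 + v)) beta 1 1) as [B [IB _]]; try lra.
  - intros a b Ha Hab v Iv. unfold itv in Iv. apply contn_in_real.
    apply (ex_derive_continuous (fun v => / (1 + v))). auto_derive. lra.
  - intros r Hr. change (Rabs (/ (1 + r)) <= 1 / (1 + r)).
    rewrite Rabs_right by (apply Rle_ge, Rlt_le, Rinv_0_lt_compat; lra). lra.
  - assert (Bp : 0 < B).
    { apply (improper_pos (bker beta)); auto.
      - apply bker_cont.
      - intros t Ht. apply (ex_derive_continuous (fun v => Rpower v (beta - 1) * / (1 + v))). unfold Rpower. auto_derive. repeat split; lra.
      - intros t Ht. apply Rmult_lt_0_compat; [apply exp_pos|apply Rinv_0_lt_compat; lra]. }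
    exists B. split; auto. intros x.
    apply norm_minus_eq0. intros eta Heta.
    assert (nx := norm_ge_0 x). assert (Mx : 0 <= M * norm x) by nra.
    assert (nJ := norm_ge_0 (J x)).
    set (k1 := 2 / (1 - beta) * (2 / (1 - beta))).
    assert (k1p : 0 < k1) by (unfold k1; apply Rmult_lt_0_compat; apply Rdiv_lt_0_compat; lra).
    destruct (Rpower_small beta (eta / 10 * beta / (M * norm x + 1))) as [e1 [He1 Pe1]]; [lra| |].
    { apply Rdiv_lt_0_compat; [apply Rmult_lt_0_compat; lra|lra]. }
    destruct (Rpower_small ((1 - beta) / 2) (eta / 10 / k1 / (M * norm x + 1))) as [e2 [He2 Pe2]]; [lra| |].
    { repeat apply Rdiv_lt_0_compat; lra. }
    destruct (IB (eta / 10 / (norm (J x) + 1))) as (ea & eb & Hea & Heab & HIB); [repeat apply Rdiv_lt_0_compat; lra|].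
    set (e0 := Rmin ea e1). set (V0 := Rmax (Rmax eb (/ e2)) e0).
    assert (e0p : 0 < e0) by (unfold e0; apply Rmin_glb_lt; auto).
    assert (e0a : e0 <= ea) by apply Rmin_l. assert (e01 : e0 <= e1) by apply Rmin_r.
    assert (V0e : e0 <= V0) by apply Rmax_r.
    assert (V0b : eb <= V0) by (eapply Rle_trans; [apply Rmax_l|apply Rmax_l]).
    assert (V02 : / e2 <= V0) by (eapply Rle_trans; [apply Rmax_r|apply Rmax_l]).
    assert (HB := HIB e0 V0 (conj e0p e0a) V0b). fold (bker beta) in HB.
    change (Rabs (RInt (V := R_CompleteNormedModule) (bker beta) e0 V0 - B) <= eta / 10 / (norm (J x) + 1)) in HB.
    set (BeV := RInt (V := R_CompleteNormedModule) (bker beta) e0 V0) in *.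
    assert (Err : M * norm x * (Rpower e0 beta / beta + 2 / (1 - beta) * Rpower V0 (- ((1 - beta) / 2)) * (2 / (1 - beta))) <= eta / 5).
    { specialize (Pe1 e0 (conj e0p e01)).
      assert (iV : 0 < / V0 <= e2).
      { split; [apply Rinv_0_lt_compat; lra|]. rewrite <- (Rinv_inv e2). apply Rinv_le_contravar; auto. apply Rinv_0_lt_compat; auto. }
      specialize (Pe2 (/ V0) iV).
      replace (Rpower (/ V0) ((1 - beta) / 2)) with (Rpower V0 (- ((1 - beta) / 2))) in Pe2.
      2: { unfold Rpower. rewrite ln_Rinv by lra. f_equal. ring. }
      set (y1 := Rpower e0 beta) in *. set (y2 := Rpower V0 (- ((1 - beta) / 2))) in *.
      assert (u1 : y1 / beta * (M * norm x + 1) <= eta / 10).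
      { apply Rle_trans with (eta / 10 * beta / (M * norm x + 1) / beta * (M * norm x + 1)); [|right; field; lra].
        apply Rmult_le_compat_r; [lra|]. apply Rmult_le_compat_r; [apply Rlt_le, Rinv_0_lt_compat; lra|auto]. }
      assert (u2 : k1 * y2 * (M * norm x + 1) <= eta / 10).
      { apply Rle_trans with (k1 * (eta / 10 / k1 / (M * norm x + 1)) * (M * norm x + 1)); [|right; field; lra].
        apply Rmult_le_compat_r; [lra|]. apply Rmult_le_compat_l; lra. }
      replace (2 / (1 - beta) * y2 * (2 / (1 - beta))) with (k1 * y2) by (unfold k1; ring).
      assert (0 < y1 / beta) by (apply Rdiv_lt_0_compat; [apply exp_pos|lra]).
      assert (0 < k1 * y2) by (apply Rmult_lt_0_compat; [auto|apply exp_pos]).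
      nra. }
    assert (BeVp : 0 <= BeV).
    { apply RInt_ge_0; auto; [apply (ex_RInt_cont_on (V := R_CompleteNormedModule)); auto; apply bker_cont; auto|].
      intros v Hv. apply Rlt_le, Rmult_lt_0_compat; [apply exp_pos|apply Rinv_0_lt_compat; lra]. }
    set (z := eta / 10 / (BeV + 1)). assert (zp : 0 < z) by (unfold z; repeat apply Rdiv_lt_0_compat; lra).
    destruct (Kpow_spec S M C0 HM HS (1 - beta) (Kpow S beta x)) as (CK & IK & _); [lra|].
    destruct (IK (eta / 5)) as (a0 & b0 & Ha0 & Hab0 & HIK); [lra|].
    destruct (sg_right_limit S C0 (J x) z zp) as [d [Hd Dd]].
    (* For v <= V0 one has a(1 + v) <= d/2, so S(a(1 + v))Jx is z-close to Jx. The bound on b makes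
       S(b(1 + v))Jx at most z, by the decay of S. *)
    set (a := Rmin a0 (d / 2 / (1 + V0))). set (b := Rmax b0 (M * (norm (J x) + 1) / z)).
    assert (V1 : 0 < 1 + V0) by lra.
    assert (ap : 0 < a) by (unfold a; apply Rmin_glb_lt; auto; repeat apply Rdiv_lt_0_compat; lra).
    assert (a1 : a <= a0) by apply Rmin_l. assert (a2 : a <= d / 2 / (1 + V0)) by apply Rmin_r.
    assert (b1 : b0 <= b) by apply Rmax_l. assert (b2 : M * (norm (J x) + 1) / z <= b) by apply Rmax_r.
    assert (ab : a <= b) by lra. assert (bp : 0 < b) by lra.
    specialize (HIK a b (conj ap a1) b1).
    assert (TA := Theta_integral_approx beta x a b e0 V0 Hb ap ab e0p V0e).
    destruct (Tf_double_integral S J M C0 HM HS J_deriv beta x a b e0 V0) as [CT ET]; auto.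
    rewrite ET in TA.
    set (I2 := RInt (fun v => scal (bker beta v) (minus (S (a * (1 + v)) (J x)) (S (b * (1 + v)) (J x)))) e0 V0) in *.
    assert (CS : forall w, 0 <= w -> cont_on e0 V0 (fun v => S (w * (1 + v)) (J x))).
    { intros w Hw. apply cont_on_ext with (fun v => S (v * w) (S w (J x))).
      - intros v Hv. rewrite <- (sg_plus S C0) by nra. f_equal. ring.
      - apply orbit_scale_cont; auto; lra. }
    assert (Cb : cont_on (V := R_CompleteNormedModule) e0 V0 (bker beta)) by (apply bker_cont; auto).
    assert (C1 : cont_on e0 V0 (fun v => scal (bker beta v) (minus (S (a * (1 + v)) (J x)) (S (b * (1 + v)) (J x))))).
    { intros v Iv. apply contn_in_scal; [apply Cb; auto|]. apply contn_in_minus; apply CS; auto; lra. }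
    assert (C2 : cont_on e0 V0 (fun v => scal (bker beta v) (J x))).
    { intros v Iv. apply contn_in_scal; [apply Cb; auto|apply contn_in_const]. }
    assert (I3 : norm (minus I2 (scal BeV (J x))) <= 2 * z * BeV).
    { unfold BeV, I2. rewrite <- RInt_scal_vec by auto. rewrite <- RInt_minus_on; auto.
      apply (norm_RInt_le (V := CompleteNormedModule.NormedModule R_AbsRing (real_space X)) (fun v => minus (scal (bker beta v) (minus (S (a * (1 + v)) (J x)) (S (b * (1 + v)) (J x)))) (scal (bker beta v) (J x)))
               (fun v => scal (2 * z) (bker beta v)) e0 V0); auto.
      - intros v Hv.
        replace (minus _ _) with (scal (bker beta v) (minus (minus (S (a * (1 + v)) (J x)) (J x)) (S (b * (1 + v)) (J x)))) by vec.
        assert (bv : 0 < bker beta v) by (apply Rmult_lt_0_compat; [apply exp_pos|apply Rinv_0_lt_compat; lra]).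
        change (norm (scal (bker beta v) (minus (minus (S (a * (1 + v)) (J x)) (J x)) (S (b * (1 + v)) (J x)))) <= 2 * z * bker beta v).
        rewrite (Rmult_comm (2 * z)). apply norm_scal_bound; [rewrite Rabs_right; lra|].
        replace (2 * z) with (z + z) by ring.
        apply norm_le_plus with (minus (S (a * (1 + v)) (J x)) (J x)) (opp (S (b * (1 + v)) (J x))); [vec| |].
        + apply Dd. split; [nra|]. apply Rle_lt_trans with (d / 2 / (1 + V0) * (1 + V0)).
          * apply Rmult_le_compat; try lra.
          * replace (d / 2 / (1 + V0) * (1 + V0)) with (d / 2) by (field; lra). lra.
        + rewrite norm_oppV. eapply Rle_trans; [apply HS; nra|].
          set (y := 1 + b * (1 + v)). assert (by1 : b <= y) by (unfold y; nra). assert (yp : 1 <= y) by (unfold y; nra).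
          apply Rmult_le_compat_r with (r := z) in b2; [|lra].
          replace (M * (norm (J x) + 1) / z * z) with (M * (norm (J x) + 1)) in b2 by (field; lra).
          apply Rmult_le_reg_r with (y * y); [nra|].
          replace (M / (y * y) * norm (J x) * (y * y)) with (M * norm (J x)) by (field; lra).
          assert (b * z <= y * z) by (apply Rmult_le_compat_r; lra).
          assert (y * z <= z * (y * y)) by (assert (0 <= z * y * (y - 1)) by (apply Rmult_le_pos; [apply Rmult_le_pos|]; lra); nra). nra.
      - apply RInt_correct. apply ex_RInt_cont_on; auto.
        intros v Iv. apply contn_in_minus; [apply C1; auto|apply C2; auto].
      - apply (is_RInt_scal (V := R_CompleteNormedModule)). apply (RInt_correct (V := R_CompleteNormedModule)). apply (ex_RInt_cont_on (V := R_CompleteNormedModule)); auto. }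
    assert (z2 : 2 * z * BeV <= eta / 5).
    { apply Rle_trans with (2 * z * (BeV + 1)); [nra|]. unfold z. right. field. lra. }
    assert (I4 : norm (minus (scal BeV (J x)) (scal B (J x))) <= eta / 10).
    { replace (minus _ _) with (scal (BeV - B) (J x)) by vec.
      apply Rle_trans with (eta / 10 / (norm (J x) + 1) * norm (J x)).
      - apply norm_scal_bound; [exact HB|lra].
      - apply Rle_trans with (eta / 10 / (norm (J x) + 1) * (norm (J x) + 1)); [|right; field; lra].
        apply Rmult_le_compat_l; [apply Rlt_le; repeat apply Rdiv_lt_0_compat; lra|lra]. }
    rewrite norm_minus_sym in HIK.
    apply Rle_trans with (eta / 5 + (eta / 5 + (eta / 5 + eta / 10))); [|lra].
    eapply norm_le_plus; [|exact HIK|].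
    2: { eapply norm_le_plus; [|eapply Rle_trans; [exact TA|exact Err]|].
         2: { eapply norm_le_plus; [reflexivity|eapply Rle_trans; [exact I3|exact z2]|exact I4]. }
         reflexivity. }
    vec.
Qed.

(** The error estimates below know A^(-alpha) only through such properties. For alpha = 0 it is the
    identity by definition and smoothing is mere boundedness. *)
Lemma frac_power_facts alpha : 0 <= alpha < 1 -> exists K, 1 <= K /\
  let P := neg_frac_pow S alpha in
  (forall x y, P (plus x y) = plus (P x) (P y)) /\ (forall r x, P (scal r x) = scal r (P x)) /\
  (forall x, norm (P x) <= K * norm x) /\ (forall x, P x = zero -> x = zero) /\
  (forall t x, 0 <= t -> S t (P x) = P (S t x)) /\
  (forall t x, 0 <= t -> norm (S t x) <= K * norm x) /\
  (forall t x, 0 < t -> exists w, P w = S t x /\ norm w <= K * Rpower t (- alpha) * norm x).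
Proof.
  intros Ha. unfold neg_frac_pow. destruct (Req_EM_T alpha 0) as [->|N].
  - exists M. cbv zeta. repeat split; auto.
    + intros x. generalize (norm_ge_0 x). nra.
    + apply (sg_norm_M S M HM HS).
    + intros t x Ht. exists (S t x). split; auto. rewrite Ropp_0, Rpower_O, Rmult_1_r by auto.
      apply (sg_norm_M S M HM HS). lra.
  - assert (Ha' : 0 < alpha < 1) by lra.
    assert (HG := Gamma_fun_pos alpha Ha'). set (Gm := Gamma_fun alpha) in *.
    change (exists K, 1 <= K /\ let P := fun x => scal (/ Gm) (Kpow S alpha x) in
      (forall x y, P (plus x y) = plus (P x) (P y)) /\ (forall r x, P (scal r x) = scal r (P x)) /\
      (forall x, norm (P x) <= K * norm x) /\ (forall x, P x = zero -> x = zero) /\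
      (forall t x, 0 <= t -> S t (P x) = P (S t x)) /\
      (forall t x, 0 <= t -> norm (S t x) <= K * norm x) /\
      (forall t x, 0 < t -> exists w, P w = S t x /\ norm w <= K * Rpower t (- alpha) * norm x)).
    (* Both orders are used: K_(1-alpha) K_alpha gives injectivity, and K_alpha K_(1-alpha) provides
       the preimage of S(t)x = J y. *)
    destruct (product_formula alpha Ha') as [B1 [HB1 E1]].
    destruct (product_formula (1 - alpha)) as [B2 [HB2 E2]]; [lra|].
    replace (1 - (1 - alpha)) with alpha in E2 by ring.
    set (k1 := Rabs (/ Gm) * (M / alpha)).
    set (k2 := Rabs (Gm / B2) * (M * (2 / (1 - alpha) + 2 / alpha))).
    assert (k1p : 0 <= k1).
    { apply Rmult_le_pos; [apply Rabs_pos|]. apply Rlt_le, Rdiv_lt_0_compat; lra. }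
    assert (p2 : 0 < 2 / (1 - alpha) + 2 / alpha).
    { assert (0 < 2 / (1 - alpha)) by (apply Rdiv_lt_0_compat; lra). assert (0 < 2 / alpha) by (apply Rdiv_lt_0_compat; lra). lra. }
    assert (k2p : 0 <= k2).
    { apply Rmult_le_pos; [apply Rabs_pos|]. apply Rmult_le_pos; lra. }
    exists (M + k1 + k2). split; [lra|]. cbv zeta.
    assert (Zero : forall b, 0 < b <= 1 -> Kpow S b zero = zero).
    { intros b Hb. transitivity (Kpow S b (scal 0 (zero : real_space X))); [f_equal; vec|].
      rewrite (Kpow_scal S M C0 HM HS) by auto. vec. }
    repeat split.
    + intros x y. rewrite (Kpow_plus S M C0 HM HS) by lra. vec.
    + intros r x. rewrite (Kpow_scal S M C0 HM HS) by lra. vec.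
    + intros x. destruct (Kpow_spec S M C0 HM HS alpha x) as (_ & _ & Nx); [lra|].
      apply Rle_trans with (k1 * norm x).
      * unfold k1. rewrite Rmult_assoc. apply norm_scal_bound; [lra|auto].
      * apply Rmult_le_compat_r; [apply norm_ge_0|lra].
    + intros x Ex. apply J_inj.
      assert (Kz : Kpow S alpha x = zero).
      { transitivity (scal Gm (scal (/ Gm) (Kpow S alpha x))); [vec_with ltac:(real_eq; field; auto)|]. rewrite Ex. vec. }
      transitivity (scal (/ B1) (scal B1 (J x))); [vec_with ltac:(real_eq; field; lra)|].
      rewrite <- E1, Kz, Zero by lra. vec.
    + intros t x Ht. rewrite (lin_scal _ (sg_lin S C0 t Ht)), (Kpow_sg S M C0 HM HS) by lra. reflexivity.
    + intros t x Ht. eapply Rle_trans; [apply (sg_norm_M S M HM HS); auto|].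
      apply Rmult_le_compat_r; [apply norm_ge_0|lra].
    + intros t x Ht. destruct (orbit t x Ht) as [y [Ey Ny]].
      exists (scal (Gm / B2) (Kpow S (1 - alpha) y)). split.
      * rewrite (Kpow_scal S M C0 HM HS), E2, Ey by lra. vec_with ltac:(real_eq; field; split; [lra|auto]).
      * assert (nx := norm_ge_0 x).
        destruct (improper_orbit (V := real_space X) (fun r => S r y) (1 - alpha) (M * norm x) t) as [l [Il Nl]]; try lra.
        -- nra.
        -- apply S_cont_pos; auto.
        -- intros r Hr. eapply Rle_trans; [apply Ny; lra|]. right. field. lra.
        -- destruct (Kpow_spec S M C0 HM HS (1 - alpha) y) as (_ & IK & _); [lra|].
           assert (El : Kpow S (1 - alpha) y = l) by (apply (improper_unique _ _ _ IK Il)).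
           rewrite El. replace (1 - alpha - 1) with (- alpha) in Nl by ring. replace (1 - (1 - alpha)) with alpha in Nl by ring.
           assert (tp : 0 < Rpower t (- alpha)) by apply exp_pos.
           apply Rle_trans with (k2 * Rpower t (- alpha) * norm x).
           ++ replace (k2 * Rpower t (- alpha) * norm x) with (Rabs (Gm / B2) * (M * norm x * (2 / (1 - alpha) + 2 / alpha) * Rpower t (- alpha))) by (unfold k2; ring).
              apply norm_scal_bound; [lra|auto].
           ++ apply Rmult_le_compat_r; auto. apply Rmult_le_compat_r; lra.
Qed.

End Product.

(** * Polynomial interpolation *)

Section Poly.
Context {V : CompleteNormedModule R_AbsRing}.
Implicit Types p q : R -> V.

(* Horner form; [is_poly d p] means that [p] has degree less than [d]. *)
Fixpoint is_poly (d : nat) (p : R -> V) : Prop :=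
  match d with
  | O => forall t, p t = zero
  | S d' => exists c q, is_poly d' q /\ forall t, p t = plus c (scal t (q t))
  end.

Lemma is_poly_ext d : forall p q, (forall t, p t = q t) -> is_poly d p -> is_poly d q.
Proof.
  destruct d; cbn; intros p q E.
  - intros H t. rewrite <- E. auto.
  - intros (c & r & Hr & H). exists c, r. split; auto. intros t. rewrite <- E. auto.
Qed.

Lemma is_poly_plus d : forall p q, is_poly d p -> is_poly d q -> is_poly d (fun t => plus (p t) (q t)).
Proof.
  induction d; cbn; intros p q.
  - intros H1 H2 t. rewrite H1, H2. vec.
  - intros (c & r & Hr & H1) (c' & r' & Hr' & H2). exists (plus c c'), (fun t => plus (r t) (r' t)).
    split; auto. intros t. rewrite H1, H2. vec.
Qed.

Lemma is_poly_scal d a : forall p, is_poly d p -> is_poly d (fun t => scal a (p t)).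
Proof.
  induction d; cbn; intros p.
  - intros H1 t. rewrite H1. vec.
  - intros (c & r & Hr & H1). exists (scal a c), (fun t => scal a (r t)).
    split; auto. intros t. rewrite H1. vec.
Qed.

Lemma is_poly_minus d p q : is_poly d p -> is_poly d q -> is_poly d (fun t => minus (p t) (q t)).
Proof.
  intros Hp Hq. apply is_poly_ext with (fun t => plus (p t) (scal (-1) (q t))); [intros; vec|].
  apply is_poly_plus; auto. apply is_poly_scal; auto.
Qed.

Lemma is_poly_S d : forall p, is_poly d p -> is_poly (S d) p.
Proof.
  induction d; intros p.
  - intros H. exists zero, (fun _ => zero). split; [cbn; auto|]. intros t. rewrite H. vec.
  - intros (c & r & Hr & H1). exists c, r. split; auto.
Qed.

Lemma is_poly_le d e p : (d <= e)%nat -> is_poly d p -> is_poly e p.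
Proof. induction 1; auto. intros. apply is_poly_S; auto. Qed.

Lemma is_poly_const (c : V) d : is_poly (S d) (fun _ => c).
Proof.
  apply is_poly_le with 1%nat; [lia|]. exists c, (fun _ => zero). split; [cbn; auto|]. intros; vec.
Qed.

Lemma is_poly_linear_mul d q a b : is_poly d q -> is_poly (S d) (fun t => scal (a * t + b) (q t)).
Proof.
  intros H. apply is_poly_ext with (fun t => plus (scal a (scal t (q t))) (scal b (q t))); [intros; vec|].
  apply is_poly_plus.
  - apply is_poly_scal. exists zero, q. split; auto. intros; vec.
  - apply is_poly_S, is_poly_scal; auto.
Qed.

Lemma is_poly_div d : forall p x, is_poly (S d) p ->
  exists q, is_poly d q /\ forall t, p t = plus (p x) (scal (t - x) (q t)).
Proof.
  induction d; intros p x (c & q & Hq & H).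
  - exists (fun _ => zero). split; [cbn; auto|]. intros t. cbn in Hq. rewrite !H, !Hq. vec.
  - destruct (IHd q x Hq) as (r & Hr & E).
    exists (fun t => plus (q x) (scal t (r t))). split.
    + exists (q x), r. split; auto.
    + intros t. rewrite !H, (E t). vec.
Qed.

Lemma horner_sum (a : nat -> V) t n :
  sum_n_m (fun k => scal (t ^ k) (a k) : V) 0 (S n) = plus (a 0%nat) (scal t (sum_n_m (fun k => scal (t ^ k) (a (S k)) : V) 0 n)).
Proof.
  induction n.
  - rewrite sum_n_Sm, !sum_n_n by lia. cbn [pow]. vec.
  - rewrite sum_n_Sm, IHn by lia. rewrite (sum_n_Sm _ 0 n) by lia. cbn [pow]. vec.
Qed.

Lemma is_poly_sum n p : is_poly (S n) p <-> exists a : nat -> V, forall t, p t = sum_n (fun k => scal (t ^ k) (a k)) n.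
Proof.
  split.
  - revert p. induction n; intros p (c & q & Hq & H).
    + exists (fun _ => c). intros t. rewrite sum_O, H. cbn in Hq. rewrite Hq. cbn. vec.
    + destruct (IHn q Hq) as [a Ha].
      exists (fun k => match k with O => c | S j => a j end). intros t. rewrite H, Ha.
      symmetry. exact (horner_sum (fun k => match k with O => c | S j => a j end) t n).
  - revert p. induction n; intros p [a Ha].
    + exists (a 0%nat), (fun _ => zero). split; [cbn; auto|]. intros t. rewrite Ha, sum_O. cbn. vec.
    + exists (a 0%nat), (fun t => sum_n (fun k => scal (t ^ k) (a (S k))) n). split.
      * apply IHn. exists (fun k => a (S k)). auto.
      * intros t. rewrite Ha. exact (horner_sum a t n).
Qed.

Lemma is_poly_affine d a b : forall p, is_poly d p -> is_poly d (fun t => p (a * t + b)).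
Proof.
  induction d; intros p.
  - cbn. auto.
  - intros (c & q & Hq & H). 
    apply is_poly_ext with (fun t => plus c (scal (a * t + b) (q (a * t + b)))); [intros; rewrite H; auto|].
    apply is_poly_plus; [apply is_poly_const|]. apply (is_poly_linear_mul d (fun t => q (a * t + b))). apply IHd; auto.
Qed.

(** Newton's recursion: the divided differences with respect to [x0] are interpolated at the
    remaining nodes, one degree lower. *)
Lemma interp_exists : forall (xs : list R) (y : R -> V), NoDup xs ->
  exists p, is_poly (length xs) p /\ forall x, In x xs -> p x = y x.
Proof.
  induction xs as [|x0 xs IH]; intros y ND.
  - exists (fun _ => zero). split; [cbn; auto|]. intros x [].
  - inversion ND as [|? ? N0 ND']; subst.
    destruct (IH (fun x => scal (/ (x - x0)) (minus (y x) (y x0))) ND') as [q [Hq Eq]].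
    exists (fun t => plus (y x0) (scal (1 * t + - x0) (q t))). split.
    + cbn [length]. apply is_poly_plus; [apply is_poly_const|apply is_poly_linear_mul; auto].
    + intros x [<-|Hx]; [vec|].
      rewrite Eq by auto. assert (x - x0 <> 0) by (intros E; apply N0; replace x0 with x by lra; auto).
      vec_with ltac:(real_eq; field; auto).
Qed.

(** The Lebesgue constant of the nodes, obtained by dividing off one node at a time instead of
    estimating basis polynomials. The case B = 0 is the uniqueness of interpolation and is used as
    such below. *)
Lemma lebesgue : forall (xs : list R), NoDup xs -> (forall x, In x xs -> 0 <= x <= 1) ->
  exists lam, 0 <= lam /\ forall p B, 0 <= B -> is_poly (length xs) p -> (forall x, In x xs -> norm (p x) <= B) ->
    forall t, 0 <= t <= 1 -> norm (p t) <= lam * B.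
Proof.
  induction xs as [|x0 xs IH]; intros ND Hx.
  - exists 0. split; [lra|]. intros p B HB Hp _ t _. cbn in Hp. apply norm_le_zero; [auto|lra].
  - inversion ND as [|? ? N0 ND']; subst.
    destruct IH as [lam [Hl H]]; auto; [intros; apply Hx; right; auto|].
    assert (D : exists D, 0 <= D /\ forall x, In x xs -> / Rabs (x - x0) <= D).
    { clear. induction xs as [|x xs [D [D0 HD]]].
      - exists 0. split; [lra|]. intros x [].
      - exists (Rmax D (/ Rabs (x - x0))). split; [eapply Rle_trans; [exact D0|apply Rmax_l]|].
        intros z [<-|Hz]; [apply Rmax_r|eapply Rle_trans; [apply HD; auto|apply Rmax_l]]. }
    destruct D as [D [D0 HD]].
    exists (1 + lam * (D * 2)). split.
    { assert (0 <= lam * (D * 2)) by (repeat apply Rmult_le_pos; lra). lra. }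
    intros p B HB Hp Bp t Ht. cbn [length] in Hp.
    destruct (is_poly_div _ p x0 Hp) as [q [Hq E]].
    assert (Nq : norm (q t) <= lam * (D * (2 * B))).
    { apply H; auto; [repeat apply Rmult_le_pos; lra|].
      intros x Ix. assert (x - x0 <> 0) by (intros F; apply N0; replace x0 with x by lra; auto).
      replace (q x) with (scal (/ (x - x0)) (minus (p x) (p x0))).
      - apply norm_scal_bound; [rewrite Rabs_inv; auto|].
        replace (2 * B) with (B + B) by ring.
        apply norm_le_plus with (p x) (opp (p x0)); [vec|apply Bp; right; auto|].
        rewrite norm_oppV. apply Bp; left; auto.
      - rewrite (E x). vec_with ltac:(real_eq; field; auto). }
    rewrite E. replace ((1 + lam * (D * 2)) * B) with (B + 1 * (lam * (D * (2 * B)))) by ring.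
    eapply norm_le_plus; [reflexivity|apply Bp; left; auto|].
    apply norm_scal_bound; auto. assert (0 <= x0 <= 1) by (apply Hx; left; auto). apply Rabs_le. lra.
Qed.

(** The power t^m is carried along for the induction: dividing out the constant coefficient of q
    raises m by one. *)
Lemma is_poly_antideriv d : forall q m, is_poly d q -> exists r, is_poly d r /\
  forall J t, deriv_in J (fun t => scal (t ^ S m) (r t)) t (scal (t ^ m) (q t)).
Proof.
  induction d; intros q m.
  - intros H. exists (fun _ => zero). split; [cbn; auto|]. intros J t. cbn in H.
    replace (scal (t ^ m) (q t)) with (zero : V) by (rewrite H; vec).
    intros e He. exists 1. split; [lra|]. intros r _ _. apply norm_le_zero; [vec|].
    generalize (Rabs_pos (r - t)); nra.
  - intros (c & q' & Hq & H). destruct (IHd q' (S m) Hq) as [r' [Hr D]].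
    assert (Hm : INR (S m) <> 0) by (apply not_0_INR; lia).
    exists (fun t => plus (scal (/ INR (S m)) c) (scal t (r' t))). split.
    + exists (scal (/ INR (S m)) c), r'. split; auto.
    + intros J t.
      assert (D1 : deriv_in J (fun t => scal (t ^ S m) (scal (/ INR (S m)) c)) t (plus (scal (INR (S m) * t ^ m) (scal (/ INR (S m)) c)) (scal (t ^ S m) (zero : V)))).
      { apply (deriv_in_scal J (fun t => t ^ S m) (fun _ => scal (/ INR (S m)) c)); [|apply deriv_in_const].
        apply deriv_in_real. apply is_derive_Reals. apply derivable_pt_lim_pow. }
      assert (D2 := deriv_in_plus _ _ _ _ _ _ D1 (D J t)).
      intros e He. destruct (D2 e He) as [dl [Hd DD]]. exists dl. split; auto.
      intros t' Jt Htt. specialize (DD t' Jt Htt). eapply Rle_trans; [right; apply f_equal|exact DD].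
      rewrite H. cbn [pow]. vec_with ltac:(real_eq; field; auto).
Qed.

Lemma taylor01 : forall s (d : nat -> R -> V) B, 0 <= B ->
  (forall k t, (k < s)%nat -> itv 0 1 t -> deriv_in (itv 0 1) (d k) t (d (S k) t)) ->
  (forall t, itv 0 1 t -> norm (d s t) <= B) ->
  exists p, is_poly s p /\ forall t, itv 0 1 t -> norm (minus (d 0%nat t) (p t)) <= B.
Proof.
  induction s as [|s IHs]; intros d B HB HD HN.
  - exists (fun _ => zero). split; [cbn; auto|]. intros t It.
    replace B with (B + 0) by ring.
    apply norm_le_plus with (d 0%nat t) (zero : V); [vec|auto|]. apply norm_le_zero; [auto|lra].
  - destruct (IHs (fun k => d (S k)) B HB) as [p' [Hp' Np]].
    + intros k t Hk It. apply HD; auto. lia.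
    + auto.
    + destruct (is_poly_antideriv s p' 0 Hp') as [r [Hr D]].
      set (P := fun t => scal (t ^ 1) (r t) : V).
      assert (DP : forall t, itv 0 1 t -> deriv_in (itv 0 1) (fun t => minus (d 0%nat t) (P t)) t (minus (d 1%nat t) (scal (t ^ 0) (p' t)))).
      { intros t It. apply deriv_in_minus; [apply HD; auto; lia|apply D]. }
      exists (fun t => plus (d 0%nat 0) (P t)). split.
      * apply is_poly_plus; [apply is_poly_const|].
        exists zero, r. split; auto. intros t. unfold P. cbn [pow]. vec.
      * intros t It. unfold itv in It.
        assert (N : norm (minus (minus (d 0%nat t) (P t)) (minus (d 0%nat 0) (P 0))) <= B * (t - 0)).
        { apply (mean_value_closed (fun t => minus (d 0%nat t) (P t))); [lra|].
          intros r' Ir. unfold itv in Ir. eexists. split.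
          - apply deriv_in_sub with (itv 0 1); [unfold itv; intros; lra|]. apply DP. unfold itv; lra.
          - replace (minus (d 1%nat r') (scal (r' ^ 0) (p' r'))) with (minus (d 1%nat r') (p' r')) by (cbn [pow]; vec).
            apply Np. unfold itv; lra. }
        replace (minus (d 0%nat t) (plus (d 0%nat 0) (P t))) with (minus (minus (d 0%nat t) (P t)) (minus (d 0%nat 0) (P 0))).
        -- eapply Rle_trans; [exact N|]. nra.
        -- unfold P. cbn [pow]. vec.
Qed.

Lemma interp_error xs s lam : (s <= length xs)%nat ->
  (forall p B, 0 <= B -> is_poly (length xs) p -> (forall x, In x xs -> norm (p x) <= B) ->
    forall t, 0 <= t <= 1 -> norm (p t) <= lam * B) ->
  (forall x, In x xs -> 0 <= x <= 1) ->
  forall (d : nat -> R -> V) B E p, 0 <= B -> 0 <= E ->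
  (forall k t, (k < s)%nat -> itv 0 1 t -> deriv_in (itv 0 1) (d k) t (d (S k) t)) ->
  (forall t, itv 0 1 t -> norm (d s t) <= B) ->
  is_poly (length xs) p -> (forall x, In x xs -> norm (minus (p x) (d 0%nat x)) <= E) ->
  forall t, 0 <= t <= 1 -> norm (minus (p t) (d 0%nat t)) <= lam * (E + B) + B.
Proof.
  intros Hs Hl Hx d B E p HB HE HD HN Hp He t Ht.
  destruct (taylor01 s d B HB HD HN) as [q [Hq Nq]].
  apply norm_le_plus with (minus (p t) (q t)) (minus (q t) (d 0%nat t)); [vec| |rewrite norm_minus_sym; apply Nq; auto].
  apply (Hl (fun t => minus (p t) (q t))); auto; [lra| |].
  - apply is_poly_minus; auto. apply is_poly_le with s; auto.
  - intros x Ix. apply norm_le_plus with (minus (p x) (d 0%nat x)) (minus (d 0%nat x) (q x)); [vec|auto|].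
    apply Nq. apply Hx; auto.
Qed.

Lemma sum1_0 (f : nat -> V) : sum_n_m f 1 0 = zero.
Proof. apply sum_n_m_zero. lia. Qed.

Lemma sum1_S (f : nat -> V) s : sum_n_m f 1 (S s) = plus (sum_n_m f 1 s) (f (S s)).
Proof. apply sum_n_Sm. lia. Qed.

Lemma sum1_bound (f : nat -> V) s B : (forall j, (1 <= j <= s)%nat -> norm (f j) <= B) -> norm (sum_n_m f 1 s) <= INR s * B.
Proof.
  induction s; intros H.
  - rewrite sum1_0. apply norm_le_zero; [auto|]. cbn. lra.
  - rewrite sum1_S, S_INR, Rmult_plus_distr_r, Rmult_1_l.
    eapply norm_le_plus; [reflexivity|apply IHs; intros; apply H; lia|apply H; lia].
Qed.

Lemma sum1_ext (f g : nat -> V) s : (forall j, (1 <= j <= s)%nat -> f j = g j) -> sum_n_m f 1 s = sum_n_m g 1 s.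
Proof. intros H. apply sum_n_m_ext_loc. auto. Qed.

Lemma sum1_minus (f g : nat -> V) s : sum_n_m (fun j => minus (f j) (g j) : V) 1 s = minus (sum_n_m f 1 s) (sum_n_m g 1 s).
Proof. induction s; [rewrite !sum1_0; vec|rewrite !sum1_S, IHs; vec]. Qed.

End Poly.

Section Lagrange.
Variables (s : nat) (c : nat -> R).
Hypothesis c_range : forall i, (1 <= i <= s)%nat -> 0 <= c i <= 1.
Hypothesis c_distinct : forall i j, (1 <= i <= s)%nat -> (1 <= j <= s)%nat -> i <> j -> c i <> c j.

Lemma lagrange_cont j t : continuous (lagrange s c j) t.
Proof.
  unfold lagrange. induction (filter (fun q => negb (Nat.eqb q j)) (seq 1 s)) as [|q l IH]; cbn.
  - apply continuous_const.
  - apply (continuous_mult (fun r => (r - c q) / (c j - c q))); auto.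
    apply (ex_derive_continuous (fun r => (r - c q) / (c j - c q))). auto_derive. auto.
Qed.

Lemma lagrange_bounded : exists m, 0 <= m /\ forall j t, (1 <= j <= s)%nat -> 0 <= t <= 1 -> Rabs (lagrange s c j t) <= m.
Proof.
  assert (H : forall n, exists m, 0 <= m /\ forall j t, (1 <= j <= n)%nat -> 0 <= t <= 1 -> Rabs (lagrange s c j t) <= m).
  { induction n as [|n [m [Hm H]]].
    - exists 0. split; [lra|]. intros; lia.
    - destruct (continuity_ab_maj (fun t => Rabs (lagrange s c (S n) t)) 0 1) as [x [Hx _]]; [lra| |].
      + intros t Ht. apply continuity_pt_filterlim.
        apply (continuous_comp (lagrange s c (S n)) Rabs); [apply lagrange_cont|apply continuous_Rabs].
      + exists (Rmax m (Rabs (lagrange s c (S n) x))). split; [eapply Rle_trans; [exact Hm|apply Rmax_l]|].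
        intros j t Hj Ht. destruct (Nat.eq_dec j (S n)) as [->|N].
        * eapply Rle_trans; [apply Hx; auto|apply Rmax_r].
        * eapply Rle_trans; [apply H; auto; lia|apply Rmax_l]. }
  apply H.
Qed.

Lemma lagrange_self j : (1 <= j <= s)%nat -> lagrange s c j (c j) = 1.
Proof.
  intros Hj. unfold lagrange.
  assert (H : forall l, (forall q, In q l -> (1 <= q <= s)%nat) ->
     fold_right Rmult 1 (map (fun q => (c j - c q) / (c j - c q)) (filter (fun q => negb (Nat.eqb q j)) l)) = 1).
  { induction l as [|q l IH]; intros Hl; cbn; auto. destruct (Nat.eqb_spec q j) as [E|N]; cbn.
    - apply IH. intros; apply Hl; right; auto.
    - rewrite IH by (intros; apply Hl; right; auto). 
      assert (c j <> c q) by (apply c_distinct; auto; apply Hl; left; auto). field. lra. }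
  apply H. intros q Hq. apply in_seq in Hq. lia.
Qed.

Lemma lagrange_other j k : (1 <= j <= s)%nat -> (1 <= k <= s)%nat -> j <> k -> lagrange s c j (c k) = 0.
Proof.
  intros Hj Hk N. unfold lagrange.
  assert (H : forall l, In k l ->
     fold_right Rmult 1 (map (fun q => (c k - c q) / (c j - c q)) (filter (fun q => negb (Nat.eqb q j)) l)) = 0).
  { induction l as [|q l IH]; intros Hl; [destruct Hl|]. destruct Hl as [->|Hl]; cbn.
    - destruct (Nat.eqb_spec k j); [lia|]. cbn. rewrite Rminus_diag_eq by auto. unfold Rdiv. ring.
    - destruct (Nat.eqb_spec q j); cbn; rewrite IH by auto; ring. }
  apply H. apply in_seq. lia.
Qed.

Context {V : CompleteNormedModule R_AbsRing}.

Lemma lagrange_is_poly j (v : V) : (1 <= j <= s)%nat -> is_poly s (fun t => scal (lagrange s c j t) v).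
Proof.
  intros Hj. unfold lagrange.
  assert (L : forall l : list nat, In j l -> (S (length (filter (fun q => negb (Nat.eqb q j)) l)) <= length l)%nat).
  { assert (F : forall l : list nat, (length (filter (fun q => negb (Nat.eqb q j)) l) <= length l)%nat)
      by (intros; apply filter_length_le).
    induction l as [|q l IH]; intros [].
    - subst q. cbn. rewrite Nat.eqb_refl. cbn. specialize (F l). lia.
    - cbn. destruct (Nat.eqb q j); cbn; specialize (IH H); lia. }
  assert (P : forall l, is_poly (S (length l)) (fun t => scal (fold_right Rmult 1 (map (fun q => (t - c q) / (c j - c q)) l)) v)).
  { induction l as [|q l IH]; cbn [length map fold_right].
    - apply is_poly_ext with (fun _ => v); [intros; vec|apply is_poly_const].
    - apply is_poly_ext with (fun t => scal (/ (c j - c q) * t + - c q / (c j - c q))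
          (scal (fold_right Rmult 1 (map (fun q => (t - c q) / (c j - c q)) l)) v)).
      + intros t. vec_with ltac:(real_eq; unfold Rdiv; ring).
      + apply is_poly_linear_mul; auto. }
  apply is_poly_le with (S (length (filter (fun q => negb (Nat.eqb q j)) (seq 1 s)))); [|apply P].
  specialize (L (seq 1 s)). rewrite length_seq in L. apply L. apply in_seq. lia.
Qed.

Lemma nodes_NoDup : NoDup (map c (seq 1 s)).
Proof.
  assert (H : forall l, NoDup l -> (forall q, In q l -> (1 <= q <= s)%nat) -> NoDup (map c l)).
  { induction l as [|q l IH]; intros ND Hl; cbn; [constructor|]. inversion ND; subst. constructor.
    - intros I. apply in_map_iff in I. destruct I as [q' [E I]].
      apply (c_distinct q' q); auto; [apply Hl; right; auto|apply Hl; left; auto|]. intros ->. auto.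
    - apply IH; auto. intros; apply Hl; right; auto. }
  apply H; [apply seq_NoDup|]. intros q Hq. apply in_seq in Hq. lia.
Qed.

(** The difference is a polynomial of degree less than s that vanishes at the s nodes, so [lebesgue]
    with B = 0 applies. *)
Lemma lagrange_reproduces (p : R -> V) t : is_poly s p -> 0 <= t <= 1 ->
  sum_n_m (fun j => scal (lagrange s c j t) (p (c j)) : V) 1 s = p t.
Proof.
  intros Hp Ht. apply minus_eq0. apply norm_eq_zeroV. apply Rle_antisym; [|apply norm_ge_0].
  destruct (lebesgue (V := V) (map c (seq 1 s)) nodes_NoDup) as [lam [_ H]].
  { intros x Hx. apply in_map_iff in Hx. destruct Hx as [q [<- Hq]]. apply in_seq in Hq. apply c_range. lia. }
  rewrite <- (Rmult_0_r lam).
  apply (H (fun t => minus (sum_n_m (fun j => scal (lagrange s c j t) (p (c j)) : V) 1 s) (p t))); auto; [lra| |].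
  - rewrite length_map, length_seq. apply is_poly_minus; auto.
    assert (G : forall n, (n <= s)%nat -> is_poly s (fun t => sum_n_m (fun j => scal (lagrange s c j t) (p (c j)) : V) 1 n)).
    { induction n; intros Hn.
      - apply is_poly_ext with (fun _ => zero); [intros; rewrite sum1_0; auto|].
        apply is_poly_le with 0%nat; [lia|]. cbn; auto.
      - apply is_poly_ext with (fun t => plus (sum_n_m (fun j => scal (lagrange s c j t) (p (c j)) : V) 1 n) (scal (lagrange s c (S n) t) (p (c (S n))))).
        + intros. rewrite sum1_S. auto.
        + apply is_poly_plus; [apply IHn; lia|apply lagrange_is_poly; lia]. }
    apply G. lia.
  - intros x Hx. apply in_map_iff in Hx. destruct Hx as [k [<- Hk]]. apply in_seq in Hk.
    apply norm_le_zero; [|lra].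
    assert (G : forall n, (n <= s)%nat -> sum_n_m (fun j => scal (lagrange s c j (c k)) (p (c j)) : V) 1 n = if Nat.leb k n then p (c k) else zero).
    { induction n; intros Hn.
      - rewrite sum1_0. destruct (Nat.leb_spec k 0); [lia|auto].
      - rewrite sum1_S, IHn by lia.
        destruct (Nat.eq_dec k (S n)) as [E|N].
        + subst k. rewrite lagrange_self by lia. destruct (Nat.leb_spec (S n) n); [lia|].
          destruct (Nat.leb_spec (S n) (S n)); [|lia]. vec.
        + rewrite lagrange_other by lia.
          destruct (Nat.leb_spec k n); destruct (Nat.leb_spec k (S n)); try lia; vec. }
    rewrite G by lia. destruct (Nat.leb_spec k s); [vec|lia].
Qed.

Lemma lagrange_error m (d : nat -> R -> V) B t : 0 <= m ->
  (forall j t, (1 <= j <= s)%nat -> 0 <= t <= 1 -> Rabs (lagrange s c j t) <= m) -> 0 <= B ->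
  (forall k t, (k < s)%nat -> itv 0 1 t -> deriv_in (itv 0 1) (d k) t (d (S k) t)) ->
  (forall t, itv 0 1 t -> norm (d s t) <= B) -> 0 <= t <= 1 ->
  norm (minus (sum_n_m (fun j => scal (lagrange s c j t) (d 0%nat (c j)) : V) 1 s) (d 0%nat t)) <= (INR s * m + 1) * B.
Proof.
  intros Hm HL HB HD HN Ht. destruct (taylor01 s d B HB HD HN) as [p [Hp Np]].
  replace ((INR s * m + 1) * B) with (INR s * (m * B) + B) by ring.
  apply norm_le_plus with (sum_n_m (fun j => minus (scal (lagrange s c j t) (d 0%nat (c j))) (scal (lagrange s c j t) (p (c j))) : V) 1 s)
     (minus (p t) (d 0%nat t)).
  - rewrite <- (lagrange_reproduces p t) by auto.
    set (D := sum_n_m (fun j => scal (lagrange s c j t) (d 0%nat (c j)) : V) 1 s).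
    set (Q := sum_n_m (fun j => scal (lagrange s c j t) (p (c j)) : V) 1 s).
    replace (sum_n_m _ 1 s) with (minus D Q) by (symmetry; apply sum1_minus). vec.
  - apply sum1_bound. intros j Hj.
    replace (minus _ _) with (scal (lagrange s c j t) (minus (d 0%nat (c j)) (p (c j)))) by vec.
    apply norm_scal_bound; [apply HL; auto|]. apply Np. apply c_range; auto.
  - rewrite norm_minus_sym. apply Np. auto.
Qed.

End Lagrange.

(** * Weakly singular convolutions *)

(** A power of the positive part. [Rpower] takes a default value at nonpositive bases, whereas the
    primitive of the singular kernel has to vanish at the end of the convolution. *)
Definition pospow (p x : R) : R := if Rle_dec x 0 then 0 else Rpower x p.

Lemma pospow_pos_eq p x : 0 < x -> pospow p x = Rpower x p.
Proof. intros. unfold pospow. destruct (Rle_dec x 0); [lra|auto]. Qed.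

Lemma pospow_nonpos p x : x <= 0 -> pospow p x = 0.
Proof. intros. unfold pospow. destruct (Rle_dec x 0); [auto|lra]. Qed.

Lemma pospow_nonneg p x : 0 <= pospow p x.
Proof. unfold pospow. destruct (Rle_dec x 0); [lra|]. apply Rlt_le, exp_pos. Qed.

Lemma pospow_mono p x y : 0 <= p -> x <= y -> pospow p x <= pospow p y.
Proof.
  intros Hp Hxy. destruct (Rle_dec x 0); [rewrite (pospow_nonpos p x) by auto; apply pospow_nonneg|].
  rewrite !pospow_pos_eq by lra. apply Rle_Rpower_l; lra.
Qed.

Lemma pospow_small p e : 0 < p -> 0 < e -> exists d, 0 < d /\ forall x, x <= d -> pospow p x <= e.
Proof.
  intros Hp He. exists (Rpower e (/ p)). split; [apply exp_pos|]. intros x Hx.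
  apply Rle_trans with (pospow p (Rpower e (/ p))); [apply pospow_mono; lra|].
  rewrite pospow_pos_eq by apply exp_pos. rewrite Rpower_mult. replace (/ p * p) with 1 by (field; lra).
  rewrite Rpower_1; lra.
Qed.

(* A primitive of [exp (lam a)] against the kernel [g (t - a)^(g - 1)], up to a small factor, see
   [weight_step] and [weight_total]: contributions older than [del] are damped by [exp (- lam del)]. *)
Definition weight (g lam del t a : R) : R :=
  - (exp (lam * (t - del)) * pospow g (t - a)) - exp (lam * t) * Rmin (pospow g (t - a)) (pospow g del).

Lemma weight_step g lam del t a b : 0 <= g -> 0 <= lam -> a <= b ->
  (pospow g (t - a) - pospow g (t - b)) * exp (lam * a) <= weight g lam del t b - weight g lam del t a.
Proof.
  intros Hg Hl Hab. unfold weight.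
  assert (M : pospow g (t - b) <= pospow g (t - a)) by (apply pospow_mono; lra).
  set (x := pospow g (t - a)) in *. set (y := pospow g (t - b)) in *. set (z := pospow g del).
  assert (E1 := exp_pos (lam * (t - del))). assert (E2 := exp_pos (lam * t)).
  assert (E3 := exp_pos (lam * a)).
  assert (Mn : Rmin y z <= Rmin x z) by (apply Rle_min_compat_r; auto).
  (* A step that starts at least [del] before t is paid by the first term of [weight]. For a later
     start both powers are at most that of [del], the minima are inactive, and the second term
     pays. *)
  destruct (Rle_dec del (t - a)).
  - assert (exp (lam * a) <= exp (lam * (t - del))).
    { destruct (Rle_lt_or_eq_dec (lam * a) (lam * (t - del))) as [H|H]; [nra|apply Rlt_le, exp_increasing; auto|rewrite H; lra]. }
    nra.
  - assert (x <= z) by (apply pospow_mono; lra).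
    rewrite !Rmin_left by lra.
    destruct (Rle_dec a t).
    + assert (exp (lam * a) <= exp (lam * t)).
      { destruct (Rle_lt_or_eq_dec (lam * a) (lam * t)) as [H'|H']; [nra|apply Rlt_le, exp_increasing; auto|rewrite H'; lra]. }
      nra.
    + assert (x = 0) by (apply pospow_nonpos; lra). assert (y = 0) by (apply pospow_nonpos; lra). nra.
Qed.

(** The last factor can be made arbitrarily small, first [pospow g del] through [del], then the
    exponential through [lam]. This is the source of smallness in the error induction. *)
Lemma weight_total g lam del t T n : 0 <= g -> 0 <= t <= T -> 0 <= lam -> 0 <= del ->
  weight g lam del t n - weight g lam del t 0 <= exp (lam * t) * (exp (- (lam * del)) * pospow g T + pospow g del).
Proof.
  intros Hg Ht Hl Hd. unfold weight.
  replace (lam * (t - del)) with (lam * t + - (lam * del)) by ring. rewrite exp_plus.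
  assert (E1 := exp_pos (- (lam * del))). assert (E2 := exp_pos (lam * t)).
  set (a := exp (- (lam * del))) in *. set (b := exp (lam * t)) in *.
  assert (N1 := pospow_nonneg g (t - n)). assert (M1 : pospow g (t - 0) <= pospow g T) by (apply pospow_mono; lra).
  assert (N2 : 0 <= Rmin (pospow g (t - n)) (pospow g del)) by (apply Rmin_glb; apply pospow_nonneg).
  assert (N3 : Rmin (pospow g (t - 0)) (pospow g del) <= pospow g del) by apply Rmin_r.
  assert (b * a * pospow g (t - 0) <= b * a * pospow g T) by (apply Rmult_le_compat_l; nra).
  assert (0 <= b * a * pospow g (t - n)) by (apply Rmult_le_pos; nra).
  assert (0 <= b * Rmin (pospow g (t - n)) (pospow g del)) by nra.
  assert (b * Rmin (pospow g (t - 0)) (pospow g del) <= b * pospow g del) by (apply Rmult_le_compat_l; lra).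
  nra.
Qed.

Section Smoothing.
Context {X : CompleteNormedModule C_AbsRing}.
Variable S : R -> real_space X -> real_space X.
Hypothesis C0 : C0_semigroup S.
Variables (alpha K : R) (P : real_space X -> real_space X).
Hypothesis Ha : 0 <= alpha < 1.
Hypothesis HK : 1 <= K.
Hypothesis P_plus : forall x y, P (plus x y) = plus (P x) (P y).
Hypothesis P_scal : forall (r : R) x, P (scal r x) = scal r (P x).
Hypothesis P_bound : forall x, norm (P x) <= K * norm x.
Hypothesis P_inj : forall x, P x = zero -> x = zero.
Hypothesis S_bound : forall t x, 0 <= t -> norm (S t x) <= K * norm x.
Hypothesis smooth : forall t x, 0 < t -> exists w, P w = S t x /\ norm w <= K * Rpower t (- alpha) * norm x.

(* With [P = A^(-alpha)]: [v] lies in V and its V-norm is at most [b]. *)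
Definition Vle (v : real_space X) (b : R) : Prop := exists w, P w = v /\ norm w <= b.

Lemma P_minus x y : P (minus x y) = minus (P x) (P y).
Proof.
  transitivity (P (plus x (scal (-1) y))); [f_equal; vec|]. rewrite P_plus, P_scal. vec.
Qed.

Lemma P_zero : P zero = zero.
Proof. transitivity (P (scal 0 (zero : real_space X))); [f_equal; vec|]. rewrite P_scal. vec. Qed.

Lemma P_eq x y : P x = P y -> x = y.
Proof. intros E. apply minus_eq0. apply P_inj. rewrite P_minus, E. vec. Qed.

Lemma Vle_mono v b b' : Vle v b -> b <= b' -> Vle v b'.
Proof. intros [w [E H]] Hb. exists w. split; auto. lra. Qed.

Lemma Vle_plus x y z p q : z = plus x y -> Vle x p -> Vle y q -> Vle z (p + q).
Proof.
  intros -> [w [E H]] [w' [E' H']]. exists (plus w w'). split; [rewrite P_plus, E, E'; auto|].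
  eapply norm_le_plus; [reflexivity|auto|auto].
Qed.

Lemma Vle_zero b : 0 <= b -> Vle zero b.
Proof. intros. exists zero. split; [apply P_zero|rewrite norm_zeroV; auto]. Qed.

Lemma conv_cont a b q h (F : R -> real_space X) : 0 < h -> b <= q -> cont_on a b F ->
  cont_on a b (fun r => S ((q - r) * h) (F r)).
Proof.
  intros Hh Hq C t It e He. unfold itv in It.
  destruct (sg_cont S C0 (F t) ((q - t) * h)) with (eps := e / 2) as [d1 [Hd1 D1]]; [nra|lra|].
  destruct (C t It (e / 2 / K)) as [d2 [Hd2 D2]]; [repeat apply Rdiv_lt_0_compat; lra|].
  exists (Rmin (d1 / h) d2). split; [apply Rmin_glb_lt; [apply Rdiv_lt_0_compat|]; lra|].
  intros r Ir Hr. unfold itv in Ir.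
  assert (L1 : Rabs (r - t) < d1 / h) by (eapply Rlt_le_trans; [exact Hr|apply Rmin_l]).
  assert (L2 : Rabs (r - t) < d2) by (eapply Rlt_le_trans; [exact Hr|apply Rmin_r]).
  assert (Hr0 : 0 <= (q - r) * h) by nra.
  replace e with (K * (e / 2 / K) + e / 2) by (field; lra).
  apply norm_le_plus with (S ((q - r) * h) (minus (F r) (F t))) (minus (S ((q - r) * h) (F t)) (S ((q - t) * h) (F t))).
  - rewrite (lin_minus _ (sg_lin S C0 _ Hr0)). vec.
  - eapply Rle_trans; [apply S_bound; auto|]. apply Rmult_le_compat_l; [lra|]. apply D2; auto.
  - apply D1; [auto|]. replace ((q - r) * h - (q - t) * h) with (- ((r - t) * h)) by ring.
    rewrite Rabs_Ropp, Rabs_mult, (Rabs_right h) by lra.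
    apply Rmult_lt_compat_r with (r := h) in L1; auto. replace (d1 / h * h) with d1 in L1 by (field; lra). auto.
Qed.

(** [beta * pospow g] is the primitive of the smoothing bound K r^(-alpha). *)
Let g := 1 - alpha.
Let beta := K / g.

(** Since b < q, every S((q - r)h) factors through S(eta) with eta = (q - b)h > 0. Thus A^alpha
    S(eta) is a bounded operator [T] that passes under the integral; the pointwise bound still
    exploits the whole time (q - r)h. *)
Lemma conv_smooth_interior a b q h (F : R -> real_space X) B : 0 < h -> a <= b -> b < q -> cont_on a b F ->
  (forall r, a <= r <= b -> norm (F r) <= B) ->
  Vle (scal h (RInt (fun r => S ((q - r) * h) (F r)) a b))
      (beta * (pospow g ((q - a) * h) - pospow g ((q - b) * h)) * B).
Proof.
  intros Hh Hab Hbq C HB.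
  assert (Hg : 0 < g) by (unfold g; lra).
  assert (Hn : 0 < (q - b) * h) by nra. set (eta := (q - b) * h) in *.
  assert (ch : exists T, forall x, P (T x) = S eta x /\ norm (T x) <= K * Rpower eta (- alpha) * norm x).
  { exists (fun x => proj1_sig (constructive_indefinite_description _ (smooth eta x Hn))).
    intros x. apply (proj2_sig (constructive_indefinite_description _ (smooth eta x Hn))). }
  destruct ch as [T HT].
  assert (LS := sg_lin S C0 eta (Rlt_le _ _ Hn)).
  assert (T_plus : forall x y, T (plus x y) = plus (T x) (T y)).
  { intros x y. apply P_eq. rewrite P_plus, !(proj1 (HT _)). apply (lin_plus _ LS). }
  assert (T_scal : forall (r : R) x, T (scal r x) = scal r (T x)).
  { intros r x. apply P_eq. rewrite P_scal, !(proj1 (HT _)). apply (lin_scal _ LS). }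
  set (F1 := fun r => S ((b - r) * h) (F r)).
  assert (C1 : cont_on a b F1) by (apply conv_cont; auto; lra).
  assert (TB : forall r, a <= r <= b -> norm (T (F1 r)) <= K * B * Rpower ((q - r) * h) (- alpha)).
  { intros r Hr. assert (Hqr : 0 < (q - r) * h) by nra.
    destruct (smooth _ (F r) Hqr) as [w [Ew Nw]].
    replace (T (F1 r)) with w.
    - eapply Rle_trans; [exact Nw|]. assert (E := exp_pos (- alpha * ln ((q - r) * h))). unfold Rpower in *.
      replace (K * B * exp (- alpha * ln ((q - r) * h))) with (K * exp (- alpha * ln ((q - r) * h)) * B) by ring.
      apply Rmult_le_compat_l; [nra|]. apply HB; auto.
    - apply P_eq. rewrite (proj1 (HT _)), Ew. unfold F1, eta. rewrite <- (sg_plus S C0); [|nra|nra].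
      f_equal. ring. }
  assert (CT : cont_on a b (fun r => T (F1 r))).
  { intros t It e He. set (k := K * Rpower eta (- alpha)).
    assert (kp : 0 < k) by (apply Rmult_lt_0_compat; [lra|apply exp_pos]).
    destruct (C1 t It (e / k)) as [d [Hd D]]; [apply Rdiv_lt_0_compat; auto|].
    exists d. split; auto. intros r Ir Hr. replace (minus (T (F1 r)) (T (F1 t))) with (T (minus (F1 r) (F1 t))).
    - eapply Rle_trans; [apply (proj2 (HT _))|]. fold k. apply Rle_trans with (k * (e / k)); [|right; field; lra].
      apply Rmult_le_compat_l; [lra|]. apply D; auto.
    - transitivity (T (plus (F1 r) (scal (-1) (F1 t)))); [f_equal; vec|]. rewrite T_plus, T_scal. vec. }
  exists (scal h (RInt (fun r => T (F1 r)) a b)). split.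
  - rewrite P_scal. f_equal.
    rewrite <- (RInt_lin T (K * Rpower eta (- alpha)) a b F1 T_plus T_scal (fun x => proj2 (HT x))) by auto.
    rewrite (proj1 (HT _)).
    rewrite (RInt_lin (S eta) K a b F1 (lin_plus _ LS) (lin_scal _ LS)) by (auto; intros; apply S_bound; lra).
    apply RInt_ext_on; auto. intros r Hr. unfold F1, eta. rewrite <- (sg_plus S C0); [|nra|nra]. f_equal. ring.
  - apply Rle_trans with (h * ((fun r => - (K * B / (g * h)) * Rpower ((q - r) * h) g) b - (fun r => - (K * B / (g * h)) * Rpower ((q - r) * h) g) a)).
    + apply norm_scal_bound; [rewrite Rabs_right; lra|].
      apply (RInt_norm_le_deriv (fun r => T (F1 r)) (fun r => - (K * B / (g * h)) * Rpower ((q - r) * h) g)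
         (fun r => K * B * Rpower ((q - r) * h) (- alpha))); auto.
      * intros t Ht. assert (Hqt : 0 < (q - t) * h) by nra.
        unfold Rpower. auto_derive; [auto|].
        replace (- alpha * ln ((q - t) * h)) with (g * ln ((q - t) * h) + - ln ((q - t) * h)) by (unfold g; ring).
        rewrite exp_plus, exp_Ropp, exp_ln by auto. replace (q + - t) with (q - t) by ring. field. repeat split; nra.
      * intros t Ht. assert (Hqt : 0 < (q - t) * h) by nra.
        apply (ex_derive_continuous (fun r => K * B * Rpower ((q - r) * h) (- alpha))). unfold Rpower. auto_derive. auto.
    + cbv beta. rewrite !pospow_pos_eq by nra. right. fold eta. unfold beta. field. nra.
Qed.

(** At the singular end b = q the integral is truncated at points tending to q. The preimages of the
    truncated integrals form a Cauchy sequence because the singularity is integrable, and continuity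
    of [P] identifies the image of their limit. *)
Lemma conv_smooth a b q h (F : R -> real_space X) B : 0 < h -> a <= b <= q -> cont_on a b F ->
  (forall r, a <= r <= b -> norm (F r) <= B) ->
  Vle (scal h (RInt (fun r => S ((q - r) * h) (F r)) a b))
      (beta * (pospow g ((q - a) * h) - pospow g ((q - b) * h)) * B).
Proof.
  intros Hh Hab C HB.
  assert (Hg : 0 < g) by (unfold g; lra).
  assert (HB0 : 0 <= B) by (apply (Rle_trans _ _ _ (norm_ge_0 (F a))); apply HB; lra).
  assert (Hbeta : 0 < beta) by (apply Rdiv_lt_0_compat; lra).
  destruct (Rlt_dec b q) as [Hbq|Hbq]; [apply conv_smooth_interior; auto; lra|].
  assert (b = q) by lra. subst b. clear Hbq. destruct Hab as [Hab _].
  set (I := fun x y => scal h (RInt (fun r => S ((q - r) * h) (F r)) x y) : real_space X).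
  assert (CI : cont_on a q (fun r => S ((q - r) * h) (F r))) by (apply conv_cont; auto; lra).
  set (b := fun n => q - (q - a) * / (INR n + 1)).
  assert (Ip : forall n, 0 < / (INR n + 1) <= 1).
  { intros n. assert (p := pos_INR n). split; [apply Rinv_0_lt_compat; lra|].
    rewrite <- Rinv_1. apply Rinv_le_contravar; lra. }
  destruct (Req_dec a q) as [Eaq|Naq].
  { subst q. exists zero. split; [|rewrite norm_zeroV; right; ring].
    rewrite P_zero. symmetry. etransitivity; [apply f_equal, RInt_point|]. apply (scal_zero_r (V := real_space X)). }
  assert (bn : forall n, a <= b n < q) by (intros n; specialize (Ip n); unfold b; nra).
  assert (bm : forall n k, (n <= k)%nat -> b n <= b k).
  { intros n k Hk. unfold b. apply le_INR in Hk. assert (p := pos_INR n).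
    assert (/ (INR k + 1) <= / (INR n + 1)) by (apply Rinv_le_contravar; lra). nra. }
  assert (CF : forall x y, a <= x -> y <= q -> cont_on x y F) by (intros; apply cont_on_sub with a q; auto; lra).
  assert (ch : exists w, forall n, P (w n) = I a (b n) /\ norm (w n) <= beta * (pospow g ((q - a) * h)) * B).
  { assert (ex : forall n, exists w, P w = I a (b n) /\ norm w <= beta * (pospow g ((q - a) * h)) * B).
    { intros n. specialize (bn n).
      destruct (conv_smooth_interior a (b n) q h F B) as [w [Ew Nw]]; auto; try lra; [apply CF; lra|intros; apply HB; lra|].
      exists w. split; auto. eapply Rle_trans; [exact Nw|]. apply Rmult_le_compat_r; auto. apply Rmult_le_compat_l; [lra|].
      assert (p := pospow_nonneg g ((q - b n) * h)). lra. }
    exists (fun n => proj1_sig (constructive_indefinite_description _ (ex n))).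
    intros n. apply (proj2_sig (constructive_indefinite_description _ (ex n))). }
  destruct ch as [w Hw].
  assert (small : forall e, 0 < e -> exists N, forall n, (N <= n)%nat -> (q - b n) * h <= e).
  { intros e He. destruct (nfloor_ex ((q - a) * h / e)) as [N HN]; [apply Rlt_le, Rdiv_lt_0_compat; [nra|auto]|].
    exists N. intros n Hn. apply le_INR in Hn. unfold b.
    replace ((q - (q - (q - a) * / (INR n + 1))) * h) with ((q - a) * h / e * / (INR n + 1) * e) by (field; assert (p := pos_INR n); lra).
    assert ((q - a) * h / e * / (INR n + 1) <= 1); [|nra].
    assert (p := pos_INR n). apply Rmult_le_reg_r with (INR n + 1); [lra|]. rewrite Rmult_assoc, Rinv_l by lra. lra. }
  assert (diff : forall n k, (n <= k)%nat -> norm (minus (w k) (w n)) <= beta * pospow g ((q - b n) * h) * B).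
  { intros n k Hk. specialize (bm n k Hk). assert (Bn := bn n). assert (Bk := bn k).
    destruct (conv_smooth_interior (b n) (b k) q h F B) as [v [Ev Nv]]; auto; try lra; [apply CF; lra|intros; apply HB; lra|].
    replace (minus (w k) (w n)) with v.
    - eapply Rle_trans; [exact Nv|]. apply Rmult_le_compat_r; auto. apply Rmult_le_compat_l; [lra|].
      assert (p := pospow_nonneg g ((q - b k) * h)). lra.
    - apply P_eq. rewrite P_minus, !(proj1 (Hw _)), Ev. unfold I.
      rewrite (RInt_Chasles_on a (b n) (b k)); [vec|lra|]. apply cont_on_sub with a q; auto; lra. }
  destruct (cauchy_lim w) as [l Hl].
  { intros e He.
    destruct (pospow_small g (e / (beta * (B + 1)))) as [d [Hd D]]; auto; [apply Rdiv_lt_0_compat; nra|].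
    destruct (small d Hd) as [N HN].
    assert (key : forall n k, (N <= n <= k)%nat -> norm (minus (w k) (w n)) <= e).
    { intros n k Hk. eapply Rle_trans; [apply diff; lia|].
      specialize (D _ (HN n ltac:(lia))). assert (p := pospow_nonneg g ((q - b n) * h)).
      apply Rle_trans with (beta * (e / (beta * (B + 1))) * (B + 1)); [|right; field; nra].
      apply Rmult_le_compat; [nra|lra| |lra]. apply Rmult_le_compat_l; lra. }
    exists N. intros n k Hn Hk. destruct (Nat.le_ge_cases n k).
    - rewrite norm_minus_sym. apply key; lia.
    - apply key; lia. }
  exists l. split.
  - apply (seq_lim_unique (fun n => P (w n))).
    + apply (seq_lim_lin (V := real_space X) (W := real_space X) P K w l); auto. apply P_minus.
    + intros e He.
      destruct (small (e / (K * (B + 1)))) as [N HN]; [apply Rdiv_lt_0_compat; nra|].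
      exists N. intros n Hn. rewrite (proj1 (Hw n)). assert (Bn := bn n).
      replace (minus (I a (b n)) _) with (opp (I (b n) q)).
      * rewrite norm_oppV. unfold I. apply Rle_trans with (h * (K * B * (q - b n))).
        -- apply norm_scal_bound; [rewrite Rabs_right; lra|]. apply RInt_norm_le; [lra|apply cont_on_sub with a q; auto; lra|].
           intros t Ht. eapply Rle_trans; [apply S_bound; nra|]. apply Rmult_le_compat_l; [lra|]. apply HB; lra.
        -- specialize (HN n Hn). apply Rle_trans with (K * (B + 1) * (e / (K * (B + 1)))); [|right; field; nra].
           replace (h * (K * B * (q - b n))) with (K * B * ((q - b n) * h)) by ring.
           apply Rmult_le_compat; nra.
      * unfold I. rewrite (RInt_Chasles_on a (b n) q); [vec|lra|auto].
  - replace (pospow g ((q - q) * h)) with 0 by (rewrite pospow_nonpos; [auto|right; ring]). rewrite Rminus_0_r.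
    apply (seq_lim_norm w l); auto. exists 0%nat. intros n _. apply Hw.
Qed.

(** S(r) is absorbed by moving the time at which the convolution is observed from q to q + r/h,
    while the range of integration stays [0, q]. *)
Lemma conv_smooth_shift q h r (F : R -> real_space X) B : 0 < h -> 0 <= q -> 0 <= r -> cont_on 0 q F ->
  (forall x, 0 <= x <= q -> norm (F x) <= B) ->
  Vle (S r (scal h (RInt (fun x => S ((q - x) * h) (F x)) 0 q)))
      (beta * (pospow g (r + q * h) - pospow g r) * B).
Proof.
  intros Hh Hq Hr C HB. assert (LS := sg_lin S C0 r Hr).
  assert (Hrh : 0 <= r / h) by (apply Rdiv_le_0_compat; lra).
  replace (S r (scal h (RInt (fun x => S ((q - x) * h) (F x)) 0 q)))
    with (scal h (RInt (fun x => S ((q + r / h - x) * h) (F x)) 0 q)).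
  - replace (r + q * h) with ((q + r / h - 0) * h) by (field; lra).
    replace (pospow g r) with (pospow g ((q + r / h - q) * h)) by (f_equal; field; lra).
    apply conv_smooth; auto. lra.
  - rewrite (lin_scal _ LS). f_equal.
    rewrite (RInt_lin (S r) K 0 q (fun x => S ((q - x) * h) (F x)) (lin_plus _ LS) (lin_scal _ LS)); auto.
    + apply RInt_ext_on; auto. intros x Hx. rewrite <- (sg_plus S C0); [|auto|nra]. f_equal. field. lra.
    + apply conv_cont; auto. lra.
Qed.

End Smoothing.

(** * The exact solution on one mesh interval *)

Section Mild.
Context {X : CompleteNormedModule C_AbsRing}.
Variable S : R -> real_space X -> real_space X.
Variable A : operator X.
Hypothesis SA : semigroup_of A S.
Variable K : R.
Hypothesis HK : 1 <= K.
Hypothesis S_bound : forall t x, 0 <= t -> norm (S t x) <= K * norm x.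

Let C0 := proj1 SA.

(** S(b - r)u(r) has derivative S(b - r)f(r): the terms with A cancel. Its proof is a product rule
    with S as an operator-valued factor, hence the three error terms. *)
Lemma variation_of_constants (u f : R -> real_space X) a b : 0 <= a <= b -> cont_on a b u -> cont_on a b f ->
  (forall t, a < t < b -> dom A (u t) /\ exists du, deriv_in (itv a b) u t du /\ plus du (A (u t)) = f t) ->
  u b = plus (S (b - a) (u a)) (RInt (fun r => S (b - r) (f r)) a b).
Proof.
  intros Hab Cu Cf D.
  assert (CC : forall F : R -> real_space X, cont_on a b F -> cont_on a b (fun r => S (b - r) (F r))).
  { intros F CF. apply cont_on_ext with (fun r => S ((b - r) * 1) (F r)); [intros; f_equal; ring|].
    apply (conv_cont S C0 K HK S_bound); auto; lra. }
  rewrite <- (ftc_in a b (fun r => S (b - r) (u r)) (fun r => S (b - r) (f r))); auto; try lra.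
  - replace (b - b) with 0 by ring. rewrite (sg_zero S C0). vec.
  - intros t Ht. destruct (D t Ht) as [Dt [du [Ddu Eq]]]. rewrite <- Eq. intros e He.
    destruct (Ddu (e / 3 / K)) as [d1 [Hd1 D1]]; [repeat apply Rdiv_lt_0_compat; lra|].
    destruct (sg_cont S C0 du (b - t)) with (eps := e / 3) as [d2 [Hd2 D2]]; [lra|lra|].
    destruct (sg_deriv S C0 A SA (u t) (b - t) Dt) with (eps := e / 3) as [d3 [Hd3 D3]]; [lra|lra|].
    exists (Rmin d1 (Rmin d2 d3)). split; [repeat apply Rmin_glb_lt; auto|].
    intros r Ir Hr. unfold itv in Ir.
    assert (L1 : Rabs (r - t) < d1) by (eapply Rlt_le_trans; [exact Hr|apply Rmin_l]).
    assert (L2 : Rabs (r - t) < d2) by (eapply Rlt_le_trans; [exact Hr|eapply Rle_trans; [apply Rmin_r|apply Rmin_l]]).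
    assert (L3 : Rabs (r - t) < d3) by (eapply Rlt_le_trans; [exact Hr|eapply Rle_trans; [apply Rmin_r|apply Rmin_r]]).
    assert (Ea : Rabs (b - r - (b - t)) = Rabs (r - t)) by (replace (b - r - (b - t)) with (- (r - t)) by ring; apply Rabs_Ropp).
    specialize (D1 r Ir L1). specialize (D2 (b - r) ltac:(lra) ltac:(lra)). specialize (D3 (b - r) ltac:(lra) ltac:(lra)).
    rewrite Ea in D3.
    assert (LS := sg_lin S C0 (b - r) ltac:(lra)). assert (LT := sg_lin S C0 (b - t) ltac:(lra)).
    replace (e * Rabs (r - t)) with (K * (e / 3 / K * Rabs (r - t)) + (Rabs (r - t) * (e / 3) + e / 3 * Rabs (r - t))) by (field; lra).
    eapply norm_le_plus with (S (b - r) (minus (minus (u r) (u t)) (scal (r - t) du)))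
      (plus (scal (r - t) (minus (S (b - r) du) (S (b - t) du)))
         (minus (minus (S (b - r) (u t)) (S (b - t) (u t))) (scal (b - r - (b - t)) (opp (S (b - t) (A (u t))))))).
    + rewrite !(lin_minus _ LS), (lin_scal _ LS), (lin_plus _ LT). vec.
    + eapply Rle_trans; [apply S_bound; lra|]. apply Rmult_le_compat_l; [lra|exact D1].
    + eapply norm_le_plus; [reflexivity|apply norm_scal_bound; [lra|exact D2]|exact D3].
Qed.

Lemma variation_of_constants_scaled (u f : R -> real_space X) a h q : 0 <= a -> 0 < h -> 0 <= q <= 1 ->
  cont_on a (a + h) u -> cont_on a (a + h) f ->
  (forall t, a < t < a + h -> dom A (u t) /\ exists du, deriv_in (itv a (a + h)) u t du /\ plus du (A (u t)) = f t) ->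
  u (a + q * h) = plus (S (q * h) (u a)) (scal h (RInt (fun r => S ((q - r) * h) (f (a + r * h))) 0 q)).
Proof.
  intros Ha Hh Hq Cu Cf D.
  assert (Hsub : forall F : R -> real_space X, cont_on a (a + h) F -> cont_on a (a + q * h) F).
  { intros F CF. apply cont_on_sub with a (a + h); auto; nra. }
  rewrite (variation_of_constants u f a (a + q * h)); [|nra|auto|auto|].
  - f_equal; [f_equal; ring|].
    set (F := fun r => S (a + q * h - r) (f r)).
    assert (CF : cont_on a (a + q * h) F).
    { apply cont_on_ext with (fun r => S ((a + q * h - r) * 1) (f r)); [intros; unfold F; f_equal; ring|].
      apply (conv_cont S C0 K HK S_bound); auto; lra. }
    assert (E := RInt_comp_lin (V := real_space X) F h a 0 q).
    replace (h * 0 + a) with a in E by ring. replace (h * q + a) with (a + q * h) in E by ring.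
    rewrite <- E by (apply ex_RInt_cont_on; [nra|auto]).
    assert (CG : cont_on 0 q (fun r => S ((q - r) * h) (f (a + r * h)))).
    { apply (conv_cont S C0 K HK S_bound); [auto|lra|]. intros t It e He. unfold itv in It.
      destruct (Cf (a + t * h)) with (eps := e) as [d [Hd Dd]]; [unfold itv; nra|auto|].
      exists (d / h). split; [apply Rdiv_lt_0_compat; auto|]. intros r Ir Hr. unfold itv in Ir. apply Dd; [unfold itv; nra|].
      replace (a + r * h - (a + t * h)) with ((r - t) * h) by ring. rewrite Rabs_mult, (Rabs_right h) by lra.
      apply Rmult_lt_compat_r with (r := h) in Hr; auto. replace (d / h * h) with d in Hr by (field; lra). auto. }
    rewrite <- (RInt_scal_on 0 q _ h) by (auto; lra).
    apply RInt_ext_on; [lra|]. intros r Hr. unfold F. f_equal. f_equal; [ring|f_equal; ring].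
  - intros t Ht. destruct (D t) as [Dt [du [Ddu Eq]]]; [nra|]. split; auto. exists du. split; auto.
    apply deriv_in_sub with (itv a (a + h)); auto. unfold itv. intros; nra.
Qed.

End Mild.

(** The factors h^k turn v and its derivatives on a mesh interval into a chain of derivatives on
    [0, 1], at whose end the h^s of the error bound appears. *)
Lemma deriv_in_rescale {V : CompleteNormedModule R_AbsRing} (J : R -> Prop) (v : R -> V) (d : V) a h k t :
  0 < h -> (forall r, itv 0 1 r -> J (a + r * h)) -> deriv_in J v (a + t * h) d ->
  deriv_in (itv 0 1) (fun r => scal (h ^ k) (v (a + r * h))) t (scal (h ^ S k) d).
Proof.
  intros Hh HJ D e He. assert (Hk : 0 < h ^ k) by (apply pow_lt; auto).
  destruct (D (e / (h ^ k * h))) as [dl [Hdl DD]]; [apply Rdiv_lt_0_compat; nra|].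
  exists (dl / h). split; [apply Rdiv_lt_0_compat; auto|]. intros r Ir Hr.
  assert (E : a + r * h - (a + t * h) = (r - t) * h) by ring.
  assert (L : Rabs ((r - t) * h) < dl).
  { rewrite Rabs_mult, (Rabs_right h) by lra. apply Rmult_lt_compat_r with (r := h) in Hr; auto.
    replace (dl / h * h) with dl in Hr by (field; lra). auto. }
  specialize (DD (a + r * h) (HJ r Ir)). rewrite E in DD. specialize (DD L).
  replace (e * Rabs (r - t)) with (h ^ k * (e / (h ^ k * h) * Rabs ((r - t) * h))).
  - replace (minus _ _) with (scal (h ^ k) (minus (minus (v (a + r * h)) (v (a + t * h))) (scal ((r - t) * h) d))).
    + apply norm_scal_bound; [rewrite Rabs_right; lra|auto].
    + cbn [pow]. vec.
  - rewrite Rabs_mult, (Rabs_right h) by lra. field. lra.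
Qed.

Section Nodes.
Variables (s : nat) (c : nat -> R).
Hypothesis c_range : forall i, (1 <= i <= s)%nat -> 0 <= c i <= 1.
Hypothesis c_distinct : forall i j, (1 <= i <= s)%nat -> (1 <= j <= s)%nat -> i <> j -> c i <> c j.

(** The interpolation nodes on the reference interval. Some c_i may be 0 or 1; removing duplicates
    lets the length account for the possible degrees of the interpolant. *)
Definition all_nodes : list R := nodup Req_EM_T (0 :: 1 :: map c (seq 1 s)).

Lemma all_nodes_range x : In x all_nodes -> 0 <= x <= 1.
Proof.
  intros H. apply nodup_In in H. destruct H as [<-|[<-|H]]; try lra.
  apply in_map_iff in H. destruct H as [q [<- Hq]]. apply in_seq in Hq. apply c_range. lia.
Qed.

Lemma all_nodes_length : (s <= length all_nodes)%nat.
Proof.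
  rewrite <- (length_seq s 1) at 1. rewrite <- (length_map c).
  apply NoDup_incl_length; [apply nodes_NoDup; auto|]. intros x Hx. apply nodup_In. right; right; auto.
Qed.

Lemma all_nodes_In x : In x all_nodes <-> x = 0 \/ x = 1 \/ exists i, (1 <= i <= s)%nat /\ x = c i.
Proof.
  unfold all_nodes. rewrite nodup_In. cbn. rewrite in_map_iff. split.
  - intros [E|[E|[i [E I]]]]; auto. apply in_seq in I. right; right. exists i. split; [lia|auto].
  - intros [E|[E|[i [I E]]]]; auto. right; right. exists i. split; auto. apply in_seq. lia.
Qed.

Lemma nodup_map_length a h l : h <> 0 ->
  length (nodup Req_EM_T (map (fun x => a + x * h) l)) = length (nodup Req_EM_T l).
Proof.
  intros Hh. assert (inj : forall x y, a + x * h = a + y * h -> x = y) by (intros x y E; apply (Rmult_eq_reg_r h); lra).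
  induction l as [|x l IH]; auto. cbn [map nodup].
  destruct (in_dec Req_EM_T x l) as [I|I]; destruct (in_dec Req_EM_T (a + x * h) (map (fun x => a + x * h) l)) as [I'|I'].
  - auto.
  - destruct I'. apply in_map_iff. exists x. auto.
  - apply in_map_iff in I'. destruct I' as [y [E Iy]]. apply inj in E. subst. contradiction.
  - cbn. auto.
Qed.

End Nodes.

Section IntervalData.
Context {X : CompleteNormedModule C_AbsRing}.
Variables (S : R -> real_space X -> real_space X) (P : real_space X -> real_space X).
Variables (s : nat) (c : nat -> R) (lam C1 Kf Ku : R) (u f : R -> real_space X).

(** Here [om] stands for A^alpha u on the reference interval and [k] for the bound of its rescaled
    s-th derivative; E admits perturbed node values, namely the errors of the scheme. *)
Definition interpolates_well (om : R -> real_space X) (k : R) : Prop :=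
  forall (p : R -> real_space X) E, 0 <= E -> is_poly (length (all_nodes s c)) p ->
    (forall x, In x (all_nodes s c) -> norm (minus (p x) (om x)) <= E) ->
    forall t, 0 <= t <= 1 -> norm (minus (p t) (om t)) <= lam * (E + k) + k.

(** All that the analysis of a step uses about the exact solution. The segments between
    discontinuity points and their derivative families disappear behind this interface. *)
Definition interval_ok (a h : R) : Prop :=
  (forall q, 0 <= q <= 1 -> u (a + q * h) = plus (S (q * h) (u a)) (scal h (RInt (fun r => S ((q - r) * h) (f (a + r * h))) 0 q))) /\
  cont_on 0 1 (fun r => f (a + r * h)) /\
  (forall q, 0 <= q <= 1 -> norm (minus (sum_n_m (fun j => scal (lagrange s c j q) (f (a + c j * h)) : real_space X) 1 s) (f (a + q * h))) <= C1 * (h ^ s * Kf)) /\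
  exists om, (forall q, 0 <= q <= 1 -> P (om q) = u (a + q * h)) /\ interpolates_well om (h ^ s * Ku).

End IntervalData.

Section Intro.
Context {X : CompleteNormedModule C_AbsRing}.
Variable S : R -> real_space X -> real_space X.
Variable A : operator X.
Hypothesis SA : semigroup_of A S.
Variable K : R.
Hypothesis HK : 1 <= K.
Hypothesis S_bound : forall t x, 0 <= t -> norm (S t x) <= K * norm x.
Variables P Q : real_space X -> real_space X.
Hypothesis P_plus : forall x y, P (plus x y) = plus (P x) (P y).
Hypothesis P_scal : forall (r : R) x, P (scal r x) = scal r (P x).
Hypothesis P_bound : forall x, norm (P x) <= K * norm x.
Hypothesis QP : forall x, Q (P x) = x.

Let inV v := exists w, P w = v.
Let nV v := norm (Q v).

(** [Q] is A^alpha, so differentiability in the V-norm is differentiability of A^alpha u in X.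
    Membership in V is asked for separately because [Q] is meaningful only there. *)
Lemma deriv_lift J v t (d : real_space X) : J t -> (forall r, J r -> inV (v r)) -> inV d ->
  is_derive_in nV J v t d -> deriv_in J (fun r => Q (v r)) t (Q d).
Proof.
  intros Jt Jv [d' Ed] D e He. destruct (D e He) as [dl [Hd DD]]. exists dl. split; auto.
  intros r Jr Hr. specialize (DD r Jr Hr). unfold nV in DD.
  destruct (Jv r Jr) as [vr Er]. destruct (Jv t Jt) as [vt Et]. rewrite <- Er, <- Et, <- Ed in *.
  rewrite !QP. rewrite <- (P_scal (r - t) d'), <- !(P_minus P P_plus P_scal), QP in DD. exact DD.
Qed.

Variables (s : nat) (c : nat -> R).
Hypothesis s_pos : (1 <= s)%nat.
Hypothesis c_range : forall i, (1 <= i <= s)%nat -> 0 <= c i <= 1.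
Hypothesis c_distinct : forall i j, (1 <= i <= s)%nat -> (1 <= j <= s)%nat -> i <> j -> c i <> c j.
Variables (m lam : R).
Hypothesis Hm : 0 <= m.
Hypothesis Hl : forall j t, (1 <= j <= s)%nat -> 0 <= t <= 1 -> Rabs (lagrange s c j t) <= m.
Hypothesis Hlam : forall (p : R -> real_space X) B, 0 <= B -> is_poly (length (all_nodes s c)) p ->
  (forall x, In x (all_nodes s c) -> norm (p x) <= B) -> forall t, 0 <= t <= 1 -> norm (p t) <= lam * B.

Lemma interval_ok_intro (J : R -> Prop) (u f : R -> real_space X) Du Df Kf Ku a h :
  0 <= a -> 0 < h -> (forall t, a <= t <= a + h -> J t) ->
  derivatives_in inV nV J s u Du -> derivatives_in (fun _ => True) norm J s f Df ->
  (forall t, J t -> 0 < t -> dom A (u t) /\ exists du, is_derive_in norm J u t du /\ plus du (A (u t)) = f t) ->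
  (forall t, J t -> norm (Df s t) <= Kf) -> (forall t, J t -> nV (Du s t) <= Ku) ->
  interval_ok S P s c lam (INR s * m + 1) Kf Ku u f a h.
Proof.
  intros Ha Hh HJ [U0 [UV UD]] [F0 [_ FD]] Sol HKf HKu.
  assert (Jr : forall r, itv 0 1 r -> J (a + r * h)) by (intros r Hr; unfold itv in Hr; apply HJ; nra).
  assert (QD : forall k t, (k < s)%nat -> J t -> deriv_in J (fun r => Q (Du k r)) t (Q (Du (Datatypes.S k) t))).
  { intros k t Hk Jt. apply deriv_lift; [auto|intros r Hr; apply UV; auto; lia|apply UV; auto; lia|apply UD; auto]. }
  assert (PU : forall t, J t -> P (Q (Du 0%nat t)) = u t).
  { intros t Jt. destruct (UV 0%nat t) as [w Ew]; [lia|auto|]. rewrite <- Ew, QP, Ew. apply U0; auto. }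
  assert (hs : 0 < h ^ s) by (apply pow_lt; auto).
  assert (DF : forall k t, (k < s)%nat -> itv 0 1 t ->
     deriv_in (itv 0 1) (fun r => scal (h ^ k) (Df k (a + r * h)) : real_space X) t (scal (h ^ Datatypes.S k) (Df (Datatypes.S k) (a + t * h)))).
  { intros k t Hk It. apply (deriv_in_rescale J (Df k)); auto. apply FD; auto. }
  assert (DU : forall k t, (k < s)%nat -> itv 0 1 t ->
     deriv_in (itv 0 1) (fun r => scal (h ^ k) (Q (Du k (a + r * h))) : real_space X) t (scal (h ^ Datatypes.S k) (Q (Du (Datatypes.S k) (a + t * h))))).
  { intros k t Hk It. apply (deriv_in_rescale J (fun r => Q (Du k r))); auto. }
  assert (NF : forall t, itv 0 1 t -> norm (scal (h ^ s) (Df s (a + t * h)) : real_space X) <= h ^ s * Kf).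
  { intros t It. apply norm_scal_bound; [rewrite Rabs_right; lra|apply HKf; auto]. }
  assert (NU : forall t, itv 0 1 t -> norm (scal (h ^ s) (Q (Du s (a + t * h))) : real_space X) <= h ^ s * Ku).
  { intros t It. apply norm_scal_bound; [rewrite Rabs_right; lra|apply HKu; auto]. }
  assert (I0 : itv 0 1 0) by (unfold itv; lra).
  assert (Kf0 : 0 <= h ^ s * Kf) by (exact (Rle_trans _ _ _ (norm_ge_0 _) (NF 0 I0))).
  assert (Ku0 : 0 <= h ^ s * Ku) by (exact (Rle_trans _ _ _ (norm_ge_0 _) (NU 0 I0))).
  assert (Cf : cont_on a (a + h) f).
  { intros t It. unfold itv in It. apply contn_in_sub with J; [unfold itv; auto|].
    assert (CD : contn_in J (Df 0%nat) t) by (apply (deriv_contn (V := real_space X) J (Df 0%nat) t (Df 1%nat t)); apply FD; auto).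
    intros e He. destruct (CD e He) as [d [Hd D]]. exists d. split; auto. intros r Hr Hrt.
    rewrite <- !F0 by auto. apply D; auto. }
  assert (Cu : cont_on a (a + h) u).
  { intros t It. unfold itv in It. apply contn_in_sub with J; [unfold itv; auto|].
    assert (CD : contn_in J (fun r => Q (Du 0%nat r)) t) by (apply (deriv_contn (V := real_space X) J _ t (Q (Du 1%nat t))); apply QD; auto).
    intros e He. destruct (CD (e / K)) as [d [Hd D]]; [apply Rdiv_lt_0_compat; lra|]. exists d. split; auto. intros r Hr Hrt.
    rewrite <- !PU by auto. rewrite <- (P_minus P P_plus P_scal). eapply Rle_trans; [apply P_bound|].
    apply Rle_trans with (K * (e / K)); [|right; field; lra]. apply Rmult_le_compat_l; [lra|]. apply D; auto. }
  split; [|split; [|split]].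
  - intros q Hq. apply (variation_of_constants_scaled S A SA K HK S_bound); auto.
    intros t Ht. destruct (Sol t) as [Dt [du [Ddu E]]]; [apply HJ; lra|lra|]. split; auto. exists du. split; auto.
    apply deriv_in_sub with J; auto.
  - intros t It e He. assert (It' := It). unfold itv in It'. destruct (Cf (a + t * h)) with (eps := e) as [d [Hd Dd]]; [unfold itv; nra|auto|].
    exists (d / h). split; [apply Rdiv_lt_0_compat; auto|]. intros r Ir Hr. unfold itv in Ir. apply Dd; [unfold itv; nra|].
    replace (a + r * h - (a + t * h)) with ((r - t) * h) by ring. rewrite Rabs_mult, (Rabs_right h) by lra.
    apply Rmult_lt_compat_r with (r := h) in Hr; auto. replace (d / h * h) with d in Hr by (field; lra). auto.
  - intros q Hq.
    assert (E0 : forall t, itv 0 1 t -> f (a + t * h) = scal (h ^ 0) (Df 0%nat (a + t * h))).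
    { intros t It. rewrite F0 by auto. cbn [pow]. symmetry. apply (scal_one (V := real_space X)). }
    rewrite (E0 q) by auto.
    rewrite (sum1_ext _ (fun j => scal (lagrange s c j q) (scal (h ^ 0) (Df 0%nat (a + c j * h))) : real_space X) s).
    + apply (lagrange_error (V := real_space X) s c c_range c_distinct m (fun k r => scal (h ^ k) (Df k (a + r * h))) (h ^ s * Kf) q); auto.
    + intros j Hj. rewrite E0; auto. apply c_range; auto.
  - exists (fun q => Q (Du 0%nat (a + q * h))). split; [intros q Hq; apply PU; auto|].
    intros p E HE Hp He t Ht.
    assert (E0 : forall t, Q (Du 0%nat (a + t * h)) = scal (h ^ 0) (Q (Du 0%nat (a + t * h)))).
    { intros x. cbn [pow]. symmetry. apply (scal_one (V := real_space X)). }
    rewrite E0. apply (interp_error (V := real_space X) (all_nodes s c) s lam) with (d := fun k r => scal (h ^ k) (Q (Du k (a + r * h)))); auto.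
    + apply all_nodes_length; auto.
    + apply all_nodes_range; auto.
    + intros x Hx. cbv beta. rewrite <- E0. apply He; auto.
Qed.

End Intro.

(** * One step of the scheme as a perturbed variation of constants *)

Section Step.
Context {X : CompleteNormedModule C_AbsRing}.
Variable S : R -> real_space X -> real_space X.
Hypothesis C0 : C0_semigroup S.
Variables (alpha K : R) (P : real_space X -> real_space X).
Hypothesis Ha : 0 <= alpha < 1.
Hypothesis HK : 1 <= K.
Hypothesis P_plus : forall x y, P (plus x y) = plus (P x) (P y).
Hypothesis P_scal : forall (r : R) x, P (scal r x) = scal r (P x).
Hypothesis P_bound : forall x, norm (P x) <= K * norm x.
Hypothesis P_inj : forall x, P x = zero -> x = zero.
Hypothesis S_bound : forall t x, 0 <= t -> norm (S t x) <= K * norm x.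
Hypothesis smooth : forall t x, 0 < t -> exists w, P w = S t x /\ norm w <= K * Rpower t (- alpha) * norm x.
Variables (s : nat) (c : nat -> R) (m : R).
Hypothesis Hl : forall j t, (1 <= j <= s)%nat -> 0 <= t <= 1 -> Rabs (lagrange s c j t) <= m.

Let g := 1 - alpha.
Let beta := K / g.

Definition lag (G : nat -> real_space X) (x : R) : real_space X :=
  sum_n_m (fun j => scal (lagrange s c j x) (G j) : real_space X) 1 s.

Definition coef_sum (h q : R) (G : nat -> real_space X) : real_space X :=
  sum_n_m (fun j => RInt (fun x => scal (lagrange s c j x) (S ((q - x) * h) (G j)) : real_space X) 0 q) 1 s.

(* The scheme at time [t_n + q h]: the stage for [q = c_i], the next nodal value for [q = 1]. *)
Definition num (U : real_space X) (G : nat -> real_space X) (h q : R) : real_space X :=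
  plus (S (q * h) U) (scal h (coef_sum h q G)).

Lemma lag_cont (G : nat -> real_space X) a b n :
  cont_on a b (fun x => sum_n_m (fun j => scal (lagrange s c j x) (G j) : real_space X) 1 n).
Proof.
  induction n.
  - apply (cont_on_ext a b (fun _ => zero : real_space X)).
    + intros. symmetry. apply (sum1_0 (V := real_space X)).
    + intros r Ir. apply contn_in_const.
  - apply (cont_on_ext a b (fun x => plus (sum_n_m (fun j => scal (lagrange s c j x) (G j) : real_space X) 1 n) (scal (lagrange s c (Datatypes.S n) x) (G (Datatypes.S n))))).
    + intros. symmetry. apply (sum1_S (V := real_space X)).
    + intros r Ir. apply contn_in_plus; [apply IHn; auto|].
      apply (contn_in_scal (itv a b) (lagrange s c (Datatypes.S n)) (fun _ => G (Datatypes.S n))); [|apply contn_in_const].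
      apply contn_in_real, lagrange_cont.
Qed.

(** The weighted sum is a single convolution with the collocation polynomial, so [num] is variation
    of constants with f replaced by [lag G]. *)
Lemma coef_sum_RInt (G : nat -> real_space X) h q : 0 < h -> 0 <= q ->
  coef_sum h q G = RInt (fun x => S ((q - x) * h) (lag G x)) 0 q.
Proof.
  intros Hh Hq. unfold coef_sum, lag.
  assert (CS : forall F : R -> real_space X, cont_on 0 q F -> cont_on 0 q (fun x => S ((q - x) * h) (F x))).
  { intros F CF. apply (conv_cont S C0 K HK S_bound); auto. lra. }
  assert (H : forall n, sum_n_m (fun j => RInt (fun x => scal (lagrange s c j x) (S ((q - x) * h) (G j)) : real_space X) 0 q) 1 n
     = RInt (fun x => S ((q - x) * h) (sum_n_m (fun j => scal (lagrange s c j x) (G j) : real_space X) 1 n)) 0 q); [|apply H].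
  induction n.
  - rewrite sum1_0. symmetry.
    transitivity (RInt (fun _ => zero : real_space X) 0 q).
    + apply RInt_ext_on; auto. intros x Hx. rewrite sum1_0. apply (lin_zero _ (sg_lin S C0 ((q - x) * h) ltac:(nra))).
    + rewrite RInt_const. vec.
  - rewrite sum1_S, IHn. 
    set (F1 := fun x => sum_n_m (fun j => scal (lagrange s c j x) (G j) : real_space X) 1 n).
    set (F2 := fun x => scal (lagrange s c (Datatypes.S n) x) (G (Datatypes.S n)) : real_space X).
    assert (CF2 : cont_on 0 q F2).
    { intros r Ir. apply (contn_in_scal (itv 0 q) (lagrange s c (Datatypes.S n)) (fun _ => G (Datatypes.S n))); [|apply contn_in_const].
      apply contn_in_real, lagrange_cont. }
    transitivity (RInt (fun x => plus (S ((q - x) * h) (F1 x)) (S ((q - x) * h) (F2 x))) 0 q).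
    + rewrite RInt_plus_on; auto.
      * apply f_equal2; [reflexivity|]. apply RInt_ext_on; auto. intros x Hx. unfold F2. symmetry. apply lin_scal.
        apply (sg_lin S C0). nra.
      * apply CS. apply lag_cont.
    + apply RInt_ext_on; auto. intros x Hx. unfold F1, F2. rewrite sum1_S.
      symmetry. apply (lin_plus _ (sg_lin S C0 ((q - x) * h) ltac:(nra))).
Qed.

Lemma lag_bound G M x : 0 <= x <= 1 -> (forall j, (1 <= j <= s)%nat -> norm (G j) <= M) -> norm (lag G x) <= INR s * m * M.
Proof.
  intros Hx HG. rewrite Rmult_assoc. apply sum1_bound. intros j Hj.
  apply norm_scal_bound; [apply Hl; auto|apply HG; auto].
Qed.

Lemma lag_minus G G' x : lag (fun j => minus (G j) (G' j)) x = minus (lag G x) (lag G' x).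
Proof.
  unfold lag. rewrite <- (sum1_minus (V := real_space X)). apply (sum1_ext (V := real_space X)). intros. vec.
Qed.

Lemma num_diff U G G' h q M : 0 < h -> 0 <= q <= 1 ->
  (forall j, (1 <= j <= s)%nat -> norm (minus (G j) (G' j)) <= M) ->
  Vle P (minus (num U G h q) (num U G' h q)) (beta * pospow g (q * h) * (INR s * m * M)).
Proof.
  intros Hh Hq HM.
  assert (H := conv_smooth_shift S C0 alpha K P Ha HK P_plus P_scal P_bound P_inj S_bound smooth
     q h 0 (lag (fun j => minus (G j) (G' j))) (INR s * m * M) Hh (proj1 Hq) (Rle_refl 0) (lag_cont _ _ _ s)).
  fold g in H. fold beta in H. rewrite Rplus_0_l, (pospow_nonpos g 0) in H by lra. rewrite Rminus_0_r in H.
  replace (minus (num U G h q) (num U G' h q)) with (S 0 (scal h (RInt (fun x => S ((q - x) * h) (lag (fun j => minus (G j) (G' j)) x)) 0 q))).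
  - apply H. intros x Hx. apply lag_bound; auto. lra.
  - rewrite (sg_zero S C0). unfold num. rewrite !coef_sum_RInt by lra.
    assert (CS : forall G, cont_on 0 q (fun x => S ((q - x) * h) (lag G x))).
    { intros F. apply (conv_cont S C0 K HK S_bound); auto; [lra|apply lag_cont]. }
    rewrite (RInt_ext_on 0 q _ (fun x => minus (S ((q - x) * h) (lag G x)) (S ((q - x) * h) (lag G' x)))).
    + rewrite RInt_minus_on; [vec|lra|auto|auto].
    + lra.
    + intros x Hx. rewrite lag_minus. apply (lin_minus _ (sg_lin S C0 ((q - x) * h) ltac:(nra))).
Qed.

(** Variation of constants is subtracted from the step. [S r] is applied throughout because the
    induction follows the error as it is seen at all later times. *)
Lemma num_step lam C1 Kf Ku (u f : R -> real_space X) a h U G M q r : 0 < h ->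
  interval_ok S P s c lam C1 Kf Ku u f a h ->
  (forall j, (1 <= j <= s)%nat -> norm (minus (G j) (f (a + c j * h))) <= M) ->
  0 <= q <= 1 -> 0 <= r ->
  exists v, S r (minus (num U G h q) (u (a + q * h))) = plus (S (r + q * h) (minus U (u a))) v /\
    Vle P v (beta * (pospow g (r + q * h) - pospow g r) * (INR s * m * M + C1 * (h ^ s * Kf))).
Proof.
  intros Hh (Hu & Cf & Ef & _) HM Hq Hr.
  assert (Cd : cont_on 0 q (fun x => minus (lag G x) (f (a + x * h)))).
  { intros t It. apply contn_in_minus; [apply lag_cont; auto|]. apply (cont_on_sub 0 1); auto; lra. }
  exists (S r (scal h (RInt (fun x => S ((q - x) * h) (minus (lag G x) (f (a + x * h)))) 0 q))). split.
  - assert (LS := sg_lin S C0 r Hr). assert (LT := sg_lin S C0 (q * h) ltac:(nra)).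
    rewrite (sg_plus S C0 r (q * h)) by nra. rewrite <- (lin_plus _ LS). f_equal.
    unfold num. rewrite coef_sum_RInt, Hu, (lin_minus _ LT) by lra.
    rewrite (RInt_ext_on 0 q (fun x => S ((q - x) * h) (minus (lag G x) (f (a + x * h)))) (fun x => minus (S ((q - x) * h) (lag G x)) (S ((q - x) * h) (f (a + x * h))))).
    + rewrite RInt_minus_on; [vec|lra| |].
      * apply (conv_cont S C0 K HK S_bound); auto; [lra|apply lag_cont].
      * apply (conv_cont S C0 K HK S_bound); auto; [lra|]. apply cont_on_sub with 0 1; auto; lra.
    + lra.
    + intros x Hx. apply (lin_minus _ (sg_lin S C0 ((q - x) * h) ltac:(nra))).
  - apply (conv_smooth_shift S C0 alpha K P Ha HK P_plus P_scal P_bound P_inj S_bound smooth); auto; [lra|].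
    intros x Hx. apply norm_le_plus with (lag (fun j => minus (G j) (f (a + c j * h))) x) (minus (lag (fun j => f (a + c j * h)) x) (f (a + x * h))).
    + rewrite lag_minus. vec.
    + apply lag_bound; auto. lra.
    + apply Ef. lra.
Qed.

End Step.

(** * The collocation scheme *)

Lemma finite_max (s : nat) (v : nat -> R) : (1 <= s)%nat ->
  exists j, (1 <= j <= s)%nat /\ forall i, (1 <= i <= s)%nat -> v i <= v j.
Proof.
  induction 1 as [|s Hs [j [Hj H]]].
  - exists 1%nat. split; [lia|]. intros i Hi. replace i with 1%nat by lia. lra.
  - destruct (Rle_dec (v j) (v (S s))).
    + exists (S s). split; [lia|]. intros i Hi. destruct (Nat.eq_dec i (S s)) as [->|]; [lra|].
      specialize (H i ltac:(lia)). lra.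
    + exists j. split; [lia|]. intros i Hi. destruct (Nat.eq_dec i (S s)) as [->|]; [lra|]. apply H. lia.
Qed.

Lemma is_poly_map {V W : CompleteNormedModule R_AbsRing} (F : V -> W) d : (forall x y, F (plus x y) = plus (F x) (F y)) ->
  (forall (r : R) x, F (scal r x) = scal r (F x)) -> F zero = zero ->
  forall p, is_poly d p -> is_poly d (fun t => F (p t)).
Proof.
  intros Fp Fs F0. induction d; intros p.
  - cbn. intros H t. rewrite H. auto.
  - intros (c & q & Hq & H). exists (F c), (fun t => F (q t)). split; [apply IHd; auto|].
    intros t. rewrite H, Fp, Fs. reflexivity.
Qed.

Section Reformulation.
Context {X : CompleteNormedModule C_AbsRing}.
Variable S : R -> real_space X -> real_space X.
Variables (s : nat) (c : nat -> R) (inV : real_space X -> Prop) (g : R -> real_space X -> real_space X -> real_space X).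
Variables (tau : R -> R) (phi : R -> real_space X) (tn : nat -> R).

Definition mesh_step (n : nat) : R := tn (Datatypes.S n) - tn n.

Definition step_ok (W : numerical X) (n : nat) : Prop :=
  let G := stage_rhs g tau c tn W n in
  nodal W (Datatypes.S n) = num S s c (nodal W n) G (mesh_step n) 1 /\
  (forall i, (1 <= i <= s)%nat -> inV (stage W n i) /\ inV (delayed tau (interp W) (tn n + c i * mesh_step n)) /\
     stage W n i = num S s c (nodal W n) G (mesh_step n) (c i)) /\
  (exists p : R -> real_space X, is_poly (length (all_nodes s c)) p /\ forall q, 0 <= q <= 1 -> interp W (tn n + q * mesh_step n) = p q) /\
  interp W (tn n) = nodal W n /\ interp W (tn (Datatypes.S n)) = nodal W (Datatypes.S n) /\
  forall i, (1 <= i <= s)%nat -> interp W (tn n + c i * mesh_step n) = stage W n i.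

(** The scheme is transported to [0, 1]: an affine change of variable preserves the number of
    distinct nodes and the degree of the interpolant. *)
Lemma is_ERKC_I_steps (W : numerical X) M : (forall n, (n < M)%nat -> 0 < mesh_step n) ->
  (is_ERKC_I S inV g tau phi s c M tn W <->
   nodal W 0%nat = phi 0 /\ (forall t, t <= 0 -> interp W t = phi t) /\ forall n, (n < M)%nat -> step_ok W n).
Proof.
  intros Hpos.
  assert (Hst : forall n, stepsize tn (n + 1) = mesh_step n) by (intros n; rewrite Nat.add_1_r; reflexivity).
  assert (Hb : forall n (G : nat -> real_space X), sum_n_m (fun i => coef_b S s c (mesh_step n) i (G i)) 1 s = coef_sum S s c (mesh_step n) 1 G).
  { intros n G. reflexivity. }
  assert (Hlen : forall n, (n < M)%nat -> Datatypes.S (length (nodup Req_EM_T (tn n :: tn (n + 1)%nat :: map (coll_point c tn n) (seq 1 s))) - 1) = length (all_nodes s c)).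
  { intros n Hn. replace (tn n :: tn (n + 1)%nat :: map (coll_point c tn n) (seq 1 s)) with (map (fun x => tn n + x * mesh_step n) (0 :: 1 :: map c (seq 1 s))).
    - rewrite nodup_map_length by (specialize (Hpos n Hn); lra). fold (all_nodes s c).
      assert (I0 : In 0 (all_nodes s c)) by (apply nodup_In; left; auto).
      destruct (all_nodes s c); [destruct I0|cbn; lia].
    - cbn [map]. f_equal; [ring|]. f_equal; [rewrite Nat.add_1_r; unfold mesh_step; ring|]. rewrite map_map. reflexivity. }
  assert (Hpoly : forall n, (n < M)%nat ->
     (interp_degree_on (tn n :: tn (n + 1)%nat :: map (coll_point c tn n) (seq 1 s)) (fun t => tn n <= t <= tn (n + 1)%nat) (interp W) <->
      exists p : R -> real_space X, is_poly (length (all_nodes s c)) p /\ forall q, 0 <= q <= 1 -> interp W (tn n + q * mesh_step n) = p q)).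
  { intros n Hn. specialize (Hpos n Hn). rewrite Nat.add_1_r. specialize (Hlen n Hn). rewrite Nat.add_1_r in Hlen.
    assert (E : tn (Datatypes.S n) = tn n + mesh_step n) by (unfold mesh_step; ring).
    unfold interp_degree_on. set (d := (length _ - 1)%nat) in *. rewrite <- Hlen. split.
    - intros [a Hsum]. exists (fun q => sum_n (fun k => scal ((mesh_step n * q + tn n) ^ k) (a k)) d). split.
      + apply (is_poly_affine (V := real_space X) (Datatypes.S d) (mesh_step n) (tn n) (fun t => sum_n (fun k => scal (t ^ k) (a k)) d)).
        apply is_poly_sum. exists a. auto.
      + intros q Hq. rewrite Hsum by (rewrite E; nra). replace (mesh_step n * q + tn n) with (tn n + q * mesh_step n) by ring. reflexivity.
    - intros [p [Hp Ep]]. apply (is_poly_affine (V := real_space X) _ (/ mesh_step n) (- tn n / mesh_step n)) in Hp.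
      apply is_poly_sum in Hp. destruct Hp as [a Hsum]. exists a. intros t Ht. rewrite <- Hsum.
      replace t with (tn n + (/ mesh_step n * t + - tn n / mesh_step n) * mesh_step n) at 1 by (field; lra). apply Ep.
      replace (/ mesh_step n * t + - tn n / mesh_step n) with ((t - tn n) / mesh_step n) by (field; lra). rewrite E in Ht. split.
      + apply Rdiv_le_0_compat; lra.
      + apply Rmult_le_reg_r with (mesh_step n); auto. unfold Rdiv. rewrite Rmult_assoc, Rinv_l by lra. lra. }
  split.
  - intros (N0 & I0 & H). split; [auto|split; [auto|]]. intros n Hn. specialize (H n Hn). cbv zeta in H.
    rewrite Hst in H. destruct H as (E1 & E2 & E3 & E4 & E5 & E6). apply Hpoly in E3; auto.
    rewrite Nat.add_1_r in *. split; [|split; [|split; [|split; [|split]]]]; auto.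
    unfold num. rewrite Rmult_1_l. rewrite E1. rewrite <- Hb. reflexivity.
  - intros (N0 & I0 & H). split; [auto|split; [auto|]]. intros n Hn. destruct (H n Hn) as (E1 & E2 & E3 & E4 & E5 & E6). cbv zeta.
    rewrite Hst. apply Hpoly in E3; auto. rewrite Nat.add_1_r in *. split; [|split; [|split; [|split; [|split]]]]; auto.
    unfold num in E1. rewrite Rmult_1_l in E1. rewrite E1. rewrite <- Hb. reflexivity.
Qed.

(** A step survives a modification of the solution after its end, since its delayed arguments do not
    reach further. It keeps the earlier steps valid when a new one is attached. *)
Lemma step_ok_ext (W W' : numerical X) n : nodal W' n = nodal W n -> nodal W' (Datatypes.S n) = nodal W (Datatypes.S n) ->
  (forall i, stage W' n i = stage W n i) -> 0 < mesh_step n -> (forall i, (1 <= i <= s)%nat -> 0 <= c i <= 1) ->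
  (forall i, (1 <= i <= s)%nat -> tn n + c i * mesh_step n - tau (tn n + c i * mesh_step n) <= tn (Datatypes.S n)) ->
  (forall t, t <= tn (Datatypes.S n) -> interp W' t = interp W t) -> step_ok W n -> step_ok W' n.
Proof.
  intros N0 N1 St Hh Hc Ht It (E1 & E2 & E3 & E4 & E5 & E6).
  assert (E : tn (Datatypes.S n) = tn n + mesh_step n) by (unfold mesh_step; ring).
  assert (D : forall i, (1 <= i <= s)%nat -> delayed tau (interp W') (tn n + c i * mesh_step n) = delayed tau (interp W) (tn n + c i * mesh_step n)).
  { intros i Hi. apply It. apply Ht; auto. }
  assert (Gq : forall q, num S s c (nodal W' n) (stage_rhs g tau c tn W' n) (mesh_step n) q = num S s c (nodal W n) (stage_rhs g tau c tn W n) (mesh_step n) q).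
  { intros q. unfold num. rewrite N0. f_equal. f_equal. unfold coef_sum. apply (sum1_ext (V := real_space X)). intros j Hj.
    assert (EG : stage_rhs g tau c tn W' n j = stage_rhs g tau c tn W n j).
    { unfold stage_rhs. rewrite St. f_equal. apply (D j Hj). }
    rewrite EG. reflexivity. }
  split; [|split; [|split; [|split; [|split]]]].
  - rewrite N1, Gq. exact E1.
  - intros i Hi. rewrite St, D, Gq by auto. apply E2; auto.
  - destruct E3 as [p [Hp Ep]]. exists p. split; auto. intros q Hq. rewrite It by (rewrite E; nra). auto.
  - rewrite It, N0 by lra. auto.
  - rewrite It, N1 by lra. auto.
  - intros i Hi. specialize (Hc i Hi). rewrite It, St by (rewrite E; nra). auto.
Qed.

End Reformulation.

Lemma choice_on {A B : Type} (b : B) (D : A -> Prop) (R : A -> B -> Prop) :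
  (forall x, D x -> exists y, R x y) -> exists k, forall x, D x -> R x (k x).
Proof.
  intros H. exists (fun x => match excluded_middle_informative (D x) with
    | left Dx => proj1_sig (constructive_indefinite_description _ (H x Dx)) | right _ => b end).
  intros x Dx. destruct excluded_middle_informative as [D'|]; [|contradiction].
  apply (proj2_sig (constructive_indefinite_description _ (H x D'))).
Qed.

(** * Error induction, uniqueness and existence *)

Section Scheme.
Context {X : CompleteNormedModule C_AbsRing}.
Variable S : R -> real_space X -> real_space X.
Hypothesis C0 : C0_semigroup S.
Variables (alpha K : R) (P : real_space X -> real_space X).
Hypothesis Ha : 0 <= alpha < 1.
Hypothesis HK : 1 <= K.
Hypothesis P_plus : forall x y, P (plus x y) = plus (P x) (P y).
Hypothesis P_scal : forall (r : R) x, P (scal r x) = scal r (P x).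
Hypothesis P_bound : forall x, norm (P x) <= K * norm x.
Hypothesis P_inj : forall x, P x = zero -> x = zero.
Hypothesis S_bound : forall t x, 0 <= t -> norm (S t x) <= K * norm x.
Hypothesis smooth : forall t x, 0 < t -> exists w, P w = S t x /\ norm w <= K * Rpower t (- alpha) * norm x.
Variables (s : nat) (c : nat -> R) (m lam : R).
Hypothesis s_pos : (1 <= s)%nat.
Hypothesis c_range : forall i, (1 <= i <= s)%nat -> 0 <= c i <= 1.
Hypothesis Hm : 0 <= m.
Hypothesis Hl : forall j t, (1 <= j <= s)%nat -> 0 <= t <= 1 -> Rabs (lagrange s c j t) <= m.
Hypothesis lam_pos : 0 <= lam.
Hypothesis Hlam : forall (p : R -> real_space X) B, 0 <= B -> is_poly (length (all_nodes s c)) p ->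
  (forall x, In x (all_nodes s c) -> norm (p x) <= B) -> forall t, 0 <= t <= 1 -> norm (p t) <= lam * B.

Variables (g : R -> real_space X -> real_space X -> real_space X) (tau : R -> R) (phi u : R -> real_space X).
Variables (T rad Lp : R).
Let inV (v : real_space X) := exists w, P w = v.
Let f t := g t (u t) (delayed tau u t).
Hypothesis u_hist : forall t, t <= 0 -> u t = phi t.
Hypothesis delayed_u_V : forall t, 0 <= t <= T -> inV (delayed tau u t).
Hypothesis u_V : forall t, 0 <= t <= T -> inV (u t).
Hypothesis rad_pos : 0 < rad.
Hypothesis Lp_pos : 0 <= Lp.
Hypothesis g_lip : forall t v1 w1 v2 w2 b1 b2, 0 <= t <= T ->
  Vle P (minus v1 (u t)) rad -> Vle P (minus v2 (u t)) rad ->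
  Vle P (minus w1 (delayed tau u t)) rad -> Vle P (minus w2 (delayed tau u t)) rad ->
  Vle P (minus v1 v2) b1 -> Vle P (minus w1 w2) b2 ->
  norm (minus (g t v1 w1) (g t v2 w2)) <= Lp * (b1 + b2).

Variables (C1 Kf Ku h rate del e0 D : R) (N : nat) (tn : nat -> R).
Notation hn := (mesh_step tn).
Hypothesis C1_pos : 0 <= C1.
Hypothesis Kf_pos : 0 <= Kf.
Hypothesis Ku_pos : 0 <= Ku.
Hypothesis h_pos : 0 < h.
Hypothesis tn0 : tn 0%nat = 0.
Hypothesis tnN : tn N = T.
Hypothesis steps : forall n, (n < N)%nat -> 0 < hn n <= h.
Hypothesis ok : forall n, (n < N)%nat -> interval_ok S P s c lam C1 Kf Ku u f (tn n) (hn n).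
Hypothesis delay_ge : forall t, 0 <= t -> h <= tau t.

Let ga := 1 - alpha.
Let beta := K / ga.
Let La := INR s * m.
Let ks := h ^ s.
Hypothesis rate_pos : 0 <= rate.
Hypothesis del_pos : 0 <= del.
Hypothesis rate_h : rate * h <= 1.
Hypothesis D_pos : 0 <= D.
(** [e0] bounds both the propagated error relative to D e^(rate t_n), by [small1], and the
    convolution over one step, by [small2]. [small3] turns the Lipschitz feedback into a
    contraction, [D_large] absorbs the consistency errors, and [small4] and [small5] keep
    interpolant and stages inside the strip. *)
Hypothesis small1 : beta * (exp (- (rate * del)) * pospow ga T + pospow ga del) * exp 1 <= e0.
Hypothesis small2 : beta * pospow ga h <= e0.
Hypothesis small3 : La * Lp * (e0 * (1 + 2 * lam)) <= 1 / 4.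
Hypothesis D_large : 4 * (La * Lp * ((lam + 1) * (ks * Ku)) + C1 * (ks * Kf)) <= D.
Hypothesis small4 : lam * (2 * (e0 * (D * exp (rate * T)))) + (lam + 1) * (ks * Ku) <= rad.
Hypothesis small5 : e0 * (D * exp (rate * T)) + e0 * (La * (Lp * (2 * rad)) + C1 * (ks * Kf)) <= rad.

(** The bound for the defect in step n that [step_error] has to reproduce. In [err], node errors of
    at most 2 e0 DE are amplified by the Lebesgue constant [lam]; the remainder is the interpolation
    error of the exact solution. *)
Let DE n := D * exp (rate * tn n).
Let err n := lam * (2 * (e0 * DE n)) + (lam + 1) * (ks * Ku).
Let Phi t a := weight ga rate del t a.

(** The case r = 0 alone would not propagate: S is bounded only by K, and each step would cost this
    factor. For all r at once, a step adds the convolution over its own interval, seen at time tn n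
    + r. *)
Definition nodal_bound (W : numerical X) n : Prop :=
  forall r, 0 <= r -> tn n + r <= T ->
    Vle P (S r (minus (nodal W n) (u (tn n)))) (beta * D * (Phi (tn n + r) (tn n) - Phi (tn n + r) 0)).

Definition interval_bound (W : numerical X) n : Prop :=
  forall q, 0 <= q <= 1 -> Vle P (minus (interp W (tn n + q * hn n)) (u (tn n + q * hn n))) (err n).

Lemma ga_pos : 0 < ga. Proof. unfold ga; lra. Qed.
Lemma beta_pos : 0 < beta. Proof. apply Rdiv_lt_0_compat; [lra|apply ga_pos]. Qed.
Lemma La_pos : 0 <= La. Proof. apply Rmult_le_pos; [apply pos_INR|auto]. Qed.
Lemma ks_pos : 0 < ks. Proof. apply pow_lt; auto. Qed.
Lemma e0_pos : 0 <= e0.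
Proof.
  eapply Rle_trans; [|apply small2]. apply Rmult_le_pos; [apply Rlt_le, beta_pos|apply pospow_nonneg].
Qed.

Lemma tn_S n : tn (Datatypes.S n) = tn n + hn n.
Proof. unfold mesh_step. ring. Qed.

Lemma tn_mono n k : (n <= k <= N)%nat -> tn n <= tn k.
Proof.
  intros [Hnk HN]. induction Hnk as [|k Hnk IH]; [lra|]. rewrite tn_S. specialize (IH ltac:(lia)).
  destruct (steps k); [lia|]. lra.
Qed.

Lemma tn_range n : (n <= N)%nat -> 0 <= tn n <= T.
Proof. intros H. rewrite <- tn0, <- tnN. split; apply tn_mono; lia. Qed.

Lemma point_range n q : (n < N)%nat -> 0 <= q <= 1 -> 0 <= tn n + q * hn n <= T.
Proof.
  intros Hn Hq. destruct (steps n Hn) as [h0 _]. destruct (tn_range n) as [t0 _]; [lia|].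
  assert (H := tn_range (Datatypes.S n) ltac:(lia)). rewrite tn_S in H. nra.
Qed.

Lemma exp_mono x y : x <= y -> exp x <= exp y.
Proof. intros [Hxy| ->]; [apply Rlt_le, exp_increasing; auto|lra]. Qed.

Lemma DE_mono n k : (n <= k <= N)%nat -> DE n <= DE k.
Proof.
  intros H. unfold DE. apply Rmult_le_compat_l; auto. apply exp_mono, Rmult_le_compat_l; auto. apply tn_mono; auto.
Qed.

Lemma DE_ge n : (n <= N)%nat -> D <= DE n.
Proof.
  intros H. rewrite <- (Rmult_1_r D) at 1. apply Rmult_le_compat_l; auto. rewrite <- exp_0. apply exp_mono.
  apply Rmult_le_pos; auto. apply tn_range; auto.
Qed.

Lemma DE_le n : (n <= N)%nat -> DE n <= D * exp (rate * T).
Proof.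
  intros H. apply Rmult_le_compat_l; auto. apply exp_mono, Rmult_le_compat_l; auto. apply tn_range; auto.
Qed.

Lemma err_mono n k : (n <= k <= N)%nat -> err n <= err k.
Proof.
  intros H. assert (E := DE_mono n k H). unfold err. apply Rplus_le_compat_r.
  apply Rmult_le_compat_l; [auto|]. apply Rmult_le_compat_l; [lra|]. apply Rmult_le_compat_l; [apply e0_pos|auto].
Qed.

Lemma err_nonneg n : 0 <= err n.
Proof.
  assert (H0 := e0_pos). assert (k0 := ks_pos).
  assert (0 <= DE n) by (apply Rmult_le_pos; [auto|apply Rlt_le, exp_pos]).
  assert (0 <= e0 * DE n) by nra. assert (0 <= ks * Ku) by nra. unfold err. nra.
Qed.

Lemma err_rad n : (n <= N)%nat -> err n <= rad.
Proof.
  intros H. eapply Rle_trans; [|apply small4]. assert (E := DE_le n H). unfold err. apply Rplus_le_compat_r.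
  apply Rmult_le_compat_l; [auto|]. apply Rmult_le_compat_l; [lra|]. apply Rmult_le_compat_l; [apply e0_pos|auto].
Qed.

(** [weight_total] estimates the accumulated weights at time t_n + q h_n. As rate h <= 1, the
    exponential there is at most e times its value at t_n, which is the origin of [exp 1] in
    [small1]. *)
Lemma propagated_bound W n q : (n < N)%nat -> nodal_bound W n -> 0 <= q <= 1 ->
  Vle P (S (q * hn n) (minus (nodal W n) (u (tn n)))) (e0 * DE n).
Proof.
  intros Hn HA Hq. destruct (steps n Hn) as [h0 h1]. assert (Rg := point_range n q Hn Hq).
  eapply Vle_mono; [apply HA; nra|].
  assert (B := beta_pos).
  set (t := tn n + q * hn n) in *.
  assert (Wt : Phi t (tn n) - Phi t 0 <= exp (rate * t) * (exp (- (rate * del)) * pospow ga T + pospow ga del)).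
  { apply weight_total; auto; [apply Rlt_le, ga_pos]. }
  set (Y := exp (- (rate * del)) * pospow ga T + pospow ga del) in *.
  assert (Y0 : 0 <= Y).
  { apply Rplus_le_le_0_compat; [apply Rmult_le_pos; [apply Rlt_le, exp_pos|]|]; apply pospow_nonneg. }
  assert (Et : exp (rate * t) <= exp (rate * tn n) * exp 1).
  { rewrite <- exp_plus. apply exp_mono. unfold t. assert (rate * hn n <= 1) by (apply Rle_trans with (rate * h); [apply Rmult_le_compat_l; auto|auto]). assert (0 <= rate * hn n) by (apply Rmult_le_pos; lra). assert (rate * (q * hn n) <= 1) by nra. nra. }
  apply Rle_trans with (beta * D * (exp (rate * tn n) * exp 1 * Y)).
  - apply Rmult_le_compat_l; [apply Rmult_le_pos; lra|]. eapply Rle_trans; [exact Wt|]. apply Rmult_le_compat_r; auto.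
  - replace (beta * D * (exp (rate * tn n) * exp 1 * Y)) with (beta * Y * exp 1 * DE n) by (unfold DE; ring).
    apply Rmult_le_compat_r; auto. apply Rmult_le_pos; [auto|apply Rlt_le, exp_pos].
Qed.

Lemma hs_le n : (n < N)%nat -> hn n ^ s <= ks.
Proof. intros Hn. destruct (steps n Hn). apply pow_incr. lra. Qed.

Lemma num_error W n G M q : (n < N)%nat -> nodal_bound W n ->
  (forall j, (1 <= j <= s)%nat -> norm (minus (G j) (f (tn n + c j * hn n))) <= M) ->
  0 <= q <= 1 ->
  Vle P (minus (num S s c (nodal W n) G (hn n) q) (u (tn n + q * hn n)))
    (e0 * DE n + e0 * (La * M + C1 * (ks * Kf))).
Proof.
  intros Hn HA HM Hq. destruct (steps n Hn) as [h0 h1].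
  assert (Bp := beta_pos). assert (Lap := La_pos). assert (Hs := hs_le n Hn). assert (Gp := ga_pos).
  assert (M0 : 0 <= M) by (exact (Rle_trans _ _ _ (norm_ge_0 _) (HM 1%nat ltac:(lia)))).
  destruct (num_step S C0 alpha K P Ha HK P_plus P_scal P_bound P_inj S_bound smooth s c m Hl
    lam C1 Kf Ku u f (tn n) (hn n) (nodal W n) G M q 0 h0 (ok n Hn) HM Hq (Rle_refl 0)) as [v [Ev Nv]].
  rewrite (sg_zero S C0) in Ev. rewrite Rplus_0_l in Ev.
  apply (Vle_plus P P_plus _ _ _ _ _ Ev).
  - apply propagated_bound; auto.
  - eapply Vle_mono; [exact Nv|]. fold ga. fold beta. rewrite Rplus_0_l, (pospow_nonpos ga 0), Rminus_0_r by lra.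
    assert (p1 : pospow ga (q * hn n) <= pospow ga h) by (apply pospow_mono; nra).
    assert (p2 := pospow_nonneg ga (q * hn n)).
    assert (0 <= La * M) by nra.
    assert (ineq : C1 * (hn n ^ s * Kf) <= C1 * (ks * Kf)) by (apply Rmult_le_compat_l; auto; apply Rmult_le_compat_r; auto).
    assert (0 <= hn n ^ s) by (apply Rlt_le, pow_lt; lra).
    assert (0 <= hn n ^ s * Kf) by nra.
    assert (0 <= C1 * (hn n ^ s * Kf)) by nra.
    assert (Q1 : beta * pospow ga (q * hn n) <= e0) by (eapply Rle_trans; [apply Rmult_le_compat_l; [lra|exact p1]|exact small2]).
    fold La. apply Rmult_le_compat; nra.
Qed.

Lemma rhs_error W n dl : (n < N)%nat ->
  (forall j, (1 <= j <= s)%nat -> Vle P (minus (delayed tau (interp W) (tn n + c j * hn n)) (delayed tau u (tn n + c j * hn n))) dl) ->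
  dl <= rad ->
  (forall j, (1 <= j <= s)%nat -> Vle P (minus (stage W n j) (u (tn n + c j * hn n))) rad) ->
  forall j b, (1 <= j <= s)%nat -> Vle P (minus (stage W n j) (u (tn n + c j * hn n))) b ->
    norm (minus (stage_rhs g tau c tn W n j) (f (tn n + c j * hn n))) <= Lp * (b + dl).
Proof.
  intros Hn Hd Hr HS j b Hj Hb. unfold stage_rhs, f, coll_point. change (stepsize tn (Datatypes.S n)) with (hn n).
  assert (Hz : forall v, Vle P (minus v v) rad).
  { intros v. replace (minus v v) with (zero : real_space X) by vec. apply (Vle_zero P P_scal). lra. }
  apply g_lip; auto.
  - apply point_range; auto.
  - eapply Vle_mono; [apply Hd; auto|auto].
Qed.

Lemma step_error W n : (n < N)%nat -> step_ok S s c inV g tau tn W n -> nodal_bound W n ->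
  (forall j, (1 <= j <= s)%nat -> Vle P (minus (delayed tau (interp W) (tn n + c j * hn n)) (delayed tau u (tn n + c j * hn n))) (err n)) ->
  (forall j, (1 <= j <= s)%nat -> Vle P (minus (stage W n j) (u (tn n + c j * hn n))) rad) ->
  nodal_bound W (Datatypes.S n) /\ interval_bound W n.
Proof.
  intros Hn (E1 & E2 & [p [Hp Ep]] & E4 & E5 & E6) HA Hd Hstage.
  destruct (steps n Hn) as [h0 h1]. assert (Bp := beta_pos). assert (Lap := La_pos). assert (Hs := hs_le n Hn). assert (Gp := ga_pos).
  assert (e0p := e0_pos). assert (ksp := ks_pos).
  set (G := stage_rhs g tau c tn W n) in *.
  destruct (finite_max s (fun j => norm (minus (G j) (f (tn n + c j * hn n)))) s_pos) as [j0 [Hj0 HM]].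
  set (M := norm (minus (G j0) (f (tn n + c j0 * hn n)))) in *.
  assert (M0 : 0 <= M) by apply norm_ge_0.
  set (z := La * M + C1 * (ks * Kf)).
  assert (NE : forall q, 0 <= q <= 1 -> Vle P (minus (num S s c (nodal W n) G (hn n) q) (u (tn n + q * hn n))) (e0 * DE n + e0 * z)).
  { intros q Hq. apply num_error; auto. }
  assert (DEn := DE_ge n ltac:(lia)).
  (* The stages are implicit, so the defect bound z occurs on both sides: [small3] and [D_large]
     give z <= DE/4 + z/4 + DE/4. *)
  assert (Hz : z <= DE n).
  { assert (HM0 : M <= Lp * (e0 * DE n + e0 * z + err n)).
    { apply rhs_error; auto; [apply err_rad; lia|]. rewrite (proj2 (proj2 (E2 j0 Hj0))). apply NE. apply c_range; auto. }
    assert (La * M <= La * (Lp * (e0 * DE n + e0 * z + err n))) by (apply Rmult_le_compat_l; auto).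
    unfold err in *.
    set (Y := (lam + 1) * (ks * Ku)) in *. set (Z := C1 * (ks * Kf)) in *.
    assert (z0 : 0 <= z).
    { unfold z. assert (0 <= ks * Kf) by nra. assert (0 <= Z) by (unfold Z; nra). nra. }
    assert (Q1 : La * Lp * e0 <= 1 / 4).
    { eapply Rle_trans; [|exact small3]. rewrite <- Rmult_assoc. rewrite <- (Rmult_1_r (La * Lp * e0)) at 1.
      apply Rmult_le_compat_l; [|lra]. apply Rmult_le_pos; [apply Rmult_le_pos|]; auto. }
    assert (Q2 : La * Lp * e0 * z <= 1 / 4 * z) by (apply Rmult_le_compat_r; auto).
    assert (Q3 : La * Lp * (e0 * (1 + 2 * lam)) * DE n <= 1 / 4 * DE n) by (apply Rmult_le_compat_r; lra).
    assert (z <= La * Lp * (e0 * (1 + 2 * lam)) * DE n + La * Lp * e0 * z + (La * Lp * Y + Z)).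
    { unfold z at 1. replace (La * Lp * (e0 * (1 + 2 * lam)) * DE n + La * Lp * e0 * z + (La * Lp * Y + Z))
        with (La * (Lp * (e0 * DE n + e0 * z + (lam * (2 * (e0 * DE n)) + Y))) + Z) by ring. lra. }
    lra. }
  assert (z0 : 0 <= z).
  { unfold z. assert (0 <= ks * Kf) by nra. assert (0 <= C1 * (ks * Kf)) by nra. nra. }
  split.
  - intros r Hr HT. rewrite tn_S in *.
    destruct (num_step S C0 alpha K P Ha HK P_plus P_scal P_bound P_inj S_bound smooth s c m Hl
      lam C1 Kf Ku u f (tn n) (hn n) (nodal W n) G M 1 r h0 (ok n Hn) HM) as [v [Ev Nv]]; [lra|auto|].
    rewrite Rmult_1_l in Ev, Nv. rewrite <- E1 in Ev. fold ga in Nv. fold beta in Nv. fold La in Nv.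
    assert (Hr2 : tn n + (r + hn n) = tn n + hn n + r) by ring.
    assert (HA' := HA (r + hn n) ltac:(lra) ltac:(lra)). rewrite Hr2 in HA'.
    eapply Vle_mono; [exact (Vle_plus P P_plus _ _ _ _ _ Ev HA' Nv)|].
    set (t := tn n + hn n + r) in *.
    (* The share of this step, with the exponential frozen at its left end, is at most the next
       increment of [Phi]; hence the bounds add up without loss. *)
    assert (Wt := weight_step ga rate del t (tn n) (tn n + hn n) ltac:(lra) rate_pos ltac:(lra)).
    replace (t - tn n) with (r + hn n) in Wt by (unfold t; ring). replace (t - (tn n + hn n)) with r in Wt by (unfold t; ring).
    fold (Phi t (tn n + hn n)) in Wt. fold (Phi t (tn n)) in Wt.
    assert (pd : 0 <= pospow ga (r + hn n) - pospow ga r) by (assert (pospow ga r <= pospow ga (r + hn n)) by (apply pospow_mono; lra); lra).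
    assert (zz : La * M + C1 * (hn n ^ s * Kf) <= DE n).
    { eapply Rle_trans; [|exact Hz]. unfold z. apply Rplus_le_compat_l, Rmult_le_compat_l; auto. apply Rmult_le_compat_r; auto. }
    assert (beta * (pospow ga (r + hn n) - pospow ga r) * (La * M + C1 * (hn n ^ s * Kf)) <= beta * D * (Phi t (tn n + hn n) - Phi t (tn n))).
    { apply Rle_trans with (beta * (pospow ga (r + hn n) - pospow ga r) * DE n).
      - apply Rmult_le_compat_l; auto. apply Rmult_le_pos; lra.
      - unfold DE. replace (beta * (pospow ga (r + hn n) - pospow ga r) * (D * exp (rate * tn n))) with
          (beta * D * ((pospow ga (r + hn n) - pospow ga r) * exp (rate * tn n))) by ring.
        apply Rmult_le_compat_l; auto. apply Rmult_le_pos; lra. }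
    lra.
  - destruct (ok n Hn) as (_ & _ & _ & om & Pom & Iom).
    set (E := 2 * (e0 * DE n)).
    assert (eD : 0 <= e0 * DE n) by nra.
    assert (NE' : forall q, 0 <= q <= 1 -> Vle P (minus (num S s c (nodal W n) G (hn n) q) (u (tn n + q * hn n))) E).
    { intros q Hq. eapply Vle_mono; [apply NE; auto|]. unfold E. assert (e0 * z <= e0 * DE n) by (apply Rmult_le_compat_l; auto). lra. }
    assert (node : forall x, In x (all_nodes s c) -> exists w, P w = p x /\ norm (minus w (om x)) <= E).
    { intros x Hx.
      assert (Vx : 0 <= x <= 1 /\ Vle P (minus (interp W (tn n + x * hn n)) (u (tn n + x * hn n))) E).
      { apply all_nodes_In in Hx. destruct Hx as [->|[->|[i [Hi ->]]]].
        - split; [lra|]. replace (tn n + 0 * hn n) with (tn n) by ring. rewrite E4.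
          assert (Pb := propagated_bound W n 0 Hn HA ltac:(lra)). rewrite Rmult_0_l, (sg_zero S C0) in Pb.
          eapply Vle_mono; [exact Pb|]. unfold E; lra.
        - split; [lra|]. rewrite Rmult_1_l, <- tn_S, E5, E1. replace (tn (Datatypes.S n)) with (tn n + 1 * hn n) by (rewrite tn_S; ring). apply NE'. lra.
        - split; [apply c_range; auto|]. rewrite E6 by auto. rewrite (proj2 (proj2 (E2 i Hi))). apply NE'. apply c_range; auto. }
      destruct Vx as [Rx [w [Ew Nw]]]. exists (plus (om x) w). split.
      - rewrite P_plus, Ew, Pom, <- Ep by auto. vec.
      - eapply Rle_trans; [right; apply f_equal|exact Nw]. vec. }
    (* [p] interpolates in X, but the error is wanted in V. The preimages at the nodes are therefore
       interpolated by [pi], and uniqueness, in the form of [Hlam] with bound 0, identifies the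
       image of [pi] under [P] with [p]. *)
    destruct (choice_on (zero : real_space X) _ _ node) as [w Hw].
    destruct (interp_exists (V := real_space X) (all_nodes s c) w (NoDup_nodup _ _)) as [pi [Hpi Epi]].
    assert (EP : forall q, 0 <= q <= 1 -> P (pi q) = p q).
    { intros q Hq. apply minus_eq0, norm_eq_zeroV, Rle_antisym; [|apply norm_ge_0].
      rewrite <- (Rmult_0_r lam). apply (Hlam (fun q => minus (P (pi q)) (p q))); auto; [lra| |].
      - apply is_poly_minus; auto. apply (is_poly_map (V := real_space X) (W := real_space X)); auto. apply (P_zero P P_scal).
      - intros x Hx. apply norm_le_zero; [|lra]. rewrite Epi, (proj1 (Hw x Hx)) by auto. vec. }
    intros q Hq. exists (minus (pi q) (om q)). split.
    + rewrite (P_minus P P_plus P_scal), EP, Pom, Ep by auto. reflexivity.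
    + eapply Rle_trans; [apply (Iom pi E); auto|].
      * unfold E. lra.
      * intros x Hx. rewrite Epi by auto. apply Hw; auto.
      * unfold err, E. assert (hn n ^ s * Ku <= ks * Ku) by (apply Rmult_le_compat_r; auto).
        assert (lam * (hn n ^ s * Ku) <= lam * (ks * Ku)) by (apply Rmult_le_compat_l; auto). lra.
Qed.

Lemma mesh_locate n r : (n <= N)%nat -> 0 < r <= tn n -> exists k q, (k < n)%nat /\ 0 <= q <= 1 /\ r = tn k + q * hn k.
Proof.
  induction n as [|n IH]; intros Hn Hr; [rewrite tn0 in Hr; lra|].
  destruct (Rle_dec r (tn n)) as [H|H].
  - destruct IH as (k & q & Hk & Hq & E); [lia|lra|]. exists k, q. split; [lia|auto].
  - destruct (steps n Hn) as [h0 _]. exists n, ((r - tn n) / hn n). rewrite tn_S in Hr. split; [lia|]. split; [split|field; lra].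
    + apply Rdiv_le_0_compat; lra.
    + apply Rmult_le_reg_r with (hn n); auto. unfold Rdiv. rewrite Rmult_assoc, Rinv_l by lra. lra.
Qed.

Lemma history_bound W n : (n <= N)%nat -> (forall t, t <= 0 -> interp W t = phi t) -> (forall k, (k < n)%nat -> interval_bound W k) ->
  forall r, r <= tn n -> Vle P (minus (interp W r) (u r)) (err n).
Proof.
  intros Hn Hh HB r Hr. destruct (Rle_dec r 0) as [H|H].
  - rewrite Hh, u_hist by auto. replace (minus (phi r) (phi r)) with (zero : real_space X) by vec.
    apply (Vle_zero P P_scal). apply err_nonneg.
  - destruct (mesh_locate n r Hn) as (k & q & Hk & Hq & ->); [lra|].
    eapply Vle_mono; [apply HB; auto|]. apply err_mono. lia.
Qed.

(** Steps do not exceed the delay, so the delayed argument of a stage lies in the history already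
    computed, and the stage equations are implicit only in the stages. *)
Lemma delayed_le n j : (n < N)%nat -> (1 <= j <= s)%nat -> tn n + c j * hn n - tau (tn n + c j * hn n) <= tn n.
Proof.
  intros Hn Hj. assert (Rg := point_range n (c j) Hn (c_range j Hj)). destruct (steps n Hn). assert (Hd := delay_ge _ (proj1 Rg)).
  assert (Hc := c_range j Hj). nra.
Qed.

(** Stated for the first M steps only: both the extension by one step and the comparison of two
    solutions need the error bound for an initial part of the mesh. *)
Lemma global_error W M : (M <= N)%nat -> nodal W 0%nat = phi 0 -> (forall t, t <= 0 -> interp W t = phi t) ->
  (forall n, (n < M)%nat -> step_ok S s c inV g tau tn W n) ->
  (forall n j, (n < M)%nat -> (1 <= j <= s)%nat -> Vle P (minus (stage W n j) (u (tn n + c j * hn n))) rad) ->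
  nodal_bound W M /\ forall k, (k < M)%nat -> interval_bound W k.
Proof.
  intros HM N0 Hh Hst HV.
  assert (H : forall n, (n <= M)%nat -> nodal_bound W n /\ forall k, (k < n)%nat -> interval_bound W k); [|apply H; auto].
  induction n as [|n IH]; intros Hn.
  - split; [|lia]. intros r Hr _. rewrite tn0, N0, u_hist by lra. replace (minus (phi 0) (phi 0)) with (zero : real_space X) by vec.
    rewrite (lin_zero _ (sg_lin S C0 r Hr)). apply (Vle_zero P P_scal). rewrite Rminus_diag. lra.
  - destruct IH as [HA HB]; [lia|].
    destruct (step_error W n) as [HA' HB']; auto; [lia| |].
    + intros j Hj. apply (history_bound W n); auto; [lia|]. apply delayed_le; auto. lia.
    + split; auto. intros k Hk. destruct (Nat.eq_dec k n) as [->|]; auto. apply HB. lia.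
Qed.

Lemma num_ext U G G' k q : (forall j, (1 <= j <= s)%nat -> G j = G' j) -> num S s c U G k q = num S s c U G' k q.
Proof.
  intros H. unfold num. f_equal. f_equal. apply (sum1_ext (V := real_space X)). intros j Hj. rewrite H; auto.
Qed.

Lemma num_0 U G k : 0 < k -> num S s c U G k 0 = U.
Proof.
  intros Hk. unfold num. rewrite (coef_sum_RInt S C0 K HK S_bound s c) by lra. rewrite Rmult_0_l, (sg_zero S C0).
  transitivity (plus U (scal k (zero : real_space X))); [|vec]. f_equal. f_equal. apply (RInt_point (V := real_space X)).
Qed.

Lemma num_contraction U G G' n q mu : (n < N)%nat -> 0 <= q <= 1 -> 0 <= mu ->
  (forall j, (1 <= j <= s)%nat -> norm (minus (G j) (G' j)) <= Lp * mu) ->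
  Vle P (minus (num S s c U G (hn n) q) (num S s c U G' (hn n) q)) (1 / 4 * mu).
Proof.
  intros Hn Hq Hmu HG. destruct (steps n Hn) as [h0 h1]. assert (Bp := beta_pos). assert (Lap := La_pos). assert (Gp := ga_pos).
  eapply Vle_mono; [apply (num_diff S C0 alpha K P Ha HK P_plus P_scal P_bound P_inj S_bound smooth s c m Hl U G G' (hn n) q (Lp * mu)); auto|].
  fold ga. fold beta. fold La.
  assert (p1 : pospow ga (q * hn n) <= pospow ga h) by (apply pospow_mono; nra).
  assert (Q0 : beta * pospow ga (q * hn n) <= e0) by (eapply Rle_trans; [apply Rmult_le_compat_l; [lra|exact p1]|exact small2]).
  assert (e0p := e0_pos).
  assert (Q1 : e0 * (La * Lp) <= 1 / 4).
  { eapply Rle_trans; [|exact small3]. replace (e0 * (La * Lp)) with (La * Lp * (e0 * 1)) by ring.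
    apply Rmult_le_compat_l; [apply Rmult_le_pos; auto|]. apply Rmult_le_compat_l; auto. lra. }
  apply Rle_trans with (e0 * (La * (Lp * mu))).
  - apply Rmult_le_compat_r; auto. apply Rmult_le_pos; [auto|]. apply Rmult_le_pos; auto.
  - replace (e0 * (La * (Lp * mu))) with (e0 * (La * Lp) * mu) by ring. apply Rmult_le_compat_r; auto.
Qed.

Lemma Vle_self v : Vle P (minus v v) 0.
Proof. replace (minus v v) with (zero : real_space X) by vec. apply (Vle_zero P P_scal). lra. Qed.

Definition starts (W : numerical X) := nodal W 0%nat = phi 0 /\ forall t, t <= 0 -> interp W t = phi t.

Definition in_strip (W : numerical X) n :=
  forall j, (1 <= j <= s)%nat -> Vle P (minus (stage W n j) (u (tn n + c j * hn n))) rad.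

(** The largest V-distance mu between the stages satisfies mu <= mu/4 by [num_contraction]. The
    strip bounds on stages and history make the Lipschitz condition applicable. *)
Lemma step_unique W1 W2 n : (n < N)%nat -> step_ok S s c inV g tau tn W1 n -> step_ok S s c inV g tau tn W2 n ->
  in_strip W1 n -> in_strip W2 n -> nodal W1 n = nodal W2 n ->
  (forall t, t <= tn n -> interp W1 t = interp W2 t) ->
  (forall t, t <= tn n -> Vle P (minus (interp W1 t) (u t)) (err n)) ->
  nodal W1 (Datatypes.S n) = nodal W2 (Datatypes.S n) /\
  forall q, 0 <= q <= 1 -> interp W1 (tn n + q * hn n) = interp W2 (tn n + q * hn n).
Proof.
  intros Hn (A1 & A2 & [p1 [Hp1 A3]] & A4 & A5 & A6) (B1 & B2 & [p2 [Hp2 B3]] & B4 & B5 & B6) V1 V2 EU EI HE.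
  destruct (steps n Hn) as [h0 h1].
  set (G1 := stage_rhs g tau c tn W1 n) in *. set (G2 := stage_rhs g tau c tn W2 n) in *.
  assert (Hw0 : forall j, (1 <= j <= s)%nat -> exists w, P w = minus (stage W1 n j) (stage W2 n j)).
  { intros j Hj. destruct (V1 j Hj) as [w1 [E1 _]]. destruct (V2 j Hj) as [w2 [E2 _]].
    exists (minus w1 w2). rewrite (P_minus P P_plus P_scal), E1, E2. vec. }
  destruct (choice_on (zero : real_space X) _ _ Hw0) as [w Hw].
  destruct (finite_max s (fun j => norm (w j)) s_pos) as [j0 [Hj0 HM]].
  set (mu := norm (w j0)) in *.
  assert (mu0 : 0 <= mu) by apply norm_ge_0.
  assert (HG : forall j, (1 <= j <= s)%nat -> norm (minus (G1 j) (G2 j)) <= Lp * mu).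
  { intros j Hj. unfold G1, G2, stage_rhs, coll_point. change (stepsize tn (Datatypes.S n)) with (hn n).
    assert (Ed : delayed tau (interp W2) (tn n + c j * hn n) = delayed tau (interp W1) (tn n + c j * hn n)).
    { symmetry. apply EI. apply delayed_le; auto. }
    assert (Vd : Vle P (minus (delayed tau (interp W1) (tn n + c j * hn n)) (delayed tau u (tn n + c j * hn n))) rad).
    { eapply Vle_mono; [apply HE; apply delayed_le; auto|apply err_rad; lia]. }
    rewrite Ed. replace (Lp * mu) with (Lp * (mu + 0)) by ring.
    apply g_lip; [apply point_range; auto|apply V1; auto|apply V2; auto|auto|auto| |apply Vle_self].
    exists (w j). split; [apply Hw; auto|apply HM; auto]. }
  assert (muz : mu = 0).
  { assert (Hc : Vle P (P (w j0)) (1 / 4 * mu)).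
    { rewrite Hw by auto. rewrite (proj2 (proj2 (A2 j0 Hj0))), (proj2 (proj2 (B2 j0 Hj0))), <- EU.
      apply num_contraction; auto. }
    destruct Hc as [w' [Ew Nw]]. apply (P_eq P P_plus P_scal P_inj) in Ew. rewrite Ew in Nw. fold mu in Nw. lra. }
  assert (EG : forall j, (1 <= j <= s)%nat -> G1 j = G2 j).
  { intros j Hj. apply minus_eq0, norm_eq_zeroV, Rle_antisym; [|apply norm_ge_0].
    eapply Rle_trans; [apply HG; auto|]. rewrite muz. lra. }
  assert (ES : forall j, (1 <= j <= s)%nat -> stage W1 n j = stage W2 n j).
  { intros j Hj. rewrite (proj2 (proj2 (A2 j Hj))), (proj2 (proj2 (B2 j Hj))), EU. apply num_ext; auto. }
  assert (EN : nodal W1 (Datatypes.S n) = nodal W2 (Datatypes.S n)) by (rewrite A1, B1, EU; apply num_ext; auto).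
  split; auto. intros q Hq. rewrite A3, B3 by auto.
  apply minus_eq0, norm_eq_zeroV, Rle_antisym; [|apply norm_ge_0].
  rewrite <- (Rmult_0_r lam). apply (Hlam (fun q => minus (p1 q) (p2 q))); auto; [lra|apply is_poly_minus; auto|].
  intros x Hx. apply norm_le_zero; [|lra].
  assert (Rx : 0 <= x <= 1) by (apply (all_nodes_range s c c_range); auto).
  rewrite <- A3, <- B3 by auto. apply all_nodes_In in Hx. destruct Hx as [->|[->|[i [Hi ->]]]].
  - replace (tn n + 0 * hn n) with (tn n) by ring. rewrite A4, B4, EU. vec.
  - rewrite Rmult_1_l, <- tn_S, A5, B5, EN. vec.
  - rewrite A6, B6, ES by auto. vec.
Qed.

Lemma numerical_unique W1 W2 : starts W1 -> starts W2 ->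
  (forall n, (n < N)%nat -> step_ok S s c inV g tau tn W1 n) -> (forall n, (n < N)%nat -> step_ok S s c inV g tau tn W2 n) ->
  (forall n, (n < N)%nat -> in_strip W1 n) -> (forall n, (n < N)%nat -> in_strip W2 n) ->
  forall t, t <= T -> interp W1 t = interp W2 t.
Proof.
  intros [N1 I1] [N2 I2] S1 S2 V1 V2.
  assert (H : forall n, (n <= N)%nat -> nodal W1 n = nodal W2 n /\ forall t, t <= tn n -> interp W1 t = interp W2 t).
  { induction n as [|n IH]; intros Hn.
    - split; [rewrite N1, N2; auto|]. intros t Ht. rewrite tn0 in Ht. rewrite I1, I2; auto.
    - destruct IH as [EU EI]; [lia|].
      destruct (global_error W1 n) as [_ HB]; auto; [lia|intros; apply S1; lia|intros; apply V1; auto; lia|].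
      destruct (step_unique W1 W2 n) as [EN EQ]; auto.
      { intros t Ht. apply (history_bound W1 n); auto. lia. }
      split; auto. intros t Ht. destruct (Rle_dec t (tn n)); auto.
      destruct (steps n Hn) as [h0 _]. rewrite tn_S in Ht.
      replace t with (tn n + (t - tn n) / hn n * hn n) by (field; lra). apply EQ. split.
      + apply Rdiv_le_0_compat; lra.
      + apply Rmult_le_reg_r with (hn n); auto. unfold Rdiv. rewrite Rmult_assoc, Rinv_l by lra. lra. }
  intros t Ht. destruct (H N) as [_ H']; [lia|]. apply H'. lra.
Qed.

(** The unknowns e j are A^alpha of the deviations of the stages from u. In these coordinates the
    strip is a ball of X, and [contraction_fixpoint] applies. *)
Lemma stage_solution W n : (n < N)%nat -> nodal_bound W n ->
  (forall t, t <= tn n -> Vle P (minus (interp W t) (u t)) (err n)) ->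
  exists e : nat -> real_space X, let st := fun j => plus (u (tn n + c j * hn n)) (P (e j)) in
    (forall j, (1 <= j <= s)%nat -> norm (e j) <= rad) /\
    forall i, (1 <= i <= s)%nat -> st i = num S s c (nodal W n)
       (fun j => g (tn n + c j * hn n) (st j) (delayed tau (interp W) (tn n + c j * hn n))) (hn n) (c i).
Proof.
  intros Hn HA HE. destruct (steps n Hn) as [h0 h1].
  set (t_ := fun j => tn n + c j * hn n).
  set (G := fun (e : nat -> real_space X) j => g (t_ j) (plus (u (t_ j)) (P (e j))) (delayed tau (interp W) (t_ j))).
  set (nm := fun (ei : (nat -> real_space X) * nat) => minus (num S s c (nodal W n) (G (fst ei)) (hn n) (c (snd ei))) (u (t_ (snd ei)))).
  assert (Vst : forall e j b, norm (e j) <= b -> Vle P (minus (plus (u (t_ j)) (P (e j))) (u (t_ j))) b).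
  { intros e j b Hb. exists (e j). split; auto. vec. }
  assert (Vd : forall j, (1 <= j <= s)%nat -> Vle P (minus (delayed tau (interp W) (t_ j)) (delayed tau u (t_ j))) rad).
  { intros j Hj. eapply Vle_mono; [apply HE; apply delayed_le; auto|apply err_rad; lia]. }
  assert (Rt : forall j, (1 <= j <= s)%nat -> 0 <= t_ j <= T) by (intros j Hj; apply point_range; auto).
  assert (Hnm : forall e i, (forall j, (1 <= j <= s)%nat -> norm (e j) <= rad) -> (1 <= i <= s)%nat -> Vle P (nm (e, i)) rad).
  { intros e i He Hi. eapply Vle_mono; [apply (num_error W n (G e) (Lp * (2 * rad)) (c i)); auto|].
    - intros j Hj. unfold G, f. replace (2 * rad) with (rad + rad) by ring. apply g_lip; [apply Rt; auto|auto|eapply Vle_mono; [apply Vle_self|lra]|auto|eapply Vle_mono; [apply Vle_self|lra]|auto|apply Vd; auto].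
    - eapply Rle_trans; [|exact small5]. apply Rplus_le_compat_r. apply Rmult_le_compat_l; [apply e0_pos|]. apply DE_le. lia. }
  (* The map takes the preimage under [P] of the residual. By [Hnm] it exists whenever the e j lie
     in the ball; where there is no preimage, the value is the default zero. *)
  destruct (choice_on (zero : real_space X) (fun ei => exists w, P w = nm ei) (fun ei w => P w = nm ei)) as [k Hk]; [auto|].
  destruct (contraction_fixpoint (V := real_space X) s (fun e i => k (e, i)) rad (1 / 4)) as [e [He Fe]]; try lra.
  - intros e He i Hi. cbv beta. destruct (Hnm e i He Hi) as [w [Ew Nw]].
    eapply Rle_trans; [right; apply f_equal|exact Nw]. apply (P_eq P P_plus P_scal P_inj). rewrite Hk by eauto. auto.
  - intros e e' d He He' Hd i Hi. cbv beta. destruct (Hnm e i He Hi) as [w [Ew _]]. destruct (Hnm e' i He' Hi) as [w' [Ew' _]].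
    assert (d0 : 0 <= d) by (exact (Rle_trans _ _ _ (norm_ge_0 _) (Hd i Hi))).
    destruct (num_contraction (nodal W n) (G e) (G e') n (c i) d) as [v [Ev Nv]]; auto.
    + intros j Hj. unfold G. replace (Lp * d) with (Lp * (d + 0)) by ring. apply g_lip; [apply Rt; auto|auto|auto|auto|auto| |apply Vle_self].
      exists (minus (e j) (e' j)). split; [rewrite (P_minus P P_plus P_scal); vec|auto].
    + eapply Rle_trans; [right; apply f_equal|exact Nv]. apply (P_eq P P_plus P_scal P_inj).
      rewrite (P_minus P P_plus P_scal), !Hk by (eexists; eauto). rewrite Ev. unfold nm. cbn [fst snd]. vec.
  - exists e. cbv zeta. split; auto. intros i Hi. destruct (Hnm e i He Hi) as [w [Ew _]].
    rewrite <- (Fe i Hi), Hk by (eexists; eauto). unfold nm. cbn [fst snd]. fold (t_ i).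
    change (fun j => g (tn n + c j * hn n) (plus (u (tn n + c j * hn n)) (P (e j))) (delayed tau (interp W) (tn n + c j * hn n))) with (G e). vec.
Qed.

Lemma numerical_extend W n : (n < N)%nat -> starts W ->
  (forall k, (k < n)%nat -> step_ok S s c inV g tau tn W k) -> (forall k, (k < n)%nat -> in_strip W k) ->
  exists W', starts W' /\ (forall k, (k < Datatypes.S n)%nat -> step_ok S s c inV g tau tn W' k) /\
    (forall k, (k < Datatypes.S n)%nat -> in_strip W' k).
Proof.
  intros Hn [N0 I0] HS HV.
  destruct (global_error W n) as [HA HB]; auto; [lia|intros; apply HV; auto|].
  assert (HE : forall t, t <= tn n -> Vle P (minus (interp W t) (u t)) (err n)) by (apply history_bound; auto; lia).
  destruct (steps n Hn) as [h0 h1].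
  destruct (stage_solution W n Hn HA HE) as [e [He Hst]]. cbv zeta in Hst.
  set (st := fun j => plus (u (tn n + c j * hn n)) (P (e j))) in *.
  set (G := fun j => g (tn n + c j * hn n) (st j) (delayed tau (interp W) (tn n + c j * hn n))) in *.
  change (forall i, (1 <= i <= s)%nat -> st i = num S s c (nodal W n) G (hn n) (c i)) in Hst.
  (* [num] is prescribed at every node, including 0 and 1. If some c_i equals 0 or 1, its stage then
     agrees with the nodal value automatically. *)
  destruct (interp_exists (V := real_space X) (all_nodes s c) (fun x => num S s c (nodal W n) G (hn n) x) (NoDup_nodup _ _)) as [p [Hp Ep]].
  set (W' := Numerical X (fun k => if Nat.eq_dec k (Datatypes.S n) then num S s c (nodal W n) G (hn n) 1 else nodal W k)
    (fun k i => if Nat.eq_dec k n then st i else stage W k i)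
    (fun t => if Rle_dec t (tn n) then interp W t else p ((t - tn n) / hn n))).
  assert (Old : forall t, t <= tn n -> interp W' t = interp W t).
  { intros t Ht. unfold W'. cbn [interp]. destruct (Rle_dec t (tn n)); [auto|lra]. }
  assert (Nd : forall k, k <> Datatypes.S n -> nodal W' k = nodal W k).
  { intros k Hk. unfold W'. cbn [nodal]. destruct (Nat.eq_dec k (Datatypes.S n)); [contradiction|auto]. }
  assert (Nn : nodal W' (Datatypes.S n) = num S s c (nodal W n) G (hn n) 1).
  { unfold W'. cbn [nodal]. destruct (Nat.eq_dec (Datatypes.S n) (Datatypes.S n)); [auto|contradiction]. }
  assert (So : forall k i, k <> n -> stage W' k i = stage W k i).
  { intros k i Hk. unfold W'. cbn [stage]. destruct (Nat.eq_dec k n); [contradiction|auto]. }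
  assert (Sn : forall i, stage W' n i = st i).
  { intros i. unfold W'. cbn [stage]. destruct (Nat.eq_dec n n); [auto|contradiction]. }
  assert (P0 : p 0 = nodal W n).
  { rewrite Ep by (apply all_nodes_In; auto). apply num_0; auto. }
  assert (In_ : interp W (tn n) = nodal W n).
  { destruct n as [|k]; [rewrite tn0, I0, N0 by lra; auto|]. apply (HS k). lia. }
  assert (New : forall q, 0 <= q <= 1 -> interp W' (tn n + q * hn n) = p q).
  { intros q Hq. unfold W'. cbn [interp]. destruct (Rle_dec (tn n + q * hn n) (tn n)) as [H|H].
    - assert (q = 0) by nra. subst q. replace (tn n + 0 * hn n) with (tn n) by ring. rewrite In_. auto.
    - f_equal. field. lra. }
  assert (EG : forall j, (1 <= j <= s)%nat -> G j = stage_rhs g tau c tn W' n j).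
  { intros j Hj. unfold stage_rhs. rewrite Sn. unfold coll_point. change (stepsize tn (Datatypes.S n)) with (hn n).
    unfold G, delayed. rewrite Old; auto. apply delayed_le; auto. }
  assert (tpos : 0 <= tn n) by (apply tn_range; lia).
  exists W'. split; [|split].
  - split; [rewrite Nd by lia; auto|]. intros t Ht. rewrite Old by lra. auto.
  - intros k Hk. destruct (Nat.eq_dec k n) as [->|Nk].
    + split; [|split; [|split; [|split; [|split]]]].
      * rewrite Nn, (Nd n) by lia. apply num_ext; auto.
      * intros i Hi. rewrite Sn. split; [|split].
        -- destruct (u_V (tn n + c i * hn n)) as [w Ew]; [apply point_range; auto|]. exists (plus w (e i)). rewrite P_plus, Ew. reflexivity.
        -- unfold delayed. rewrite Old by (apply delayed_le; auto).
           destruct (delayed_u_V (tn n + c i * hn n)) as [w Ew]; [apply point_range; auto|].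
           destruct (HE (tn n + c i * hn n - tau (tn n + c i * hn n))) as [v [Ev _]]; [apply delayed_le; auto|].
           exists (plus v w). rewrite P_plus, Ev, Ew. unfold delayed. vec.
        -- rewrite (Nd n) by lia. rewrite Hst by auto. apply num_ext; auto.
      * exists p. split; auto.
      * rewrite Old by lra. rewrite (Nd n) by lia. auto.
      * replace (tn (Datatypes.S n)) with (tn n + 1 * hn n) by (rewrite tn_S; ring). rewrite New by lra.
        rewrite Ep by (apply all_nodes_In; auto). auto.
      * intros i Hi. rewrite New by (apply c_range; auto). rewrite Ep by (apply all_nodes_In; eauto). rewrite Sn. symmetry. auto.
    + destruct (steps k) as [hk _]; [lia|].
      apply (step_ok_ext S s c inV g tau tn W W' k); auto; try lia; try (apply Nd; lia).
      * intros i Hi. eapply Rle_trans; [apply delayed_le; auto; lia|]. apply tn_mono. lia.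
      * intros t Ht. apply Old. eapply Rle_trans; [exact Ht|]. apply tn_mono. lia.
      * apply HS. lia.
  - intros k Hk j Hj. destruct (Nat.eq_dec k n) as [->|Nk].
    + rewrite Sn. exists (e j). split; [unfold st; vec|auto].
    + rewrite So by auto. apply HV; auto. lia.
Qed.

Lemma numerical_exists : exists W, starts W /\ (forall n, (n < N)%nat -> step_ok S s c inV g tau tn W n) /\ (forall n, (n < N)%nat -> in_strip W n).
Proof.
  assert (H : forall M, (M <= N)%nat -> exists W, starts W /\ (forall n, (n < M)%nat -> step_ok S s c inV g tau tn W n) /\ (forall n, (n < M)%nat -> in_strip W n)); [|apply H; auto].
  induction M as [|M IH]; intros HM.
  - exists (Numerical X (fun _ => phi 0) (fun _ _ => zero) phi). split; [split; auto|split; intros; lia].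
  - destruct IH as (W & HW & HS & HV); [lia|]. apply (numerical_extend W M); auto.
Qed.

Lemma numerical_error W : starts W -> (forall n, (n < N)%nat -> step_ok S s c inV g tau tn W n) -> (forall n, (n < N)%nat -> in_strip W n) ->
  forall t, t <= T -> Vle P (minus (interp W t) (u t)) (lam * (2 * (e0 * (D * exp (rate * T)))) + (lam + 1) * (h ^ s * Ku)).
Proof.
  intros [N0 I0] HS HV t Ht. destruct (global_error W N) as [_ HB]; auto; [intros; apply HV; auto|].
  rewrite <- tnN in Ht |- *. apply history_bound; auto.
Qed.

End Scheme.

(** * Choice of the constants and conclusion *)

Lemma exp_small x y del : 0 <= x -> 0 < y -> 0 < del -> exists rate, 0 <= rate /\ exp (- (rate * del)) * x <= y.
Proof.
  intros Hx Hy Hd. exists (x / y / del). split; [apply Rdiv_le_0_compat; [apply Rdiv_le_0_compat|]; lra|].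
  replace (x / y / del * del) with (x / y) by (field; lra).
  rewrite exp_Ropp. assert (E := exp_ineq1_le (x / y)). assert (p := Rdiv_le_0_compat x y Hx Hy).
  apply Rmult_le_reg_l with (exp (x / y)); [lra|]. rewrite <- Rmult_assoc, Rinv_r, Rmult_1_l by lra.
  apply Rle_trans with ((1 + x / y) * y); [|apply Rmult_le_compat_r; lra].
  replace ((1 + x / y) * y) with (y + x) by (field; lra). lra.
Qed.

(** The order of choice is e0 from the Lipschitz and Lebesgue constants, then [del] and [rate] from
    e0, and h0 last. Only D varies with h, and it is proportional to h^s; this is how the order s
    reaches the final bound. *)
Lemma scheme_constants ga beta La Lp lam C1 Kf Ku rad tau0 T s : 0 < ga -> 0 < beta -> 0 <= La -> 0 <= Lp -> 0 <= lam ->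
  0 <= C1 -> 0 <= Kf -> 0 <= Ku -> 0 < rad -> 0 < tau0 -> (1 <= s)%nat ->
  exists rate del e0 h0 C, 0 <= rate /\ 0 <= del /\ 0 < h0 /\ 0 < C /\
    La * Lp * (e0 * (1 + 2 * lam)) <= 1 / 4 /\
    beta * (exp (- (rate * del)) * pospow ga T + pospow ga del) * exp 1 <= e0 /\
    forall h, 0 < h <= h0 ->
      let D := 4 * (La * Lp * ((lam + 1) * (h ^ s * Ku)) + C1 * (h ^ s * Kf)) in
      h <= tau0 /\ rate * h <= 1 /\ 0 <= D /\ beta * pospow ga h <= e0 /\
      lam * (2 * (e0 * (D * exp (rate * T)))) + (lam + 1) * (h ^ s * Ku) <= rad /\
      e0 * (D * exp (rate * T)) + e0 * (La * (Lp * (2 * rad)) + C1 * (h ^ s * Kf)) <= rad /\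
      lam * (2 * (e0 * (D * exp (rate * T)))) + (lam + 1) * (h ^ s * Ku) <= C * h ^ s * (Kf + Ku).
Proof.
  intros Hga Hb HLa HLp Hlam HC1 HKf HKu Hrad Htau Hs.
  set (LL := La * Lp). assert (HLL : 0 <= LL) by (apply Rmult_le_pos; auto).
  set (e0 := / (4 * (LL + 1) * (1 + 2 * lam))).
  assert (He0 : 0 < e0) by (apply Rinv_0_lt_compat; nra).
  assert (E3 : LL * (e0 * (1 + 2 * lam)) <= 1 / 4).
  { unfold e0. replace (LL * (/ (4 * (LL + 1) * (1 + 2 * lam)) * (1 + 2 * lam))) with (LL / (4 * (LL + 1))) by (field; lra).
    apply Rmult_le_reg_r with (4 * (LL + 1)); [lra|]. unfold Rdiv at 1. rewrite Rmult_assoc, Rinv_l by lra. lra. }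
  assert (E4 : LL * e0 <= 1 / 4).
  { eapply Rle_trans; [|exact E3]. apply Rmult_le_compat_l; auto. rewrite <- (Rmult_1_r e0) at 1. apply Rmult_le_compat_l; lra. }
  set (y := e0 / (2 * beta * exp 1)). assert (ex1 := exp_pos 1).
  assert (Hy : 0 < y) by (apply Rdiv_lt_0_compat; [auto|nra]).
  destruct (pospow_small ga y Hga Hy) as [del [Hdel Pdel]].
  destruct (exp_small (pospow ga T) y del (pospow_nonneg _ _) Hy Hdel) as [rate [Hrate Prate]].
  destruct (pospow_small ga (e0 / beta) Hga) as [h1 [Hh1 Ph1]]; [apply Rdiv_lt_0_compat; auto|].
  set (E := exp (rate * T)). assert (HE : 0 < E) by apply exp_pos.
  set (Dc := 4 * (LL * ((lam + 1) * Ku) + C1 * Kf)).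
  assert (HDc : 0 <= Dc).
  { unfold Dc. assert (0 <= LL * ((lam + 1) * Ku)) by (apply Rmult_le_pos; [auto|apply Rmult_le_pos; lra]).
    assert (0 <= C1 * Kf) by (apply Rmult_le_pos; auto). lra. }
  set (Z4 := lam * (2 * (e0 * (Dc * E))) + (lam + 1) * Ku).
  set (Z5 := e0 * (Dc * E) + e0 * (C1 * Kf)).
  assert (DE0 : 0 <= e0 * (Dc * E)) by (apply Rmult_le_pos; [lra|apply Rmult_le_pos; lra]).
  assert (HZ4 : 0 <= Z4).
  { unfold Z4. assert (0 <= lam * (2 * (e0 * (Dc * E)))) by (apply Rmult_le_pos; lra).
    assert (0 <= (lam + 1) * Ku) by (apply Rmult_le_pos; lra). lra. }
  assert (HZ5 : 0 <= Z5).
  { unfold Z5. assert (0 <= e0 * (C1 * Kf)) by (apply Rmult_le_pos; [lra|apply Rmult_le_pos; lra]). lra. }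
  set (C := lam * (2 * (e0 * (4 * (LL * (lam + 1) + C1) * E))) + (lam + 1)).
  assert (HC : 0 < C).
  { unfold C. assert (0 <= lam * (2 * (e0 * (4 * (LL * (lam + 1) + C1) * E)))); [|lra].
    apply Rmult_le_pos; [auto|]. apply Rmult_le_pos; [lra|]. apply Rmult_le_pos; [lra|]. apply Rmult_le_pos; [|lra].
    assert (0 <= LL * (lam + 1)) by (apply Rmult_le_pos; lra). lra. }
  (* The six entries serve, in order, h^s <= h, h <= tau0, rate h <= 1, the one-step bound by e0,
     and the two strip conditions. The last one uses only half of [rad], as the Lipschitz term may
     take the other half. *)
  set (h0 := Rmin (Rmin 1 tau0) (Rmin (Rmin (/ (rate + 1)) h1) (Rmin (rad / (Z4 + 1)) (rad / 2 / (Z5 + 1))))).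
  exists rate, del, e0, h0, C.
  split; [auto|split; [lra|split; [|split; [auto|split; [auto|split]]]]].
  - repeat apply Rmin_glb_lt; auto; try lra; [apply Rinv_0_lt_compat; lra|apply Rdiv_lt_0_compat; lra|apply Rdiv_lt_0_compat; lra].
  - apply Rle_trans with (beta * (y + y) * exp 1).
    + apply Rmult_le_compat_r; [lra|]. apply Rmult_le_compat_l; [lra|]. specialize (Pdel del (Rle_refl _)). lra.
    + right. unfold y. field. lra.
  - intros h [Hh Hhh0]. cbv zeta.
    assert (M : forall a b, h <= Rmin a b -> h <= a /\ h <= b).
    { intros a b H. split; eapply Rle_trans; [exact H|apply Rmin_l|exact H|apply Rmin_r]. }
    apply M in Hhh0. destruct Hhh0 as [H1 H2]. apply M in H1. apply M in H2. destruct H2 as [H2 H3]. apply M in H2. apply M in H3.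
    destruct H1 as [H1 Ht]. destruct H2 as [Hr H2]. destruct H3 as [H4 H5].
    assert (ks0 : 0 < h ^ s) by (apply pow_lt; auto).
    assert (ksh : h ^ s <= h).
    { destruct s as [|s']; [lia|]. cbn [pow]. assert (h ^ s' <= 1) by (rewrite <- (pow1 s'); apply pow_incr; lra).
      apply Rle_trans with (h * 1); [apply Rmult_le_compat_l; lra|lra]. }
    assert (Q : forall a Z, 0 <= Z -> h <= a / (Z + 1) -> h * Z <= a).
    { intros a Z HZ Hq. apply Rmult_le_compat_r with (r := Z + 1) in Hq; [|lra].
      replace (a / (Z + 1) * (Z + 1)) with a in Hq by (field; lra). nra. }
    assert (Q4 := Q rad Z4 HZ4 H4). assert (Q5 := Q (rad / 2) Z5 HZ5 H5).
    replace (4 * (LL * ((lam + 1) * (h ^ s * Ku)) + C1 * (h ^ s * Kf))) with (h ^ s * Dc) by (unfold Dc; ring).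
    fold E.
    assert (R4 : lam * (2 * (e0 * (h ^ s * Dc * E))) + (lam + 1) * (h ^ s * Ku) = h ^ s * Z4) by (unfold Z4; ring).
    split; [auto|split; [|split; [|split; [|split; [|split]]]]].
    + apply Rmult_le_compat_r with (r := rate + 1) in Hr; [|lra]. rewrite Rinv_l in Hr by lra. nra.
    + apply Rmult_le_pos; lra.
    + specialize (Ph1 h H2). apply Rmult_le_compat_l with (r := beta) in Ph1; [|lra].
      replace (beta * (e0 / beta)) with e0 in Ph1 by (field; lra). auto.
    + rewrite R4. apply Rle_trans with (h * Z4); auto. apply Rmult_le_compat_r; auto.
    + replace (e0 * (h ^ s * Dc * E) + e0 * (La * (Lp * (2 * rad)) + C1 * (h ^ s * Kf))) with (h ^ s * Z5 + LL * e0 * (2 * rad)) by (unfold Z5, LL; ring).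
      assert (h ^ s * Z5 <= h * Z5) by (apply Rmult_le_compat_r; auto).
      assert (LL * e0 * (2 * rad) <= 1 / 4 * (2 * rad)) by (apply Rmult_le_compat_r; lra). lra.
    + rewrite R4. replace (C * h ^ s * (Kf + Ku)) with (h ^ s * (C * (Kf + Ku))) by ring. apply Rmult_le_compat_l; [lra|].
      unfold Z4, C, Dc. 
      set (k := lam * (2 * e0 * 4 * E)).
      assert (k0 : 0 <= k) by (apply Rmult_le_pos; [auto|]; repeat apply Rmult_le_pos; lra).
      replace (lam * (2 * (e0 * (4 * (LL * ((lam + 1) * Ku) + C1 * Kf) * E))) + (lam + 1) * Ku)
        with (k * (LL * (lam + 1) * Ku + C1 * Kf) + (lam + 1) * Ku) by (unfold k; ring).
      replace ((lam * (2 * (e0 * (4 * (LL * (lam + 1) + C1) * E))) + (lam + 1)) * (Kf + Ku))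
        with (k * ((LL * (lam + 1) + C1) * (Kf + Ku)) + (lam + 1) * (Kf + Ku)) by (unfold k; ring).
      apply Rplus_le_compat; [apply Rmult_le_compat_l; auto|apply Rmult_le_compat_l; lra].
      assert (0 <= LL * (lam + 1)) by (apply Rmult_le_pos; lra). nra.
Qed.

Lemma max_step_ge N tn n : (n < N)%nat -> mesh_step tn n <= max_step N tn.
Proof.
  intros Hn. unfold max_step. assert (I : In (stepsize tn (S n)) (map (stepsize tn) (seq 1 N))) by (apply in_map, in_seq; lia).
  change (mesh_step tn n) with (stepsize tn (S n)). revert I. generalize (stepsize tn (S n)).
  induction (map (stepsize tn) (seq 1 N)) as [|a l IH]; intros x []; cbn.
  - subst. apply Rmax_l.
  - eapply Rle_trans; [apply IH; auto|apply Rmax_r].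
Qed.

Lemma mesh_mono xi m T N tn : is_mesh xi m T N tn -> forall n k, (n <= k <= N)%nat -> tn n <= tn k.
Proof.
  intros (_ & _ & H & _) n k [Hnk HN]. induction Hnk as [|k Hnk IH]; [lra|].
  specialize (IH ltac:(lia)). specialize (H k ltac:(lia)). lra.
Qed.

(** Take the last index up to m whose discontinuity point is at most t_n. The next one is either a
    mesh point beyond t_n or xi (m + 1) >= T, so it does not fall inside the mesh interval. *)
Lemma mesh_in_segment xi m T N tn n : xi 0%nat = 0 -> xi m < T <= xi (m + 1)%nat ->
  is_mesh xi m T N tn -> (n < N)%nat ->
  exists mu, (1 <= mu <= m + 1)%nat /\ forall t, tn n <= t <= tn (S n) -> segment xi T mu t.
Proof.
  intros X0 HT HM Hn. assert (Mono := mesh_mono _ _ _ _ _ HM). destruct HM as (T0 & TN & _ & Hxi).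
  assert (H : forall k, exists mu, (mu <= k)%nat /\ xi mu <= tn n /\ forall j, (mu < j <= k)%nat -> tn n < xi j).
  { induction k as [|k [mu (Hmu & Hle & Hj)]].
    - exists 0%nat. split; [lia|]. split; [rewrite X0, <- T0; apply Mono; lia|intros; lia].
    - destruct (Rle_dec (xi (S k)) (tn n)).
      + exists (S k). split; [lia|]. split; auto. intros; lia.
      + exists mu. split; [lia|]. split; auto. intros j Hjk. destruct (Nat.eq_dec j (S k)) as [->|]; [lra|apply Hj; lia]. }
  destruct (H m) as [mu (Hmu & Hle & Hj)]. exists (S mu). split; [lia|]. intros t Ht. unfold segment. cbn [pred].
  assert (tn (S n) <= T) by (rewrite <- TN; apply Mono; lia).
  split; [lra|]. apply Rmin_glb; [|lra]. destruct (Nat.eq_dec mu m) as [->|Nm].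
  - rewrite <- Nat.add_1_r. lra.
  - destruct (Hxi (S mu)) as [k [Hk Ek]]; [lia|]. specialize (Hj (S mu) ltac:(lia)). rewrite <- Ek in *.
    assert (n < k)%nat.
    { destruct (Nat.lt_ge_cases n k); auto. specialize (Mono k n ltac:(lia)). lra. }
    specialize (Mono (S n) k ltac:(lia)). lra.
Qed.

Lemma lub_ge (E : R -> Prop) y : bound E -> E y -> y <= real (Lub_Rbar E).
Proof.
  intros [M HM] Ey. destruct (Lub_Rbar_correct E) as [H1 H2]. specialize (H1 y Ey).
  specialize (H2 (Finite M)). assert (H3 : Rbar_le (Lub_Rbar E) M) by (apply H2; intros x Ex; apply HM; auto).
  destruct (Lub_Rbar E); cbn in *; auto; contradiction.
Qed.

(** Injectivity makes the preimage unique, which is what [iota] requires to return it. *)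
Lemma frac_pow_neg {X : CompleteNormedModule C_AbsRing} (S : R -> real_space X -> real_space X) alpha w :
  (forall x y, neg_frac_pow S alpha x = neg_frac_pow S alpha y -> x = y) ->
  frac_pow S alpha (neg_frac_pow S alpha w) = w.
Proof.
  intros inj. apply inj. apply (iota_correct (fun x => neg_frac_pow S alpha x = neg_frac_pow S alpha w)).
  exists w. split; [auto|]. intros y E. symmetry. apply inj. auto.
Qed.

Theorem theorem4p1
  (X : CompleteNormedModule C_AbsRing) (A : operator X)
  (sectorial_A : sectorial A) (dense_A : densely_defined A)
  (spectrum_A : forall lam : C, in_spectrum A lam -> 0 < Re lam)
  (expA : R -> real_space X -> real_space X) (expA_A : semigroup_of A expA)
  (alpha : R) (alpha_range : 0 <= alpha < 1)
  (T : R) (T_pos : 0 < T)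
  (tau : R -> R) (tau_delay : is_delay tau)
  (xi : nat -> R) (xi_points : discontinuity_points tau xi)
  (m : nat) (xi_m : xi m < T <= xi (m + 1)%nat)
  (g : R -> real_space X -> real_space X -> real_space X)
  (phi : R -> real_space X)
  (phi_V : forall t, - tau 0 <= t <= 0 -> in_V expA alpha (phi t))
  (u : R -> real_space X)
  (u_sol : is_solution A (in_V expA alpha) g tau phi xi m T u)
  (rad L : R) (rad_pos : 0 < rad)
  (g_lip : lipschitz_in_strip (in_V expA alpha) (norm_V expA alpha) g tau T u rad L)
  (s : nat) (s_pos : (1 <= s)%nat) (c : nat -> R)
  (c_range : forall i, (1 <= i <= s)%nat -> 0 <= c i <= 1)
  (c_distinct : forall i j, (1 <= i <= s)%nat -> (1 <= j <= s)%nat -> i <> j -> c i <> c j)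
  (Du Df : nat -> nat -> R -> real_space X) :
  let f := fun t => g t (u t) (delayed tau u t) in
  forall
  (u_smooth : forall mu, (1 <= mu <= m + 1)%nat ->
     derivatives_in (in_V expA alpha) (norm_V expA alpha) (segment xi T mu) s u (Du mu))
  (f_smooth : forall mu, (1 <= mu <= m + 1)%nat ->
     derivatives_in (fun _ => True) norm (segment xi T mu) s f (Df mu))
  (u_bounded : bound (segment_norms (norm_V expA alpha) xi T m (fun mu => Du mu s)))
  (f_bounded : bound (segment_norms norm xi T m (fun mu => Df mu s)))
  (varrho : R) (varrho_gt1 : 1 < varrho),
  exists h0 C : R, 0 < h0 /\ 0 < C /\
    forall (N : nat) (tn : nat -> R),
      is_mesh xi m T N tn ->
      (forall j, (1 <= j < N)%nat -> stepsize tn j <= varrho * stepsize tn (j + 1)) ->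
      max_step N tn <= h0 ->
      let numerical_solution := fun W : numerical X =>
        is_ERKC_I expA (in_V expA alpha) g tau phi s c N tn W /\
        stages_in_strip (norm_V expA alpha) u rad s c N tn W in
      (exists W, numerical_solution W) /\
      (forall W1 W2, numerical_solution W1 -> numerical_solution W2 ->
         forall t, t <= T -> interp W1 t = interp W2 t) /\
      (forall W, numerical_solution W ->
         forall t, 0 <= t <= T ->
           in_V expA alpha (minus (interp W t) (u t)) /\
           norm_V expA alpha (minus (interp W t) (u t)) <=
             C * max_step N tn ^ s *
               (segment_sup norm xi T m (fun mu => Df mu s) +
                segment_sup (norm_V expA alpha) xi T m (fun mu => Du mu s))).

Proof.
  intros f u_smooth f_smooth u_bounded f_bounded varrho _.
  assert (C0 := proj1 expA_A).
  destruct (semigroup_estimates A expA sectorial_A dense_A spectrum_A expA_A) as (M & J & HM & LJ & AJ & JA & HS & HSA).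
  assert (J_inj : forall x, J x = zero -> x = zero).
  { intros x E. destruct (AJ x) as [_ <-]. rewrite E.
    destruct sectorial_A as ((D0 & Dp & Ds) & _). destruct (Dp _ _ D0 D0) as [_ E0].
    transitivity (minus (plus (A zero) (A zero)) (A zero) : real_space X); [vec|]. rewrite <- E0.
    replace (plus zero zero) with (zero : real_space X) by vec. vec. }
  destruct (frac_power_facts expA J M C0 HM HS J_inj) with (alpha := alpha)
    as (K & HK & P_plus & P_scal & P_bound & P_inj & P_comm & S_bound & smooth); auto.
  { intros x t Ht. destruct (AJ x) as [DJ EJ]. replace (opp (expA t x)) with (opp (expA t (A (J x)))) by (rewrite EJ; reflexivity). apply (sg_deriv expA C0 A); auto. }
  { intros t x Ht. apply (generator_orbit A expA sectorial_A dense_A expA_A M J); auto. }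
  set (P := neg_frac_pow expA alpha) in *. set (Q := frac_pow expA alpha).
  assert (P_eq' : forall x y, P x = P y -> x = y) by (apply (P_eq P P_plus P_scal P_inj)).
  assert (QP : forall w, Q (P w) = w) by (intros w; apply frac_pow_neg; auto).
  assert (VleQ : forall v b, in_V expA alpha v -> norm_V expA alpha v <= b -> Vle P v b).
  { intros v b [w <-] Hb. unfold norm_V in Hb. fold P in Hb. fold (Q (P w)) in Hb. rewrite QP in Hb. exists w. auto. }
  assert (VleQ' : forall v b, Vle P v b -> in_V expA alpha v /\ norm_V expA alpha v <= b).
  { intros v b [w [<- Hb]]. split; [exists w; auto|]. unfold norm_V. fold Q. rewrite QP. auto. }
  destruct (lagrange_bounded s c) as (mm & Hmm & Hl).
  destruct (lebesgue (V := real_space X) (all_nodes s c) (NoDup_nodup _ _) (all_nodes_range s c c_range)) as (lam & lam_pos & Hlam).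
  destruct tau_delay as [[tau0 [tau0_pos tau_ge]] tau_mono].
  destruct xi_points as [xi0 xi_step].
  set (Kf := segment_sup norm xi T m (fun mu => Df mu s)). set (Ku := segment_sup (norm_V expA alpha) xi T m (fun mu => Du mu s)).
  assert (HKf : forall mu t, (1 <= mu <= m + 1)%nat -> segment xi T mu t -> norm (Df mu s t) <= Kf).
  { intros mu t Hmu Ht. apply lub_ge; auto. exists mu, t. auto. }
  assert (HKu : forall mu t, (1 <= mu <= m + 1)%nat -> segment xi T mu t -> norm_V expA alpha (Du mu s t) <= Ku).
  { intros mu t Hmu Ht. apply (lub_ge (segment_norms (norm_V expA alpha) xi T m (fun mu => Du mu s))); auto. exists mu, t. auto. }
  (* The first segment contains 0; hence both suprema are taken over nonempty sets and are
     nonnegative. *)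
  assert (seg0 : segment xi T 1 0).
  { unfold segment. cbn [pred]. rewrite xi0. split; [lra|]. apply Rmin_glb; [apply xi_step|lra]. }
  assert (Kf_pos : 0 <= Kf) by (exact (Rle_trans _ _ _ (norm_ge_0 _) (HKf 1%nat 0 ltac:(lia) seg0))).
  assert (Ku_pos : 0 <= Ku) by (exact (Rle_trans _ _ _ (norm_ge_0 _) (HKu 1%nat 0 ltac:(lia) seg0))).
  destruct u_sol as (u_hist & u_V & u_eq).
  (* As t - tau t increases, its nonpositive values stay in [- tau 0, 0], where the history is known
     to lie in V. *)
  assert (delayed_u_V : forall t, 0 <= t <= T -> in_V expA alpha (delayed tau u t)).
  { intros t Ht. unfold delayed. assert (Hd := tau_ge t (proj1 Ht)). destruct (Rle_dec (t - tau t) 0).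
    - rewrite u_hist by auto. apply phi_V. split; auto. destruct (Req_dec t 0) as [->|Nt]; [lra|].
      assert (H := tau_mono 0 t ltac:(lra) ltac:(lra)). lra.
    - apply u_V. lra. }
  (* L carries no sign condition, while the smallness conditions require a nonnegative constant. *)
  set (Lp := Rmax L 0). assert (Lp_pos : 0 <= Lp) by apply Rmax_r.
  assert (g_lip' : forall t v1 w1 v2 w2 b1 b2, 0 <= t <= T ->
    Vle P (minus v1 (u t)) rad -> Vle P (minus v2 (u t)) rad ->
    Vle P (minus w1 (delayed tau u t)) rad -> Vle P (minus w2 (delayed tau u t)) rad ->
    Vle P (minus v1 v2) b1 -> Vle P (minus w1 w2) b2 ->
    norm (minus (g t v1 w1) (g t v2 w2)) <= Lp * (b1 + b2)).
  { intros t v1 w1 v2 w2 b1 b2 Ht H1 H2 H3 H4 H5 H6.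
    assert (add : forall v x : real_space X, in_V expA alpha x -> Vle P (minus v x) rad -> in_V expA alpha v).
    { intros v x [w Ew] [w' [Ew' _]]. exists (plus w' w). fold P. rewrite P_plus, Ew'. fold P in Ew. rewrite Ew. vec. }
    assert (Ub := u_V t Ht). assert (Wb := delayed_u_V t Ht).
    eapply Rle_trans; [apply g_lip; auto; first [solve [apply (add _ (u t)); auto] | solve [apply (add _ (delayed tau u t)); auto] | idtac]; apply VleQ'; auto|].
    apply VleQ' in H5. apply VleQ' in H6. destruct H5 as [_ H5]. destruct H6 as [_ H6].
    assert (n5 : 0 <= norm_V expA alpha (minus v1 v2)) by apply norm_ge_0.
    assert (n6 : 0 <= norm_V expA alpha (minus w1 w2)) by apply norm_ge_0.
    assert (L <= Lp) by apply Rmax_l.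
    apply Rle_trans with (Lp * (norm_V expA alpha (minus v1 v2) + norm_V expA alpha (minus w1 w2))).
    - apply Rmult_le_compat_r; lra.
    - apply Rmult_le_compat_l; lra. }
  set (ga := 1 - alpha). set (beta := K / ga). set (La := INR s * mm). set (C1 := INR s * mm + 1).
  assert (La_pos : 0 <= La) by (apply Rmult_le_pos; [apply pos_INR|auto]).
  assert (ga_pos : 0 < ga) by (unfold ga; lra).
  assert (C1_pos : 0 <= C1) by (unfold C1; fold La; lra).
  destruct (scheme_constants ga beta La Lp lam C1 Kf Ku rad tau0 T s) as
    (rate & del & e0 & h0 & C & rate_pos & del_pos & h0_pos & C_pos & small3 & small1 & Hh); auto.
  { apply Rdiv_lt_0_compat; lra. }
  exists h0, C. split; [auto|split; [auto|]]. intros N tn mesh _ Hmax numerical_solution.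
  set (h := max_step N tn) in *. set (D := 4 * (La * Lp * ((lam + 1) * (h ^ s * Ku)) + C1 * (h ^ s * Kf))).
  assert (mesh' := mesh). destruct mesh' as (tn0 & tnN & tn_incr & _).
  assert (N_pos : (0 < N)%nat).
  { destruct N; [|lia]. lra. }
  assert (steps : forall n, (n < N)%nat -> 0 < mesh_step tn n <= h).
  { intros n Hn. split; [unfold mesh_step; specialize (tn_incr n Hn); lra|apply max_step_ge; auto]. }
  assert (h_pos : 0 < h) by (destruct (steps 0%nat N_pos); lra).
  destruct (Hh h) as (h_tau & rate_h & D_pos & small2 & small4 & small5 & final); [auto|]. fold D in D_pos, small4, small5, final.
  assert (delay_ge : forall t, 0 <= t -> h <= tau t) by (intros t Ht; specialize (tau_ge t Ht); lra).
  assert (ok : forall n, (n < N)%nat -> interval_ok expA P s c lam C1 Kf Ku u f (tn n) (mesh_step tn n)).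
  { intros n Hn. destruct (mesh_in_segment xi m T N tn n xi0 xi_m mesh Hn) as (mu & Hmu & Hseg).
    destruct (steps n Hn) as [hp _].
    apply (interval_ok_intro expA A expA_A K HK S_bound P Q P_plus P_scal P_bound QP s c s_pos c_range c_distinct mm lam Hmm Hl Hlam
      (segment xi T mu) u f (Du mu) (Df mu) Kf Ku (tn n) (mesh_step tn n)); auto.
    - rewrite <- tn0. apply (mesh_mono _ _ _ _ _ mesh). lia.
    - intros t Ht. apply Hseg. replace (tn (S n)) with (tn n + mesh_step tn n) by (unfold mesh_step; ring). auto.
    - intros t Ht. apply (HKu mu t); auto. }
  assert (Ex := numerical_exists expA C0 alpha K P alpha_range HK P_plus P_scal P_bound P_inj S_bound smooth s c mm lam s_pos c_range
    Hmm Hl lam_pos Hlam g tau phi u T rad Lp u_hist delayed_u_V u_V rad_pos Lp_pos g_lip' C1 Kf Ku h rate del e0 D N tn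
    C1_pos Kf_pos Ku_pos h_pos tn0 tnN steps ok delay_ge rate_pos del_pos rate_h D_pos small1 small2 small3 (Rle_refl D) small4 small5).
  assert (Un := numerical_unique expA C0 alpha K P alpha_range HK P_plus P_scal P_bound P_inj S_bound smooth s c mm lam s_pos c_range
    Hmm Hl lam_pos Hlam g tau phi u T rad Lp u_hist rad_pos Lp_pos g_lip' C1 Kf Ku h rate del e0 D N tn
    C1_pos Kf_pos Ku_pos h_pos tn0 tnN steps ok delay_ge rate_pos del_pos rate_h D_pos small1 small2 small3 (Rle_refl D) small4).
  assert (Er := numerical_error expA C0 alpha K P alpha_range HK P_plus P_scal P_bound P_inj S_bound smooth s c mm lam s_pos c_range
    Hmm Hl lam_pos Hlam g tau phi u T rad Lp u_hist rad_pos Lp_pos g_lip' C1 Kf Ku h rate del e0 D N tn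
    C1_pos Kf_pos Ku_pos h_pos tn0 tnN steps ok delay_ge rate_pos del_pos rate_h D_pos small1 small2 small3 (Rle_refl D) small4).
  assert (uV' : forall n i, (n < N)%nat -> (1 <= i <= s)%nat -> in_V expA alpha (u (tn n + c i * mesh_step tn n))).
  { intros n i Hn Hi. apply u_V. destruct (steps n Hn) as [hp _]. assert (Hc := c_range i Hi).
    assert (m1 := mesh_mono _ _ _ _ _ mesh 0 n ltac:(lia)). assert (m2 := mesh_mono _ _ _ _ _ mesh (S n) N ltac:(lia)).
    rewrite tn0 in m1. rewrite tnN in m2. replace (tn (S n)) with (tn n + mesh_step tn n) in m2 by (unfold mesh_step; ring). nra. }
  (* A bound on [norm_V] does not imply membership in V, because [frac_pow] is a default value
     outside; for the stages membership comes from the scheme itself. *)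
  assert (Num : forall W, numerical_solution W <-> starts phi W /\
    (forall n, (n < N)%nat -> step_ok expA s c (in_V expA alpha) g tau tn W n) /\ (forall n, (n < N)%nat -> in_strip P s c u rad tn W n)).
  { intros W. unfold numerical_solution, starts.
    rewrite (is_ERKC_I_steps expA s c (in_V expA alpha) g tau phi tn W N) by (intros n Hn; apply steps; auto). split.
    - intros [(N0 & I0 & HSt) HV]. split; [auto|split; [auto|]]. intros n Hn i Hi. apply VleQ; [|apply (HV n i); auto].
      destruct (HSt n Hn) as (_ & E2 & _). destruct (E2 i Hi) as [[w Ew] _]. destruct (uV' n i Hn Hi) as [w' Ew'].
      exists (minus w w'). fold P. rewrite (P_minus P P_plus P_scal). fold P in Ew, Ew'. rewrite Ew, Ew'. auto.
    - intros ([N0 I0] & HSt & HV). split; [auto|]. intros n i Hn Hi. apply VleQ'. apply (HV n Hn i Hi). }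
  split; [|split].
  - destruct Ex as [W HW]. exists W. apply Num. exact HW.
  - intros W1 W2 H1 H2. apply Num in H1. apply Num in H2. destruct H1 as (A1 & A2 & A3). destruct H2 as (B1 & B2 & B3).
    apply Un; auto.
  - intros W HW t Ht. apply Num in HW. destruct HW as (A1 & A2 & A3).
    apply VleQ'. eapply Vle_mono; [apply Er; auto; lra|]. exact final.
Qed.
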